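(* Let $\rho:\Gamma_0(2)\to\mathrm{GL}_2(\mathbf{C})$ be an irreducible representation such that $\rho(T)$ is diagonalizable. Let $k_0$ be the least integer with $M_{k_0}(\rho)\neq0$ and let $F$ be a nonzero element of $M_{k_0}(\rho)$. Then there exist complex numbers $A,B,r$, determined by $\rho$ and such that $1+A-B$ and $1+B-A$ are not nonpositive integers, together with a matrix $Q\in\mathrm{GL}_2(\mathbf{C})$, such that for all $\tau\in\mathfrak{H}$ with $\mathrm{Im}\,\tau$ sufficiently large $$F(\tau)=Q\begin{bmatrix}\eta^{2k_0}(\tau)(\mathfrak{J}(\tau)-1)^r\mathfrak{J}(\tau)^{-A}\,{}_2F_1(A,\tfrac12+A,1+A-B;\mathfrak{J}(\tau)^{-1})\\ \eta^{2k_0}(\tau)(\mathfrak{J}(\tau)-1)^r\mathfrak{J}(\tau)^{-B}\,{}_2F_1(B,\tfrac12+B,1+B-A;\mathfrak{J}(\tau)^{-1})\end{bmatrix}.$$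
   Context: $\Gamma=\mathrm{SL}_2(\mathbf{Z})$, $\Gamma_0(2)=\{\begin{pmatrix}a&b\\c&d\end{pmatrix}\in\Gamma: 2\mid c\}$, $T=\begin{pmatrix}1&1\\0&1\end{pmatrix}$, $\mathfrak{H}$ the upper half-plane, $q=e^{2\pi i\tau}$, $q^s:=e^{2\pi i s\tau}$ for $s\in\mathbf{C}$. For $k\in\mathbf{Z}$, $(F|_k\gamma)(\tau):=(c\tau+d)^{-k}F(\frac{a\tau+b}{c\tau+d})$. $M_k(\rho)$ is the space of holomorphic $F:\mathfrak{H}\to\mathbf{C}^2$ with $F|_k\gamma=\rho(\gamma)F$ for all $\gamma\in\Gamma_0(2)$ which are holomorphic at all cusps (for each $\gamma\in\Gamma$, after conjugating into Jordan form for $\rho(h)$ where $\gamma T^N=h\gamma$ and $N$ is minimal with $T^N$ in all $\Gamma$-conjugates of $\Gamma_0(2)$, the components of $F|_k\gamma$ are polynomials in $\tau$ with coefficient functions $\sum_{n\in\mathbf{Z}}a_ne^{2\pi i(n+\mu)\tau/N}$, $e^{2\pi i\mu}$ an eigenvalue of $\rho(h)$, with $a_n=0$ when $\mathrm{Re}(n+\mu)<0$). $E_2=1-24\sum_{n\ge1}\sigma(n)q^n$, $E_4=1+240\sum_{n\ge1}\sigma_3(n)q^n$, $G(\tau)=-E_2(\tau)+2E_2(2\tau)$, $\mathfrak{J}=\frac{3G^2}{E_4-G^2}$ (so $\mathfrak{J}=\frac{1}{64q}(1+O(q))$), $\eta(\tau)=q^{1/24}\prod_{n\ge1}(1-q^n)$.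 ${}_2F_1(\alpha,\beta,\gamma;z)=1+\sum_{n\ge1}\frac{(\alpha)_n(\beta)_n}{(\gamma)_n}\frac{z^n}{n!}$ with $(\alpha)_n=\prod_{i=0}^{n-1}(\alpha+i)$. For $\mathrm{Im}\,\tau$ large, $(\mathfrak{J}-1)^r\mathfrak{J}^{-s}$ means $\mathfrak{J}^{r-s}(1-\mathfrak{J}^{-1})^r$, where $(1-x)^r=\sum_n\binom{r}{n}(-x)^n$ and $\mathfrak{J}^{r-s}:=(64q)^{s-r}(64q\mathfrak{J})^{r-s}$ with $(64q\mathfrak{J})^{r-s}=(1+O(q))^{r-s}$ given by the binomial series. *)

(* Defs.v *)
From HB Require Import structures.
From mathcomp Require Import all_boot all_order all_algebra ring.
From mathcomp Require Import complex.
From mathcomp Require Import all_classical all_reals all_analysis.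
Import Order.TTheory GRing.Theory Num.Theory.
Import numFieldNormedType.Exports.

Set Implicit Arguments.
Unset Strict Implicit.
Unset Printing Implicit Defensive.

Local Open Scope classical_set_scope.
Local Open Scope ring_scope.

(* R[i] packed as a numClosedFieldType, so that its canonical topology and
   normed module structure over itself are found by inference; derivability
   over this field is complex differentiability. *)
Definition Cfield (R : realType) : numClosedFieldType := R[i].

Definition SL2Z (g : 'M[int]_2) : Prop := \det g = 1.

Definition Gamma02 (g : 'M[int]_2) : Prop := SL2Z g /\ (2 %| (g 1 0)%R)%Z.

Definition Tmx : 'M[int]_2 := 1%:M + delta_mx 0 1.

(* The equation g * T ^+ N = h * g says that T ^+ N is the conjugate
   g^-1 * h * g of h. *)
Definition in_all_conjugates (N : nat) : Prop :=
  forall g : 'M[int]_2, SL2Z g ->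
    exists2 h, Gamma02 h & g * Tmx ^+ N = h * g.

Definition is_cusp_period (N : nat) : Prop :=
  [/\ (0 < N)%N, in_all_conjugates N
    & forall M : nat, (0 < M)%N -> in_all_conjugates M -> (N <= M)%N].

Lemma TmxX (N : nat) : Tmx ^+ N = 1%:M + N%:Z *: delta_mx 0 1.
Proof.
have dd : (delta_mx 0 1 : 'M[int]_2) *m (delta_mx 0 1 : 'M[int]_2) = 0.
  by apply: mul_delta_mx_0.
elim: N => [|N IHN]; first by rewrite scale0r addr0.
rewrite exprSr IHN /Tmx -mulmxE mulmxDl mul1mx mulmxDr mulmx1 -scalemxAl dd.
by rewrite scaler0 addr0 -addrA -(addn1 N) PoszD scalerDl scale1r [X in _ + X]addrC.
Qed.

Lemma is_cusp_periodP (N : nat) : is_cusp_period N <-> N = 2%N.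
Proof.
have det2 (g : 'M[int]_2) : \det g = g 0 0 * g 1 1 - g 0 1 * g 1 0.
  rewrite (expand_det_row _ 0) big_ord_recl big_ord1 /cofactor !det_mx11 !mxE /=.
  rewrite expr0 expr1 mul1r mulN1r mulrN.
  by congr (_ * g _ _ - g _ _ * g _ _); apply: val_inj.
have lift01 : lift (0 : 'I_2) (0 : 'I_1) = 1 by apply: val_inj.
have all2 : in_all_conjugates 2.
  move=> g Hg; move: (TmxX 2); move: (Tmx ^+ 2) => K KE.
  have dK : \det K = 1 by rewrite det2 KE !mxE.
  exists (g *m K *m \adj g); last by rewrite -mulmxE -mulmxA mul_adj_mx Hg mulmx1.
  split.
    have : \det (g *m \adj g) = 1 by rewrite mul_mx_adj Hg det1.
    by rewrite /SL2Z !det_mulmx dK Hg mulr1 mul1r.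
  suff -> : (g *m K *m \adj g) 1 0 = 2%:Z * (- (g 1 0 * g 1 0)).
    by rewrite dvdz_mulr.
  have a00 : (\adj g) 0 0 = g 1 1.
    rewrite mxE /cofactor det_mx11 !mxE /= expr0 mul1r.
    by congr (g _ _); apply: val_inj.
  have a10 : (\adj g) 1 0 = - g 1 0.
    rewrite mxE /cofactor det_mx11 !mxE /= expr1 mulN1r.
    by congr (- g _ _); apply: val_inj.
  move: (\adj g) a00 a10 => X X00 X10.
  rewrite KE !mxE !big_ord_recl !big_ord0 !mxE !big_ord_recl !big_ord0 !mxE /=.
  rewrite !lift01 X00 X10; ring.
have not1 : ~ in_all_conjugates 1.
  pose S : 'M[int]_2 := delta_mx 1 0 - delta_mx 0 1.
  have HS : SL2Z S by rewrite /SL2Z det2 !mxE.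
  case/(_ S HS) => h [_ h10] /matrixP E.
  have := E 1 1.
  rewrite (TmxX 1) -!mulmxE !mxE !big_ord_recl !big_ord0 !mxE /= !lift01 => E11.
  have h10E : h 1 0 = -1.
    move: E11; rewrite !(mul0r, mulr0, mul1r, mulr1, subr0, sub0r, add0r, addr0).
    rewrite mulrN mulr1 => E11.
    by apply/eqP; rewrite -eqr_oppLR; apply/eqP; rewrite -E11.
  by rewrite h10E in h10.
split=> [[N0 HN Nmin]|->].
  have := Nmin 2%N isT all2.
  by case: N N0 HN {Nmin} => [|[|[|N]]].
by split=> // -[|[|M]].
Qed.

Section Defs.
Variable R : realType.
Local Notation C := (Cfield R).

Definition cRe (z : C) : R := complex.Re z.
Definition cIm (z : C) : R := complex.Im z.
Definition ofR (x : R) : C := Complex x 0.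
Definition iC : C := Complex 0 1.

Definition upper_half_plane (tau : C) : Prop := 0 < cIm tau.

Definition cexp (z : C) : C :=
  ofR (expR (cRe z)) * (ofR (cos (cIm z)) + iC * ofR (sin (cIm z))).

Definition e2pi (z : C) : C := cexp (2%:R * ofR pi * iC * z).

(* A representation Gamma_0(2) -> GL_2(C) is a map on integer matrices whose
   values outside Gamma_0(2) are irrelevant. *)
Definition representation (rho : 'M[int]_2 -> 'M[C]_2) : Prop :=
  (forall g, Gamma02 g -> rho g \in unitmx) /\
  (forall g h, Gamma02 g -> Gamma02 h -> rho (g * h) = rho g *m rho h).

Definition irreducible (rho : 'M[int]_2 -> 'M[C]_2) : Prop :=
  forall W : {vspace 'cV[C]_2},
    (forall g w, Gamma02 g -> w \in W -> rho g *m w \in W) ->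
    W = 0%VS \/ W = fullv.

Definition moebius (g : 'M[int]_2) (tau : C) : C :=
  ((g 0 0)%:~R * tau + (g 0 1)%:~R) / ((g 1 0)%:~R * tau + (g 1 1)%:~R).

Definition slash (k : int) (g : 'M[int]_2) (F : C -> 'cV[C]_2) (tau : C) :
    'cV[C]_2 :=
  ((g 1 0)%:~R * tau + (g 1 1)%:~R) ^ (- k) *: F (moebius g tau).

Definition holomorphic_on_H (F : C -> 'cV[C]_2) : Prop :=
  forall (i : 'I_2) (tau : C), upper_half_plane tau ->
    derivable (fun z : C => F z i 0) tau 1.

Definition jordan_form (J : 'M[C]_2) : Prop :=
  J 1 0 = 0 /\ (J 0 1 = 0 \/ (J 0 1 = 1 /\ J 0 0 = J 1 1)).

Definition has_sum_Z (u : int -> C) (s : C) : Prop :=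
  exists s1 s2 : C,
    [/\ series (fun n : nat => u n%:Z) @ \oo --> s1,
        series (fun n : nat => u (- (n.+1)%:Z)) @ \oo --> s2
      & s = s1 + s2].

Definition cusp_expansion (N : nat) (mu : C) (f : C -> C) : Prop :=
  exists a : int -> C,
    (forall n : int, cRe (n%:~R + mu) < 0 -> a n = 0) /\
    (forall tau : C, upper_half_plane tau ->
       has_sum_Z (fun n => a n * e2pi ((n%:~R + mu) * tau / N%:R)) (f tau)).

Definition holomorphic_at_cusps (k : int) (rho : 'M[int]_2 -> 'M[C]_2)
    (F : C -> 'cV[C]_2) : Prop :=
  forall (N : nat) (g h : 'M[int]_2),
    is_cusp_period N -> SL2Z g -> Gamma02 h -> g * Tmx ^+ N = h * g ->
  exists P : 'M[C]_2,
    [/\ P \in unitmx, jordan_form (P *m rho h *m invmx P)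
      & forall i : 'I_2,
        exists2 mu : C, eigenvalue (rho h) (e2pi mu) &
        exists (d : nat) (f : 'I_d -> C -> C),
          (forall j, cusp_expansion N mu (f j)) /\
          (forall tau : C, upper_half_plane tau ->
             (P *m slash k g F tau) i 0 = \sum_(j < d) f j tau * tau ^+ j)].

Definition modular_form (k : int) (rho : 'M[int]_2 -> 'M[C]_2)
    (F : C -> 'cV[C]_2) : Prop :=
  [/\ holomorphic_on_H F,
      forall (g : 'M[int]_2) (tau : C), Gamma02 g -> upper_half_plane tau ->
        slash k g F tau = rho g *m F tau
    & holomorphic_at_cusps k rho F].

Definition nonzero_on_H (F : C -> 'cV[C]_2) : Prop :=
  exists2 tau : C, upper_half_plane tau & F tau != 0.

Definition least_weight (rho : 'M[int]_2 -> 'M[C]_2) (k0 : int) : Prop :=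
  (exists2 F, modular_form k0 rho F & nonzero_on_H F) /\
  (forall (k : int) F, modular_form k rho F -> nonzero_on_H F -> k0 <= k).

Definition qpow (s tau : C) : C := e2pi (s * tau).

Definition divisor_sigma (l n : nat) : nat := (\sum_(d <- divisors n) d ^ l)%N.

Definition E2 (tau : C) : C :=
  1 - 24%:R * limn (series (fun n => (divisor_sigma 1 n.+1)%:R * qpow 1 tau ^+ n.+1)).

Definition E4 (tau : C) : C :=
  1 + 240%:R * limn (series (fun n => (divisor_sigma 3 n.+1)%:R * qpow 1 tau ^+ n.+1)).

Definition G (tau : C) : C := - E2 tau + 2%:R * E2 (2%:R * tau).

Definition frakJ (tau : C) : C := 3%:R * G tau ^+ 2 / (E4 tau - G tau ^+ 2).

Definition dedekind_eta (tau : C) : C :=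
  qpow (24%:R)^-1 tau *
  limn (fun N : nat => \prod_(1 <= n < N) (1 - qpow 1 tau ^+ n)).

Definition pochhammer (a : C) (n : nat) : C := \prod_(i < n) (a + i%:R).

Definition hyp2F1 (a b c z : C) : C :=
  limn (series (fun n : nat =>
    pochhammer a n * pochhammer b n / pochhammer c n * (z ^+ n / (n`!)%:R))).

Definition binom (r : C) (n : nat) : C := (\prod_(i < n) (r - i%:R)) / (n`!)%:R.

(* The binomial series of (1 + u)^r. *)
Definition binomial_series (r u : C) : C :=
  limn (series (fun n : nat => binom r n * u ^+ n)).

(* (64 q)^s, with the real logarithm of 64. *)
Definition pow64q (s tau : C) : C := cexp (s * ofR (ln 64%:R)) * qpow s tau.

(* The branch of J^w given by (64 q)^(-w) (64 q J)^w. *)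
Definition Jpow (w tau : C) : C :=
  pow64q (- w) tau * binomial_series w (64%:R * qpow 1 tau * frakJ tau - 1).

(* (J - 1)^r J^(-s), on the branch J^(r-s) (1 - J^-1)^r. *)
Definition J1pow_Jpow (r s tau : C) : C :=
  Jpow (r - s) tau * binomial_series r (- (frakJ tau)^-1).

Definition col2 (x y : C) : 'cV[C]_2 := \col_i (if i == 0 then x else y).

End Defs.

(* Main.v *)
Require Import Defs.
From mathcomp Require Import all_boot all_order all_algebra ring lra.
From mathcomp Require Import complex zify.
From mathcomp Require Import all_classical all_reals all_analysis.
Import Order.TTheory GRing.Theory Num.Theory.
Import numFieldNormedType.Exports.
Set Implicit Arguments.
Unset Strict Implicit.
Unset Printing Implicit Defensive.
Local Open Scope classical_set_scope.
Local Open Scope ring_scope.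

(* Let E = E_4 - G^2, so that J^-1 = E / (3 G^2).  Level two analogues of
   Ramanujan's identities, obtained from Liouville's elementary identity for
   divisor sums, express the logarithmic derivatives of E and of 4 G^2 - E_4
   through G and E_2; hence both are infinite products without zeros, E of
   order one at infinity and nonzero at the cusp 0.  The weight 4 modularity of
   E_4 comes from the Lipschitz formula, and gives that of E and G on
   Gamma_0(2).

   Diagonalizing rho(T), a form is a pair of q-series.  Let F have least weight
   k_0.  A form of weight less than k_0 + 4 vanishing at infinity is zero, since
   it can be divided by E.  With irreducibility this forces both components of F
   to have nonzero leading coefficients at distinct exponents, makes F unique up
   to scalars, and puts a second order equation on F: the combination of D^2 F,
   G D F and G^2 F that vanishes at infinity is a multiple of E F (D being the
   Serre derivative).  In the variable J^-1 this is a hypergeometric equation up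
   to the factor eta^(2 k_0) (J - 1)^r J^-A.  The closed form and the component
   of F with the same exponent are then proportional, because their Wronskian
   has too high an order at infinity for the first order equation it satisfies. *)

(** * Absolutely convergent series *)

(** No contour integral or valence formula is used: the analysis rests on power series with Cauchy
    bounds and on the fact that a function with zero derivative on a convex set is constant. This is
    why zeros are excluded by products and solutions are compared through first order equations.
    Only the modular law of E_4 is proved directly, since E and 4 G^2 - E_4 are combinations of
    E_4(tau) and E_4(2 tau); G is the logarithmic derivative of their quotient 1/(J - 1), which is
    invariant under Gamma_0(2). The cusp condition refers to a Jordan form and allows powers of tau,
    yet it must survive derivation, multiplication by G and division by E; at the cusps with c odd
    it is replaced by membership in a class closed under these operations. In z = 1/J the singular
    points are z = 0 at infinity, z = 1 at the cusp 0 and z = oo where G vanishes. The exponents at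
    z = 0 are nu_i - k_0/12, with e^(2 pi i nu_i) the eigenvalues of rho(T). The number r is an
    exponent at z = 1, which the factor (J - 1)^r moves to 0. The exponents at z = oo differ by 1/2
    because J is a multiple of G^2. *)

Section Cabs.
Variable R : realType.
Local Notation C := (Cfield R).

(** The norm of [Cfield R] takes its values in the complex field itself; its real part brings all
    estimates into the ordered field [R], within reach of [lra] and [nra]. *)
Definition cabs (z : C) : R := complex.Re `|z|.

Lemma cabsE (z : C) : `|z| = ofR (cabs z).
Proof. by rewrite /cabs normc_def. Qed.

Lemma cabsM (x y : C) : cabs (x * y) = cabs x * cabs y.
Proof. by rewrite /cabs normrM !cabsE /= !mul0r subr0. Qed.

Lemma cabs_ge0 (x : C) : 0 <= cabs x.
Proof. by rewrite -lecR -[X in _ <= X]cabsE normr_ge0. Qed.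

Lemma cabsD (x y : C) : cabs (x + y) <= cabs x + cabs y.
Proof.
have := ler_normD x y; rewrite !cabsE.
have -> : ofR (cabs x) + ofR (cabs y) = ofR (cabs x + cabs y).
  by apply/eqP; rewrite eq_complex /= addr0 !eqxx.
by rewrite lecR.
Qed.

Lemma cabs0 : cabs 0 = 0.
Proof. by rewrite /cabs normr0. Qed.
Lemma cabs1 : cabs 1 = 1.
Proof. by rewrite /cabs normr1. Qed.
Lemma cabsN (x : C) : cabs (- x) = cabs x.
Proof. by rewrite /cabs normrN. Qed.
Lemma cabsX (x : C) n : cabs (x ^+ n) = cabs x ^+ n.
Proof. by elim: n => [|n IH]; rewrite ?cabs1 // !exprS cabsM IH. Qed.
Lemma cabs_eq0 (x : C) : (cabs x == 0) = (x == 0).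
Proof. by rewrite -[RHS]normr_eq0 [X in _ = (X == _)]cabsE eq_complex /= eqxx andbT. Qed.
Lemma cabs_gt0 (x : C) : (0 < cabs x) = (x != 0).
Proof. by rewrite lt_def cabs_ge0 andbT cabs_eq0. Qed.
Lemma cabsV (x : C) : cabs x^-1 = (cabs x)^-1.
Proof.
have [->|x0] := eqVneq x 0; first by rewrite invr0 cabs0 invr0.
have c0 : cabs x != 0 by rewrite cabs_eq0.
apply: (mulfI c0); rewrite -cabsM !mulfV //; exact: cabs1.
Qed.
Lemma cabs_sum I (r : seq I) (P : pred I) (f : I -> C) :
  cabs (\sum_(i <- r | P i) f i) <= \sum_(i <- r | P i) cabs (f i).
Proof.
elim/big_ind2: _ => [|x a y b xa yb|//]; first by rewrite cabs0.
by apply: le_trans (cabsD _ _) _; rewrite lerD.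
Qed.
Lemma cabs_ofR (x : R) : cabs (ofR x) = `|x|.
Proof. by rewrite /cabs normc_def /= expr0n addr0 sqrtr_sqr. Qed.
Lemma cabsB (x y : C) : cabs (x - y) = cabs (y - x).
Proof. by rewrite -opprB cabsN. Qed.
Lemma ofRE (x : R) : ofR x = real_complex R x. Proof. by []. Qed.
Lemma ofR_nat n : ofR (n%:R : R) = n%:R.
Proof. by rewrite ofRE rmorph_nat. Qed.
Lemma cabs_nat n : cabs n%:R = n%:R.
Proof. by rewrite -ofR_nat cabs_ofR ger0_norm // ler0n. Qed.
Lemma cRe_le (z : C) : `|cRe z| <= cabs z.
Proof.
rewrite /cabs normc_def /= /cRe -sqrtr_sqr ler_wsqrtr // lerDl; exact: sqr_ge0.
Qed.
Lemma cIm_le (z : C) : `|cIm z| <= cabs z.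
Proof.
rewrite /cabs normc_def /= /cIm -sqrtr_sqr ler_wsqrtr // lerDr; exact: sqr_ge0.
Qed.
Lemma complexRI (z : C) : z = ofR (cRe z) + iC R * ofR (cIm z).
Proof.
by case: z => a b; apply/eqP; rewrite eq_complex /cRe /cIm /=; apply/andP; split; apply/eqP; ring.
Qed.
Lemma cabs_iC : cabs (iC R) = 1.
Proof. by rewrite /cabs normc_def /= expr0n expr1n add0r sqrtr1. Qed.
Lemma cabs_leRI (z : C) : cabs z <= `|cRe z| + `|cIm z|.
Proof.
rewrite {1}[z]complexRI; apply: le_trans (cabsD _ _) _.
by rewrite cabsM cabs_iC mul1r !cabs_ofR.
Qed.
Lemma cReD (x y : C) : cRe (x + y) = cRe x + cRe y.
Proof. by case: x; case: y. Qed.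
Lemma cImD (x y : C) : cIm (x + y) = cIm x + cIm y.
Proof. by case: x; case: y. Qed.
Lemma cReN (x : C) : cRe (- x) = - cRe x.
Proof. by case: x. Qed.
Lemma cImN (x : C) : cIm (- x) = - cIm x.
Proof. by case: x. Qed.
Lemma cReM (x y : C) : cRe (x * y) = cRe x * cRe y - cIm x * cIm y.
Proof. by case: x; case: y. Qed.
Lemma cImM (x y : C) : cIm (x * y) = cRe x * cIm y + cIm x * cRe y.
Proof. by case: x => a b; case: y. Qed.
Lemma cRe_ofR (x : R) : cRe (ofR x) = x. Proof. by []. Qed.
Lemma cIm_ofR (x : R) : cIm (ofR x) = 0. Proof. by []. Qed.
Lemma cRe_nat n : cRe (n%:R : C) = n%:R.
Proof. by rewrite -ofR_nat. Qed.
Lemma cIm_nat n : cIm (n%:R : C) = 0.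
Proof. by rewrite -ofR_nat. Qed.
Lemma cRe_int (n : int) : cRe (n%:~R : C) = n%:~R.
Proof. by case: n => n; rewrite ?NegzE ?mulrNz ?cReN cRe_nat. Qed.
Lemma cIm_int (n : int) : cIm (n%:~R : C) = 0.
Proof. by case: n => n; rewrite ?NegzE ?mulrNz ?cImN cIm_nat ?oppr0. Qed.
Lemma complex_eqP (x y : C) : cRe x = cRe y -> cIm x = cIm y -> x = y.
Proof. by case: x => a b; case: y => c d /= ; rewrite /cRe /cIm /= => -> ->. Qed.
Lemma iC2 : iC R * iC R = -1.
Proof. by apply: complex_eqP; rewrite ?cReM ?cImM /cRe /cIm /= ?mul0r ?mulr0 ?mul1r ?sub0r ?addr0 ?oppr0. Qed.
Lemma iC_neq0 : iC R != 0.
Proof. by rewrite -cabs_eq0 cabs_iC oner_eq0. Qed.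
Lemma ofRD (x y : R) : ofR (x + y) = ofR x + ofR y.
Proof. by rewrite !ofRE rmorphD. Qed.
Lemma ofRM (x y : R) : ofR (x * y) = ofR x * ofR y.
Proof. by rewrite !ofRE rmorphM. Qed.
Lemma ofRN (x : R) : ofR (- x) = - ofR x.
Proof. by rewrite !ofRE rmorphN. Qed.
Lemma cabsBl (x y : C) : cabs x - cabs y <= cabs (x - y).
Proof. by rewrite lerBlDr -{1}(subrK y x) cabsD. Qed.

(* Convergence in C, whose norm is C-valued, in terms of the real modulus. *)
Lemma cvgC_P (u : nat -> C) (l : C) : (u @ \oo --> l) <->
  (forall e : R, 0 < e -> exists N, forall n, (N <= n)%N -> cabs (u n - l) < e).
Proof.
split.
  move=> /cvgrPdist_lt H e e0.
  have e0' : 0 < (ofR e : C) by rewrite ltcR.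
  have [N _ HN] := H _ e0'.
  exists N => n Nn; have := HN n Nn; rewrite /= cabsE ltcR cabsB; exact.
move=> H; apply/cvgrPdist_lt => e e0.
have er : e = ofR (cRe e).
  by apply: complex_eqP => //; move: e0; rewrite ltcE => /andP [/eqP /= H0 _]; rewrite /cIm H0.
have e0' : 0 < cRe e by move: e0; rewrite {1}er ltcR.
have [N HN] := H _ e0'.
exists N => // n /= Nn; rewrite cabsE er ltcR cabsB; exact: HN.
Qed.

Lemma cvgR_P (u : nat -> R) (l : R) : (u @ \oo --> l) <->
  (forall e : R, 0 < e -> exists N, forall n, (N <= n)%N -> `|u n - l| < e).
Proof.
split.
  move=> /cvgrPdist_lt H e e0; have [N _ HN] := H _ e0.
  by exists N => n Nn; rewrite distrC; apply: HN.
move=> H; apply/cvgrPdist_lt => e e0; have [N HN] := H _ e0.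
by exists N => // n /= Nn; rewrite distrC; apply: HN.
Qed.

Lemma cvgC_lim (u : nat -> C) l : u @ \oo --> l -> limn u = l.
Proof. move=> H; apply: cvg_lim => //; exact: norm_hausdorff. Qed.

Lemma cvgC_uniq (u : nat -> C) (l m : C) : u @ \oo --> l -> u @ \oo --> m -> l = m.
Proof. by move=> /cvgC_lim <- /cvgC_lim. Qed.

Lemma cvgCZ (u : nat -> C) (c l : C) : u @ \oo --> l -> (fun n => c * u n) @ \oo --> c * l.
Proof. by move=> H; exact: (cvgM (cvg_cst c) H). Qed.
Lemma cvgC_RI (u : nat -> C) (x y : R) :
  (fun n => cRe (u n)) @ \oo --> x -> (fun n => cIm (u n)) @ \oo --> y ->
  u @ \oo --> (ofR x + iC R * ofR y).
Proof.
move=> /cvgR_P Hx /cvgR_P Hy; apply/cvgC_P => e e0.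
have e2 : 0 < e / 2 by rewrite divr_gt0.
have [N HN] := Hx _ e2; have [M HM] := Hy _ e2.
exists (maxn N M) => n; rewrite geq_max => /andP[Nn Mn].
apply: le_lt_trans (cabs_leRI _) _.
have -> : cRe (u n - (ofR x + iC R * ofR y)) = cRe (u n) - x.
  by case: (u n) => a b; rewrite /cRe /=; ring.
have -> : cIm (u n - (ofR x + iC R * ofR y)) = cIm (u n) - y.
  by case: (u n) => a b; rewrite /cIm /=; ring.
by rewrite [e]splitr ltrD // ?HN ?HM.
Qed.
End Cabs.

Section Series.
Variable R : realType.
Local Notation C := (Cfield R).
Implicit Types u v : nat -> C.

(** A bound on the sums of moduli rather than a limit: comparison, shifts and double sums only need
    the bound. *)
Definition asum u := exists K : R, forall n, \sum_(i < n) cabs (u i) <= K.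
Definition sumC u : C := limn (series u).

Lemma seriesE u n : series u n = \sum_(i < n) u i.
Proof. by rewrite /series /= big_mkord. Qed.

Lemma real_absum_cvg (x : nat -> R) K : (forall n, \sum_(i < n) `|x i| <= K) ->
  cvgn (series x).
Proof.
move=> H; apply: normed_cvg; apply: nondecreasing_is_cvgn.
  move=> n m nm; rewrite -subr_ge0 sub_series_geq //; apply: sumr_ge0 => i _ /=.
  exact: normr_ge0.
by exists K => _ [n _ <-]; rewrite /= /series /= big_mkord; apply: H.
Qed.

Lemma asum_cvg u : asum u -> series u @ \oo --> sumC u.
Proof.
move=> [K H].
have HR : cvgn (series (fun i => cRe (u i))).
  apply: (@real_absum_cvg _ K) => n; apply: le_trans (H n).
  by apply: ler_sum => i _; apply: cRe_le.
have HI : cvgn (series (fun i => cIm (u i))).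
  apply: (@real_absum_cvg _ K) => n; apply: le_trans (H n).
  by apply: ler_sum => i _; apply: cIm_le.
have E (f : C -> R) : {morph f : a b / a + b} -> f 0 = 0 ->
    (fun n => f (series u n)) = series (fun i => f (u i)).
  move=> fD f0; apply/funext => n; rewrite !/series /=; exact: (big_morph f fD f0).
have HH : series u @ \oo --> (ofR (limn (series (fun i => cRe (u i)))) + iC R * ofR (limn (series (fun i => cIm (u i)))) : C).
  apply: cvgC_RI; first by rewrite E //; exact: cReD.
  by rewrite E //; exact: cImD.
by rewrite /sumC (cvgC_lim HH).
Qed.

Lemma sumC_P u (s : C) : (forall e : R, 0 < e -> exists N, forall n, (N <= n)%N ->
  cabs (\sum_(i < n) u i - s) < e) -> sumC u = s.
Proof.
move=> H; apply: cvgC_lim; apply/cvgC_P => e e0; have [N HN] := H e e0.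
by exists N => n Nn; rewrite seriesE HN.
Qed.

Lemma asum_eps u : asum u -> forall e : R, 0 < e -> exists N, forall n, (N <= n)%N ->
  cabs (\sum_(i < n) u i - sumC u) < e.
Proof.
move=> /asum_cvg /cvgC_P H e e0; have [N HN] := H e e0.
by exists N => n Nn; rewrite -seriesE HN.
Qed.

Lemma asum_tail u : asum u -> forall e : R, 0 < e -> exists N, forall m n, (N <= m)%N ->
  \sum_(m <= i < n) cabs (u i) <= e.
Proof.
move=> [K H] e e0.
have Hc : cvgn (series (fun i => cabs (u i))).
  apply: (@real_absum_cvg _ K) => n; apply: le_trans (H n).
  by apply: ler_sum => i _; rewrite ger0_norm ?cabs_ge0.
have /cvgR_P HH := Hc.
have e2 : 0 < e / 2 by rewrite divr_gt0.
have [N HN] := HH _ e2; exists N => m n Nm.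
have [nm|mn] := leqP n m; first by rewrite big_geq // ltW.
have := HN m Nm; have := HN n (leq_trans Nm (ltnW mn)).
set L := lim _; rewrite !ltr_norml => /andP[_ b1] /andP[b2 _].
have -> : \sum_(m <= i < n) cabs (u i) =
   series (fun i => cabs (u i)) n - series (fun i => cabs (u i)) m.
  by rewrite sub_series_geq // ltnW.
lra.
Qed.

Lemma eq_asum u v : u =1 v -> asum u -> asum v.
Proof. by move=> /funext ->. Qed.
Lemma eq_sumC u v : u =1 v -> sumC u = sumC v.
Proof. by move=> /funext ->. Qed.

Lemma asum_le u v : (forall n, cabs (u n) <= cabs (v n)) -> asum v -> asum u.
Proof.
move=> H [K HK]; exists K => n; apply: le_trans (HK n); exact: ler_sum.
Qed.
Lemma asumD u v : asum u -> asum v -> asum (fun n => u n + v n).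
Proof.
move=> [K HK] [L HL]; exists (K + L) => n; apply: le_trans (lerD (HK n) (HL n)).
rewrite -big_split; apply: ler_sum => i _; exact: cabsD.
Qed.
Lemma asumZ c u : asum u -> asum (fun n => c * u n).
Proof.
move=> [K HK]; exists (cabs c * K) => n.
under eq_bigr do rewrite cabsM.
by rewrite -mulr_sumr ler_wpM2l ?cabs_ge0.
Qed.
Lemma asum_shift u N : asum u <-> asum (fun n => u (n + N)%N).
Proof.
split=> -[K HK].
  exists K => n; apply: le_trans (HK (N + n)%N); rewrite big_split_ord /=.
  have -> : \sum_(i < n) cabs (u (i + N)%N) = \sum_(i < n) cabs (u (N + i)%N).
    by apply: eq_bigr => i _; rewrite addnC.
  by rewrite lerDr sumr_ge0 // => i _; apply: cabs_ge0.
exists (\sum_(i < N) cabs (u i) + K) => n.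
apply: (@le_trans _ _ (\sum_(i < N + n) cabs (u i))).
  rewrite addnC big_split_ord /= lerDl sumr_ge0 // => i _; exact: cabs_ge0.
rewrite big_split_ord /= lerD2l.
have -> : \sum_(i < n) cabs (u (N + i)%N) = \sum_(i < n) cabs (u (i + N)%N).
  by apply: eq_bigr => i _; rewrite addnC.
exact: HK.
Qed.
Lemma sumC_fin u N : (forall n, (N <= n)%N -> u n = 0) -> sumC u = \sum_(i < N) u i.
Proof.
move=> H; apply: sumC_P => e e0; exists N => n Nn.
rewrite -(subnKC Nn) big_split_ord /= [X in _ + X - _]big1 ?addr0 ?subrr ?cabs0 // => i _.
by rewrite H // leq_addr.
Qed.
Lemma sumCD u v : asum u -> asum v -> sumC (fun n => u n + v n) = sumC u + sumC v.
Proof.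
move=> Hu Hv; apply: sumC_P => e e0; have e2 : 0 < e / 2 by rewrite divr_gt0.
have [N HN] := asum_eps Hu e2; have [M HM] := asum_eps Hv e2.
exists (maxn N M) => n; rewrite geq_max => /andP[Nn Mn].
rewrite big_split /= opprD addrACA [e]splitr; apply: le_lt_trans (cabsD _ _) _.
by rewrite ltrD ?HN ?HM.
Qed.
Lemma sumCZ c u : asum u -> sumC (fun n => c * u n) = c * sumC u.
Proof.
move=> /asum_cvg Hu; apply: cvgC_lim.
have -> : series (fun n => c * u n) = (fun n => c * series u n).
  by apply/funext => n; rewrite !seriesE mulr_sumr.
exact: cvgCZ.
Qed.
Lemma sumCB u v : asum u -> asum v -> sumC (fun n => u n - v n) = sumC u - sumC v.
Proof.
move=> Hu Hv; rewrite (@eq_sumC _ (fun n => u n + (-1) * v n)); last by move=> n; rewrite mulN1r.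
by rewrite sumCD ?sumCZ ?mulN1r //; apply: asumZ.
Qed.

Lemma sumC_split u N : asum u -> sumC u = \sum_(i < N) u i + sumC (fun n => u (n + N)%N).
Proof.
move=> Hu; have Hu' := (asum_shift u N).1 Hu.
apply: sumC_P => e e0; have [M HM] := asum_eps Hu' e0.
exists (N + M)%N => n Nn.
have NnN : (N <= n)%N by apply: leq_trans Nn; apply: leq_addr.
rewrite -(subnKC NnN) big_split_ord /=.
have -> : \sum_(i < n - N) u (N + i)%N = \sum_(i < n - N) u (i + N)%N.
  by apply: eq_bigr => i _; rewrite addnC.
rewrite opprD addrACA subrr add0r; apply: HM.
by rewrite -(leq_add2l N) subnKC.
Qed.
Lemma sumC_recl u : asum u -> sumC u = u 0%N + sumC (fun n => u n.+1).
Proof.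
move=> Hu; rewrite (sumC_split 1 Hu) big_ord1; congr (_ + _).
by apply: eq_sumC => n; rewrite addn1.
Qed.

Lemma sumC_le u K : (forall n, \sum_(i < n) cabs (u i) <= K) -> cabs (sumC u) <= K.
Proof.
move=> HK; apply/ler_addgt0Pr => e e0.
have Hu : asum u by exists K.
have [N HN] := asum_eps Hu e0; have := HN N (leqnn _).
have := HK N; have := cabs_sum (index_enum 'I_N) predT (fun i : 'I_N => u i).
set s := \sum_(i < N) u i => h1 h2 h3.
have := cabsBl (sumC u) s; rewrite cabsB => h4.
by lra.
Qed.

Lemma sumC_bound u : asum u -> exists K : R, (forall n, \sum_(i < n) cabs (u i) <= K)
   /\ 0 <= K.
Proof. by move=> [K HK]; exists K; split => //; have := HK 0%N; rewrite big_ord0. Qed.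

(** Domination by a product makes everything uniform: the n by n square differs from the first n
    full rows by the row tails, each at most b i times one tail of c. Squares are chosen because
    they are symmetric in the two indices. *)
Lemma sumC_double (t : nat -> nat -> C) (b c : nat -> R) :
  (forall m n, cabs (t m n) <= b m * c n) -> (forall n, 0 <= b n) -> (forall n, 0 <= c n) ->
  asum (fun n => ofR (b n)) -> asum (fun n => ofR (c n)) ->
  [/\ forall m, asum (t m), asum (fun m => sumC (t m)) &
   forall e : R, 0 < e -> exists N, forall n, (N <= n)%N ->
     cabs (\sum_(i < n) \sum_(j < n) t i j - sumC (fun m => sumC (t m))) < e].
Proof.
move=> Ht b0 c0 Hb Hc.
have cb i : cabs (ofR (b i)) = b i by rewrite cabs_ofR ger0_norm.
have cc i : cabs (ofR (c i)) = c i by rewrite cabs_ofR ger0_norm.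
have [B [HB B0]] := sumC_bound Hb; have [D [HD D0]] := sumC_bound Hc.
have A1 m : asum (t m).
  apply: (@asum_le _ (fun n => ofR (b m) * ofR (c n))); last exact: asumZ.
  by move=> n; rewrite cabsM cb cc.
have row m : cabs (sumC (t m)) <= b m * D.
  apply: sumC_le => n; apply: (@le_trans _ _ (\sum_(i < n) b m * c i)); first exact: ler_sum.
  rewrite -mulr_sumr ler_wpM2l //; apply: le_trans (HD n).
  by apply: ler_sum => i _; rewrite cc.
have A2 : asum (fun m => sumC (t m)).
  exists (B * D) => n; apply: (@le_trans _ _ (\sum_(i < n) b i * D)); first exact: ler_sum.
  rewrite -mulr_suml ler_wpM2r //; apply: le_trans (HB n).
  by apply: ler_sum => i _; rewrite cb.
split=> // e e0.
have e2 : 0 < e / 2 by rewrite divr_gt0.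
have [N1 HN1] := asum_eps A2 e2.
(* B + 1 replaces B, which may be 0; summed against b this tail costs at most e / 2. *)
have e3 : 0 < e / 2 / (B + 1) by rewrite divr_gt0 // ltr_wpDl.
have [N2 HN2] := asum_tail Hc e3.
exists (maxn N1 N2) => n; rewrite geq_max => /andP[n1 n2].
set s := sumC (fun m => _).
have -> : \sum_(i < n) \sum_(j < n) t i j - s =
  (\sum_(i < n) sumC (t i) - s) - \sum_(i < n) (sumC (fun j => t i (j + n)%N)).
  rewrite addrAC; congr (_ - s); rewrite -sumrB; apply: eq_bigr => i _.
  by rewrite (sumC_split n (A1 i)) addrK.
apply: le_lt_trans (cabsD _ _) _; rewrite cabsN [e]splitr.
apply: ltr_leD; first exact: HN1.
apply: le_trans (cabs_sum _ _ _) _.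
apply: (@le_trans _ _ (\sum_(i < n) b i * (e / 2 / (B + 1)))).
  apply: ler_sum => i _; apply: sumC_le => k.
  apply: (@le_trans _ _ (\sum_(j < k) b i * c (j + n)%N)); first exact: ler_sum.
  rewrite -mulr_sumr ler_wpM2l //.
  have -> : \sum_(j < k) c (j + n)%N = \sum_(n <= j < n + k) cabs (ofR (c j)).
    transitivity (\sum_(0 + n <= j < n + k) cabs (ofR (c j))); last by [].
    by rewrite big_addn addKn big_mkord; apply: eq_bigr => j _; rewrite cc.
  exact: HN2.
rewrite -mulr_suml; apply: (@le_trans _ _ (B * (e / 2 / (B + 1)))).
  apply: ler_wpM2r; first exact: ltW.
  apply: le_trans (HB n).
  by apply: ler_sum => i _; rewrite cb.
rewrite mulrA ler_pdivrMr ?ltr_wpDl // mulrC ler_wpM2l ?ltW //; lra.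
Qed.

(** The same square sums approach both iterated sums. *)
Lemma sumC_fubini (t : nat -> nat -> C) (b c : nat -> R) :
  (forall m n, cabs (t m n) <= b m * c n) -> (forall n, 0 <= b n) -> (forall n, 0 <= c n) ->
  asum (fun n => ofR (b n)) -> asum (fun n => ofR (c n)) ->
  sumC (fun m => sumC (t m)) = sumC (fun n => sumC (t^~ n)).
Proof.
move=> Ht b0 c0 Hb Hc.
have [_ _ H1] := sumC_double Ht b0 c0 Hb Hc.
have Ht' : forall m n, cabs (t n m) <= c m * b n by move=> m n; rewrite mulrC.
have [_ _ H2] := sumC_double Ht' c0 b0 Hc Hb.
apply/eqP; rewrite -subr_eq0 -cabs_eq0 eq_le cabs_ge0 andbT.
apply/ler_addgt0Pr => e e0; rewrite add0r.
have e2 : 0 < e / 2 by rewrite divr_gt0.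
have [N1 HN1] := H1 _ e2; have [N2 HN2] := H2 _ e2.
have := HN1 (maxn N1 N2) (leq_maxl _ _); have := HN2 (maxn N1 N2) (leq_maxr _ _).
rewrite exchange_big /=; set s := \sum_i _; set x := sumC _; set y := sumC (fun _ => sumC _).
move=> h1 h2; have -> : y - x = (s - x) - (s - y) by ring.
apply: le_trans (cabsD _ _) _; rewrite cabsN; lra.
Qed.

Lemma geo_sum (s : R) n : 0 <= s < 1 -> \sum_(i < n) s ^+ i <= (1 - s)^-1.
Proof.
move=> /andP[s0 s1]; have s1' : 0 < 1 - s by rewrite subr_gt0.
rewrite -[X in _ <= X]mul1r ler_pdivlMr //.
have -> : (\sum_(i < n) s ^+ i) * (1 - s) = 1 - s ^+ n.
  elim: n => [|n IH]; first by rewrite big_ord0 mul0r expr0 subrr.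
  by rewrite big_ord_recr /= mulrDl IH exprSr; ring.
by rewrite gerBl exprn_ge0.
Qed.

Lemma asum_geo u K (s : R) : 0 <= s < 1 -> (forall n, cabs (u n) <= K * s ^+ n) ->
  (forall n, \sum_(i < n) cabs (u i) <= K / (1 - s)) /\ asum u.
Proof.
move=> Hs Hu; have K0 : 0 <= K by have := Hu 0%N; rewrite expr0 mulr1; apply: le_trans; apply: cabs_ge0.
have H n : \sum_(i < n) cabs (u i) <= K / (1 - s).
  apply: (@le_trans _ _ (\sum_(i < n) K * s ^+ i)); first exact: ler_sum.
  by rewrite -mulr_sumr ler_wpM2l // geo_sum.
by split => //; exists (K / (1 - s)).
Qed.
End Series.

(** * Power series *)

Lemma le_of_eq (R : realType) (x y : R) : x = y -> x <= y.
Proof. by move=> ->. Qed.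

Section PowerSeries.
Variable R : realType.
Local Notation C := (Cfield R).
Implicit Types a b : nat -> C.

(* Cauchy's estimates on each smaller circle, i.e. convergence for |z| < r. *)
Definition PS (r : R) a := forall rho, 0 < rho < r ->
  exists K : R, forall n, cabs (a n) * rho ^+ n <= K.
Definition ps a (z : C) : C := sumC (fun n => a n * z ^+ n).
Definition conv a b (n : nat) : C := \sum_(i < n.+1) a i * b (n - i)%N.
Definition nps a (n : nat) : C := n%:R * a n.

(** The Cauchy bound at the midpoint of |z| and r leaves a geometric factor |z| / rho < 1. This
    margin pays for absolute convergence, derivatives and products without any loss of radius. *)
Lemma PS_geo r a (z : C) : PS r a -> cabs z < r ->
  exists K s : R, [/\ 0 <= s < 1, 0 <= K & forall n, cabs (a n * z ^+ n) <= K * s ^+ n].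
Proof.
move=> Ha zr; have z0 := cabs_ge0 z.
pose rho := (cabs z + r) / 2.
have rp : 0 < rho < r by rewrite /rho; apply/andP; split; lra.
have zrho : cabs z < rho by rewrite /rho; lra.
have [K HK] := Ha _ rp; have /andP[rho0 _] := rp.
exists K, (cabs z / rho); split.
- by apply/andP; split; [rewrite divr_ge0 // ltW | rewrite ltr_pdivrMr // mul1r].
- by have := HK 0%N; rewrite expr0 mulr1; apply: le_trans; apply: cabs_ge0.
move=> n; rewrite cabsM cabsX expr_div_n mulrA ler_pdivlMr ?exprn_gt0 //.
by rewrite mulrAC ler_wpM2r ?exprn_ge0.
Qed.

Lemma PS_asum r a (z : C) : PS r a -> cabs z < r -> asum (fun n => a n * z ^+ n).
Proof. by move=> Ha zr; have [K [s [Hs K0 H]]] := PS_geo Ha zr; have [] := asum_geo Hs H. Qed.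

Lemma PS_le r a b : (forall n, cabs (a n) <= cabs (b n)) -> PS r b -> PS r a.
Proof.
move=> H Hb rho Hr; have [K HK] := Hb _ Hr; exists K => n; apply: le_trans (HK n).
by rewrite ler_wpM2r // exprn_ge0 // ltW //; case/andP: Hr.
Qed.
Lemma PS_mono r r' a : r' <= r -> PS r a -> PS r' a.
Proof.
by move=> rr H rho /andP[r0 r1]; apply: H; rewrite r0 /=; apply: lt_le_trans rr.
Qed.
Lemma PSD r a b : PS r a -> PS r b -> PS r (fun n => a n + b n).
Proof.
move=> Ha Hb rho Hr; have [K HK] := Ha _ Hr; have [L HL] := Hb _ Hr.
exists (K + L) => n; apply: le_trans (lerD (HK n) (HL n)).
by rewrite -mulrDl ler_wpM2r ?cabsD // exprn_ge0 // ltW //; case/andP: Hr.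
Qed.
Lemma PSZ r c a : PS r a -> PS r (fun n => c * a n).
Proof.
move=> Ha rho Hr; have [K HK] := Ha _ Hr.
by exists (cabs c * K) => n; rewrite cabsM -mulrA ler_wpM2l ?cabs_ge0.
Qed.
Lemma PSB r a b : PS r a -> PS r b -> PS r (fun n => a n - b n).
Proof.
move=> Ha Hb; have := PSD Ha (PSZ (-1) Hb).
by congr PS; apply/funext => n; rewrite mulN1r.
Qed.

(** Each of the n + 1 copies of s^n is at most a term s^i of the geometric series with i <= n. *)
Lemma nbound (s : R) n : 0 <= s < 1 -> n.+1%:R * s ^+ n <= (1 - s)^-1.
Proof.
move=> Hs; apply: le_trans (geo_sum n.+1 Hs).
have -> : n.+1%:R * s ^+ n = \sum_(i < n.+1) s ^+ n by rewrite sumr_const card_ord mulr_natl.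
apply: ler_sum => i _; case/andP: Hs => s0 s1.
by rewrite ler_wiXn2l // ?ltW // -ltnS.
Qed.

Lemma PS_mid r a rho : PS r a -> 0 < rho < r ->
  exists K s : R, [/\ 0 <= s < 1, 0 <= K & forall n, cabs (a n) * rho ^+ n <= K * s ^+ n].
Proof.
move=> Ha /andP[r0 r1].
have [K [s [Hs K0 H]]] := PS_geo (z := ofR rho) Ha (ltac:(by rewrite cabs_ofR gtr0_norm)).
exists K, s; split => // n; have := H n.
by rewrite cabsM cabsX cabs_ofR gtr0_norm.
Qed.

Lemma PS_nps r a : PS r a -> PS r (nps a).
Proof.
move=> Ha rho Hr; have [K [s [Hs K0 H]]] := PS_mid Ha Hr.
exists (K / (1 - s)) => n; rewrite /nps cabsM cabs_nat -mulrA.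
apply: (@le_trans _ _ (n.+1%:R * (K * s ^+ n))).
  by rewrite ler_pM ?ler0n ?ler_nat // mulr_ge0 ?cabs_ge0 // exprn_ge0 // ltW //; case/andP: Hr.
by rewrite mulrCA ler_wpM2l // nbound.
Qed.

Lemma PS_shift r a : PS r a -> PS r (fun n => a n.+1).
Proof.
move=> Ha rho Hr; have [K HK] := Ha _ Hr; have /andP[r0 _] := Hr.
by exists (K / rho) => n; rewrite ler_pdivlMr // -mulrA -exprSr.
Qed.
Lemma PS_unshift r a : PS r (fun n => a n.+1) -> PS r a.
Proof.
move=> Ha rho Hr; have [K HK] := Ha _ Hr; have /andP[r0 _] := Hr.
exists (cabs (a 0%N) + K * rho) => -[|n].
  rewrite expr0 mulr1 lerDl mulr_ge0 //; last exact: ltW.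
  by have := HK 0%N; rewrite expr0 mulr1; apply: le_trans; apply: cabs_ge0.
rewrite exprSr mulrA; apply: (@le_trans _ _ (K * rho)); last by rewrite lerDr cabs_ge0.
by apply: ler_wpM2r; [exact: ltW | exact: HK].
Qed.

Lemma PS_conv r a b : PS r a -> PS r b -> PS r (conv a b).
Proof.
move=> Ha Hb rho Hr; have [K [s [Hs K0 H]]] := PS_mid Ha Hr; have [L HL] := Hb _ Hr.
have L0 : 0 <= L by have := HL 0%N; rewrite expr0 mulr1; apply: le_trans; apply: cabs_ge0.
have /andP[s0 s1] := Hs; have /andP[r0 _] := Hr.
exists (K * L / (1 - s)) => n.
apply: (@le_trans _ _ (\sum_(i < n.+1) K * L * s ^+ i)); last first.
  by rewrite -mulr_sumr ler_wpM2l ?mulr_ge0 // geo_sum.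
apply: le_trans (ler_wpM2r _ (cabs_sum _ _ _)) _; first by rewrite exprn_ge0 // ltW.
rewrite mulr_suml; apply: ler_sum => i _.
have -> : rho ^+ n = rho ^+ i * rho ^+ (n - i) by rewrite -exprD subnKC // -ltnS.
rewrite cabsM mulrACA [leRHS]mulrAC; apply: ler_pM => //.
- by rewrite mulr_ge0 ?cabs_ge0 // exprn_ge0 // ltW.
- by rewrite mulr_ge0 ?cabs_ge0 // exprn_ge0 // ltW.
Qed.

Lemma PS_const r c : PS r (fun n => if n == 0%N then c else 0).
Proof.
move=> rho Hr; exists (cabs c) => -[|n] /=; first by rewrite expr0 mulr1.
by rewrite cabs0 mul0r cabs_ge0.
Qed.
Lemma ps_const c z : ps (fun n => if n == 0%N then c else 0) z = c.
Proof.
rewrite /ps (@sumC_fin _ _ 1%N) ?big_ord1 ?expr0 ?mulr1 //.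
by case=> // n _; rewrite mul0r.
Qed.

Lemma psD r a b z : PS r a -> PS r b -> cabs z < r ->
  ps (fun n => a n + b n) z = ps a z + ps b z.
Proof.
move=> Ha Hb zr; rewrite /ps -(sumCD (PS_asum Ha zr) (PS_asum Hb zr)).
by apply: eq_sumC => n; rewrite mulrDl.
Qed.
Lemma psZ r c a z : PS r a -> cabs z < r -> ps (fun n => c * a n) z = c * ps a z.
Proof.
move=> Ha zr; rewrite /ps -(sumCZ _ (PS_asum Ha zr)).
by apply: eq_sumC => n; rewrite mulrA.
Qed.
Lemma psB r a b z : PS r a -> PS r b -> cabs z < r ->
  ps (fun n => a n - b n) z = ps a z - ps b z.
Proof.
move=> Ha Hb zr; rewrite /ps -(sumCB (PS_asum Ha zr) (PS_asum Hb zr)).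
by apply: eq_sumC => n; rewrite mulrBl.
Qed.
Lemma ps0 a : ps a 0 = a 0%N.
Proof.
rewrite /ps (@sumC_fin _ _ 1%N) ?big_ord1 ?expr0 ?mulr1 //.
by case=> // n _; rewrite exprS mul0r mulr0.
Qed.
Lemma ps_recl r a z : PS r a -> cabs z < r -> ps a z = a 0%N + z * ps (fun n => a n.+1) z.
Proof.
move=> Ha zr; rewrite /ps (sumC_recl (PS_asum Ha zr)) expr0 mulr1; congr (_ + _).
rewrite -sumCZ; last exact: (PS_asum (PS_shift Ha) zr).
by apply: eq_sumC => n; rewrite exprS mulrCA.
Qed.

(** The Cauchy product as a double sum over n and i <= n. With m the larger of the two ratios a term
    is at most K L m^n, and m^n = g^n g^n <= g^n g^i where g is the square root of m: this is the
    product form that [sumC_fubini] asks for. *)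
Lemma ps_conv r a b z : PS r a -> PS r b -> cabs z < r -> ps (conv a b) z = ps a z * ps b z.
Proof.
move=> Ha Hb zr; have [K [s [Hs K0 HK]]] := PS_geo Ha zr.
have [L [s' [Hs' L0 HL]]] := PS_geo Hb zr.
pose m := Num.max s s'; pose g := Num.sqrt m.
have /andP[s0 s1] := Hs; have /andP[s0' s1'] := Hs'.
have m0 : 0 <= m by rewrite le_max s0.
have gm : g ^+ 2 = m by rewrite sqr_sqrtr.
have g0 : 0 <= g by apply: sqrtr_ge0.
have g1 : g < 1 by rewrite -sqrtr1 ltr_sqrt // gt_max s1 s1'.
have Hg : 0 <= g < 1 by rewrite g0 g1.
pose u n := a n * z ^+ n; pose v n := b n * z ^+ n.
pose t n i := if (i <= n)%N then u i * v (n - i)%N else 0.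
have mX x n : 0 <= x -> x <= m -> x ^+ n <= m ^+ n by move=> x0 xm; rewrite lerXn2r // nnegrE.
have Ht n i : cabs (t n i) <= (K * L * g ^+ n) * g ^+ i.
  rewrite /t; case: leqP => [ni|_]; last by rewrite cabs0 !mulr_ge0 // exprn_ge0.
  rewrite cabsM; apply: (@le_trans _ _ (K * m ^+ i * (L * m ^+ (n - i)))).
    apply: ler_pM; rewrite ?cabs_ge0 //.
      by apply: le_trans (HK _) _; rewrite ler_wpM2l // mX // le_max lexx.
    by apply: le_trans (HL _) _; rewrite ler_wpM2l // mX // le_max lexx orbT.
  rewrite mulrACA -exprD subnKC // -[leRHS]mulrA ler_wpM2l ?mulr_ge0 // -gm -exprM -exprD.
  by rewrite ler_wiXn2l // ?ltW // mulSn mul1n leq_add2l.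
have geoA (M : R) : 0 <= M -> asum (fun n => ofR (M * g ^+ n)).
  move=> M0; have [] := @asum_geo _ (fun n => ofR (M * g ^+ n)) M g Hg => // n.
  by rewrite cabs_ofR ger0_norm // mulr_ge0 // exprn_ge0.
have A1 : asum (fun n => ofR (g ^+ n)).
  by have := geoA 1 ler01; congr asum; apply/funext => n; rewrite mul1r.
have b0 n : 0 <= K * L * g ^+ n by rewrite !mulr_ge0 // exprn_ge0.
have c0 n : 0 <= g ^+ n by rewrite exprn_ge0.
have E := sumC_fubini Ht b0 c0 (geoA _ (mulr_ge0 K0 L0)) A1.
transitivity (sumC (fun n => sumC (t n))).
  apply: eq_sumC => n; rewrite (@sumC_fin _ _ n.+1); last by move=> i ni; rewrite /t leqNgt ni.
  rewrite /conv mulr_suml; apply: eq_bigr => i _.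
  have ni : (i <= n)%N by rewrite -ltnS.
  rewrite /t ni /u /v mulrACA -exprD subnKC //.
rewrite E mulrC /ps -(sumCZ _ (PS_asum Ha zr)); apply: eq_sumC => i.
have At : asum (t^~ i).
  apply: (@asum_le _ _ (fun n => ofR (g ^+ i) * ofR (K * L * g ^+ n))).
    by move=> n; rewrite cabsM !cabs_ofR !ger0_norm // mulrC.
  by apply: asumZ; apply: geoA; apply: mulr_ge0.
rewrite (sumC_split i At) big1 ?add0r; last by move=> n _; rewrite /t leqNgt ltn_ord.
rewrite mulrC -(sumCZ _ (PS_asum Hb zr)); apply: eq_sumC => n.
by rewrite /t leq_addl addnK.
Qed.

(** Differentiation term by term as one estimate: the remainder is quadratic in h, with a constant
    obtained by summing n^2 |a n| rho^n. *)
Lemma PS_pow_bound r a z : PS r a -> cabs z < r ->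
  exists d M : R, [/\ 0 < d, 0 <= M & forall h, cabs h < d ->
    cabs (ps a (z + h) - ps a z - ps (fun n => nps a n.+1) z * h) <= M * cabs h ^+ 2].
Proof.
move=> Ha zr; have z0 := cabs_ge0 z.
pose rho := (cabs z + r) / 2.
have rho0 : 0 < rho by rewrite /rho; lra.
have rhor : rho < r by rewrite /rho; lra.
have zrho : cabs z < rho by rewrite /rho; lra.
have crho : cabs (ofR rho) = rho by rewrite cabs_ofR gtr0_norm.
have [M HM] := PS_asum (z := ofR rho) (PS_nps (PS_nps Ha)) (ltac:(by rewrite crho)).
have M0 : 0 <= M by have := HM 0%N; rewrite big_ord0.
exists (rho - cabs z), (M / rho ^+ 2); split; first by rewrite subr_gt0.
  by rewrite divr_ge0 // exprn_ge0 // ltW.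
move=> h hd; have wr : cabs (z + h) < rho by have := cabsD z h; lra.
(* Induction on n; the factor rho^2 stands on the left so that no exponent n - 2 occurs. *)
have rem n : rho ^+ 2 * cabs ((z + h) ^+ n - z ^+ n - n%:R * z ^+ n.-1 * h)
    <= n%:R ^+ 2 * rho ^+ n * cabs h ^+ 2.
  elim: n => [|n IH].
    by rewrite !expr0 mul0r mul0r subrr subr0 cabs0 mulr0 expr0n /= !mul0r.
  have -> : (z + h) ^+ n.+1 - z ^+ n.+1 - n.+1%:R * z ^+ n.+1.-1 * h =
     (z + h) * ((z + h) ^+ n - z ^+ n - n%:R * z ^+ n.-1 * h) + n%:R * z ^+ n.-1 * h ^+ 2.
    case: n {IH} => [|n] /=; first by rewrite !expr0 !expr1; ring.
    by rewrite !exprS -natr1; ring.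
  have zn : rho ^+ 2 * (n%:R * cabs z ^+ n.-1) <= n%:R * rho ^+ n.+1.
    case: n {IH} => [|n] /=; first by rewrite !mul0r mulr0.
    rewrite mulrCA ler_wpM2l ?ler0n //.
    have -> : rho ^+ n.+2 = rho ^+ n * rho ^+ 2 by rewrite -exprD addn2.
    rewrite mulrC.
    apply: ler_wpM2r; first by rewrite exprn_ge0 // ltW.
    by apply: lerXn2r; rewrite ?nnegrE; lra.
  apply: le_trans (ler_wpM2l _ (cabsD _ _)) _; first by rewrite exprn_ge0 // ltW.
  rewrite mulrDr !cabsM !cabsX cabs_nat.
  apply: (@le_trans _ _ (n%:R ^+ 2 * rho ^+ n.+1 * cabs h ^+ 2 + n%:R * rho ^+ n.+1 * cabs h ^+ 2)).
    apply: lerD; last by rewrite [leLHS]mulrA; exact: (ler_wpM2r (sqr_ge0 (cabs h)) zn).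
    rewrite mulrCA; apply: (@le_trans _ _ (rho * (n%:R ^+ 2 * rho ^+ n * cabs h ^+ 2))).
      exact: (ler_pM (cabs_ge0 _) (mulr_ge0 (exprn_ge0 2 (ltW rho0)) (cabs_ge0 _)) (ltW wr) IH).
    by rewrite [rho ^+ n.+1]exprS; apply: le_of_eq; ring.
  rewrite -mulrDl -mulrDl ler_wpM2r ?sqr_ge0 // ler_wpM2r ?exprn_ge0 ?ltW // -natr1.
  have := ler0n R n; nra.
have w_r : cabs (z + h) < r by lra.
have An : asum (fun n => a n * (n%:R * z ^+ n.-1)).
  apply/(asum_shift _ 1); have := PS_asum (PS_shift (PS_nps Ha)) zr; apply: eq_asum => n.
  by rewrite addn1 /= /nps; ring.
have -> : ps (fun n => nps a n.+1) z = sumC (fun n => a n * (n%:R * z ^+ n.-1)).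
  rewrite (sumC_recl An) mul0r mulr0 add0r; apply: eq_sumC => n /=.
  by rewrite /nps; ring.
rewrite /ps -(sumCB (PS_asum Ha w_r) (PS_asum Ha zr)) mulrC -(sumCZ _ An) -sumCB; last 2 first.
- have := asumD (PS_asum Ha w_r) (asumZ (-1) (PS_asum Ha zr)).
  by apply: eq_asum => n; rewrite mulN1r.
- exact: asumZ.
apply: sumC_le => n; rewrite mulrAC ler_pdivlMr ?exprn_gt0 //.
rewrite mulr_suml; apply: (@le_trans _ _ (\sum_(i < n) cabs (nps (nps a) i * ofR rho ^+ i) * cabs h ^+ 2)).
  apply: ler_sum => i _.
  rewrite -mulrBr [h * _]mulrCA -mulrBr.
  have -> : h * (i%:R * z ^+ i.-1) = i%:R * z ^+ i.-1 * h by rewrite mulrC.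
  rewrite [cabs (a i * _)]cabsM [leLHS]mulrC mulrCA.
  apply: le_trans (ler_wpM2l (cabs_ge0 _) (rem i)) _.
  rewrite /nps !cabsM cabsX crho cabs_nat; apply: le_of_eq; ring.
by rewrite -mulr_suml ler_wpM2r ?sqr_ge0.
Qed.
End PowerSeries.

(** * Complex derivatives and the exponential *)

Section ComplexDerivative.
Variable R : realType.
Local Notation C := (Cfield R).
Implicit Types (f g : C -> C) (z l m : C).

(** Written without a quotient, so that products, compositions and h = 0 need no side condition;
    [cder_derivable] returns to the notion in which holomorphy is stated. *)
Definition cder f z l := forall e : R, 0 < e -> exists2 d : R, 0 < d &
  forall h : C, cabs h < d -> cabs (f (z + h) - f z - l * h) <= e * cabs h.

Lemma cder_derivable f z l : cder f z l -> derivable f z 1.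
Proof.
move=> H; apply/cvg_ex; exists l; apply/cvgrPdist_le => e e0.
have er : e = ofR (cRe e).
  by apply: complex_eqP => //; move: e0; rewrite ltcE => /andP [/eqP /= H0 _]; rewrite /cIm H0.
have e0' : 0 < cRe e by move: e0; rewrite {1}er ltcR.
have [d d0 Hd] := H _ e0'.
have d0' : 0 < (ofR d : C) by rewrite ltcR.
near=> h.
have h0 : h != 0 by near: h; exact: nbhs_dnbhs_neq.
have hd : cabs h < d.
  by rewrite -ltcR -[X in X < _]cabsE; near: h; exact: dnbhs0_lt.
rewrite cabsE er lecR cabsB /= [h *: 1]mulr1.
have -> : h^-1 *: (f (h + z) - f z) - l = h^-1 * (f (z + h) - f z - l * h).
  rewrite [h + z]addrC mulrBr [l * h]mulrC mulKf //.
by rewrite cabsM cabsV mulrC ler_pdivrMr ?cabs_gt0 // Hd.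
Unshelve. all: by end_near. Qed.

Lemma cder_quad f z l (d M : R) : 0 < d -> 0 <= M ->
  (forall h, cabs h < d -> cabs (f (z + h) - f z - l * h) <= M * cabs h ^+ 2) -> cder f z l.
Proof.
move=> d0 M0 H e e0; exists (Num.min d (e / (M + 1))).
  by rewrite lt_min d0 divr_gt0 // ltr_wpDl.
move=> h; rewrite lt_min => /andP[hd he]; apply: le_trans (H h hd) _.
rewrite expr2 mulrA ler_wpM2r ?cabs_ge0 //.
have M1 : 0 < M + 1 by rewrite ltr_wpDl.
move: he; rewrite ltr_pdivlMr // mulrDr mulr1 mulrC => he.
have := cabs_ge0 h; lra.
Qed.

Lemma cder_local f g z l (d : R) : 0 < d -> (forall h, cabs h < d -> f (z + h) = g (z + h)) ->
  cder f z l -> cder g z l.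
Proof.
move=> d0 E H e e0; have [d' d0' Hd] := H e e0; exists (Num.min d d').
  by rewrite lt_min d0.
move=> h; rewrite lt_min => /andP[h1 h2].
by rewrite -E // -[X in g X]addr0 -E ?cabs0 // addr0 Hd.
Qed.

Lemma cder_eq f z l m : cder f z l -> l = m -> cder f z m.
Proof. by move=> H <-. Qed.

Lemma cder_ext f g z l : f =1 g -> cder f z l -> cder g z l.
Proof. by move=> /funext ->. Qed.

Lemma cder_uniq f z l m : cder f z l -> cder f z m -> l = m.
Proof.
move=> H1 H2; apply/eqP; rewrite -subr_eq0 -cabs_eq0 eq_le cabs_ge0 andbT.
apply/ler_addgt0Pr => e e0; rewrite add0r.
have e2 : 0 < e / 2 by rewrite divr_gt0.
have [d d0 Hd] := H1 _ e2; have [d' d0' Hd'] := H2 _ e2.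
pose c := Num.min d d' / 2; have c0 : 0 < c by rewrite divr_gt0 // lt_min d0.
have ccE : cabs (ofR c) = c by rewrite cabs_ofR gtr0_norm.
have cm : c < Num.min d d' by rewrite /c; have : 0 < Num.min d d'; [rewrite lt_min d0 | lra].
move: cm; rewrite lt_min => /andP[cd cd'].
have A := Hd (ofR c) (ltac:(by rewrite ccE)); have B := Hd' (ofR c) (ltac:(by rewrite ccE)).
have T : cabs ((l - m) * ofR c) <= e * c.
  have -> : (l - m) * ofR c = (f (z + ofR c) - f z - m * ofR c) - (f (z + ofR c) - f z - l * ofR c) by ring.
  apply: le_trans (cabsD _ _) _; rewrite cabsN; rewrite ccE in A B; lra.
by move: T; rewrite cabsM ccE ler_pM2r.
Qed.

Lemma cder_cst c z : cder (fun=> c) z 0.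
Proof.
by move=> e e0; exists 1 => // h _; rewrite subrr mul0r subr0 cabs0 mulr_ge0 ?cabs_ge0 // ltW.
Qed.
Lemma cder_id z : cder id z 1.
Proof.
move=> e e0; exists 1 => // h _; have -> : z + h - z - 1 * h = 0 by ring.
by rewrite cabs0 mulr_ge0 ?cabs_ge0 // ltW.
Qed.
Lemma cderD f g z l m : cder f z l -> cder g z m -> cder (fun x => f x + g x) z (l + m).
Proof.
move=> H1 H2 e e0; have e2 : 0 < e / 2 by rewrite divr_gt0.
have [d d0 Hd] := H1 _ e2; have [d' d0' Hd'] := H2 _ e2.
exists (Num.min d d'); first by rewrite lt_min d0.
move=> h; rewrite lt_min => /andP[h1 h2].
have -> : f (z + h) + g (z + h) - (f z + g z) - (l + m) * h =
  (f (z + h) - f z - l * h) + (g (z + h) - g z - m * h) by ring.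
apply: le_trans (cabsD _ _) _; have := Hd h h1; have := Hd' h h2; lra.
Qed.

Lemma cderM f g z l m : cder f z l -> cder g z m ->
  cder (fun x => f x * g x) z (l * g z + f z * m).
Proof.
move=> H1 H2 e e0.
set F := f z; set G := g z.
pose K := cabs G + cabs m + 1 + cabs F + cabs l + cabs l * cabs m.
have [[[F0 G0] l0] m0] := (cabs_ge0 F, cabs_ge0 G, cabs_ge0 l, cabs_ge0 m).
have lm0 : 0 <= cabs l * cabs m by rewrite mulr_ge0.
have K0 : 0 < K by rewrite /K; lra.
pose e' := Num.min 1 (e / K).
have e'0 : 0 < e' by rewrite lt_min ltr01 divr_gt0.
have e'1 : e' <= 1 by rewrite ge_min lexx.
have e'K : e' * K <= e by rewrite -ler_pdivlMr // ge_min lexx orbT.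
have [d d0 Hd] := H1 _ e'0; have [d' d0' Hd'] := H2 _ e'0.
clearbody e'; exists (Num.min e' (Num.min d d')); first by rewrite !lt_min e'0 d0.
move=> h; rewrite !lt_min => /and3P[h0 h1 h2].
have A := Hd h h1; have B := Hd' h h2; have hp := cabs_ge0 h.
set rf := f (z + h) - F - l * h in A; set rg := g (z + h) - G - m * h in B.
have -> : f (z + h) * g (z + h) - F * G - (l * G + F * m) * h =
  rf * (G + m * h + rg) + (F + l * h) * rg + l * m * h * h by rewrite /rf /rg; ring.
have b1 : cabs (G + m * h + rg) <= cabs G + cabs m + 1.
  apply: le_trans (cabsD _ _) _; apply: lerD; last by nra.
  by apply: le_trans (cabsD _ _) _; rewrite lerD2l cabsM ler_piMr //; lra.
have b2 : cabs (F + l * h) <= cabs F + cabs l.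
  by apply: le_trans (cabsD _ _) _; rewrite lerD2l cabsM ler_piMr //; lra.
apply: (@le_trans _ _ (e' * cabs h * (cabs G + cabs m + 1) + (cabs F + cabs l) * (e' * cabs h) + cabs l * cabs m * e' * cabs h)).
  apply: le_trans (cabsD _ _) _; apply: lerD.
    apply: le_trans (cabsD _ _) _; apply: lerD; rewrite cabsM; apply: ler_pM; rewrite ?cabs_ge0 //.
  rewrite !cabsM ler_wpM2r // ler_wpM2l //; exact: ltW.
have -> : e' * cabs h * (cabs G + cabs m + 1) + (cabs F + cabs l) * (e' * cabs h) + cabs l * cabs m * e' * cabs h = e' * K * cabs h by rewrite /K; ring.
by rewrite ler_wpM2r.
Qed.

Lemma cderZ c f z l : cder f z l -> cder (fun x => c * f x) z (c * l).
Proof. by move=> H; apply: cder_eq (cderM (cder_cst c z) H) _; rewrite mul0r add0r. Qed.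
Lemma cderN f z l : cder f z l -> cder (fun x => - f x) z (- l).
Proof.
move=> H; have := cderZ (-1) H; rewrite mulN1r; apply: cder_ext => x; exact: mulN1r.
Qed.
Lemma cderB f g z l m : cder f z l -> cder g z m -> cder (fun x => f x - g x) z (l - m).
Proof. by move=> H1 /cderN; apply: cderD. Qed.

Lemma cder_comp f g z l m : cder g z m -> cder f (g z) l -> cder (fun x => f (g x)) z (l * m).
Proof.
move=> H2 H1 e e0.
have [l0 m0] := (cabs_ge0 l, cabs_ge0 m).
pose K := cabs m + 1 + cabs l; have K0 : 0 < K by rewrite /K; lra.
pose e' := Num.min 1 (e / K).
have e'0 : 0 < e' by rewrite lt_min ltr01 divr_gt0.
have e'1 : e' <= 1 by rewrite ge_min lexx.
have e'K : e' * K <= e by rewrite -ler_pdivlMr // ge_min lexx orbT.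
have [d d0 Hd] := H1 _ e'0; have [d' d0' Hd'] := H2 _ e'0.
exists (Num.min d' (d / (cabs m + 1))); first by rewrite !lt_min d0' divr_gt0 //; lra.
move=> h; rewrite !lt_min => /andP[h1]; rewrite ltr_pdivlMr; last by lra.
move=> h2; have B := Hd' h h1; have hp := cabs_ge0 h.
set k := g (z + h) - g z.
have kb : cabs k <= (cabs m + 1) * cabs h.
  have -> : k = m * h + (k - m * h) by ring.
  apply: le_trans (cabsD _ _) _; rewrite mulrDl cabsM lerD2l mul1r.
  apply: le_trans B _; by rewrite ler_piMl.
have A := Hd k (ltac:(lra)).
have -> : g (z + h) = g z + k by rewrite /k; ring.
have -> : f (g z + k) - f (g z) - l * m * h = (f (g z + k) - f (g z) - l * k) + l * (k - m * h) by ring.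
apply: le_trans (cabsD _ _) _; rewrite cabsM.
have : cabs l * cabs (k - m * h) <= cabs l * (e' * cabs h) by rewrite ler_wpM2l.
have : e' * cabs k <= e' * ((cabs m + 1) * cabs h) by rewrite ler_wpM2l // ltW.
have : e' * K * cabs h <= e * cabs h by rewrite ler_wpM2r.
by rewrite /K; lra.
Qed.

Lemma cder_inv z : z != 0 -> cder (fun x => x^-1) z (- z ^- 2).
Proof.
move=> z0; have zp : 0 < cabs z by rewrite cabs_gt0.
apply: (@cder_quad _ _ _ (cabs z / 2) (2 / cabs z ^+ 3)); first by rewrite divr_gt0.
  by rewrite divr_ge0 // exprn_ge0 // ltW.
move=> h hz; have zh : cabs z / 2 <= cabs (z + h).
  by have := cabsBl z (- h); rewrite cabsN opprK; lra.
have zh0 : z + h != 0 by rewrite -cabs_gt0; lra.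
have -> : (z + h)^-1 - z^-1 - - z ^- 2 * h = h ^+ 2 / (z ^+ 2 * (z + h)).
  by field; rewrite z0 zh0.
rewrite cabsM cabsX cabsV mulrC ler_wpM2r ?sqr_ge0 // cabsM cabsX.
rewrite -[leLHS]mul1r ler_pdivrMr; last by rewrite mulr_gt0 ?exprn_gt0 //; lra.
rewrite mulrAC ler_pdivlMr ?exprn_gt0 // mul1r exprS.

have := ler_wpM2l (exprn_ge0 2 (ltW zp)) zh; lra.
Qed.

Lemma cderV f z l : f z != 0 -> cder f z l -> cder (fun x => (f x)^-1) z (- (f z) ^- 2 * l).
Proof. by move=> f0 H; apply: cder_comp H (cder_inv f0). Qed.

Lemma cderX f z l n : cder f z l -> cder (fun x => f x ^+ n.+1) z (n.+1%:R * f z ^+ n * l).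
Proof.
move=> H; elim: n => [|n IH].
  by apply: cder_eq (cder_ext _ H) _; [move=> x; rewrite expr1 | rewrite expr0 mulr1 mul1r].
apply: cder_eq (cder_ext _ (cderM H IH)) _; first by move=> x; rewrite [RHS]exprS.
by rewrite -[n.+2%:R]natr1 exprS; ring.
Qed.

Lemma ps_cder r a z : PS r a -> cabs z < r -> cder (ps a) z (ps (fun n => nps a n.+1) z).
Proof.
by move=> Ha zr; have [d [M [d0 M0 H]]] := PS_pow_bound Ha zr; apply: cder_quad d0 M0 H.
Qed.

(** The mean value theorem is real, so it is applied to the real and imaginary parts of f along the
    segment from x to y. Most uniqueness statements for differential equations below reduce to this
    lemma, through a product or quotient with zero derivative. *)
Lemma cder0_cst f (U : C -> Prop) :
  (forall (x y : C) (t : R), U x -> U y -> 0 <= t <= 1 -> U (x + ofR t * (y - x))) ->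
  (forall z, U z -> cder f z 0) -> forall x y, U x -> U y -> f x = f y.
Proof.
move=> cU Hf x y Ux Uy.
have key (p : C -> R) : (forall a b, p (a - b) = p a - p b) -> (forall a, `|p a| <= cabs a) ->
    p (f x) = p (f y).
  move=> pB pl; pose g (t : R) := p (f (x + ofR t * (y - x))).
  have Dg (t e : R) : 0 <= t <= 1 -> 0 < e -> exists2 d : R, 0 < d &
      forall h, `|h| < d -> `|g (t + h) - g t| <= e * `|h|.
    move=> t01 e0; have [l0 l1] := (cabs_ge0 (y - x), ltr01 (R := R)).
    (* The 1 keeps L positive when x = y. *)
    pose L := cabs (y - x) + 1; have L0 : 0 < L by rewrite /L; lra.
    have eL : 0 < e / L by rewrite divr_gt0.
    have [d d0 Hd] := Hf _ (cU x y t Ux Uy t01) _ eL.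
    exists (d / L); first by rewrite divr_gt0.
    move=> h; rewrite ltr_pdivlMr // => hd.
    have hL : cabs (ofR h * (y - x)) <= `|h| * L.
      by rewrite cabsM cabs_ofR ler_wpM2l // /L lerDl.
    have := Hd (ofR h * (y - x)) (le_lt_trans hL hd).
    rewrite mul0r subr0 -addrA -mulrDl -ofRD => A.
    rewrite /g -pB; apply: le_trans (pl _) _; apply: le_trans A _.
    apply: le_trans (ler_wpM2l (ltW eL) hL) _.
    by rewrite (_ : e / L * (`|h| * L) = e * `|h|) //; field; rewrite gt_eqF.
  have cg : {within `[0, 1], continuous g}.
    apply: continuous_in_subspaceT => t; rewrite inE /= in_itv /= => t01.
    apply/cvgrPdist_le => e e0; have [d d0 Hd] := Dg t 1 t01 ltr01.
    have de : 0 < Num.min d e by rewrite lt_min d0.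
    have : \forall s \near nbhs t, `|t - s| < Num.min d e by apply/nbhs_ballP; exists (Num.min d e).
    apply: filterS => s; rewrite lt_min => /andP[s1 s2].
    have := Hd (s - t); rewrite [t + _]addrC subrK mul1r [`|s - t|]distrC => Hs.
    by rewrite distrC; apply: le_trans (Hs s1) (ltW s2).
  have dg (t : R) : t \in `]0, 1[%R -> is_derive t 1 g 0.
    rewrite in_itv /= => /andP[t0 t1].
    have H : (fun h => h^-1 *: (g (h *: 1 + t) - g t)) @ 0^' --> (0 : R).
      apply/cvgrPdist_le => e e0; have [|d d0 Hd] := Dg t e _ e0; first by rewrite !ltW.
      near=> h.
      have h0 : h != 0 by near: h; exact: nbhs_dnbhs_neq.
      have hd : `|h| < d by near: h; exact: dnbhs0_lt.
      rewrite sub0r normrN normrM normfV mulrC ler_pdivrMr ?normr_gt0 //.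
      by rewrite [h *: 1]mulr1 [h + t]addrC Hd.
    apply: DeriveDef; first by apply/cvg_ex; exists 0.
    by apply: cvg_lim.
  have [c _] := MVT_segment (ler01 (R := R)) dg cg.
  rewrite mul0r /g => /eqP; rewrite subr_eq0 => /eqP.
  have -> : x + ofR 1 * (y - x) = y by rewrite (_ : ofR 1 = 1 :> C) // mul1r addrC subrK.
  by rewrite (_ : ofR 0 = 0 :> C) // mul0r addr0 => ->.
apply: complex_eqP.
  by apply: key => [a b|a]; [rewrite cReD cReN | exact: cRe_le].
by apply: key => [a b|a]; [rewrite cImD cImN | exact: cIm_le].
Unshelve. all: by end_near. Qed.
End ComplexDerivative.

(** * The complex exponential and e^(2 pi i z) *)

Section Exponential.
Variable R : realType.
Local Notation C := (Cfield R).
Implicit Types (z w : C).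

Lemma is_derive_eps (f : R -> R) (t l e : R) : is_derive t 1 f l -> 0 < e ->
  exists2 d : R, 0 < d & forall h, `|h| < d -> `|f (t + h) - f t - l * h| <= e * `|h|.
Proof.
move=> [H <-] e0; have /cvgrPdist_le Hc : (fun h => h^-1 *: (f (h *: 1 + t) - f t)) @ 0^' --> 'D_1 f t := H.
have [d /= d0 Hd] := Hc _ e0.
exists d => // h hd; have [->|h0] := eqVneq h 0; first by rewrite addr0 subrr mulr0 subr0 normr0 mulr0.
have := Hd h; rewrite /ball_ /= sub0r normrN => /(_ hd h0).
rewrite [h *: 1]mulr1 [h + t]addrC.
have -> : f (t + h) - f t - 'D_1 f t * h = - (h * ('D_1 f t - h^-1 *: (f (t + h) - f t))).
  by rewrite mulrBr /GRing.scale /= mulVKf // opprB mulrC.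
by move=> A; rewrite normrN normrM mulrC ler_wpM2r.
Qed.

Lemma cRe_cexp z : cRe (cexp z) = expR (cRe z) * cos (cIm z).
Proof. by rewrite /cexp cReM cReD cReM cImD cImM /cRe /cIm /=; ring. Qed.
Lemma cIm_cexp z : cIm (cexp z) = expR (cRe z) * sin (cIm z).
Proof. by rewrite /cexp cImM cReD cReM cImD cImM /cRe /cIm /=; ring. Qed.

Lemma cexpD z w : cexp (z + w) = cexp z * cexp w.
Proof.
apply: complex_eqP.
  by rewrite [LHS]cRe_cexp cReM !cRe_cexp !cIm_cexp cReD cImD expRD cosD; ring.
by rewrite [LHS]cIm_cexp cImM !cRe_cexp !cIm_cexp cReD cImD expRD sinD; ring.
Qed.
Lemma cexp0 : cexp (0 : C) = 1.
Proof.
by apply: complex_eqP; rewrite ?cRe_cexp ?cIm_cexp /cRe /cIm /= ?expR0 ?cos0 ?sin0 ?mulr1 ?mulr0.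
Qed.
Lemma cexpN z : cexp (- z) = (cexp z)^-1.
Proof.
have E : cexp (- z) * cexp z = 1 by rewrite -cexpD addNr cexp0.
have n0 : cexp z != 0 by apply: contra_eqN E => /eqP ->; rewrite mulr0 eq_sym oner_eq0.
by apply: (mulIf n0); rewrite E mulVf.
Qed.
Lemma cexp_neq0 z : cexp z != 0.
Proof.
have E : cexp (- z) * cexp z = 1 by rewrite -cexpD addNr cexp0.
by apply: contra_eqN E => /eqP ->; rewrite mulr0 eq_sym oner_eq0.
Qed.
Lemma cabs_RI z (r : R) : 0 <= r -> cRe z ^+ 2 + cIm z ^+ 2 = r ^+ 2 -> cabs z = r.
Proof. by move=> r0 E; rewrite /cabs normc_def /= -/(cRe z) -/(cIm z) E sqrtr_sqr ger0_norm. Qed.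
Lemma cabs_cexp z : cabs (cexp z) = expR (cRe z).
Proof.
apply: cabs_RI; first exact: expR_ge0.
by rewrite cRe_cexp cIm_cexp !exprMn -mulrDr cos2Dsin2 mulr1.
Qed.
Lemma cexpMn z n : cexp (n%:R * z) = cexp z ^+ n.
Proof.
elim: n => [|n IH]; first by rewrite mul0r cexp0.
by rewrite -natr1 mulrDl mul1r cexpD IH exprSr.
Qed.

Lemma cexp_cder0 : cder (@cexp R) 0 1.
Proof.
move=> e e0.
pose e' := Num.min 1 (e / 8).
have e'0 : 0 < e' by rewrite lt_min ltr01 divr_gt0.
have [d1 d10 H1] := is_derive_eps (is_derive_expR (0 : R)) e'0.
have [d2 d20 H2] := is_derive_eps (is_derive_cos (0 : R)) e'0.
have [d3 d30 H3] := is_derive_eps (is_derive_sin (0 : R)) e'0.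
have e'1 : e' <= 1 by rewrite ge_min lexx.
have e'8 : e' * 8 <= e by rewrite -ler_pdivlMr // ge_min lexx orbT.
clearbody e'.
exists (Num.min e' (Num.min d1 (Num.min d2 d3))); first by rewrite !lt_min e'0 d10 d20 d30.
move=> h; rewrite !lt_min => /and4P[h0 h1 h2 h3].
have xh := cRe_le h; have yh := cIm_le h; set x := cRe h in xh *; set y := cIm h in yh *.
have := H1 x (le_lt_trans xh h1); rewrite add0r expR0 mul1r => A1.
have := H2 y (le_lt_trans yh h2); rewrite add0r sin0 cos0 oppr0 mul0r subr0 => A2.
have := H3 y (le_lt_trans yh h3); rewrite add0r sin0 cos0 subr0 mul1r => A3.
rewrite add0r cexp0 mul1r.
have hp := cabs_ge0 h; have [xp yp] := (normr_ge0 x, normr_ge0 y).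
have cb := cos_max y; have sb := sin_max y.
(* The error splits into the three real remainders a, b, c; the bounds [B1] and [B2] below add up to
   7 e' |h|, whence the 8 in e'. *)
pose a := expR x - 1 - x; pose b := cos y - 1; pose c := sin y - y.
have ax : `|a| <= e' * cabs h by apply: le_trans A1 _; rewrite ler_wpM2l // ltW.
have bx : `|b| <= e' * cabs h by apply: le_trans A2 _; rewrite ler_wpM2l // ltW.
have cx : `|c| <= e' * cabs h by apply: le_trans A3 _; rewrite ler_wpM2l // ltW.
have sy : `|sin y| <= 2 * cabs h.
  have -> : sin y = c + y by rewrite /c; ring.
  by apply: le_trans (ler_normD _ _) _; nra.
have x1 : `|x| <= 1 by lra.
apply: le_trans (cabs_leRI _) _.
rewrite !cReD !cReN !cImD !cImN cRe_cexp cIm_cexp -/x -/y.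
have -> : cRe (1 : C) = 1 by []. have -> : cIm (1 : C) = 0 by [].
have -> : expR x * cos y - 1 - x = a * cos y + (1 + x) * b by rewrite /a /b; ring.
have -> : expR x * sin y - 0 - y = a * sin y + c + x * sin y by rewrite /a /c; ring.
have P (u v p q : R) : `|u| <= p -> `|v| <= q -> `|u * v| <= p * q.
  by move=> up vq; rewrite normrM ler_pM.
have B1 : `|a * cos y + (1 + x) * b| <= e' * cabs h * 1 + 2 * (e' * cabs h).
  apply: le_trans (ler_normD _ _) _; apply: lerD; apply: P => //.
  by apply: le_trans (ler_normD _ _) _; rewrite normr1; lra.
have B2 : `|a * sin y + c + x * sin y| <= e' * cabs h * 1 + e' * cabs h + e' * (2 * cabs h).
  apply: le_trans (ler_normD _ _) _; apply: lerD; last by apply: P => //; lra.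
  by apply: le_trans (ler_normD _ _) _; apply: lerD => //; apply: P.
have E8 : e' * 8 * cabs h <= e * cabs h by rewrite ler_wpM2r.
have E0 : 0 <= e' * cabs h by rewrite mulr_ge0 // ltW.
clear - R B1 B2 E8 E0; lra.
Qed.

Lemma cexp_cder z : cder (@cexp R) z (cexp z).
Proof.
have H : cder (fun w => cexp z * cexp (w - z)) z (cexp z * (1 * (1 - 0))).
  apply: cderZ; apply: (@cder_comp _ (@cexp R) (fun w => w - z)).
    by apply: cderB; [exact: cder_id | exact: cder_cst].
  by rewrite subrr; exact: cexp_cder0.
rewrite subr0 !mulr1 in H; apply: cder_ext H => w.
by rewrite -cexpD addrC subrK.
Qed.

Definition tpi : C := 2%:R * ofR pi * iC R.
Lemma tpi_neq0 : tpi != 0.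
Proof.
have p0 : (ofR pi : C) != 0 by rewrite -cabs_eq0 cabs_ofR normr_eq0 gt_eqF // pi_gt0.
by rewrite /tpi !mulf_neq0 ?iC_neq0 // pnatr_eq0.
Qed.
Lemma cRe_tpi z : cRe (tpi * z) = - (2 * pi * cIm z).
Proof. by rewrite /tpi -ofR_nat /cRe /cIm; case: z => x y /=; ring. Qed.
Lemma cIm_tpi z : cIm (tpi * z) = 2 * pi * cRe z.
Proof. by rewrite /tpi -ofR_nat /cRe /cIm; case: z => x y /=; ring. Qed.

Lemma e2piE z : e2pi z = cexp (tpi * z). Proof. by []. Qed.
Lemma e2piD z w : e2pi (z + w) = e2pi z * e2pi w.
Proof. by rewrite !e2piE mulrDr cexpD. Qed.
Lemma e2pi0 : e2pi (0 : C) = 1.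
Proof. by rewrite e2piE mulr0 cexp0. Qed.
Lemma e2piN z : e2pi (- z) = (e2pi z)^-1.
Proof. by rewrite !e2piE mulrN cexpN. Qed.
Lemma e2pi_neq0 z : e2pi z != 0.
Proof. exact: cexp_neq0. Qed.
Lemma e2piMn z n : e2pi (n%:R * z) = e2pi z ^+ n.
Proof. by rewrite !e2piE mulrCA cexpMn. Qed.
Lemma cabs_e2pi z : cabs (e2pi z) = expR (- (2 * pi * cIm z)).
Proof. by rewrite e2piE cabs_cexp cRe_tpi. Qed.
Lemma e2pi1 : e2pi (1 : C) = 1.
Proof.
have [R1 I1] : cRe (1 : C) = 1 /\ cIm (1 : C) = 0 by [].
apply: complex_eqP; rewrite e2piE ?cRe_cexp ?cIm_cexp cRe_tpi cIm_tpi R1 I1.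
  by rewrite mulr0 oppr0 expR0 mulr1 mul1r mulr_natl cos2pi.
by rewrite mulr0 oppr0 expR0 mulr1 mul1r mulr_natl sin2pi.
Qed.
Lemma e2pi_half : e2pi (2%:R^-1 : C) = -1.
Proof.
have E : e2pi (2%:R^-1 : C) ^+ 2 = 1 by rewrite -e2piMn mulfV ?pnatr_eq0 // e2pi1.
have N1 : e2pi (2%:R^-1 : C) != 1.
  have h2 : (2%:R^-1 : C) = ofR (2^-1) by rewrite ofRE fmorphV rmorph_nat.
  apply/eqP => /(congr1 (@cRe R)); rewrite e2piE cRe_cexp cRe_tpi cIm_tpi h2.
  rewrite cRe_ofR cIm_ofR mulr0 oppr0 expR0 mul1r mulrAC divff ?pnatr_eq0 // mul1r cospi /cRe /=.
  lra.
by move/eqP: E; rewrite sqrf_eq1 (negPf N1) /= => /eqP.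
Qed.
Lemma e2pi_int (n : int) : e2pi (n%:~R : C) = 1.
Proof.
case: n => n; first by rewrite -[_%:~R]mulr1 e2piMn e2pi1 expr1n.
by rewrite NegzE mulrNz e2piN -[_%:~R]mulr1 e2piMn e2pi1 expr1n invr1.
Qed.
Lemma e2pi_cder z : cder (@e2pi R) z (tpi * e2pi z).
Proof.
rewrite mulrC; apply: (@cder_comp _ (@cexp R) (fun w => tpi * w)).
  by apply: cder_eq (cderZ tpi (cder_id z)) _; rewrite mulr1.
exact: cexp_cder.
Qed.
Lemma e2pi_disc z : 0 < cIm z -> cabs (e2pi z) < 1.
Proof.
by move=> z0; rewrite cabs_e2pi -expR0 ltr_expR oppr_lt0 !mulr_gt0 // pi_gt0.
Qed.

(** The modulus forces Im z = 0. For the fractional part y of Re z, cos (2 pi y) = 1 gives sin (pi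
    y) = 0, while sin is positive inside (0, pi). *)
Lemma e2pi_eq1 z : e2pi z = 1 -> exists n : int, z = n%:~R.
Proof.
move=> H; exists (Num.floor (cRe z)).
have pp := pi_gt0 R.
have Iz : cIm z = 0.
  have E : expR (- (2 * pi * cIm z)) = expR 0 by rewrite -cabs_e2pi H cabs1 expR0.
  have /eqP := expR_inj E.
  by rewrite oppr_eq0 !mulf_eq0 (gt_eqF pp) pnatr_eq0 /= => /eqP.
set n := Num.floor _; pose y := cRe z - n%:~R.
have Hy : 0 <= y < 1.
  have := floor_itv (cRe z); rewrite -/n intrD => /andP[a b].
  by rewrite /y subr_ge0 a /= ltrBlDl.
have Hz : e2pi (z - n%:~R) = 1 by rewrite e2piD H e2piN e2pi_int invr1 mulr1.
have Rz : cRe (z - n%:~R) = y by rewrite cReD cReN cRe_int.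
have Iz' : cIm (z - n%:~R) = 0 by rewrite cImD cImN cIm_int Iz subr0.
have y0 : y = 0.
  have := congr1 (@cRe R) Hz; rewrite e2piE cRe_cexp cRe_tpi cIm_tpi Rz Iz' mulr0 oppr0 expR0 mul1r.
  have -> : 2 * pi * y = (pi * y) *+ 2 by rewrite mulr2n; ring.
  rewrite cos_mulr2n cos2sin2 => E.
  have /eqP : sin (pi * y) ^+ 2 = 0 by move: E; rewrite {1}/cRe /=; rewrite !mulr2n; lra.
  rewrite expf_eq0 /= => /eqP s0.
  case/andP: Hy => y0 y1; move: y0; rewrite le_eqVlt => /orP[/eqP <- //|y0].
  have := @sin_gt0_pi R (pi * y); rewrite s0 ltxx => A.
  have : 0 < pi * y < pi by rewrite mulr_gt0 // gtr_pMr.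
  by move/A.
apply: complex_eqP; rewrite ?cRe_int ?cIm_int //.
by move: y0; rewrite /y => /eqP; rewrite subr_eq0 => /eqP.
Qed.

Lemma e2pi_surj w : w != 0 -> exists z, e2pi z = w.
Proof.
move=> w0; have wp : 0 < cabs w by rewrite cabs_gt0.
have pp := pi_gt0 R.
have pn : (pi : R) != 0 by rewrite gt_eqF.
pose x := cRe w / cabs w; pose y := cIm w / cabs w.
have E : x ^+ 2 + y ^+ 2 = 1.
  have : cabs w ^+ 2 = cRe w ^+ 2 + cIm w ^+ 2.
    by rewrite /cabs normc_def /= sqr_sqrtr // addr_ge0 ?sqr_ge0.
  rewrite /x /y !expr_div_n -mulrDl => <-; rewrite divff // expf_neq0 // gt_eqF //.
have x1 : -1 <= x <= 1 by apply/andP; split; nra.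
have [th [ct st]] : exists th : R, cos th = x /\ sin th = y.
  have [_ ca] := acos_def x1; have sa := sin_acos x1.
  have s2 : 1 - x ^+ 2 = y ^+ 2 by lra.
  rewrite s2 sqrtr_sqr in sa.
  have [y0|y0] := leP 0 y; first by exists (acos x); rewrite ca sa ger0_norm.
  by exists (- acos x); rewrite cosN ca sinN sa ltr0_norm // opprK.
exists (Complex (th / (2 * pi)) (- ln (cabs w) / (2 * pi))).
apply: complex_eqP; rewrite e2piE ?cRe_cexp ?cIm_cexp cRe_tpi cIm_tpi /=.
  have -> : - (2 * pi * (- ln (cabs w) / (2 * pi))) = ln (cabs w) by field; apply: lt0r_neq0; lra.
  have -> : 2 * pi * (th / (2 * pi)) = th by field; apply: lt0r_neq0; lra.
  by rewrite lnK ?posrE // ct /x mulrC divfK // gt_eqF.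
have -> : - (2 * pi * (- ln (cabs w) / (2 * pi))) = ln (cabs w) by field; apply: lt0r_neq0; lra.
have -> : 2 * pi * (th / (2 * pi)) = th by field; apply: lt0r_neq0; lra.
by rewrite lnK ?posrE // st /y mulrC divfK // gt_eqF.
Qed.

Lemma e2pi_surj01 w : w != 0 -> exists2 z, e2pi z = w & 0 <= cRe z < 1.
Proof.
move=> /e2pi_surj [z Hz]; exists (z - (Num.floor (cRe z))%:~R).
  by rewrite e2piD e2piN e2pi_int invr1 mulr1.
rewrite cReD cReN cRe_int; have := floor_itv (cRe z); rewrite intrD => /andP[a b].
by rewrite subr_ge0 a /= ltrBlDl.
Qed.
End Exponential.

(** * First order equations on the unit disc, dilations and Lambert series *)

Section FirstOrder.
Variable R : realType.
Local Notation C := (Cfield R).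
Implicit Types (a b chi u : nat -> C) (q z : C).

Lemma ps_cder_disc a q : PS 1 a -> cabs q < 1 -> cder (ps a) q (ps (fun n => nps a n.+1) q).
Proof. exact: ps_cder. Qed.

Lemma q_ps_sh_nps r a q : PS r a -> cabs q < r -> q * ps (fun n => nps a n.+1) q = ps (nps a) q.
Proof. by move=> Ha qr; rewrite (ps_recl (PS_nps Ha) qr) {2}/nps mul0r add0r. Qed.

(** Each new coefficient depends on all earlier ones, hence a recursion that carries the whole
    prefix. *)
Fixpoint expseq chi n : seq C :=
  if n is m.+1 then
    let s := expseq chi m in
    rcons s (m.+1%:R^-1 * \sum_(k < m.+1) chi k * s`_(m - k))
  else [:: 1].

(* The power series solution of u' = chi u with u(0) = 1. *)
Definition expsol chi n : C := (expseq chi n)`_n.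

Lemma size_expseq chi n : size (expseq chi n) = n.+1.
Proof. by elim: n => //= n IH; rewrite size_rcons IH. Qed.

Lemma expseq_nth chi n k : (k <= n)%N -> (expseq chi n)`_k = expsol chi k.
Proof.
elim: n => [|n IH]; first by case: k.
rewrite leq_eqVlt => /orP[/eqP -> //|kn].
by rewrite /= nth_rcons size_expseq kn IH.
Qed.

Lemma expsol0 chi : expsol chi 0 = 1. Proof. by []. Qed.
Lemma expsolS chi n : n.+1%:R * expsol chi n.+1 = conv chi (expsol chi) n.
Proof.
rewrite {1}/expsol /= nth_rcons size_expseq ltnn eqxx mulrA mulfV ?pnatr_eq0 // mul1r.
by apply: eq_bigr => i _; rewrite expseq_nth // leq_subr.
Qed.

(** The bound is S itself and not an unspecified constant: this is what makes the tails of the eta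
    product tend to 1 in [eta_limit]. As S <= 1, all earlier terms are bounded by 1, and the
    recursion then gives S again. *)
Lemma expsol_bound chi (rho S : R) n : 0 < rho -> S <= 1 ->
  (forall n, \sum_(k < n) cabs (chi k) * rho ^+ k.+1 <= S) ->
  cabs (expsol chi n.+1) * rho ^+ n.+1 <= S.
Proof.
move=> r0 S1 HS; have S0 : 0 <= S by have := HS 0%N; rewrite big_ord0.
have r0' k : 0 <= rho ^+ k by rewrite exprn_ge0 // ltW.
have step m : (forall k, (k <= m)%N -> cabs (expsol chi k) * rho ^+ k <= 1) ->
    cabs (expsol chi m.+1) * rho ^+ m.+1 <= S.
  move=> H; have m1 : 1 <= m.+1%:R :> R by rewrite ler1n.
  have : m.+1%:R * (cabs (expsol chi m.+1) * rho ^+ m.+1) <= S.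
    rewrite mulrA -[X in X * cabs _](@cabs_nat R) -cabsM expsolS.
    apply: le_trans (ler_wpM2r _ (cabs_sum _ _ _)) _ => //.
    rewrite mulr_suml; apply: le_trans _ (HS m.+1); apply: ler_sum => i _.
    have im : (i <= m)%N by rewrite -ltnS.
    have -> : rho ^+ m.+1 = rho ^+ i.+1 * rho ^+ (m - i) by rewrite -exprD addSn subnKC.
    by rewrite cabsM mulrACA ler_piMr ?mulr_ge0 ?cabs_ge0 // H // leq_subr.
  apply: le_trans; rewrite ler_peMl // mulr_ge0 ?cabs_ge0 //.
apply: (step n); elim/ltn_ind: n => n IH k; case: k => [|k] kn.
  by rewrite expsol0 cabs1 expr0 mulr1.
by apply: le_trans S1; apply: (step k) => j jk; apply: (IH k).
Qed.

(** Past the index N0 > S the factor S / (n + 1) in the recursion is at most 1, so no later term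
    exceeds the bound valid for the first N0. *)
Lemma expsol_PS chi : PS 1 chi -> PS 1 (expsol chi).
Proof.
move=> Hc rho /andP[r0 r1].
have r0' k : 0 <= rho ^+ k by rewrite exprn_ge0 // ltW.
have crho : cabs (ofR rho) = rho by rewrite cabs_ofR gtr0_norm.
have [S0 HS0] := PS_asum (z := ofR rho) Hc (ltac:(by rewrite crho)).
pose S := Num.max 0 S0 * rho.
have HS n : \sum_(k < n) cabs (chi k) * rho ^+ k.+1 <= S.
  apply: (@le_trans _ _ (S0 * rho)).
    2: by apply: ler_wpM2r; [exact: ltW | rewrite le_max lexx orbT].
  apply: (@le_trans _ _ ((\sum_(k < n) cabs (chi k * ofR rho ^+ k)) * rho)).
    rewrite mulr_suml; apply: ler_sum => i _.
    by rewrite cabsM cabsX crho -mulrA -exprSr.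
  by apply: ler_wpM2r; [exact: ltW | exact: HS0].
have Sp : 0 <= S by apply: mulr_ge0; [rewrite le_max lexx | exact: ltW].
pose v n := cabs (expsol chi n) * rho ^+ n.
have v0 n : 0 <= v n by rewrite mulr_ge0 ?cabs_ge0.
pose N0 := (Num.truncn S).+1; pose K := \sum_(i < N0) v i.
have K0 : 0 <= K by apply: sumr_ge0.
exists K; elim/ltn_ind => n IH.
have [nN|Nn] := ltnP n N0.
  by rewrite /K (bigD1 (Ordinal nN)) //= lerDl sumr_ge0.
case: n IH Nn => // n IH Nn.
have SN : S <= n.+1%:R.
  by have /andP[_ H] := truncn_itv Sp; apply: le_trans (ltW H) _; rewrite ler_nat.
have H : n.+1%:R * v n.+1 <= S * K.
  rewrite /v mulrA -[X in X * cabs _](@cabs_nat R) -cabsM expsolS.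
  apply: le_trans (ler_wpM2r _ (cabs_sum _ _ _)) _ => //.
  apply: le_trans (ler_wpM2r K0 (HS n.+1)); rewrite !mulr_suml; apply: ler_sum => i _.
  have im : (i <= n)%N by rewrite -ltnS.
  have -> : rho ^+ n.+1 = rho ^+ i.+1 * rho ^+ (n - i) by rewrite -exprD addSn subnKC.
  by rewrite cabsM mulrACA ler_wpM2l ?mulr_ge0 ?cabs_ge0 // IH // ltnS leq_subr.
have : n.+1%:R * v n.+1 <= n.+1%:R * K by apply: le_trans H _; rewrite ler_wpM2r.
by rewrite ler_pM2l ?ltr0n.
Qed.

Lemma expsol_cder chi q : PS 1 chi -> cabs q < 1 ->
  cder (ps (expsol chi)) q (ps chi q * ps (expsol chi) q).
Proof.
move=> Hc q1; have Hu := expsol_PS Hc.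
apply: cder_eq (ps_cder_disc Hu q1) _; rewrite -(ps_conv Hc Hu q1).
by congr (ps _ q); apply/funext => n; rewrite /nps expsolS.
Qed.

Definition disc q := cabs q < 1.
Lemma disc_convex (x y : C) (t : R) : disc x -> disc y -> 0 <= t <= 1 -> disc (x + ofR t * (y - x)).
Proof.
move=> x1 y1 /andP[t0 t1]; rewrite /disc.
have -> : x + ofR t * (y - x) = ofR (1 - t) * x + ofR t * y.
  have -> : ofR (1 - t) = 1 - ofR t :> C by rewrite ofRD ofRN.
  by ring.
apply: le_lt_trans (cabsD _ _) _; rewrite !cabsM !cabs_ofR !ger0_norm //; last by lra.
move: x1 y1; rewrite /disc => x1 y1.
have [->|t0'] := eqVneq t 0; first by rewrite mul0r addr0 subr0 mul1r.
have tp : 0 < t by rewrite lt_def t0' t0.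
nra.
Qed.
Lemma disc0 : disc 0. Proof. by rewrite /disc cabs0 ltr01. Qed.

(** The product with the solution for -chi has derivative zero. This is the source of zero-freeness
    for the infinite products below. *)
Lemma expsol_inv chi q : PS 1 chi -> cabs q < 1 ->
  ps (expsol chi) q * ps (expsol (fun n => -1 * chi n)) q = 1.
Proof.
move=> Hc q1; set chi' := fun n => _; have Hc' : PS 1 chi' by apply: PSZ.
have -> : 1 = ps (expsol chi) 0 * ps (expsol chi') 0 :> C by rewrite !ps0 !expsol0 mulr1.
apply: (cder0_cst (f := fun x => ps (expsol chi) x * ps (expsol chi') x) disc_convex) => //; last exact: disc0.
move=> z z1; apply: cder_eq (cderM (expsol_cder Hc z1) (expsol_cder Hc' z1)) _.
by rewrite /chi' (psZ _ Hc z1); ring.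
Qed.
Lemma expsol_neq0 chi q : PS 1 chi -> cabs q < 1 -> ps (expsol chi) q != 0.
Proof.
move=> Hc q1; have := expsol_inv Hc q1; apply: contra_eqN => /eqP ->.
by rewrite mul0r eq_sym oner_eq0.
Qed.

Lemma expsol_uniq chi (f : C -> C) q : PS 1 chi ->
  (forall z, disc z -> cder f z (ps chi z * f z)) -> disc q ->
  f q = f 0 * ps (expsol chi) q.
Proof.
move=> Hc Hf q1; have Hc' : PS 1 (fun n => -1 * chi n) by apply: PSZ.
have E : f q * ps (expsol (fun n => -1 * chi n)) q = f 0 * ps (expsol (fun n => -1 * chi n)) 0.
  apply: (cder0_cst (f := fun x => f x * ps (expsol (fun n => -1 * chi n)) x) disc_convex) => //; last exact: disc0.
  move=> z z1; apply: cder_eq (cderM (Hf _ z1) (expsol_cder Hc' z1)) _.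
  by rewrite (psZ _ Hc z1); ring.
rewrite !ps0 expsol0 mulr1 in E; rewrite -E -mulrA [X in _ * X]mulrC expsol_inv //.
by rewrite mulr1.
Qed.

Lemma sumC_mult (d : nat) (u : nat -> C) : (0 < d)%N -> asum u ->
  (forall n, ~~ (d %| n)%N -> u n = 0) ->
  asum (fun n => u (d * n)%N) /\ sumC u = sumC (fun n => u (d * n)%N).
Proof.
move=> d0 Hu u0.
have E (T : nmodType) (v : nat -> T) M : (forall n, ~~ (d %| n)%N -> v n = 0) ->
    \sum_(i < d * M) v i = \sum_(i < M) v (d * i)%N.
  move=> v0; elim: M => [|M IH]; first by rewrite muln0 !big_ord0.
  rewrite mulnS addnC big_split_ord /= IH big_ord_recr /=; congr (_ + _).
  case: d d0 v0 {IH u0} => // d _ v0; rewrite big_ord_recl /= addn0 big1 ?addr0 // => i _.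
  rewrite v0 // dvdn_addr ?dvdn_mulr //; apply/negP => /dvdn_leq /= /(_ isT).
  by rewrite /bump leq0n add1n ltnS leqNgt ltn_ord.
have A : asum (fun n => u (d * n)%N).
  have [K HK] := Hu; exists K => n; rewrite -(E _ (fun i => cabs (u i))) //.
  by move=> i /u0 ->; rewrite cabs0.
split => //; apply/eqP; rewrite -subr_eq0 -cabs_eq0 eq_le cabs_ge0 andbT.
apply/ler_addgt0Pr => e e0; rewrite add0r; have e2 : 0 < e / 2 by rewrite divr_gt0.
have [N HN] := asum_eps Hu e2; have [M HM] := asum_eps A e2.
have a1 := HN (d * maxn N M)%N (leq_trans (leq_maxl N M) (leq_pmull _ d0)).
have a2 := HM (maxn N M) (leq_maxr _ _).
rewrite E // in a1; set s := \sum_(i < _) _ in a1 a2.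
have -> : sumC u - sumC (fun n => u (d * n)%N) = (s - sumC (fun n => u (d * n)%N)) - (s - sumC u) by ring.
apply: le_trans (cabsD _ _) _; rewrite cabsN; lra.
Qed.

(** The coefficients of f(q^d), if [a] holds those of f. *)
Definition dil (d : nat) a n : C := if (d %| n)%N then a (n %/ d)%N else 0.

Lemma PS_dil d a : (0 < d)%N -> PS 1 a -> PS 1 (dil d a).
Proof.
move=> d0 Ha rho /andP[r0 r1]; have [] := Ha (rho ^+ d).
  by rewrite exprn_gt0 //= exprn_ilt1 ?ltW // -lt0n.
move=> K HK; exists K => n; rewrite /dil; case: ifP => [/dvdnP [m ->]|_].
  by rewrite mulnK // mulnC exprM.
rewrite cabs0 mul0r; apply: le_trans (HK 0%N); by rewrite expr0 mulr1 cabs_ge0.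
Qed.

Lemma disc_exp q d : (0 < d)%N -> cabs q < 1 -> cabs (q ^+ d) < 1.
Proof. by move=> d0 q1; rewrite cabsX exprn_ilt1 ?cabs_ge0 // -lt0n. Qed.

Lemma ps_dil d a q : (0 < d)%N -> PS 1 a -> cabs q < 1 -> ps (dil d a) q = ps a (q ^+ d).
Proof.
move=> d0 Ha q1; have Hd := PS_dil d0 Ha.
rewrite /ps; have [|_ ->] := sumC_mult d0 (PS_asum Hd q1).
  by move=> n nd; rewrite /dil (negPf nd) mul0r.
by apply: eq_sumC => n; rewrite /dil dvdn_mulr // mulKn // exprM.
Qed.

Lemma PS_1 : PS 1 (fun=> 1 : C).
Proof.
move=> rho /andP[r0 r1]; exists 1 => n; rewrite cabs1 mul1r exprn_ile1 // ltW //.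
Qed.
Lemma ps_1 q : cabs q < 1 -> ps (fun=> 1) q = (1 - q)^-1.
Proof.
move=> q1; have := ps_recl PS_1 q1; set s := ps _ _ => E.
have n0 : 1 - q != 0.
  rewrite subr_eq0; apply: contraTneq q1 => <-; by rewrite cabs1 ltxx.
by apply: (mulfI n0); rewrite mulfV // mulrBl mul1r {1}E addrK.
Qed.
Lemma PS_pow k : PS 1 (fun n => n%:R ^+ k : C).
Proof.
elim: k => [|k IH]; first exact: PS_1.
by have := PS_nps IH; congr PS; apply/funext => n; rewrite /nps exprS.
Qed.
(* [divisors 0] is [:: 1], hence the explicit zeroth coefficient. *)
Definition sg l n : C := if n is 0%N then 0 else (divisor_sigma l n)%:R.
Lemma sgE l n : sg l n.+1 = \sum_(d <- divisors n.+1) d%:R ^+ l.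
Proof. by rewrite /sg /divisor_sigma natr_sum; apply: eq_bigr => d _; rewrite natrX. Qed.
Lemma sg_sum l n M : (0 < n)%N -> (n < M)%N -> sg l n = \sum_(1 <= d < M) (d %| n)%N%:R * d%:R ^+ l.
Proof.
case: n => // n n0 nM; rewrite sgE.
have -> : \sum_(1 <= d < M) (d %| n.+1)%N%:R * d%:R ^+ l = \sum_(d <- [seq d <- index_iota 1 M | (d %| n.+1)%N]) d%:R ^+ l :> C.
  by rewrite big_filter [RHS]big_mkcond; apply: eq_bigr => d _; case: (d %| _)%N; rewrite ?mul1r ?mul0r.
apply: perm_big; apply: uniq_perm; rewrite ?divisors_uniq ?filter_uniq ?iota_uniq // => d.
rewrite mem_filter mem_index_iota -dvdn_divisors //.
case: (boolP (d %| n.+1)%N) => //= dn; symmetry; apply/andP; split.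
  exact: dvdn_gt0 n0 dn.
exact: leq_ltn_trans (dvdn_leq n0 dn) nM.
Qed.
Lemma PS_sg l : PS 1 (sg l).
Proof.
apply: (PS_le (b := fun n => n%:R ^+ l.+1)) (PS_pow _) => n.
case: n => [|n]; first by rewrite cabs0 cabs_ge0.
rewrite cabsX !cabs_nat -natrX ler_nat.
rewrite /divisor_sigma expnS; apply: (@leq_trans (\sum_(d <- divisors n.+1) n.+1 ^ l)).
  rewrite big_seq [X in (_ <= X)%N]big_seq; apply: leq_sum => d; rewrite -dvdn_divisors // => /dvdn_leq H.
  by case: (l) => // l'; rewrite leq_exp2r // H.
rewrite big_const_seq count_predT iter_addn_0 mulnC leq_mul2r; apply/orP; right.
have /uniq_leq_size : uniq (divisors n.+1) by exact: divisors_uniq.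
move=> /(_ (iota 1 n.+1)) H; rewrite -[X in (_ <= X)%N](size_iota 1); apply: H => d.
rewrite -dvdn_divisors // mem_iota add1n ltnS => dn.
by rewrite (dvdn_gt0 _ dn) //= dvdn_leq.
Qed.
Lemma sg0 l : sg l 0 = 0. Proof. by []. Qed.

(** A double sum over n and the divisors d + 1 of n, taken in both orders: one gives divisor sums,
    the other geometric series. For the domination, |q|^n = g^n g^n <= g^n g^d because d < n. *)
Lemma lambert_sum (l : nat) q : cabs q < 1 ->
  ps (sg l) q = sumC (fun d => d.+1%:R ^+ l * (q ^+ d.+1 / (1 - q ^+ d.+1))).
Proof.
move=> q1; pose g := Num.sqrt (cabs q).
have g0 : 0 <= g by apply: sqrtr_ge0.
have g1 : g < 1 by rewrite -sqrtr1 ltr_sqrt.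
have gg : g ^+ 2 = cabs q by rewrite sqr_sqrtr // cabs_ge0.
have cg : cabs (ofR g) = g by rewrite cabs_ofR ger0_norm.
pose t n d := (if (d.+1 %| n)%N && (0 < n)%N then d.+1%:R ^+ l * q ^+ n else 0) : C.
have Ht n d : cabs (t n d) <= (n%:R ^+ l * g ^+ n) * g ^+ d.
  rewrite /t; case: ifP => [/andP[dn n0]|_]; last by rewrite cabs0 !mulr_ge0 ?exprn_ge0 ?ler0n.
  have dln := dvdn_leq n0 dn.
  rewrite cabsM !cabsX cabs_nat -mulrA -gg -exprM -exprD.
  apply: ler_pM; rewrite ?exprn_ge0 ?ler0n //.
    by rewrite lerXn2r ?nnegrE ?ler0n // ler_nat.
  by rewrite ler_wiXn2l // ?ltW // mulSn mul1n leq_add2l ltnW.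
have b0 n : 0 <= n%:R ^+ l * g ^+ n by rewrite mulr_ge0 ?exprn_ge0 ?ler0n.
have c0 n : 0 <= g ^+ n by rewrite exprn_ge0.
have Hb : asum (fun n => ofR (n%:R ^+ l * g ^+ n)).
  have := PS_asum (z := ofR g) (PS_pow l) (ltac:(by rewrite cg)); apply: eq_asum => n.
  by rewrite ofRM; congr (_ * _); rewrite !ofRE rmorphXn /= ?rmorph_nat.
have Hc : asum (fun n => ofR (g ^+ n)).
  have := PS_asum (z := ofR g) PS_1 (ltac:(by rewrite cg)); apply: eq_asum => n.
  by rewrite mul1r !ofRE rmorphXn.
have E := sumC_fubini Ht b0 c0 Hb Hc.
transitivity (sumC (fun n => sumC (t n))).
  apply: eq_sumC => n; rewrite (@sumC_fin _ _ n).
    case: n => [|n]; first by rewrite sg0 mul0r big_ord0.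
    rewrite (@sg_sum _ _ n.+2) // big_add1 /= big_mkord mulr_suml; apply: eq_bigr => d _.
    by rewrite /t andbT; case: (_ %| _)%N; rewrite ?mul1r ?mul0r.
  move=> d nd; rewrite /t; case: ifP => // /andP[dn n0]; have := dvdn_leq n0 dn.
  by rewrite ltnNge nd.
rewrite E; apply: eq_sumC => d.
have Qd := disc_exp (ltn0Sn d) q1.
have At : asum (fun n => t n d).
  apply: (@asum_le _ _ (fun n => ofR (g ^+ d) * ofR (n%:R ^+ l * g ^+ n))); last exact: asumZ.
  by move=> n; rewrite cabsM !cabs_ofR !ger0_norm // mulrC.
have [|_ ->] := sumC_mult (ltn0Sn d) At.
  by move=> n nd; rewrite /t (negPf nd).
have A2 := PS_asum PS_1 Qd.
transitivity (d.+1%:R ^+ l * sumC (fun n => if n is m.+1 then 1 * (q ^+ d.+1) ^+ n else 0)).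
  rewrite -sumCZ; last first.
    by apply: asum_le A2 => -[|n] //; rewrite cabs0 cabs_ge0.
  apply: eq_sumC => -[|n]; first by rewrite /t muln0 andbF mulr0.
  by rewrite /t dvdn_mulr // muln_gt0 /= mul1r exprM.
congr (_ * _); rewrite sumC_recl; last by apply: asum_le A2 => -[|n] //; rewrite cabs0 cabs_ge0.
rewrite add0r -(ps_1 Qd) /ps -(sumCZ _ A2); apply: eq_sumC => n.
by rewrite !mul1r exprS.
Qed.
End FirstOrder.

(** * Liouville's identity and Ramanujan's differential equations *)

Section Liouville.
Local Open Scope nat_scope.
(* The number of pairs (m, m') of positive integers with j m + k m' = N. *)
Definition npairs (N j k : nat) := \sum_(0 <= m < N) \sum_(0 <= m' < N) (j * m.+1 + k * m'.+1 == N).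

Lemma npairsC N j k : npairs N j k = npairs N k j.
Proof.
rewrite /npairs exchange_big; apply: eq_bigr => m _; apply: eq_bigr => m' _.
by rewrite addnC.
Qed.

Lemma npairs_big N j k : N < j + k -> npairs N j k = 0.
Proof.
move=> H; rewrite /npairs big1 // => m _; rewrite big1 // => m' _.
by case: eqP => // E; nia.
Qed.

(* Pairs with m > m', m < m' and m = m' are counted separately. *)
Lemma npairs_rec N j k : 0 < N -> 0 < j -> 0 < k ->
  npairs N j k = npairs N j (j + k) + npairs N (j + k) k + ((j + k) %| N).
Proof.
move: N => M M0 j0 k0.
have T (f : nat -> nat -> nat) : \sum_(0 <= m < M) \sum_(0 <= m' < M) f m m' =
  \sum_(0 <= m < M) \sum_(0 <= m' < M) (m' < m) * f m m' +
  \sum_(0 <= m < M) \sum_(0 <= m' < M) (m < m') * f m m' + \sum_(0 <= m < M) f m m.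
  rewrite -!big_split /=; apply: eq_big_nat => m /andP[_ mM].
  have -> : f m m = \sum_(0 <= m' < M) (m == m') * f m m'.
    rewrite (bigD1_seq m) //= ?mem_index_iota ?iota_uniq //.
    by rewrite eqxx mul1n big1 ?addn0 // => i /negPf; rewrite eq_sym => ->.
  rewrite -!big_split /=; apply: eq_big_nat => m' _; case: ltngtP; lia.
have lower (f : nat -> nat -> bool) : (forall m m', f m m' -> m < M) ->
  \sum_(0 <= m < M) \sum_(0 <= m' < M) (m' < m) * f m m' =
  \sum_(0 <= m' < M) \sum_(0 <= t < M) f (m' + t.+1) m'.
  move=> Hf; rewrite exchange_big; apply: eq_big_nat => m' /andP[_ m'M].
  rewrite (big_cat_nat _ m'M) //= big_nat_cond big1 => [|m /andP[/andP[_ H] _]]; last first.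
    by rewrite ltnNge -ltnS H.
  rewrite add0n -{1}[m'.+1]add0n big_addn.
  rewrite [RHS](big_cat_nat _ (leq_subr m'.+1 M)) //= [X in _ = _ + X]big_nat_cond.
  rewrite [X in _ = _ + X]big1 ?addn0 => [|m /andP[/andP[H _] _]]; last first.
    case: (boolP (f _ _)) => // /Hf; lia.
  apply: eq_bigr => t _; rewrite addnS addnC ltnS leq_addr mul1n.
  by rewrite addnS addnC.
(* With m = m' + t + 1 one has j (m + 1) + k (m' + 1) = j (t + 1) + (j + k) (m' + 1). *)
have E1 : \sum_(0 <= m < M) \sum_(0 <= m' < M) (m' < m) * (j * m.+1 + k * m'.+1 == M) = npairs M j (j + k).
  rewrite (lower (fun m m' => j * m.+1 + k * m'.+1 == M)); last by move=> m m' /eqP; nia.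
  rewrite /npairs exchange_big; apply: eq_bigr => t _; apply: eq_bigr => m' _.
  by congr (nat_of_bool (_ == _)); nia.
have E2 : \sum_(0 <= m < M) \sum_(0 <= m' < M) (m < m') * (j * m.+1 + k * m'.+1 == M) = npairs M (j + k) k.
  rewrite exchange_big (lower (fun m' m => j * m.+1 + k * m'.+1 == M)); last by move=> m m' /eqP; nia.
  rewrite /npairs; apply: eq_bigr => t _; apply: eq_bigr => m' _.
  by congr (nat_of_bool (_ == _)); nia.
rewrite {1}/npairs T E1 E2; congr (_ + _).
have [/dvdnP [q Hq]|nd] := boolP (j + k %| M).
  have q0 : 0 < q by rewrite lt0n; apply: contraTneq M0 => q0; rewrite Hq q0.
  have qM : q <= M by rewrite Hq; nia.
  rewrite (bigD1_seq q.-1) ?mem_index_iota ?iota_uniq //=; last by lia.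
  rewrite prednK // big1 ?addn0 => [|i Hi].
    by have -> : j * q + k * q == M by rewrite Hq; lia.
  by case: eqP => // E; move: Hi; nia.
rewrite big1 // => i _; case: eqP => // E; case/negP: nd.
by apply/dvdnP; exists i.+1; nia.
Qed.

(** For N = q n the pairs are the positive solutions of m + m' = q, of which there are q - 1; the
    divisibility term supplies the missing one. *)
Lemma npairs_diag N n : 0 < n -> 0 < N -> npairs N n n + (n %| N) = (N %/ n) * (n %| N).
Proof.
move=> n0 N0; have [/dvdnP [q Nq]|nd] := boolP (n %| N); last first.
  rewrite muln0 addn0 /npairs big1 // => m _; rewrite big1 // => m' _.
  by case: eqP => // E; case/negP: nd; apply/dvdnP; exists (m.+1 + m'.+1); lia.
case: q Nq => [|q] Nq; first by rewrite Nq in N0.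
rewrite Nq mulnK // muln1 addn1; congr _.+1.
have qN : q <= q.+1 * n by nia.
rewrite /npairs (big_cat_nat _ qN) //= [X in _ + X]big_nat_cond [X in _ + X]big1 => [|m /andP[/andP[H _] _]]; last first.
  by rewrite big1 // => m' _; case: eqP => // E; nia.
rewrite addn0; transitivity (\sum_(0 <= m < q) 1); last by rewrite sum_nat_const_nat subn0 muln1.
apply: eq_big_nat => m /andP[_ mq].
rewrite (bigD1_seq (q - m.+1)) ?mem_index_iota ?iota_uniq //=; last by nia.
have -> : n * m.+1 + n * (q - m.+1).+1 == q.+1 * n by apply/eqP; nia.
by rewrite big1 // => i Hi; case: eqP => // E; move: Hi; nia.
Qed.

(** Sort the pairs by the value i of j m: then m and m' are determined, and they exist exactly when
    j divides i and k divides N - i, both positive. *)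
Lemma npairs_conv N j k : 0 < N -> 0 < j -> 0 < k ->
  npairs N j k = \sum_(0 <= i < N.+1) ((j %| i) && (0 < i)) * ((k %| N - i) && (0 < N - i)).
Proof.
move=> N0 j0 k0; rewrite /npairs.
have dv d i : 0 < d -> i <= N -> \sum_(0 <= m < N) (d * m.+1 == i) = ((d %| i) && (0 < i)).
  move=> d0 iN; case: i iN => [|i] iN.
    by rewrite andbF big1 // => m _; case: eqP => //; nia.
  rewrite andbT; have [/dvdnP [q Hq]|nd] := boolP (d %| _).
    have q0 : 0 < q by case: q Hq.
    rewrite (bigD1_seq q.-1) ?mem_index_iota ?iota_uniq //=; last by nia.
    rewrite prednK // [X in X == _]mulnC Hq eqxx big1 // => t Ht.
    by case: eqP => // E; move: Ht; nia.
  rewrite big1 // => t _; case: eqP => // E; case/negP: nd; rewrite -E; exact: dvdn_mulr.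
transitivity (\sum_(0 <= i < N.+1) \sum_(0 <= m < N) \sum_(0 <= m' < N) (j * m.+1 == i) * (k * m'.+1 == N - i)).
  rewrite [RHS]exchange_big; apply: eq_bigr => m _; rewrite [RHS]exchange_big; apply: eq_bigr => m' _.
  have [le|gt] := leqP (j * m.+1) N.
    rewrite (bigD1_seq (j * m.+1)) ?mem_index_iota ?iota_uniq //= eqxx mul1n.
    rewrite [X in _ = _ + X]big1 ?addn0 => [|i Hi]; last by rewrite eq_sym (negPf Hi).
    by congr (nat_of_bool _); apply/eqP/eqP; lia.
  case: eqP => [E|_]; first by lia.
  rewrite big_nat_cond big1 // => i /andP[/andP[_ H] _].
  by case: eqP => // E; lia.
apply: eq_big_nat => i /andP[_ iN]; rewrite -(dv j i) // -(dv k (N - i)) ?leq_subr // big_distrlr /=.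
by [].
Qed.
End Liouville.

Section LiouvilleIdentity.
Variable F : comNzRingType.
Implicit Types f : nat -> F.

(* Liouville's elementary identity, evaluated by the recursion [npairs_rec]. *)
Lemma liouville (N M : nat) f : (0 < N)%N -> (N < M)%N -> f 0%N = 0 ->
  \sum_(1 <= j < M) \sum_(1 <= k < M)
     (npairs N j k)%:R * (f (maxn j k - minn j k)%N - f (j + k)%N) =
  \sum_(1 <= n < M) (n %| N)%:R *
     (f n *+ 2 * (N %/ n)%:R - f n * n.+1%:R - (\sum_(1 <= m < n) f m) *+ 2).
Proof.
move=> N0 NM f0.
pose b j k : F := (npairs N j k)%:R.
pose l n : F := (n %| N)%:R.
have bC j k : b j k = b k j by rewrite /b npairsC.
have rec n k : (0 < n)%N -> (0 < k)%N -> b n k = b n (n + k)%N + b k (n + k)%N + l (n + k)%N.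
  by move=> n0 k0; rewrite /b npairs_rec // !natrD [npairs N (n + k) k]npairsC.
have bbig j k : (M <= k)%N -> b j k = 0 by move=> H; rewrite /b npairs_big //; lia.
have lbig k : (M <= k)%N -> l k = 0.
  by move=> H; rewrite /l; case: (boolP (k %| N)%N) => // /dvdn_leq; lia.
have M1 : (1 <= M)%N by lia.
have diag n : (0 < n)%N -> b n n = l n * (N %/ n)%:R - l n.
  move=> n0; apply/eqP; rewrite -(inj_eq (addIr (l n))) subrK /b /l -natrD -natrM npairs_diag //.
  by rewrite mulnC.
pose A n := \sum_(1 <= k < n) b n k.
pose L n := \sum_(n.+1 <= k < M) l k.
(* By symmetry this is twice the part with k < j, the diagonal dropping out since f 0 = 0; then n =
   j - k becomes the index. *)
have S1 : \sum_(1 <= j < M) \sum_(1 <= k < M) b j k * f (maxn j k - minn j k)%N =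
  (\sum_(1 <= n < M) f n * (b n n + A n - L n)) *+ 2.
  have T : \sum_(1 <= j < M) \sum_(1 <= k < M) b j k * f (maxn j k - minn j k)%N =
      (\sum_(1 <= k < M) \sum_(1 <= n < M) f n * b k (n + k)%N) *+ 2.
    have half : \sum_(1 <= j < M) \sum_(1 <= k < M) (if (k < j)%N then b j k * f (j - k)%N else 0) =
       \sum_(1 <= k < M) \sum_(1 <= n < M) f n * b k (n + k)%N.
      rewrite exchange_big_nat /=; apply: eq_big_nat => k /andP[k0 kM].
      rewrite (big_cat_nat _ (m := 1) (n := k.+1)) //= big_nat_cond big1 ?add0r; last first.
        by move=> j /andP[/andP[_ H] _]; rewrite ltnNge -ltnS H.
      rewrite [RHS](big_cat_nat _ (m := 1) (n := (M - k)%N)) /=; [|lia|lia].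
      rewrite [X in _ = _ + X]big_nat_cond [X in _ = _ + X]big1 ?addr0; last first.
        by move=> j /andP[/andP[H _] _]; rewrite bbig ?mulr0 //; lia.
      have -> : k.+1 = (1 + k)%N by [].
      rewrite big_addn; apply: eq_big_nat => n /andP[n0 _].
      have -> : (k < n + k)%N by lia.
      by rewrite addnK mulrC bC.
    rewrite mulr2n -{1}half -half [X in _ = _ + X]exchange_big_nat /= -big_split /=.
    apply: eq_big_nat => j /andP[j0 jM]; rewrite -big_split /=.
    apply: eq_big_nat => k /andP[k0 kM].
    case: (ltngtP j k) => [jk|jk|->].
    - by rewrite add0r bC; congr (_ * f _); lia.
    - by rewrite addr0; congr (_ * f _); lia.
    by rewrite subnn f0 mulr0 addr0.
  rewrite T; congr (_ *+ 2); rewrite exchange_big_nat /=; apply: eq_big_nat => n /andP[n0 nM].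
  rewrite -mulr_sumr; congr (_ * _).
  (* b k (n+k) = b n k - b n (n+k) - l (n+k): telescoping *)
  have -> : \sum_(1 <= k < M) b k (n + k)%N =
     \sum_(1 <= k < M) b n k - \sum_(1 <= k < M) b n (n + k)%N - \sum_(1 <= k < M) l (n + k)%N.
    rewrite -!sumrB; apply: eq_big_nat => k /andP[k0 _].
    by rewrite (rec n k) //; ring.
  have shift (g : nat -> F) : (forall k, (M <= k)%N -> g k = 0) ->
     \sum_(1 <= k < M) g (n + k)%N = \sum_(n.+1 <= k < M) g k.
    move=> gbig; have -> : n.+1 = (1 + n)%N by [].
    rewrite big_addn (big_cat_nat _ (m := 1) (n := (M - n)%N)) /=; [|lia|lia].
    rewrite [X in _ + X]big_nat_cond [X in _ + X]big1 ?addr0; last first.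
      by move=> j /andP[/andP[H _] _]; rewrite gbig //; lia.
    by apply: eq_big_nat => j _; rewrite addnC.
  rewrite !shift //; last by move=> k; apply: bbig.
  rewrite (big_cat_nat _ (m := 1) (n := n.+1)) //= addrK big_nat_recr //= /A /L.
  by rewrite addrC.
(* Grouped by n = j + k: [rec] splits b j (n - j) into b n j, b n (n - j) and l n, and j -> n - j
   identifies the second sum with the first, which is A n. *)
have S2 : \sum_(1 <= j < M) \sum_(1 <= k < M) b j k * f (j + k)%N =
  \sum_(1 <= n < M) f n * (A n *+ 2 + n.-1%:R * l n).
  transitivity (\sum_(1 <= j < M) \sum_(1 <= n < M) (if (j < n)%N then b j (n - j)%N * f n else 0)).
    apply: eq_big_nat => j /andP[j0 jM].
    rewrite [RHS](big_cat_nat _ (m := 1) (n := j.+1)) //= [X in _ = X + _]big_nat_cond [X in _ = X + _]big1 ?add0r; last first.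
      by move=> k /andP[/andP[_ H] _]; rewrite ltnNge -ltnS H.
    have -> : j.+1 = (1 + j)%N by [].
    rewrite big_addn (big_cat_nat _ (m := 1) (n := (M - j)%N)) /=; [|lia|lia].
    rewrite [X in _ + X]big_nat_cond [X in _ + X]big1 ?addr0; last first.
      move=> k /andP[/andP[H _] _]; rewrite /b npairs_big ?mul0r //; lia.
    apply: eq_big_nat => k /andP[k0 _].
    have -> : (j < k + j)%N by lia.
    by rewrite addnK addnC.
  rewrite exchange_big_nat /=; apply: eq_big_nat => n /andP[n0 nM].
  rewrite (big_cat_nat _ (m := 1) (n := n)) //=; last by lia.
  rewrite [X in _ + X]big_nat_cond [X in _ + X]big1 ?addr0; last first.
    by move=> k /andP[/andP[H _] _]; rewrite ltnNge H.
  have -> : \sum_(1 <= j < n) (if (j < n)%N then b j (n - j)%N * f n else 0) =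
     \sum_(1 <= j < n) f n * (b n j + b n (n - j)%N + l n).
    apply: eq_big_nat => j /andP[j0 jn]; rewrite jn (rec j (n - j)%N) //; last by lia.
    by rewrite subnKC; [rewrite [b j n]bC [b (n - j)%N n]bC mulrC | lia].
  rewrite -mulr_sumr; congr (_ * _); rewrite !big_split /= mulr2n /A.
  congr (_ + _ + _); last by rewrite sumr_const_nat subn1 mulr_natl.
  rewrite big_nat_rev /=; apply: eq_big_nat => j /andP[j0 jn]; congr (b n _); lia.
transitivity (\sum_(1 <= j < M) \sum_(1 <= k < M) b j k * f (maxn j k - minn j k)%N -
   \sum_(1 <= j < M) \sum_(1 <= k < M) b j k * f (j + k)%N).
  rewrite -sumrB; apply: eq_bigr => j _; rewrite -sumrB; apply: eq_bigr => k _.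
  by rewrite mulrBr.
(* The sums A n cancel between [S1] and [S2]; only diagonal and divisor terms remain. *)
rewrite S1 S2 -sumrMnl -sumrB.
have fL : \sum_(1 <= n < M) f n * L n = \sum_(1 <= n < M) l n * \sum_(1 <= m < n) f m.
  transitivity (\sum_(1 <= n < M) \sum_(1 <= k < M) (if (n < k)%N then f n * l k else 0)).
    apply: eq_big_nat => n /andP[n0 nM].
    rewrite (big_cat_nat _ (m := 1) (n := n.+1)) //= big_nat_cond big1 ?add0r; last first.
      by move=> k /andP[/andP[_ H] _]; rewrite ltnNge -ltnS H.
    by rewrite /L mulr_sumr; apply: eq_big_nat => k /andP[-> _].
  rewrite exchange_big_nat /=; apply: eq_big_nat => k /andP[k0 kM].
  rewrite (big_cat_nat _ (m := 1) (n := k)) //=; last by lia.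
  rewrite [X in _ + X]big_nat_cond [X in _ + X]big1 ?addr0; last first.
    by move=> n /andP[/andP[H _] _]; rewrite ltnNge H.
  rewrite mulr_sumr; apply: eq_big_nat => n /andP[_ ->]; exact: mulrC.
transitivity (\sum_(1 <= n < M) ((f n * (b n n *+ 2 - n.-1%:R * l n)) - (f n * L n) *+ 2)).
  by apply: eq_bigr => n _; ring.
rewrite sumrB sumrMnl fL -sumrMnl -sumrB; apply: eq_big_nat => n /andP[n0 _].
rewrite -/(l n) diag //; case: n n0 => // n _ /=; rewrite -[n.+2%:R]natr1 -[n.+1%:R]natr1; ring.
Qed.
End LiouvilleIdentity.

Section DivisorSums.
Variable R : realType.
Local Notation C := (Cfield R).
Implicit Types (f g h : nat -> C) (q : C).
Local Notation sg := (@sg R).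

Definition divsum g n : C := if n is 0%N then 0 else \sum_(1 <= d < n.+1) (d %| n)%N%:R * g d.

Lemma divsum_ext g n M : (n < M)%N -> divsum g n = if n is 0%N then 0 else \sum_(1 <= d < M) (d %| n)%N%:R * g d.
Proof.
case: n => // n nM; rewrite /divsum [RHS](big_cat_nat _ (m := 1) (n := n.+2)) //=.
rewrite [X in _ = _ + X]big_nat_cond [X in _ = _ + X]big1 ?addr0 // => d /andP[/andP[H _] _].
by case: (boolP (d %| n.+1)%N) => [/dvdn_leq|]; [lia | rewrite mul0r].
Qed.

Lemma divsum_pow l : divsum (fun d => d%:R ^+ l) =1 sg l.
Proof. by case=> // n; rewrite (@sg_sum _ _ _ n.+2). Qed.

Lemma divsumD g h n : divsum (fun d => g d + h d) n = divsum g n + divsum h n.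
Proof. by case: n => [|n]; rewrite /divsum ?addr0 // -big_split; apply: eq_bigr => d _; rewrite mulrDr. Qed.
Lemma divsumZ c g n : divsum (fun d => c * g d) n = c * divsum g n.
Proof. by case: n => [|n]; rewrite /divsum ?mulr0 // mulr_sumr; apply: eq_bigr => d _; rewrite mulrCA. Qed.
(** When the weight separates into g j and h k, the pair count is a coefficient of a product of two
    q-series. *)
Lemma npairs_tw N M g h : (0 < N)%N -> (N < M)%N ->
  \sum_(1 <= j < M) \sum_(1 <= k < M) (npairs N j k)%:R * (g j * h k) = conv (divsum g) (divsum h) N.
Proof.
move=> N0 NM.
transitivity (\sum_(0 <= i < N.+1) \sum_(1 <= j < M) \sum_(1 <= k < M)
   ((((j %| i) && (0 < i)) * ((k %| N - i) && (0 < N - i)))%N%:R * (g j * h k))).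
  rewrite [RHS]exchange_big /=; apply: eq_big_nat => j /andP[j0 _].
  rewrite [RHS]exchange_big /=; apply: eq_big_nat => k /andP[k0 _].
  by rewrite npairs_conv // natr_sum mulr_suml.
rewrite /conv -(big_mkord predT (fun i => divsum g i * divsum h (N - i)%N)).
apply: eq_big_nat => i /andP[_ iN].
rewrite (@divsum_ext _ _ M); last by lia.
rewrite (@divsum_ext _ (N - i)%N M); last by lia.
case: i iN => [|i] iN.
  by rewrite mul0r big1 // => j _; rewrite big1 // => k _; rewrite andbF mul0n mul0r.
case E : (N - i.+1)%N => [|m].
  by rewrite mulr0 big1 // => j _; rewrite big1 // => k _; rewrite andbF muln0 mul0r.
rewrite mulr_suml; apply: eq_bigr => j _; rewrite mulr_sumr; apply: eq_bigr => k _.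
by rewrite !andbT natrM; ring.
Qed.

(** For n dividing N, f n (N / n) = N g1 n. The factor N outside the divisor sum is q d/dq on the
    series: this is how derivatives enter. *)
Lemma liouville_tw N f g1 g2 : (0 < N)%N -> f 0%N = 0 -> (forall n, f n = n%:R * g1 n) ->
  (forall n, (0 < n)%N -> g2 n = - (f n * n.+1%:R) - (\sum_(1 <= m < n) f m) *+ 2) ->
  \sum_(1 <= j < N.+1) \sum_(1 <= k < N.+1)
     (npairs N j k)%:R * (f (maxn j k - minn j k)%N - f (j + k)%N) =
  2%:R * (N%:R * divsum g1 N) + divsum g2 N.
Proof.
move=> N0 f0 Hg1 Hg2; rewrite liouville //.
case: N N0 => // N _; rewrite /divsum !mulr_sumr -big_split; apply: eq_big_nat => n /andP[n0 nN].
rewrite Hg2 //= Hg1.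
have [/dvdnP [m ->]|_] := boolP (n %| N.+1)%N; last by rewrite !mul0r !mulr0 addr0.
rewrite mulnK // natrM; ring.
Qed.

Lemma sum_formula f (P : nat -> C) : (forall n, P n.+1 = P n + f n) -> P 1%N = 0 ->
  forall n, (0 < n)%N -> \sum_(1 <= m < n) f m = P n.
Proof.
move=> HP P1; elim=> // -[|n] IH _; first by rewrite big_geq.
by rewrite big_nat_recr //= IH // -HP.
Qed.

(** The sign (-1)^d has the same value at j + k and at |j - k|, namely the product of the signs of j
    and k, so Liouville's identity still separates after twisting by it. This is the origin of the
    level two identities. *)
Definition sgn (d : nat) : C := (-1) ^+ d.
Definition tg l := divsum (fun d => sgn d * d%:R ^+ l).

Lemma sgn_absdiff j k : sgn (maxn j k - minn j k)%N = sgn j * sgn k.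
Proof.
have E i m : (i <= m)%N -> sgn (m - i)%N = sgn m * sgn i.
  move=> im; rewrite -{2}(subnK im) /sgn exprD -mulrA -exprD addnn -mul2n exprM.
  by rewrite sqrrN expr1n expr1n mulr1.
by case: (leqP j k) => H; rewrite E ?(ltnW H) // mulrC.
Qed.
Lemma natr_absdiff2 j k : ((maxn j k - minn j k)%N%:R) ^+ 2 = (j%:R - k%:R) ^+ 2 :> C.
Proof.
by case: (leqP j k) => H; rewrite natrB ?(ltnW H) // -[RHS]sqrrN opprB.
Qed.

(** Liouville's identity for f n = n^2, where (j - k)^2 - (j + k)^2 = -4 j k. It is Ramanujan's
    equation for E_2, read on coefficients. *)
Lemma sig_id1 N : -4%:R * conv (sg 1) (sg 1) N =
  2%:R * nps (sg 1) N - 5%:R / 3%:R * sg 3 N - 3%:R^-1 * sg 1 N.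
Proof.
case: N => [|N]; first by rewrite /conv big_ord1 /nps !sg0; ring.
pose f n : C := n%:R ^+ 2.
have := @liouville_tw N.+1 f (fun n => n%:R ^+ 1) (fun n => - (5%:R / 3%:R) * n%:R ^+ 3 + - 3%:R^-1 * n%:R ^+ 1) isT.

have tE l : divsum (fun n => n%:R ^+ l) = sg l by apply/funext; exact: divsum_pow.
rewrite divsumD !divsumZ !tE => H; transitivity (2%:R * (N.+1%:R * sg 1 N.+1) + (- (5%:R / 3%:R) * sg 3 N.+1 + - 3%:R^-1 * sg 1 N.+1)); last by rewrite /nps; ring.

rewrite -H.
- have := @npairs_tw N.+1 N.+2 (fun n => n%:R ^+ 1) (fun n => n%:R ^+ 1) isT (ltnSn _).
  have -> : divsum (fun n => n%:R ^+ 1) = sg 1 by apply/funext; exact: divsum_pow.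
  move=> <-; rewrite mulr_sumr; apply: eq_bigr => j _; rewrite mulr_sumr; apply: eq_bigr => k _.
  by rewrite /f natr_absdiff2 natrD; ring.
- by rewrite /f expr0n.
- by move=> n; rewrite /f expr1.
move=> n n0; rewrite (@sum_formula f (fun n => (n%:R - 1) * n%:R * (2%:R * n%:R - 1) / 6%:R)) //.
- by rewrite /f -natr1; field.
- by move=> m; rewrite /f -natr1; field.
by rewrite subrr !mul0r.
Qed.

(** Liouville's identity for f n = n^4, where (j - k)^4 - (j + k)^4 = -8 (j k^3 + j^3 k). It is
    Ramanujan's equation for the derivative of E_4, with E_6 present through sigma_5. *)
Lemma sig_id2 N : -8%:R * (conv (sg 1) (sg 3) N + conv (sg 3) (sg 1) N) =
  2%:R * nps (sg 3) N - 7%:R / 5%:R * sg 5 N - 2%:R / 3%:R * sg 3 N + 15%:R^-1 * sg 1 N.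
Proof.
case: N => [|N]; first by rewrite /conv !big_ord1 /nps !sg0; ring.
pose f n : C := n%:R ^+ 4.
have := @liouville_tw N.+1 f (fun n => n%:R ^+ 3) (fun n => - (7%:R / 5%:R) * n%:R ^+ 5 + (- (2%:R / 3%:R) * n%:R ^+ 3 + 15%:R^-1 * n%:R ^+ 1)) isT.
rewrite !divsumD !divsumZ !divsum_pow => H; transitivity (2%:R * (N.+1%:R * sg 3 N.+1) + (- (7%:R / 5%:R) * sg 5 N.+1 + (- (2%:R / 3%:R) * sg 3 N.+1 + 15%:R^-1 * sg 1 N.+1))); last by rewrite /nps; ring.
rewrite -H.
- have A := @npairs_tw N.+1 N.+2 (fun n => n%:R ^+ 1) (fun n => n%:R ^+ 3) isT (ltnSn _).
  have B := @npairs_tw N.+1 N.+2 (fun n => n%:R ^+ 3) (fun n => n%:R ^+ 1) isT (ltnSn _).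
  have tE l : divsum (fun n => n%:R ^+ l) = sg l by apply/funext; exact: divsum_pow.
  rewrite !tE in A B; rewrite -A -B -big_split mulr_sumr; apply: eq_bigr => j _.
  rewrite -big_split mulr_sumr; apply: eq_bigr => k _ /=.
  have -> : f (maxn j k - minn j k)%N = ((j%:R - k%:R) ^+ 2) ^+ 2 by rewrite /f -natr_absdiff2 -exprM.
  by rewrite /f natrD; ring.
- by rewrite /f expr0n.
- by move=> n; rewrite /f -exprS.
move=> n n0; rewrite (@sum_formula f (fun n => n%:R ^+ 5 / 5%:R - n%:R ^+ 4 / 2%:R + n%:R ^+ 3 / 3%:R - n%:R / 30%:R)) //.
- by rewrite /f -natr1; field.
- by move=> m; rewrite /f -natr1; field.
by field.
Qed.

(** The twisted analogue of [sig_id1], for f n = (-1)^n n^2; the alternating sum of squares is only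
    quadratic in n, which changes the coefficients. *)
Lemma sig_id3 N : -4%:R * conv (tg 1) (tg 1) N = 2%:R * nps (tg 1) N - tg 3 N - tg 1 N.
Proof.
case: N => [|N]; first by rewrite /conv big_ord1 /nps /tg /divsum; ring.
pose f n : C := sgn n * n%:R ^+ 2.
have := @liouville_tw N.+1 f (fun n => sgn n * n%:R ^+ 1) (fun n => - 1 * (sgn n * n%:R ^+ 3) + - 1 * (sgn n * n%:R ^+ 1)) isT.
rewrite divsumD !divsumZ => H; transitivity (2%:R * (N.+1%:R * tg 1 N.+1) + (- 1 * tg 3 N.+1 + - 1 * tg 1 N.+1)); last by rewrite /nps; ring.
rewrite -H.
- rewrite -(@npairs_tw N.+1 N.+2 _ _ isT (ltnSn _)) mulr_sumr; apply: eq_bigr => j _; rewrite mulr_sumr; apply: eq_bigr => k _.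
  rewrite /f natr_absdiff2 sgn_absdiff natrD; have -> : sgn (j + k) = sgn j * sgn k by rewrite /sgn exprD.
  by ring.
- by rewrite /f expr0n mulr0.
- by move=> n; rewrite /f; ring.
move=> n n0; rewrite (@sum_formula f (fun n => - sgn n * n%:R * (n%:R - 1) / 2%:R)) //.
- by rewrite /f -natr1; field.
- by move=> m; rewrite /f -natr1 /sgn exprS; field.
by rewrite subrr mulr0 mul0r.
Qed.

Lemma sig_id4 N : -8%:R * (conv (tg 1) (tg 3) N + conv (tg 3) (tg 1) N) =
  2%:R * nps (tg 3) N - tg 5 N - 2%:R * tg 3 N + tg 1 N.
Proof.
case: N => [|N]; first by rewrite /conv !big_ord1 /nps /tg /divsum; ring.
pose f n : C := sgn n * n%:R ^+ 4.
have := @liouville_tw N.+1 f (fun n => sgn n * n%:R ^+ 3) (fun n => - 1 * (sgn n * n%:R ^+ 5) + (- 2%:R * (sgn n * n%:R ^+ 3) + 1 * (sgn n * n%:R ^+ 1))) isT.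
rewrite !divsumD !divsumZ => H; transitivity (2%:R * (N.+1%:R * tg 3 N.+1) + (- 1 * tg 5 N.+1 + (- 2%:R * tg 3 N.+1 + 1 * tg 1 N.+1))); last by rewrite /nps; ring.
rewrite -H.
- have A := @npairs_tw N.+1 N.+2 (fun n => sgn n * n%:R ^+ 1) (fun n => sgn n * n%:R ^+ 3) isT (ltnSn _).
  have B := @npairs_tw N.+1 N.+2 (fun n => sgn n * n%:R ^+ 3) (fun n => sgn n * n%:R ^+ 1) isT (ltnSn _).
  rewrite -A -B -big_split mulr_sumr; apply: eq_bigr => j _.
  rewrite -big_split mulr_sumr; apply: eq_bigr => k _ /=.
  have -> : f (maxn j k - minn j k)%N = sgn j * sgn k * ((j%:R - k%:R) ^+ 2) ^+ 2.
    by rewrite /f -natr_absdiff2 -exprM sgn_absdiff.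
  rewrite /f natrD; have -> : sgn (j + k) = sgn j * sgn k by rewrite /sgn exprD.
  by ring.
- by rewrite /f expr0n mulr0.
- by move=> n; rewrite /f; ring.
move=> n n0; rewrite (@sum_formula f (fun n => - sgn n * (n%:R ^+ 4 - 2%:R * n%:R ^+ 3 + n%:R) / 2%:R)) //.
- by rewrite /f -natr1; field.
- by move=> m; rewrite /f -natr1 /sgn exprS; field.
by rewrite /sgn; field.
Qed.

(** The sign (-1)^d is -1 plus 2 for even d, and the even divisors of N are twice the divisors of N
    / 2. *)
Lemma tgE l N : tg l N = - sg l N + 2%:R ^+ l.+1 * dil 2 (sg l) N.
Proof.
case: N => [|N]; first by rewrite /tg /divsum /dil dvdn0 div0n sg0; ring.
rewrite -divsum_pow /dil.
have -> : tg l N.+1 = - divsum (fun d => d%:R ^+ l) N.+1 + 2%:R * \sum_(1 <= d < N.+2) ((2 %| d) && (d %| N.+1))%N%:R * d%:R ^+ l.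
  rewrite /tg /divsum mulr_sumr -sumrN -big_split; apply: eq_bigr => d _ /=.
  have -> : sgn d = - 1 + 2%:R * (2 %| d)%N%:R.
    rewrite /sgn -signr_odd dvdn2; case: (odd d) => /=; rewrite ?expr1 ?expr0; ring.
  by case: (2 %| d)%N; case: (d %| _)%N => /=; ring.
congr (_ + _); rewrite exprS -mulrA; congr (_ * _).
have [/dvdnP [m Hm]|nd] := boolP (2 %| N.+1)%N; last first.
  rewrite mulr0 big_nat_cond big1 // => d _; case: (boolP (2 %| d)%N) => [H|_]; last by rewrite mul0r.
  case: (boolP (d %| N.+1)%N) => [H2|_]; last by rewrite mul0r.
  by case/negP: nd; apply: dvdn_trans H2.
rewrite Hm mulnK // -divsum_pow (@divsum_ext _ _ m.+1) //.
have m0 : (0 < m)%N by lia.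
have even_sum (F : nat -> C) K : \sum_(1 <= d < (K.*2).+1) (2 %| d)%N%:R * F d = \sum_(1 <= e < K.+1) F e.*2.
  elim: K => [|K IH]; first by rewrite !big_geq.
  rewrite doubleS big_nat_recr //= big_nat_recr //= IH [RHS]big_nat_recr //=.
  by rewrite !dvdn2 /= odd_double /= mul0r addr0 mul1r doubleS.
case: m m0 Hm => // m _ Hm; rewrite mulr_sumr.
transitivity (\sum_(1 <= d < (m.+1.*2).+1) (2 %| d)%N%:R * ((d %| m.+1.*2)%N%:R * d%:R ^+ l) : C).
  rewrite muln2; apply: eq_bigr => d _; case: (2 %| d)%N; rewrite /= ?mul1r ?mul0r //.
rewrite even_sum; apply: eq_bigr => e _.
by rewrite -!muln2 dvdn_pmul2r // natrM exprMn; ring.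
Qed.
End DivisorSums.

(** * Ramanujan's equations in level two *)

Section Ramanujan.
Variable R : realType.
Local Notation C := (Cfield R).
Implicit Types (f g : C -> C) (q l m : C) (a b chi : nat -> C).
Local Notation disc := (@disc R).
Local Notation sg := (@sg R).
Local Notation tg := (@tg R).

(* [isQD f q l]: l is the value at q of q d/dq f. *)
Definition isQD f q l := exists2 m, cder f q m & q * m = l.

Lemma isQD_eq f q l m : isQD f q l -> l = m -> isQD f q m. Proof. by move=> H <-. Qed.
Lemma isQD_cst c q : isQD (fun=> c) q 0.
Proof. by exists 0; [exact: cder_cst | rewrite mulr0]. Qed.
Lemma isQD_D f g q l m : isQD f q l -> isQD g q m -> isQD (fun x => f x + g x) q (l + m).
Proof. by move=> [x Hx <-] [y Hy <-]; exists (x + y); [exact: cderD | rewrite mulrDr]. Qed.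
Lemma isQD_B f g q l m : isQD f q l -> isQD g q m -> isQD (fun x => f x - g x) q (l - m).
Proof. by move=> [x Hx <-] [y Hy <-]; exists (x - y); [exact: cderB | rewrite mulrBr]. Qed.
Lemma isQD_M f g q l m : isQD f q l -> isQD g q m -> isQD (fun x => f x * g x) q (l * g q + f q * m).
Proof.
move=> [x Hx <-] [y Hy <-]; exists (x * g q + f q * y); first exact: cderM.
ring.
Qed.
Lemma isQD_Z c f q l : isQD f q l -> isQD (fun x => c * f x) q (c * l).
Proof. by move=> H; apply: isQD_eq (isQD_M (isQD_cst c q) H) _; rewrite mul0r add0r. Qed.
Lemma isQD_uniq f q l m : isQD f q l -> isQD f q m -> l = m.
Proof. by move=> [x Hx <-] [y Hy <-]; rewrite (cder_uniq Hx Hy). Qed.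
Lemma isQD_ext f g q l : (forall x, disc x -> f x = g x) -> disc q -> isQD f q l -> isQD g q l.
Proof.
move=> fg q1 [m Hm <-]; exists m => //.
apply: (cder_local (d := 1 - cabs q)) Hm; first by rewrite subr_gt0.
by move=> h hd; apply: fg; rewrite /disc; have := cabsD q h; lra.
Qed.

Lemma isQD_ps a q : PS 1 a -> disc q -> isQD (ps a) q (ps (nps a) q).
Proof.
rewrite /disc => Ha q1; exists (ps (fun n => nps a n.+1) q); first exact: (ps_cder Ha q1).
exact: (q_ps_sh_nps Ha q1).
Qed.
Lemma isQD_ps2 a q : PS 1 a -> disc q -> isQD (fun x => ps a (x ^+ 2)) q (2%:R * ps (nps a) (q ^+ 2)).
Proof.
move=> Ha q1; have q2 : disc (q ^+ 2) by apply: disc_exp.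
exists (ps (fun n => nps a n.+1) (q ^+ 2) * (2%:R * q ^+ 1 * 1)).
  apply: cder_comp; first by apply: cderX; exact: cder_id.
  exact: (ps_cder Ha q2).
by rewrite -(q_ps_sh_nps Ha q2); ring.
Qed.

Definition sE2 q : C := 1 - 24%:R * ps (sg 1) q.
Definition sE4 q : C := 1 + 240%:R * ps (sg 3) q.
Definition sG q : C := - sE2 q + 2%:R * sE2 (q ^+ 2).
Definition sE q : C := sE4 q - sG q ^+ 2.

Lemma nps_dil a : nps (dil 2 a) = fun n => 2%:R * dil 2 (nps a) n.
Proof.
apply/funext => n; rewrite /nps /dil; case: ifP => [/dvdnP [m ->]|_]; last by rewrite !mulr0.
by rewrite mulnK // natrM; ring.
Qed.

Lemma PS_tg (l : nat) : PS 1 (tg l).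
Proof.
have -> : tg l = (fun n => -1 * sg l n + 2%:R ^+ l.+1 * dil 2 (sg l) n).
  by apply/funext => n; rewrite tgE mulN1r.
by apply: PSD; apply: PSZ; [exact: PS_sg | apply: PS_dil => //; exact: PS_sg].
Qed.

Section AtPoint.
Variable q : C.
Hypothesis q1 : disc q.
Let q2 : disc (q ^+ 2). Proof. exact: disc_exp. Qed.
Let PSs := @PS_sg R.

Lemma ps_lin (c1 c2 c3 c4 : C) a1 a2 a3 a4 (x : C) : disc x -> PS 1 a1 -> PS 1 a2 -> PS 1 a3 -> PS 1 a4 ->
  ps (fun n => c1 * a1 n + c2 * a2 n + c3 * a3 n + c4 * a4 n) x =
  c1 * ps a1 x + c2 * ps a2 x + c3 * ps a3 x + c4 * ps a4 x.
Proof.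
move=> x1 h1 h2 h3 h4; have Z c (a : nat -> C) : PS 1 a -> PS 1 (fun n => c * a n) := @PSZ R 1 c a.
rewrite (psD (PSD (PSD (Z _ _ h1) (Z _ _ h2)) (Z _ _ h3)) (Z _ _ h4) x1).
rewrite (psD (PSD (Z _ _ h1) (Z _ _ h2)) (Z _ _ h3) x1) (psD (Z _ _ h1) (Z _ _ h2) x1).
by rewrite (psZ _ h1 x1) (psZ _ h2 x1) (psZ _ h3 x1) (psZ _ h4 x1).
Qed.

Lemma ps_id1 (x : C) : disc x -> -4%:R * (ps (sg 1) x * ps (sg 1) x) =
  2%:R * ps (nps (sg 1)) x - 5%:R / 3%:R * ps (sg 3) x - 3%:R^-1 * ps (sg 1) x.
Proof.
move=> x1; rewrite -(ps_conv (PSs 1) (PSs 1) x1) -(psZ _ (PS_conv (PSs 1) (PSs 1)) x1).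
have -> : (fun n => - 4 * conv (sg 1) (sg 1) n) = (fun n =>
   2%:R * nps (sg 1) n + - (5%:R / 3%:R) * sg 3 n + - 3%:R^-1 * sg 1 n + 0 * sg 1 n).
  by apply/funext => n; rewrite sig_id1; ring.
rewrite ps_lin //; [ring | exact: PS_nps].
Qed.
Lemma ps_id2 (x : C) : disc x -> -16%:R * (ps (sg 1) x * ps (sg 3) x) =
  2%:R * ps (nps (sg 3)) x - 7%:R / 5%:R * ps (sg 5) x - 2%:R / 3%:R * ps (sg 3) x + 15%:R^-1 * ps (sg 1) x.
Proof.
move=> x1.
transitivity (- 8%:R * (ps (conv (sg 1) (sg 3)) x + ps (conv (sg 3) (sg 1)) x)).
  by rewrite (ps_conv (PSs 1) (PSs 3) x1) (ps_conv (PSs 3) (PSs 1) x1); ring.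
rewrite -(psD (PS_conv (PSs 1) (PSs 3)) (PS_conv (PSs 3) (PSs 1)) x1).
rewrite -(psZ _ (PSD (PS_conv (PSs 1) (PSs 3)) (PS_conv (PSs 3) (PSs 1))) x1).
have -> : (fun n => - 8 * (conv (sg 1) (sg 3) n + conv (sg 3) (sg 1) n)) = (fun n =>
   2%:R * nps (sg 3) n + - (7%:R / 5%:R) * sg 5 n + - (2%:R / 3%:R) * sg 3 n + 15%:R^-1 * sg 1 n).
  by apply/funext => n; rewrite sig_id2; ring.
rewrite ps_lin //; [ring | exact: PS_nps].
Qed.
Lemma ps_id3 : -4%:R * (ps (tg 1) q * ps (tg 1) q) =
  2%:R * ps (nps (tg 1)) q - ps (tg 3) q - ps (tg 1) q.
Proof.
have P := PS_tg; rewrite -(ps_conv (P 1%N) (P 1%N) q1) -(psZ _ (PS_conv (P 1%N) (P 1%N)) q1).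
have -> : (fun n => - 4 * conv (tg 1) (tg 1) n) = (fun n =>
   2%:R * nps (tg 1) n + - 1 * tg 3 n + - 1 * tg 1 n + 0 * tg 1 n).
  by apply/funext => n; rewrite sig_id3; ring.
rewrite ps_lin //; [ring | exact: PS_nps].
Qed.
Lemma ps_id4 : -16%:R * (ps (tg 1) q * ps (tg 3) q) =
  2%:R * ps (nps (tg 3)) q - ps (tg 5) q - 2%:R * ps (tg 3) q + ps (tg 1) q.
Proof.
have P := PS_tg.
transitivity (- 8%:R * (ps (conv (tg 1) (tg 3)) q + ps (conv (tg 3) (tg 1)) q)).
  by rewrite (ps_conv (P 1%N) (P 3%N) q1) (ps_conv (P 3%N) (P 1%N) q1); ring.
rewrite -(psD (PS_conv (P 1%N) (P 3%N)) (PS_conv (P 3%N) (P 1%N)) q1).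
rewrite -(psZ _ (PSD (PS_conv (P 1%N) (P 3%N)) (PS_conv (P 3%N) (P 1%N))) q1).
have -> : (fun n => - 8 * (conv (tg 1) (tg 3) n + conv (tg 3) (tg 1) n)) = (fun n =>
   2%:R * nps (tg 3) n + - 1 * tg 5 n + - 2%:R * tg 3 n + 1 * tg 1 n).
  by apply/funext => n; rewrite sig_id4; ring.
rewrite ps_lin //; [ring | exact: PS_nps].
Qed.

Lemma ps_tg (l : nat) : ps (tg l) q = - ps (sg l) q + 2%:R ^+ l.+1 * ps (sg l) (q ^+ 2).
Proof.
have PSd : PS 1 (dil 2 (sg l)) by apply: PS_dil.
have -> : tg l = (fun n => 2%:R ^+ l.+1 * dil 2 (sg l) n - sg l n).
  by apply/funext => n; rewrite tgE addrC.
rewrite (psB (PSZ _ PSd) (PSs l) q1) (psZ _ PSd q1) (ps_dil _ (PSs l) q1) //.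
by rewrite addrC.
Qed.
Lemma ps_nps_tg (l : nat) : ps (nps (tg l)) q = - ps (nps (sg l)) q + 2%:R ^+ l.+2 * ps (nps (sg l)) (q ^+ 2).
Proof.
have PSn := PS_nps (PSs l).
have PSd : PS 1 (dil 2 (nps (sg l))) by apply: PS_dil.
have -> : nps (tg l) = (fun n => 2%:R ^+ l.+2 * dil 2 (nps (sg l)) n - nps (sg l) n).
  apply/funext => n; have := congr1 (fun f : nat -> C => f n) (nps_dil (sg l)); rewrite /nps tgE => E.
  by rewrite mulrDr mulrCA E [_ ^+ l.+2]exprS; ring.
rewrite (psB (PSZ _ PSd) PSn q1) (psZ _ PSd q1) (ps_dil _ PSn q1) //.
by rewrite addrC.
Qed.
End AtPoint.

(** [ps_id1] at q and at q^2 expresses the two derivatives that occur in [ps_id3]; substituting them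
    leaves an algebraic relation between the sigma_1 and sigma_3 series. *)
Lemma G2_E4 q : disc q -> 5%:R * sG q ^+ 2 = sE4 q + 4%:R * sE4 (q ^+ 2).
Proof.
move=> q1; have q2 : disc (q ^+ 2) by apply: disc_exp.
have i1 := ps_id1 q1; have i2 := ps_id1 q2; have i3 := ps_id3 q1.
rewrite !ps_tg // ps_nps_tg // in i3.
rewrite /sG /sE2 /sE4.
move: (ps (sg 1) q) (ps (sg 1) (q ^+ 2)) (ps (sg 3) q) (ps (sg 3) (q ^+ 2))
  (ps (nps (sg 1)) q) (ps (nps (sg 1)) (q ^+ 2)) i1 i2 i3 => U U' V V' dU dU' i1 i2 i3.
apply/eqP; rewrite -subr_eq0.
set L1 := - 4 * (U * U) in i1; set L2 := - 4 * (U' * U') in i2.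
have e1 : dU = (L1 + 5%:R / 3%:R * V + 3%:R^-1 * U) / 2%:R by rewrite i1; field.
have e2 : dU' = (L2 + 5%:R / 3%:R * V' + 3%:R^-1 * U') / 2%:R by rewrite i2; field.
move/eqP: i3; rewrite -subr_eq0 e1 e2 /L1 /L2 => /eqP i3.
(* The multiplier -360 matches the goal with the relation [i3]. *)
by apply/eqP; rewrite -[RHS](mulr0 (- 360%:R)) -[in RHS]i3; field.
Qed.

Lemma isQD_G q : disc q -> isQD sG q ((sE2 q * sG q - sG q ^+ 2 + sE q) / 6%:R).
Proof.
move=> q1; have q2 : disc (q ^+ 2) by apply: disc_exp.
have H1 : isQD sE2 q (- 24%:R * ps (nps (sg 1)) q).
  by apply: isQD_eq (isQD_B (isQD_cst 1 q) (isQD_Z 24%:R (isQD_ps (@PS_sg R 1) q1))) _; ring.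
have H2 : isQD (fun x => sE2 (x ^+ 2)) q (- 48%:R * ps (nps (sg 1)) (q ^+ 2)).
  by apply: isQD_eq (isQD_B (isQD_cst 1 q) (isQD_Z 24%:R (isQD_ps2 (@PS_sg R 1) q1))) _; ring.
have H := isQD_D (isQD_Z (-1) H1) (isQD_Z 2%:R H2).
have E : (fun x => -1 * sE2 x + 2 * sE2 (x ^+ 2)) = sG by apply/funext => x; rewrite /sG mulN1r.
rewrite E in H; apply: isQD_eq H _.
have i1 := ps_id1 q1; have i2 := ps_id1 q2; have i3 := G2_E4 q1.
move: i3; rewrite /sE /sG /sE2 /sE4.
move: (ps (sg 1) q) (ps (sg 1) (q ^+ 2)) (ps (sg 3) q) (ps (sg 3) (q ^+ 2))
  (ps (nps (sg 1)) q) (ps (nps (sg 1)) (q ^+ 2)) i1 i2 {H1 H2 E q2 q1} => U U' V V' dU dU' i1 i2 i3.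
have e1 : dU = (- 4 * (U * U) + 5%:R / 3%:R * V + 3%:R^-1 * U) / 2%:R by rewrite i1; field.
have e2 : dU' = (- 4 * (U' * U') + 5%:R / 3%:R * V' + 3%:R^-1 * U') / 2%:R by rewrite i2; field.
have e3 : V = (5%:R * (- (1 - 24%:R * U) + 2 * (1 - 24%:R * U')) ^+ 2 - 4 * (1 + 240%:R * V') - 1) / 240%:R.
  by rewrite i3; field.
by rewrite e1 e2 e3; field.
Qed.

(** Differentiating [G2_E4] ties the derivative of sigma_3 at q^2 to the one at q, and [ps_id2] at q
    and q^2 expresses both sigma_5 series; [ps_id4] then determines the one remaining unknown. *)
Lemma isQD_E q : disc q -> isQD sE q ((2%:R * sG q + sE2 q) / 3%:R * sE q).
Proof.
move=> q1; have q2 : disc (q ^+ 2) by apply: disc_exp.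
have TG := isQD_G q1.
have T4 : isQD sE4 q (240%:R * ps (nps (sg 3)) q).
  by apply: isQD_eq (isQD_D (isQD_cst 1 q) (isQD_Z 240%:R (isQD_ps (@PS_sg R 3) q1))) _; ring.
have T4' : isQD (fun x => sE4 (x ^+ 2)) q (480%:R * ps (nps (sg 3)) (q ^+ 2)).
  by apply: isQD_eq (isQD_D (isQD_cst 1 q) (isQD_Z 240%:R (isQD_ps2 (@PS_sg R 3) q1))) _; ring.
have TGG := isQD_M TG TG.
have K2 : 240%:R * ps (nps (sg 3)) q + 4%:R * (480%:R * ps (nps (sg 3)) (q ^+ 2)) =
   10%:R * sG q * ((sE2 q * sG q - sG q ^+ 2 + sE q) / 6%:R).
  apply: isQD_uniq (isQD_D T4 (isQD_Z 4%:R T4')) _.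
  apply: isQD_ext (isQD_eq (isQD_Z 5%:R TGG) _) => //; last by field.
  by move=> x x1; rewrite -G2_E4 // expr2.
have TE : isQD sE q (240%:R * ps (nps (sg 3)) q - 2%:R * sG q * ((sE2 q * sG q - sG q ^+ 2 + sE q) / 6%:R)).
  by apply: isQD_eq (isQD_B T4 TGG) _; ring.
apply: isQD_eq TE _.
have i2 := ps_id2 q1; have i2' := ps_id2 q2; have i4 := ps_id4 q1.
rewrite !ps_tg // ps_nps_tg // in i4.
have G := G2_E4 q1.
move: K2; rewrite /sE; set a := sE2 q; set g := sG q; set w := sE4 q => K2.
have e0 : ps (sg 1) q = (1 - a) / 24%:R by rewrite /a /sE2; field.
have eb : g = - a + 2%:R * (1 - 24%:R * ps (sg 1) (q ^+ 2)) by [].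
have e0' : ps (sg 1) (q ^+ 2) = (2%:R - g - a) / 48%:R.
  have gen (u v : C) : u = (2%:R - (- v + 2%:R * (1 - 24%:R * u)) - v) / 48%:R by field.
  by rewrite eb; exact: gen.
have e3 : ps (sg 3) q = (w - 1) / 240%:R by rewrite /w /sE4; field.
have e3' : ps (sg 3) (q ^+ 2) = (5%:R * g ^+ 2 - w - 4%:R) / 960%:R.
  by rewrite /g G -/w /sE4; field.
move: i2 i2' i4; rewrite e0 e0' e3 e3'.
move: (ps (nps (sg 3)) q) (ps (nps (sg 3)) (q ^+ 2)) K2 (ps (sg 5) q) (ps (sg 5) (q ^+ 2)) => dV dV' K2 X X' i2 i2' i4.
have x1 : X = (2%:R * dV + 16%:R * ((1 - a) / 24%:R * ((w - 1) / 240%:R)) - 2%:R / 3%:R * ((w - 1) / 240%:R) + 15%:R^-1 * ((1 - a) / 24%:R)) * 5%:R / 7%:R.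
  apply/eqP; rewrite -subr_eq0; move/eqP: i2; rewrite -subr_eq0 => /eqP i2.
  by apply/eqP; rewrite -[RHS](mulr0 (5%:R / 7%:R)) -[in RHS]i2; field.
have x1' : X' = (2%:R * dV' + 16%:R * ((2%:R - g - a) / 48%:R * ((5%:R * g ^+ 2 - w - 4%:R) / 960%:R)) - 2%:R / 3%:R * ((5%:R * g ^+ 2 - w - 4%:R) / 960%:R) + 15%:R^-1 * ((2%:R - g - a) / 48%:R)) * 5%:R / 7%:R.
  apply/eqP; rewrite -subr_eq0; move/eqP: i2'; rewrite -subr_eq0 => /eqP i2'.
  by apply/eqP; rewrite -[RHS](mulr0 (5%:R / 7%:R)) -[in RHS]i2'; field.
have v1 : dV' = (10 * g * ((a * g - g ^+ 2 + (w - g ^+ 2)) / 6) - 240%:R * dV) / 1920%:R.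
  by rewrite -K2; field.
move: i4; rewrite x1 x1' v1 => i4.
apply/eqP; rewrite -subr_eq0; move/eqP: i4; rewrite -subr_eq0 => /eqP i4.
pose k : C := - 84%:R.
by apply/eqP; rewrite -[RHS](mulr0 k) -[in RHS]i4 /k; field.
Qed.
End Ramanujan.

(** * Lipschitz formula and modularity of E_4 *)

Lemma ps_bound (R : realType) (r rho : R) (a : nat -> Cfield R) : PS r a -> 0 < rho < r ->
  exists2 K : R, 0 <= K & forall z, cabs z <= rho -> cabs (ps a z) <= K.
Proof.
move=> Ha Hr; have /andP[r0 r1] := Hr.
have crho : cabs (ofR rho : Cfield R) = rho by rewrite cabs_ofR gtr0_norm.
have [K HK] := PS_asum (z := ofR rho) Ha (ltac:(by rewrite crho)).
exists K; first by have := HK 0%N; rewrite big_ord0.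
move=> z zr; apply: sumC_le => n; apply: le_trans (HK n); apply: ler_sum => i _.
by rewrite !cabsM !cabsX crho ler_wpM2l ?cabs_ge0 // lerXn2r // nnegrE ?cabs_ge0 // ltW.
Qed.

Section Lipschitz.
Variable R : realType.
Local Notation C := (Cfield R).
Implicit Types (z w tau Q : C).

Definition expc n : C := (n`!)%:R^-1.
Lemma PS_expc (r : R) : PS r expc.
Proof.
move=> rho /andP[r0 _]; exists (expR rho) => -[|n].
  rewrite /expc fact0 invr1 cabs1 mul1r expr0 -expR0 ler_expR; exact: ltW.
rewrite /expc cabsV cabs_nat mulrC.
by apply: le_trans (expR_ge1Dxn n (ltW r0)); rewrite lerDr.
Qed.
Lemma cexp_series z : cexp z = ps expc z.
Proof.
have D w : cder (ps expc) w (ps expc w).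
  have P' : PS (cabs w + 1) expc := @PS_expc _.
  apply: cder_eq (ps_cder P' _) _; first by rewrite ltrDl.
  congr (ps _ w); apply/funext => n; have n0 : n.+1%:R != 0 :> C by rewrite pnatr_eq0.
  by rewrite /nps /expc factS natrM invfM mulrA mulfV // mul1r.
have E : ps expc z * cexp (- z) = ps expc 0 * cexp (- 0).
  apply: (@cder0_cst R (fun w => ps expc w * cexp (- w)) (fun=> True)) => // w _.
  apply: cder_eq (cderM (D w) (cder_comp (cderN (cder_id w)) (cexp_cder (- w)))) _.
  by ring.
rewrite ps0 oppr0 cexp0 /expc fact0 invr1 mulr1 in E.
by rewrite -[RHS]mulr1 -(mulVf (cexp_neq0 z)) -cexpN mulrA [_ * cexp (- z)]E mul1r.
Qed.

Lemma cexp_taylor3 : exists2 K : R, 0 <= K & forall v, cabs v <= 1 ->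
  cabs (cexp v - 1 - v - v ^+ 2 / 2%:R) <= K * cabs v ^+ 3.
Proof.
have P : PS 2 expc := @PS_expc _.
have [K K0 HK] := ps_bound (rho := 1) (PS_shift (PS_shift (PS_shift P))) (ltac:(lra)).
exists K => // v v1.
have v2 : cabs v < 2 by lra.
rewrite cexp_series (ps_recl P v2) (ps_recl (PS_shift P) v2) (ps_recl (PS_shift (PS_shift P)) v2).
set s := ps _ v; have -> : expc 0 + v * (expc 1 + v * (expc 2 + v * s)) - 1 - v - v ^+ 2 / 2 = v ^+ 3 * s.
  by rewrite /expc (_ : 0`! = 1)%N // (_ : 1`! = 1)%N // (_ : 2`! = 2)%N //; field.
by rewrite cabsM cabsX mulrC ler_wpM2r ?exprn_ge0 ?cabs_ge0 // HK.
Qed.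

(* [fL (e2pi w) = sin(pi w)^-4 - 2/3 sin(pi w)^-2] *)
Definition fL Q : C := (16%:R * Q ^+ 2 + 8%:R / 3%:R * Q * (1 - Q) ^+ 2) / (1 - Q) ^+ 4.

Lemma fL_dup (P : C) : P ^+ 2 != 1 -> fL P + fL (- P) = 16%:R * fL (P ^+ 2).
Proof.
move=> H; have H1 : 1 - P != 0 by apply: contra H; rewrite subr_eq0 => /eqP <-; rewrite expr1n.
have H2 : 1 + P != 0 by apply: contra H; rewrite addrC addr_eq0 => /eqP ->; rewrite sqrrN expr1n.
have E : 1 - P ^+ 2 = (1 - P) * (1 + P) by ring.
rewrite /fL E opprK; field; by rewrite H1 H2.
Qed.

Definition ph w : C := fL (e2pi w).
Lemma ph_int w (n : int) : ph (w + n%:~R) = ph w.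
Proof. by rewrite /ph e2piD e2pi_int mulr1. Qed.
(** [ph] is a multiple of the second derivative of 1 / sin^2(pi w), hence this exact duplication
    law. Iterated, it writes [ph] as a scaled sum over 2^m points of one period, for which a
    comparison with (pi w)^-4 is precise enough. *)
Lemma ph_dup w : e2pi w != 1 -> ph (w / 2%:R) + ph ((w + 1) / 2%:R) = 16%:R * ph w.
Proof.
have E : e2pi w = e2pi (w / 2%:R) ^+ 2 by rewrite -e2piMn mulrC divfK ?pnatr_eq0.
move=> H; rewrite /ph E -fL_dup -?E //; congr (_ + fL _).
by rewrite mulrDl e2piD mul1r e2pi_half mulrN1.
Qed.

Lemma e2pi_div_neq1 w m : e2pi w != 1 -> (0 < m)%N -> e2pi (w / m%:R) != 1.
Proof.
move=> H m0; apply: contra H => /eqP E.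
by rewrite -(divfK (x := m%:R) _ w) ?pnatr_eq0 -?lt0n // mulrC e2piMn E expr1n.
Qed.
Lemma e2piDnat w k : e2pi (w + k%:R) = e2pi w.
Proof. by rewrite e2piD (e2pi_int _ k) mulr1. Qed.

Lemma ph_iter w m : e2pi w != 1 ->
  \sum_(k < 2 ^ m) ph ((w + k%:R) / (2 ^ m)%N%:R) = 16%:R ^+ m * ph w.
Proof.
move=> H; elim: m => [|m IH]; first by rewrite expn0 big_ord1 addr0 divr1 expr0 mul1r.
rewrite expnS mul2n -addnn big_split_ord /= -big_split /= exprS -mulrA -IH mulr_sumr.
have p0 : (2 ^ m)%N%:R != 0 :> C by rewrite pnatr_eq0 -lt0n expn_gt0.
apply: eq_bigr => k _.
rewrite -ph_dup; last by apply: e2pi_div_neq1; rewrite ?e2piDnat // expn_gt0.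
have E : (2 ^ m + 2 ^ m)%N%:R = (2 ^ m)%N%:R * 2%:R :> C by rewrite addnn -mul2n natrM mulrC.
rewrite E natrD; congr (ph _ + ph _); field; exact: p0.
Qed.

(** The same iteration at w = 0 with the pole left out; the value 1/3 of [ph] at 1/2 drives the
    recursion S -> 16 S + 1/3. *)
Lemma ph_iter0 m : \sum_(1 <= k < 2 ^ m) ph (k%:R / (2 ^ m)%N%:R) = (16%:R ^+ m - 1) / 45%:R.
Proof.
elim: m => [|m IH]; first by rewrite big_geq // expr0 subrr mul0r.
have m1 : (1 <= 2 ^ m)%N by rewrite expn_gt0.
have p0 : (2 ^ m)%N%:R != 0 :> C by rewrite pnatr_eq0 -lt0n expn_gt0.
have E : (2 ^ m.+1)%N%:R = (2 ^ m)%N%:R * 2%:R :> C by rewrite expnS natrM mulrC.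
rewrite (big_cat_nat _ (m := 1) (n := (2 ^ m)%N)) //=; last by rewrite leq_exp2l.
rewrite [X in _ + X]big_ltn; last by rewrite ltn_exp2l.
have -> : \sum_((2 ^ m).+1 <= k < 2 ^ m.+1) ph (k%:R / (2 ^ m.+1)%N%:R) =
   \sum_(1 <= k < 2 ^ m) ph ((k%:R / (2 ^ m)%N%:R + 1) / 2%:R).
  have -> : (2 ^ m).+1 = (1 + 2 ^ m)%N by [].
  rewrite big_addn expnS mul2n -addnn addnK; apply: eq_bigr => k _.
  by congr (ph _); rewrite addnn -mul2n natrM natrD; field; exact: p0.
have -> : ph ((2 ^ m)%N%:R / (2 ^ m.+1)%N%:R) = 3%:R^-1.
  by rewrite E invfM mulrA mulfV // mul1r /ph e2pi_half /fL; field.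
rewrite addrCA -big_split /=.
have -> : \sum_(1 <= k < 2 ^ m) (ph (k%:R / (2 ^ m.+1)%N%:R) + ph ((k%:R / (2 ^ m)%N%:R + 1) / 2%:R)) =
   \sum_(1 <= k < 2 ^ m) 16%:R * ph (k%:R / (2 ^ m)%N%:R).
  apply: eq_big_nat => k /andP[k0 km]; rewrite -ph_dup.
    by congr (ph _ + _); rewrite E; field; exact: p0.
  apply/eqP => /e2pi_eq1 [n Hn].
  have H : (k%:Z)%:~R = (n * (2 ^ m)%N%:Z)%:~R :> C by rewrite intrM -!pmulrn -Hn divfK.
  move/intr_inj: H => H.
  case: n Hn H => n _ H; last first.
    have : (k%:Z <= 0)%R by rewrite H NegzE mulNr oppr_le0 mulr_ge0.
    by rewrite lez_nat leqNgt k0.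
  move: H; rewrite -PoszM => -[H]; move: km k0; rewrite H; case: n {H} => [|n]; first by rewrite mul0n.
  by rewrite mulSn ltnNge leq_addr.
by rewrite -mulr_sumr IH exprS; field.
Qed.

Definition piC : C := ofR pi.
Lemma piC_neq0 : piC != 0.
Proof. by rewrite -cabs_eq0 cabs_ofR normr_eq0 gt_eqF // pi_gt0. Qed.
Lemma cabs_piC : cabs piC = pi. Proof. by rewrite cabs_ofR gtr0_norm // pi_gt0. Qed.
Lemma tpi4 : tpi R ^+ 4 = 16%:R * piC ^+ 4.
Proof.
have -> : tpi R ^+ 4 = 16%:R * piC ^+ 4 * (iC R * iC R) ^+ 2 by rewrite /tpi -/piC; ring.
by rewrite iC2 sqrrN expr1n mulr1.
Qed.
Lemma cabs_tpi : cabs (tpi R) = 2 * pi.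
Proof. by rewrite /tpi !cabsM cabs_nat cabs_piC cabs_iC mulr1. Qed.

Definition snh v : C := cexp v - cexp (- v).
Lemma ph_snh w : e2pi w != 1 -> ph w = 16%:R / snh (tpi R * w / 2%:R) ^+ 4 + 8%:R / 3%:R / snh (tpi R * w / 2%:R) ^+ 2.
Proof.
move=> H; set v := _ / 2%:R; have e0 := cexp_neq0 v.
have E : e2pi w = cexp v ^+ 2 by rewrite -cexpMn /v mulrC divfK ?pnatr_eq0.
rewrite /ph /fL /snh cexpN; rewrite E in H *.
have H1 : 1 - cexp v ^+ 2 != 0 by rewrite subr_eq0 eq_sym.
have -> : cexp v - (cexp v)^-1 = - (1 - cexp v ^+ 2) / cexp v by field.
by field; rewrite H1 e0.
Qed.

(** With u = 2 pi i w, snh (u / 2) = u + O(u^3): the fourth powers differ by O(u^6), over a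
    denominator of order u^8. *)
Lemma ph_near : exists2 d : R, 0 < d <= 4^-1 & exists2 K : R, 0 <= K & forall w, w != 0 -> cabs w <= d ->
  e2pi w != 1 /\ cabs (ph w - (piC * w) ^- 4) <= K / cabs w ^+ 2.
Proof.
have [K K0 HK] := cexp_taylor3.
have pp := pi_gt0 R; have p2 := pi_ge2 R.
have K1 : 0 < 2 * K + 1 by lra.
pose d : R := Num.min (4^-1) (Num.min (pi^-1) ((pi * (2 * K + 1))^-1)).
exists d.
  by rewrite ge_min lexx andbT !lt_min !invr_gt0 ltr0n pp mulr_gt0.
exists (130%:R * K + 3); first lra.
move=> w w0; rewrite /d !le_min => /and3P[d1 d2 d3].
have wp : 0 < cabs w by rewrite cabs_gt0.
set u := tpi R * w; set v := u / 2%:R.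
have cu : cabs u = 2 * pi * cabs w by rewrite /u cabsM cabs_tpi.
have cv : cabs v = pi * cabs w by rewrite /v cabsM cu cabsV cabs_nat; field.
have v1 : cabs v <= 1 by rewrite cv mulrC -ler_pdivlMr // div1r.
have vK : (2 * K + 1) * cabs v <= 1.
  have : cabs w * (pi * (2 * K + 1)) <= 1 by rewrite -ler_pdivlMr ?mulr_gt0 // div1r.
  by rewrite cv; lra.
have vp : 0 < cabs v by rewrite cv mulr_gt0.
set S := snh v.
have Sv : cabs (S - u) <= 2 * K * cabs v ^+ 3.
  have -> : S - u = (cexp v - 1 - v - v ^+ 2 / 2%:R) - (cexp (- v) - 1 - (- v) - (- v) ^+ 2 / 2%:R).
    by rewrite /S /snh /v; field.
  apply: le_trans (cabsD _ _) _; rewrite cabsN.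
  have A := HK v v1; have B := HK (- v) (ltac:(by rewrite cabsN)); rewrite cabsN in B; lra.
have Su : cabs (S - u) <= cabs v.
  apply: le_trans Sv _.
  have -> : 2 * K * cabs v ^+ 3 = (2 * K * cabs v) * (cabs v * cabs v) by ring.
  apply: le_trans (_ : 1 * (1 * cabs v) <= _); last by rewrite !mul1r.
  by apply: ler_pM; rewrite ?mulr_ge0 ?cabs_ge0 //; [nra | rewrite ler_wpM2r ?cabs_ge0].
have uv : cabs u = 2 * cabs v by rewrite cu cv; ring.
have S1 : cabs v <= cabs S.
  by have := cabsBl u (u - S); rewrite subKr [cabs (u - S)]cabsB; lra.
have S3 : cabs S <= 3 * cabs v.
  by have := cabsD (S - u) u; rewrite subrK; lra.
have S0 : S != 0 by rewrite -cabs_gt0; lra.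
have u0 : u != 0 by rewrite -cabs_gt0; lra.
have e1 : e2pi w != 1.
  apply: contra S0 => /eqP E; rewrite /S /snh cexpN subr_eq0; apply/eqP.
  have e0 := cexp_neq0 v; apply: (mulIf e0); rewrite mulVf // -E e2piE -cexpD.
  by congr cexp; rewrite /v /u; field.
split => //; rewrite ph_snh // -/u -/v -/S.
have -> : (piC * w) ^- 4 = 16%:R / u ^+ 4.
  by rewrite /u [in RHS]exprMn tpi4; field; rewrite w0 piC_neq0.
have -> : 16%:R / S ^+ 4 + 8%:R / 3%:R / S ^+ 2 - 16%:R / u ^+ 4 =
   16%:R * ((u - S) * (u + S) * (u ^+ 2 + S ^+ 2)) / (S ^+ 4 * u ^+ 4) + 8%:R / 3%:R / S ^+ 2.
  by field; rewrite S0 u0.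
clearbody S v u.
have vw : (cabs v ^+ 2)^-1 <= (cabs w ^+ 2)^-1.
  rewrite lef_pV2 ?posrE ?exprn_gt0 // lerXn2r ?nnegrE ?ltW // cv; nra.
apply: le_trans (_ : (130%:R * K + 3) / cabs v ^+ 2 <= _); last by rewrite ler_wpM2l //; lra.
apply: le_trans (cabsD _ _) _; rewrite [leRHS]mulrDl; apply: lerD.
  have A : cabs ((u - S) * (u + S) * (u ^+ 2 + S ^+ 2)) <= (2 * K * cabs v ^+ 3) * (5%:R * cabs v) * (13%:R * cabs v ^+ 2).
    rewrite !cabsM; apply: ler_pM; rewrite ?mulr_ge0 ?cabs_ge0 //.
      apply: ler_pM; rewrite ?cabs_ge0 //; first by rewrite cabsB.
      by apply: le_trans (cabsD _ _) _; lra.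
    apply: le_trans (cabsD _ _) _; rewrite !cabsX uv.
    have := lerXn2r 2 (cabs_ge0 S) (mulr_ge0 (ler0n _ 3) (ltW vp)) S3; lra.
  move: A; set X := (u - S) * _ * _ => A.
  rewrite [cabs (_ / _)]cabsM cabsV [cabs (16%:R * X)]cabsM cabs_nat [cabs (S ^+ 4 * _)]cabsM !cabsX.
  have dp : 0 < cabs S ^+ 4 * cabs u ^+ 4 by rewrite mulr_gt0 // exprn_gt0 // cabs_gt0.
  rewrite ler_pdivrMr //.
  apply: le_trans (ler_wpM2l _ A) _; first by rewrite ler0n.
  have B : cabs v ^+ 4 * (16%:R * cabs v ^+ 4) <= cabs S ^+ 4 * cabs u ^+ 4.
    rewrite uv [(2 * _) ^+ 4]exprMn; apply: ler_pM; rewrite ?mulr_ge0 ?exprn_ge0 ?cabs_ge0 //.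
      by rewrite lerXn2r ?nnegrE ?cabs_ge0.
    by rewrite -natrX.
  have -> : 16%:R * (2 * K * cabs v ^+ 3 * (5%:R * cabs v) * (13%:R * cabs v ^+ 2)) = 130%:R * K / cabs v ^+ 2 * (cabs v ^+ 4 * (16%:R * cabs v ^+ 4)).
    by field; rewrite gt_eqF.
  by rewrite ler_wpM2l // divr_ge0 ?exprn_ge0 ?cabs_ge0 // mulr_ge0 ?ler0n.
rewrite !cabsM !cabsV cabsX !cabs_nat.
apply: ler_pM; rewrite ?invr_ge0 ?exprn_ge0 ?cabs_ge0 //; [lra..|].
rewrite lef_pV2 ?posrE ?exprn_gt0 //; last by lra.
by rewrite lerXn2r ?nnegrE ?cabs_ge0.
Qed.

(** Away from the pole |snh| is at least |sin (pi Re w)|, which is bounded below while |Re w| lies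
    between d / 2 and 3/4, short of the next pole. *)
Lemma ph_far (d : R) : 0 < d <= 4^-1 -> exists2 K : R, 0 <= K & forall w, `|cRe w| <= 3 / 4 -> `|cIm w| <= d / 2 -> d < cabs w ->
  e2pi w != 1 /\ cabs (ph w) <= K.
Proof.
move=> /andP[d0 d4]; have pp := pi_gt0 R.
pose c := sin (pi * (d / 2)).
have c0 : 0 < c by apply: sin_gt0_pi; rewrite !mulr_gt0 ?divr_gt0 //= gtr_pMr //; lra.
exists (16%:R / c ^+ 4 + 3 / c ^+ 2).
  by rewrite addr_ge0 // divr_ge0 ?exprn_ge0 ?ler0n // ltW.
move=> w x1 y1 dw.
set v := tpi R * w / 2%:R; set S := snh v.
have [x y] := (cRe w, cIm w).
have vE : cRe v = - (pi * cIm w) /\ cIm v = pi * cRe w.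
  have h2 : (2%:R^-1 : C) = ofR (2^-1) by rewrite ofRE fmorphV rmorph_nat.
  rewrite /v h2; split; first by rewrite cReM cRe_tpi cIm_tpi cRe_ofR cIm_ofR; field.
  by rewrite cImM cRe_tpi cIm_tpi cRe_ofR cIm_ofR; field.
have [vR vI] := vE.
have xw : d / 2 <= `|cRe w| by have := cabs_leRI w; lra.
have sx : c <= `|sin (pi * cRe w)|.
  have key t : d / 2 <= t <= 1/2 -> c <= sin (pi * t).
    move=> /andP[t0 t1]; rewrite /c leNgt ltr_sin ?in_itv /=; last 2 first.
    - by apply/andP; split; [nra | rewrite ler_pM2l //; lra].
    - by apply/andP; split; [nra | rewrite ler_pM2l //; lra].
    by rewrite -leNgt ler_pM2l.
  have key2 t : d / 2 <= t <= 3/4 -> c <= sin (pi * t).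
    move=> /andP[t0 t1]; have [th|th] := leP t (1/2); first by apply: key; rewrite t0.
    have -> : sin (pi * t) = sin (pi * (1 - t)).
      by rewrite mulrBr mulr1 sinB sinpi cospi mul0r sub0r mulN1r opprK.
    by apply: key; apply/andP; split; lra.
  have -> : `|sin (pi * cRe w)| = `|sin (pi * `|cRe w|)|.
    have [h|h] := leP 0 (cRe w); first by rewrite (ger0_norm h).
    by rewrite (ltr0_norm h) mulrN sinN normrN.
  by apply: le_trans (key2 _ _) (ler_norm _); rewrite xw x1.
have SI : cIm S = (expR (cRe v) + expR (- cRe v)) * sin (cIm v).
  by rewrite /S /snh cImD cImN !cIm_cexp cReN cImN sinN; ring.
have ex : 1 <= expR (cRe v) + expR (- cRe v).
  have [h|h] := leP 0 (cRe v).
    by have := expR_ge1Dx (cRe v); have := expR_ge0 (- cRe v); lra.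
  by have := expR_ge1Dx (- cRe v); have := expR_ge0 (cRe v); lra.
have Sc : c <= cabs S.
  apply: le_trans (cIm_le S); rewrite SI normrM vI.
  apply: le_trans sx _; rewrite ler_peMl // ger0_norm //; lra.
have S0 : S != 0 by rewrite -cabs_gt0; lra.
have e1 : e2pi w != 1.
  apply: contra S0 => /eqP E; rewrite /S /snh cexpN subr_eq0; apply/eqP.
  have e0 := cexp_neq0 v; apply: (mulIf e0); rewrite mulVf // -E e2piE -cexpD.
  by congr cexp; rewrite /v; field.
split => //; rewrite ph_snh // -/v -/S; apply: le_trans (cabsD _ _) _; apply: lerD.
  rewrite cabsM cabsV cabsX cabs_nat ler_wpM2l ?ler0n // lef_pV2 ?posrE ?exprn_gt0 //; last by lra.
  by rewrite lerXn2r ?nnegrE ?cabs_ge0 // ltW.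
rewrite !cabsM !cabsV cabsX !cabs_nat.
apply: ler_pM; rewrite ?invr_ge0 ?exprn_ge0 ?cabs_ge0 //; [lra..|].
rewrite lef_pV2 ?posrE ?exprn_gt0 //; last by lra.
by rewrite lerXn2r ?nnegrE ?cabs_ge0 // ltW.
Qed.

(** The width 3/4 is what [lipschitz] needs: its points have real part at most (M / 2 + M) / (2 M)
    in absolute value. *)
Lemma ph_bound : exists2 d : R, 0 < d & exists2 K : R, 0 <= K & forall w, w != 0 ->
  `|cRe w| <= 3 / 4 -> `|cIm w| <= d -> e2pi w != 1 /\ cabs (ph w - (piC * w) ^- 4) <= K / cabs w ^+ 2.
Proof.
have [d Hd [K K0 HK]] := ph_near; have [L L0 HL] := ph_far Hd.
have /andP[d0 d4] := Hd; have p2 := pi_ge2 R.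
exists (d / 2); first by rewrite divr_gt0.
exists (K + L + d ^- 4); first by rewrite !addr_ge0 // invr_ge0 exprn_ge0 // ltW.
move=> w w0 x1 y1; have wp : 0 < cabs w by rewrite cabs_gt0.
have [wd|dw] := leP (cabs w) d.
  have [e1 A] := HK w w0 wd; split => //; apply: le_trans A _.
  rewrite ler_wpM2r ?invr_ge0 ?exprn_ge0 ?cabs_ge0 // -addrA lerDl addr_ge0 // invr_ge0 exprn_ge0 // ltW //.
have [e1 A] := HL w x1 y1 dw; split => //.
have w1 : cabs w <= 1 by have := cabs_leRI w; lra.
apply: le_trans (_ : L + d ^- 4 <= _).
  apply: le_trans (cabsD _ _) _; rewrite cabsN; apply: lerD => //.
  rewrite cabsV cabsX cabsM cabs_piC lef_pV2 ?posrE ?exprn_gt0 ?mulr_gt0 //; last by lra.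
  rewrite lerXn2r ?nnegrE ?mulr_ge0 ?ltW //; [lra|nra].
have B : 0 <= L + d ^- 4 by rewrite addr_ge0 // invr_ge0 exprn_ge0 // ltW.
apply: le_trans (_ : (L + d ^- 4) / cabs w ^+ 2 <= _).
  rewrite ler_pdivlMr ?exprn_gt0 // ler_piMr // exprn_ile1 // ltW //.
by rewrite ler_wpM2r ?invr_ge0 ?exprn_ge0 ?cabs_ge0 // -addrA lerDr.
Qed.
End Lipschitz.

(** * Lattice sums, the Lipschitz formula and zeta(4) *)

Section Lattice.
Variable R : realType.
Local Notation C := (Cfield R).
Implicit Types (z w tau Q : C).
Local Notation upper := (@upper_half_plane R).

Lemma isq_bound n : \sum_(i < n) (i.+1%:R ^- 2 : R) <= 2.
Proof.
case: n => [|n]; first by rewrite big_ord0 ler0n.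
suff : \sum_(i < n.+1) (i.+1%:R ^- 2 : R) <= 2 - (n.+1%:R)^-1.
  by move=> H; apply: le_trans H _; rewrite gerBl invr_ge0 ler0n.
elim: n => [|n IH]; first by rewrite big_ord1 expr1n !invr1; lra.
rewrite big_ord_recr /=; apply: le_trans (lerD IH (lexx _)) _.
have n0 : 0 < n.+1%:R :> R by rewrite ltr0n.
have e2 : n.+2%:R = n.+1%:R + 1 :> R by rewrite natr1.
rewrite e2; set x := n.+1%:R in n0 *.
have -> : 2 - x^-1 + (x + 1) ^- 2 = 2 - (x + 1)^-1 - (x * (x + 1) ^+ 2)^-1.
  by field; apply/andP; split; apply: lt0r_neq0; lra.
by rewrite gerBl invr_ge0 mulr_ge0 ?exprn_ge0 //; lra.
Qed.

Lemma asum_isq (K : R) : asum (fun n => ofR (K * n.+1%:R ^- 2) : C).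
Proof.
apply: (@eq_asum _ (fun n => ofR K * ofR (n.+1%:R ^- 2))); first by move=> n; rewrite ofRM.
apply: asumZ; exists 2 => n; apply: le_trans (isq_bound n); apply: ler_sum => i _.
by rewrite cabs_ofR ger0_norm // invr_ge0 exprn_ge0.
Qed.

(** M comes from y^2 <= 2 (x Re tau + y)^2 + 2 (x Re tau)^2, the x^2 terms being absorbed by (x Im
    tau)^2. *)
Lemma quad_form tau : cIm tau != 0 -> exists2 c : R, 0 < c & forall x y : R,
  c * (x ^+ 2 + y ^+ 2) <= cabs (ofR x * tau + ofR y) ^+ 2.
Proof.
set a := cRe tau; set b := cIm tau => b0.
have bp : 0 < b ^+ 2 by rewrite lt_def sqrf_eq0 b0 sqr_ge0.
pose M := (1 + 2 * a ^+ 2) / b ^+ 2 + 2.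
have M0 : 0 < M by rewrite /M; have := sqr_ge0 a => ?; rewrite ltr_wpDl // divr_ge0 ?sqr_ge0 //; lra.
exists M^-1; first by rewrite invr_gt0.
move=> x y; rewrite mulrC ler_pdivrMr //.
have -> : cabs (ofR x * tau + ofR y) ^+ 2 = (x * a + y) ^+ 2 + (x * b) ^+ 2.
  rewrite /cabs normc_def /= sqr_sqrtr ?addr_ge0 ?sqr_ge0 //.
  by rewrite /a /b; case: (tau) => u v /=; rewrite /cRe /cIm /=; ring.
have -> : ((x * a + y) ^+ 2 + (x * b) ^+ 2) * M = x ^+ 2 * (1 + 2 * a ^+ 2) + 2 * (x * a + y) ^+ 2 + (x * a + y) ^+ 2 * ((1 + 2 * a ^+ 2) / b ^+ 2) + 2 * (x * b) ^+ 2.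
  by rewrite /M; field.
have : 0 <= (x * a + y) ^+ 2 * ((1 + 2 * a ^+ 2) / b ^+ 2).
  by rewrite mulr_ge0 ?sqr_ge0 // divr_ge0 ?sqr_ge0 //; have := sqr_ge0 a; lra.
have := sqr_ge0 (x * b); have := sqr_ge0 (2 * x * a + y); lra.
Qed.

Lemma quad_form4 tau : cIm tau != 0 -> exists2 c : R, 0 <= c & forall x y : R, 0 < x ^+ 2 + y ^+ 2 ->
  ofR x * tau + ofR y != 0 /\ cabs ((ofR x * tau + ofR y) ^- 4) <= c / (x ^+ 2 + y ^+ 2) ^+ 2.
Proof.
move=> /quad_form [c c0 Hc]; exists (c ^- 2); first by rewrite invr_ge0 exprn_ge0 // ltW.
move=> x y s0; have H := Hc x y.
have n0 : 0 < cabs (ofR x * tau + ofR y) ^+ 2 by apply: lt_le_trans H; rewrite mulr_gt0.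
have nn : ofR x * tau + ofR y != 0.
  by rewrite -cabs_eq0; apply: contraTneq n0 => ->; rewrite expr0n ltxx.
split => //; rewrite cabsV cabsX -invfM lef_pV2 ?posrE.
- have -> : cabs (ofR x * tau + ofR y) ^+ 4 = (cabs (ofR x * tau + ofR y) ^+ 2) ^+ 2 by rewrite -exprM.
  rewrite -exprMn lerXn2r // ?nnegrE ?sqr_ge0 //.
  by apply: mulr_ge0; exact: ltW.
- have -> : cabs (ofR x * tau + ofR y) ^+ 4 = (cabs (ofR x * tau + ofR y) ^+ 2) ^+ 2 by rewrite -exprM.
  by rewrite exprn_gt0.
by rewrite mulr_gt0 ?exprn_gt0.
Qed.

Lemma ofRnat n : ofR (n%:R : R) = n%:R :> C. Proof. exact: ofR_nat. Qed.

(** The terms n and -n of a row are paired; the middle term tau^-4 is kept apart. *)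
Definition zrow tau n : C := (tau + n.+1%:R) ^- 4 + (tau - n.+1%:R) ^- 4.

(** The inequality 2 x y <= (x + y)^2, for the squares x and y of the two indices, turns the bound
    into a product, as the exchange of summations requires. *)
Lemma zrow_bound tau : cIm tau != 0 -> exists2 c : R, 0 <= c & forall m n,
  [/\ m.+1%:R * tau + n.+1%:R != 0, m.+1%:R * tau - n.+1%:R != 0 & cabs (zrow (m.+1%:R * tau) n) <= c * m.+1%:R ^- 2 * n.+1%:R ^- 2].
Proof.
move=> /quad_form4 [c c0 Hc]; exists c => // m n.
have [mp np] : 0 < m.+1%:R :> R /\ 0 < n.+1%:R :> R by rewrite !ltr0n.
have P : m.+1%:R ^+ 2 + n.+1%:R ^+ 2 > 0 :> R by rewrite addr_gt0 ?exprn_gt0.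
have P' : m.+1%:R ^+ 2 + (- n.+1%:R) ^+ 2 > 0 :> R by rewrite sqrrN.
have [n1 A] := Hc _ _ P; have [n2 B] := Hc _ _ P'.
rewrite ofRN !ofRnat in n1 n2 A B; split => //.
apply: le_trans (cabsD _ _) _; apply: le_trans (lerD A B) _; rewrite sqrrN.
set x := m.+1%:R ^+ 2 in P *; set y := n.+1%:R ^+ 2 in P *.
have [x0 y0] : 0 < x /\ 0 < y by rewrite /x /y !exprn_gt0.
have -> : c / (x + y) ^+ 2 + c / (x + y) ^+ 2 = c * (2 / (x + y) ^+ 2) by ring.
rewrite -mulrA -invfM ler_wpM2l // ler_pdivrMr ?exprn_gt0 // mulrC ler_pdivlMr ?mulr_gt0 //.
have := sqr_ge0 (x - y); have : 0 < x * y by rewrite mulr_gt0. nra.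
Qed.

Lemma zrow_asum tau : cIm tau != 0 -> asum (zrow tau).
Proof.
move=> /zrow_bound [c c0 Hc]; apply: asum_le (asum_isq c) => n.
have [_ _] := Hc 0%N n; rewrite mul1r expr1n invr1 mulr1 cabs_ofR ger0_norm //.
by rewrite mulr_ge0 // invr_ge0 exprn_ge0.
Qed.

Lemma pow_small (e : R) : 0 < e -> exists m0, forall m, (m0 <= m)%N -> ((2 ^ m)%N%:R)^-1 < e.
Proof.
move=> e0; exists (Num.truncn (e^-1)).+1 => m Hm.
have H : e^-1 < (2 ^ m)%N%:R.
  have e1 : 0 <= e^-1 by rewrite invr_ge0 ltW.
  have /andP[_ A] := truncn_itv e1.
  apply: lt_le_trans A _; rewrite ler_nat; apply: leq_trans Hm _; exact: ltnW (ltn_expl _ _).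
by rewrite -[e]invrK ltf_pV2 ?posrE ?invr_gt0 // (lt_trans _ H) // invr_gt0.
Qed.

Lemma neq1_upper tau : upper tau -> e2pi tau != 1.
Proof.
by move=> t0; apply: contraTneq (e2pi_disc t0) => ->; rewrite cabs1 ltxx.
Qed.

(** Each of the 2 M terms of the iterated duplication formula differs from its model (pi (tau + k) /
    (2 M))^-4 by O(M^2); after division by (2 M)^4 the total error is O(1 / M). *)
Lemma lipschitz tau : upper tau -> piC R ^+ 4 * ph tau = tau ^- 4 + sumC (zrow tau).
Proof.
move=> t0; have b0 : 0 < cIm tau := t0.
have tn1 := neq1_upper t0.
have As := zrow_asum (lt0r_neq0 b0).
have [d d0 [K K0 HK]] := ph_bound R.
have pp := pi_gt0 R; have pn := piC_neq0 R.
apply/eqP; rewrite -subr_eq0 -cabs_eq0 eq_le cabs_ge0 andbT.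
apply/ler_addgt0Pr => e e0; rewrite add0r.
have [c c0 Hc] := quad_form4 (lt0r_neq0 b0).
have e2 : 0 < e / 2 by rewrite divr_gt0.
have [N HN] := asum_eps As e2.
pose L := pi ^+ 4 * (K / cIm tau ^+ 2) + c.
have p4 : 0 <= pi ^+ 4 :> R by rewrite exprn_ge0 // ltW.
have Kb : 0 <= K / cIm tau ^+ 2 by rewrite divr_ge0 // exprn_ge0 // ltW.
have L0 : 0 <= L by rewrite addr_ge0 // mulr_ge0.
pose e' := Num.min (e / 2 / (L + 1)) (Num.min (d / cIm tau) ((2 * `|cRe tau| + 1)^-1)).
have r1 : 0 < 2 * `|cRe tau| + 1 by have := normr_ge0 (cRe tau); lra.
have e'0 : 0 < e' by rewrite !lt_min !divr_gt0 ?invr_gt0 //; lra.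
have [m0 Hm] := pow_small e'0.
pose m := maxn m0 N; have := Hm m (leq_maxl _ _); rewrite /e' !lt_min => /and3P[M1 M2 M3].
set M := (2 ^ m)%N in M1 M2 M3.
have NM : (N <= M)%N by apply: leq_trans (leq_maxr m0 N) _; exact: ltnW (ltn_expl _ _).
have Mp : (0 < M)%N by rewrite expn_gt0.
have MR : 0 < M%:R :> R by rewrite ltr0n.
have MC : M%:R != 0 :> C by rewrite pnatr_eq0 -lt0n.
have MC2 : 2%:R * M%:R != 0 :> C by rewrite mulf_neq0 ?MC // pnatr_eq0.
have Md : cIm tau / (2 * M%:R) <= d.
  move: M2; rewrite ltr_pdivlMr // => M2; rewrite ler_pdivrMr ?mulr_gt0 //.
  have : M%:R * (M%:R^-1 * cIm tau) < M%:R * d by rewrite ltr_pM2l.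
  rewrite mulVKf ?gt_eqF // => A; have : 0 < M%:R * d by rewrite mulr_gt0.
  lra.
have Mr : 2 * `|cRe tau| <= M%:R.
  move: M3; rewrite ltf_pV2 ?posrE // => M3; lra.
have E16 : 16%:R ^+ m.+1 = (2%:R * M%:R) ^+ 4 :> C.
  rewrite /M natrX -exprS -exprM mulnC exprM; congr (_ ^+ _); rewrite -natrX //.
(* The residues k >= M are shifted by -2 M, which centres the points around 0 and is harmless since
   [ph] has period 1. *)
have S1 : \sum_(k < M) (ph ((tau + k%:R) / (2%:R * M%:R)) + ph ((tau - k.+1%:R) / (2%:R * M%:R))) = (2%:R * M%:R) ^+ 4 * ph tau.
  rewrite -E16 -ph_iter // expnS mul2n -addnn big_split_ord /= big_split /= addnn -mul2n natrM.
  congr (_ + _); rewrite (reindex_inj rev_ord_inj) /=; apply: eq_bigr => k _.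
  rewrite -(ph_int _ (1 : int)); congr ph.
  have -> : (M - k.+1).+1%:R = M%:R - k%:R :> C by rewrite subnSK // natrB // ltnW.
  by rewrite natrD -/M; field.
have S2 n : \sum_(k < n) ((tau + k%:R) ^- 4 + (tau - k.+1%:R) ^- 4) =
    tau ^- 4 + \sum_(k < n) zrow tau k - (tau + n%:R) ^- 4.
  elim: n => [|n IH]; first by rewrite !big_ord0 !addr0 subrr.
  by rewrite !big_ord_recr /= IH /zrow; ring.
have tx (x : R) : cIm tau <= cabs (tau + ofR x).
  have -> : cIm tau = cIm (tau + ofR x) by rewrite cImD cIm_ofR addr0.
  by apply: le_trans (ler_norm _) (cIm_le _).
have term (x : R) : `|x| <= M%:R ->
    cabs (ph ((tau + ofR x) / (2%:R * M%:R)) - (2%:R * M%:R) ^+ 4 * (piC R ^- 4 * (tau + ofR x) ^- 4)) <= K * (2 * M%:R) ^+ 2 / cIm tau ^+ 2.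
  move=> xM; set w := (tau + ofR x) / _.
  have t0' : tau + ofR x != 0 by rewrite -cabs_gt0; apply: lt_le_trans (tx x).
  have w0 : w != 0 by rewrite mulf_neq0 // invr_eq0.
  have i2M : (2%:R * M%:R)^-1 = ofR ((2 * M%:R)^-1) :> C by rewrite ofRE fmorphV rmorphM !rmorph_nat.
  have wR : `|cRe w| <= 3 / 4.
    rewrite /w i2M cReM cIm_ofR mulr0 subr0 cReD !cRe_ofR normrM [`|_^-1|]ger0_norm ?invr_ge0 ?mulr_ge0 //.
    rewrite ler_pdivrMr ?mulr_gt0 //; apply: le_trans (ler_normD _ _) _; lra.
  have wI : `|cIm w| <= d.
    rewrite /w i2M cImM cIm_ofR mulr0 add0r cImD cIm_ofR addr0 cRe_ofR ger0_norm //.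
    by rewrite divr_ge0 // ?mulr_ge0 // ltW.
  have [_ A] := HK w w0 wR wI.
  have -> : (2%:R * M%:R) ^+ 4 * (piC R ^- 4 * (tau + ofR x) ^- 4) = (piC R * w) ^- 4.
    by rewrite /w; field; rewrite MC pn t0'.
  apply: le_trans A _; rewrite /w cabsM cabsV cabsM !cabs_nat expr_div_n invf_div mulrA.
  rewrite ler_wpM2l ?mulr_ge0 ?exprn_ge0 //.
  have tp := lt_le_trans b0 (tx x).
  by rewrite lef_pV2 ?posrE ?exprn_gt0 // lerXn2r ?nnegrE ?tx // ltW.
have Tot : cabs ((2%:R * M%:R) ^+ 4 * ph tau - (2%:R * M%:R) ^+ 4 * piC R ^- 4 * (tau ^- 4 + \sum_(k < M) zrow tau k - (tau + M%:R) ^- 4)) <= (2 * M%:R) * (K * (2 * M%:R) ^+ 2 / cIm tau ^+ 2).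
  rewrite -S1 -S2 mulr_sumr -sumrB; apply: le_trans (cabs_sum _ _ _) _.
  apply: (@le_trans _ _ (\sum_(k < M) (K * (2 * M%:R) ^+ 2 / cIm tau ^+ 2 + K * (2 * M%:R) ^+ 2 / cIm tau ^+ 2))).
    apply: ler_sum => k _.
    have kM : (k.+1%:R : R) <= M%:R by rewrite ler_nat.
    have A := term k%:R (ltac:(rewrite ger0_norm ?ler0n // ler_nat ltnW //)).
    have B := term (- k.+1%:R) (ltac:(by rewrite normrN ger0_norm ?ler0n)).
    rewrite ofRN !ofRnat in A B.
    apply: le_trans (lerD A B); apply: le_trans (cabsD _ _).
    by rewrite mulrDr !mulrA addrACA opprD.
  by rewrite sumr_const card_ord -[_ *+ M]mulr_natl; apply: le_of_eq; ring.
have Tot2 : cabs (piC R ^+ 4 * ph tau - (tau ^- 4 + \sum_(k < M) zrow tau k - (tau + M%:R) ^- 4)) <= pi ^+ 4 * (K / cIm tau ^+ 2) * M%:R^-1.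
  have M24 : 0 < (2 * M%:R) ^+ 4 :> R by rewrite exprn_gt0 // mulr_gt0.
  rewrite -(ler_pM2l M24).
  have -> : (2 * M%:R) ^+ 4 = cabs ((2%:R * M%:R) ^+ 4) :> R by rewrite cabsX cabsM !cabs_nat.
  rewrite -cabsM; set X := tau ^- 4 + _ - _ in Tot *.
  have -> : (2%:R * M%:R) ^+ 4 * (piC R ^+ 4 * ph tau - X) = piC R ^+ 4 * ((2%:R * M%:R) ^+ 4 * ph tau - (2%:R * M%:R) ^+ 4 * piC R ^- 4 * X).
    by field.
  rewrite cabsM cabsX cabs_piC; apply: le_trans (ler_wpM2l _ Tot) _; first by rewrite exprn_ge0 // ltW.
  rewrite cabsX cabsM !cabs_nat.
  have -> : pi ^+ 4 * (2 * M%:R * (K * (2 * M%:R) ^+ 2 / cIm tau ^+ 2)) = pi ^+ 4 * (K / cIm tau ^+ 2) * (8%:R * M%:R ^+ 3) by ring.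
  have -> : (2 * M%:R) ^+ 4 * (pi ^+ 4 * (K / cIm tau ^+ 2) / M%:R) = pi ^+ 4 * (K / cIm tau ^+ 2) * (16%:R * M%:R ^+ 3).
    by field; apply/andP; split; apply: lt0r_neq0.
  apply: ler_wpM2l; first exact: mulr_ge0.
  by apply: ler_wpM2r; rewrite ?ler_nat // exprn_ge0 // ltW.
have T3 : cabs ((tau + M%:R) ^- 4) <= c * M%:R^-1.
  have M1' : 1 <= M%:R :> R by rewrite ler1n.
  have P : 0 < 1 ^+ 2 + M%:R ^+ 2 :> R by rewrite addr_gt0 ?exprn_gt0.
  have [_] := Hc 1 M%:R P; rewrite (_ : ofR 1 = 1 :> C) // mul1r ofRnat => A.
  apply: le_trans A _; rewrite ler_wpM2l // lef_pV2 ?posrE ?exprn_gt0 //.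
  rewrite expr1n; nra.
have T := HN M NM.
set s := \sum_(k < M) _ in T Tot2; set Z := sumC _ in T *.
have -> : piC R ^+ 4 * ph tau - (tau ^- 4 + Z) = (piC R ^+ 4 * ph tau - (tau ^- 4 + s - (tau + M%:R) ^- 4)) + (s - Z) - (tau + M%:R) ^- 4 by ring.
apply: le_trans (cabsD _ _) _; rewrite cabsN.
apply: le_trans (lerD (cabsD _ _) (lexx _)) _.
have LM : L * M%:R^-1 <= e / 2.
  move: M1; rewrite ltr_pdivlMr; last by lra.
  have : 0 <= M%:R^-1 :> R by rewrite invr_ge0 ltW.
  lra.
have : L * M%:R^-1 = pi ^+ 4 * (K / cIm tau ^+ 2) * M%:R^-1 + c * M%:R^-1 by rewrite /L mulrDl.
lra.
Qed.

(** The argument of [lipschitz] on the real axis, with [ph_iter0] for [ph_iter]: its limit 1/45 is 2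
    zeta(4) / pi^4. *)
Lemma zeta4 : asum (fun n => n.+1%:R ^- 4 : C) /\ sumC (fun n => n.+1%:R ^- 4 : C) = piC R ^+ 4 / 90%:R.
Proof.
have As : asum (fun n => n.+1%:R ^- 4 : C).
  apply: asum_le (asum_isq 1) => n; rewrite cabsV cabsX cabs_nat cabs_ofR mul1r ger0_norm ?invr_ge0 ?exprn_ge0 //.
  by rewrite lef_pV2 ?posrE ?exprn_gt0 ?ltr0n // ler_weXn2l // ler1n.
split => //.
have [d d0 [K K0 HK]] := ph_bound R.
have pp := pi_gt0 R; have pn := piC_neq0 R.
apply/eqP; rewrite -subr_eq0 -cabs_eq0 eq_le cabs_ge0 andbT.
apply/ler_addgt0Pr => e e0; rewrite add0r.
have e2 : 0 < e / 2 by rewrite divr_gt0.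
have [N HN] := asum_eps As e2.
pose L := pi ^+ 4 * (2 * K + 1).
have L0 : 0 < L by rewrite mulr_gt0 ?exprn_gt0 //; lra.
pose e' := e / 2 / L.
have e'0 : 0 < e' by rewrite !divr_gt0.
have [m0 Hm] := pow_small e'0.
pose m := maxn m0 N.+1; have := Hm m (leq_maxl _ _) => M1.
set M := (2 ^ m)%N in M1.
have NM : (N.+1 <= M)%N by apply: leq_trans (leq_maxr m0 N.+1) _; exact: ltnW (ltn_expl _ _).
have Mp : (0 < M)%N by rewrite expn_gt0.
have MR : 0 < M%:R :> R by rewrite ltr0n.
have MC : M%:R != 0 :> C by rewrite pnatr_eq0 -lt0n.
have MC2 : 2%:R * M%:R != 0 :> C by rewrite mulf_neq0 ?MC // pnatr_eq0.
have E16 : 16%:R ^+ m.+1 = (2%:R * M%:R) ^+ 4 :> C.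
  rewrite /M natrX -exprS -exprM mulnC exprM; congr (_ ^+ _); rewrite -natrX //.
have M2 : (2 ^ m.+1 = M + M)%N by rewrite expnS mul2n addnn.
have S1 : (\sum_(k < M.-1) (ph (k.+1%:R / (2%:R * M%:R) : C) + ph (- k.+1%:R / (2%:R * M%:R) : C))) + ph (2%:R^-1 : C) = ((2%:R * M%:R) ^+ 4 - 1) / 45%:R :> C.
  rewrite -E16 -ph_iter0 M2 natrD -mulr2n -[M%:R *+ 2]mulr_natl.
  rewrite (big_cat_nat _ (m := 1) (n := M)) //=; last by rewrite leq_addr.
  rewrite [X in _ = _ + X]big_ltn; last by rewrite -[X in (X < _)%N]addn0 ltn_add2l.
  have -> : M%:R / (2%:R * M%:R) = 2%:R^-1 :> C by field.
  rewrite big_split /= addrAC -addrA; congr (_ + (_ + _)).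
    by rewrite big_add1 big_mkord.
  have -> : M.+1 = (1 + M)%N by [].
  rewrite big_addn addnK big_nat_rev /= big_add1 big_mkord; apply: eq_bigr => k _.
  rewrite -(ph_int _ (1 : int)); congr ph; have kM : (k < M)%N := leq_trans (ltn_ord k) (leq_pred M).
  by rewrite add1n subSS natrD natrB //; field.
have term (x : C) n : x = n.+1%:R \/ x = - n.+1%:R -> (n.+1 <= M)%N ->
    cabs (ph (x / (2%:R * M%:R)) - (2%:R * M%:R) ^+ 4 * (piC R ^- 4 * n.+1%:R ^- 4)) <= K * (2 * M%:R) ^+ 2.
  move=> Hx nM; set w := x / _.
  have xR : exists2 y : R, x = ofR y & `|y| = n.+1%:R.
    case: Hx => ->; first by exists n.+1%:R; rewrite ?ofRnat // ger0_norm.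
    by exists (- n.+1%:R); rewrite ?ofRN ?ofRnat // normrN ger0_norm.
  have [y xy yn] := xR.
  have cx : cabs x = n.+1%:R by rewrite xy cabs_ofR.
  have x0 : x != 0 by rewrite -cabs_gt0 cx ltr0n.
  have n0 : n.+1%:R != 0 :> C by rewrite pnatr_eq0.
  have w0 : w != 0 by rewrite mulf_neq0 // invr_eq0.
  have i2M : (2%:R * M%:R)^-1 = ofR ((2 * M%:R)^-1) :> C by rewrite ofRE fmorphV rmorphM !rmorph_nat.
  have wE : w = ofR (y / (2 * M%:R)) by rewrite /w xy i2M -ofRM.
  have wR : `|cRe w| <= 3 / 4.
    rewrite wE cRe_ofR normrM yn [`|_^-1|]ger0_norm ?invr_ge0 ?mulr_ge0 //.
    rewrite ler_pdivrMr ?mulr_gt0 //; have : n.+1%:R <= M%:R :> R by rewrite ler_nat. lra.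
  have wI : `|cIm w| <= d by rewrite wE cIm_ofR normr0 ltW.
  have [_ A] := HK w w0 wR wI.
  have -> : (2%:R * M%:R) ^+ 4 * (piC R ^- 4 * n.+1%:R ^- 4) = (piC R * w) ^- 4.
    rewrite /w; move: n0 Hx; move: (n.+1%:R : C) => y' n0 [->|->]; by field; rewrite MC pn n0.
  apply: le_trans A _; rewrite /w cabsM cabsV cabsM !cabs_nat cx expr_div_n invf_div.
  rewrite ler_wpM2l // ler_piMr ?exprn_ge0 //.
  by rewrite invf_le1 ?exprn_gt0 ?ltr0n // exprn_ege1 // ler1n.
have T := HN M.-1 (ltac:(by rewrite -ltnS prednK)).
set s := \sum_(k < M.-1) _ in T; set Z := sumC _ in T *.
have Tot : cabs (((2%:R * M%:R) ^+ 4 - 1) / 45%:R - 3%:R^-1 - (2%:R * M%:R) ^+ 4 * piC R ^- 4 * (2%:R * s)) <= (2 * M%:R) * (K * (2 * M%:R) ^+ 2).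
  have -> : 3%:R^-1 = ph (2%:R^-1) :> C by rewrite /ph e2pi_half /fL; field.
  rewrite -S1 addrK /s mulr_sumr mulr_sumr -sumrB; apply: le_trans (cabs_sum _ _ _) _.
  apply: (@le_trans _ _ (\sum_(k < M.-1) (K * (2 * M%:R) ^+ 2 + K * (2 * M%:R) ^+ 2))).
    apply: ler_sum => k _.
    have kM : (k.+1 <= M)%N := leq_trans (ltn_ord k) (leq_pred M).
    have A := @term k.+1%:R k (or_introl erefl) kM.
    have B := @term (- k.+1%:R) k (or_intror erefl) kM.
    apply: le_trans (lerD A B); apply: le_trans (cabsD _ _).
    apply: le_of_eq; congr cabs; ring.
  rewrite sumr_const card_ord -[_ *+ M.-1]mulr_natl.
  have MM : M.-1%:R <= M%:R :> R by rewrite ler_nat leq_pred.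
  have P : 0 <= K * (2 * M%:R) ^+ 2 by rewrite mulr_ge0 // exprn_ge0 // mulr_ge0.
  apply: le_trans (ler_wpM2r _ MM) _; first by rewrite addr_ge0.
  by apply: le_of_eq; ring.
have Tot2 : cabs (s - piC R ^+ 4 / 90%:R) <= L * M%:R^-1.
  have M24 : 0 < 2 * (2 * M%:R) ^+ 4 :> R by rewrite mulr_gt0 // exprn_gt0 // mulr_gt0.
  rewrite -(ler_pM2l M24).
  have -> : 2 * (2 * M%:R) ^+ 4 = cabs (2%:R * (2%:R * M%:R) ^+ 4) :> R by rewrite cabsM cabsX cabsM !cabs_nat.
  rewrite -cabsM.
  have -> : 2%:R * (2%:R * M%:R) ^+ 4 * (s - piC R ^+ 4 / 90%:R) = - piC R ^+ 4 * ((((2%:R * M%:R) ^+ 4 - 1) / 45%:R - 3%:R^-1 - (2%:R * M%:R) ^+ 4 * piC R ^- 4 * (2%:R * s)) + (45%:R^-1 + 3%:R^-1)).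
    by field.
  rewrite [in X in _ <= X]cabsM [cabs (- _ * _)]cabsM [cabs (- _)]cabsN [cabs (piC R ^+ 4)]cabsX cabs_piC.
  have B45 : cabs (45%:R^-1 + 3%:R^-1 : C) <= 1.
    by apply: le_trans (cabsD _ _) _; rewrite !cabsV !cabs_nat; lra.
  apply: le_trans (ler_wpM2l _ (le_trans (cabsD _ _) (lerD Tot B45))) _; first by rewrite exprn_ge0 // ltW.
  rewrite cabsX cabsM !cabs_nat /L.
  have -> : 2 * (2 * M%:R) ^+ 4 * (pi ^+ 4 * (2 * K + 1) / M%:R) = pi ^+ 4 * ((2 * K + 1) * (32%:R * M%:R ^+ 3)).
    by field; apply: lt0r_neq0.
  rewrite ler_wpM2l ?exprn_ge0 //; first exact: ltW.
  have M1' : 1 <= M%:R :> R by rewrite ler1n.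
  have M3 : 1 <= M%:R ^+ 3 :> R by rewrite exprn_ege1.
  have : 0 <= K * (M%:R ^+ 3) by rewrite mulr_ge0 // exprn_ge0.
  lra.
have -> : Z - piC R ^+ 4 / 90%:R = (s - piC R ^+ 4 / 90%:R) - (s - Z) by ring.
apply: le_trans (cabsD _ _) _; rewrite cabsN.
have : L * M%:R^-1 <= e / 2.
  by move: M1; rewrite /e' ltr_pdivlMr // mulrC => /ltW.
lra.
Qed.
End Lattice.

(** * Modularity of E_4 *)

Section Modularity.
Variable R : realType.
Local Notation C := (Cfield R).
Implicit Types (z w tau q : C) (a b c d j : int).
Local Notation upper := (@upper_half_plane R).
Local Notation disc := (@disc R).
Local Notation sg := (@sg R).

Lemma npsX k : nps (fun n => n%:R ^+ k : C) = (fun n => n%:R ^+ k.+1).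
Proof. by apply/funext => n; rewrite /nps exprS. Qed.

Lemma ps_cube q : disc q -> ps (fun n => n%:R ^+ 3) q = q * (1 + 4%:R * q + q ^+ 2) / (1 - q) ^+ 4.
Proof.
move=> q1.
have n1 x : disc x -> 1 - x != 0.
  by move=> x1; rewrite subr_eq0; apply: contraTneq x1 => <-; rewrite /disc cabs1 ltxx.
have g0 x : disc x -> isQD (fun x => (1 - x)^-1) x (x * (1 - x)^-1 ^+ 2).
  move=> x1; exists ((1 - x)^-1 ^+ 2) => //.
  have H : cder (fun x : C => 1 - x) x (0 - 1) := cderB (cder_cst 1 x) (cder_id x).
  by apply: cder_eq (@cderV R (fun x => 1 - x) x _ (n1 _ x1) H) _; field; exact: n1.
have p1 x : disc x -> ps (fun n => n%:R ^+ 1) x = x * (1 - x)^-1 ^+ 2.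
  move=> x1; apply: isQD_uniq (g0 _ x1); rewrite -npsX.
  apply: (isQD_ext (f := ps (fun n => n%:R ^+ 0)) _ x1); last exact: isQD_ps (PS_pow 0) x1.
  by move=> y y1; rewrite -ps_1.
have idT x : isQD (fun y : C => y) x x by exists 1; [exact: cder_id | exact: mulr1].
have p2 x : disc x -> ps (fun n => n%:R ^+ 2) x = x * (1 - x)^-1 ^+ 2 + 2%:R * x ^+ 2 * (1 - x)^-1 ^+ 3.
  move=> x1; rewrite -npsX; apply: (@isQD_uniq _ (ps (fun n => n%:R ^+ 1)) x).
    exact: isQD_ps (PS_pow 1) x1.
  apply: (isQD_ext (f := fun y => y * ((1 - y)^-1 * (1 - y)^-1)) _ x1).
    by move=> y y1; rewrite p1 // expr2.
  apply: isQD_eq (isQD_M (idT x) (isQD_M (g0 _ x1) (g0 _ x1))) _; ring.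
rewrite -npsX; apply: (@isQD_uniq _ (ps (fun n => n%:R ^+ 2)) q).
  exact: isQD_ps (PS_pow 2) q1.
apply: (isQD_ext (f := fun y => y * ((1 - y)^-1 * (1 - y)^-1) + 2%:R * (y * y * ((1 - y)^-1 * ((1 - y)^-1 * (1 - y)^-1)))) _ q1).
  by move=> y y1; rewrite p2 //; ring.
apply: isQD_eq (isQD_D (isQD_M (idT q) (isQD_M (g0 _ q1) (g0 _ q1))) (isQD_Z 2%:R (isQD_M (isQD_M (idT q) (idT q)) (isQD_M (g0 _ q1) (isQD_M (g0 _ q1) (g0 _ q1)))))) _.
by field; exact: n1.
Qed.

(** [fL] is 8/3 times the rational function of [ps_cube], so [lipschitz] is the q-expansion of a row
    of the lattice. *)
Lemma ph_ps tau : upper tau -> ph tau = 8%:R / 3%:R * ps (fun n => n%:R ^+ 3) (e2pi tau).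
Proof.
move=> t0; rewrite ps_cube; last exact: e2pi_disc.
rewrite /ph /fL; have := neq1_upper t0; rewrite eq_sym -subr_eq0 => H; field; exact: H.
Qed.

(** Collects the divisor sums by powers of q^(m + 1), so that the Lipschitz formula applies to each
    multiple (m + 1) tau. *)
Lemma sg3_double q : disc q ->
  ps (sg 3) q = sumC (fun m => ps (fun n => n%:R ^+ 3) (q ^+ m.+1)).
Proof.
move=> q1; rewrite lambert_sum //; have q0 := cabs_ge0 q.
pose t (m n : nat) : C := n.+1%:R ^+ 3 * q ^+ (m.+1 * n.+1)%N.
have qm m : disc (q ^+ m.+1) by apply: disc_exp.
have E1 m : ps (fun n => n%:R ^+ 3) (q ^+ m.+1) = sumC (t m).
  rewrite (ps_recl (PS_pow 3) (qm m)) expr0n /= add0r /ps -sumCZ.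
    by apply: eq_sumC => n; rewrite /t mulnS exprD exprM; ring.
  exact: PS_asum (PS_shift (PS_pow 3)) (qm m).
have E2 n : n.+1%:R ^+ 3 * (q ^+ n.+1 / (1 - q ^+ n.+1)) = sumC (t^~ n).
  rewrite -(ps_1 (qm n)) /ps -sumCZ -?sumCZ.
  - by apply: eq_sumC => m; rewrite /t mul1r mulSn exprD mulnC exprM.
  - by apply: asumZ; exact: (PS_asum (@PS_1 R) (qm n)).
  - exact: (PS_asum (@PS_1 R) (qm n)).
rewrite (eq_sumC E1) (eq_sumC E2); symmetry.
apply: (@sumC_fubini _ _ (fun m => cabs q ^+ m) (fun n => n.+1%:R ^+ 3 * cabs q ^+ n)).
- move=> m n; rewrite /t cabsM !cabsX cabs_nat mulrCA ler_wpM2l ?exprn_ge0 // -exprD.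
  by apply: ler_wiXn2l => //; [exact: ltW | rewrite mulnS mulSn; lia].
- by move=> m; rewrite exprn_ge0.
- by move=> m; rewrite mulr_ge0 ?exprn_ge0.
- apply: (asum_geo (K := 1) (s := cabs q) _ _).2; first by rewrite q0.
  by move=> m; rewrite mul1r cabs_ofR ger0_norm // exprn_ge0.
have Q1 : cabs (ofR (cabs q) : C) < 1 by rewrite cabs_ofR ger0_norm.
apply: eq_asum (PS_asum (PS_shift (PS_pow 3)) Q1) => n /=.
by rewrite ofRM !ofRE !rmorphXn /= rmorph_nat.
Qed.

Definition e4 tau : C := sE4 (e2pi tau).

Definition latt tau : C := sumC (fun m => sumC (zrow (m.+1%:R * tau))).

Lemma upper_natM tau m : upper tau -> upper (m.+1%:R * tau).
Proof.
by rewrite /upper_half_plane => t0; rewrite cImM cRe_nat cIm_nat mul0r addr0 mulr_gt0.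
Qed.

(** The two axes of the lattice are summed in closed form by [zeta4], giving 1 and tau^-4. In this
    shape tau -> -1/tau visibly exchanges the two terms, up to tau^4, and transposes [latt]. *)
Lemma e4_lattice tau : upper tau -> e4 tau = 1 + tau ^- 4 + 90%:R / piC R ^+ 4 * latt tau.
Proof.
move=> t0; have q1 := e2pi_disc t0; have pn := piC_neq0 R.
have [Z1 Z2] := zeta4 R.
have L m : ps (fun n => n%:R ^+ 3) (e2pi tau ^+ m.+1) = 3%:R / 8%:R / piC R ^+ 4 * (tau ^- 4 * m.+1%:R ^- 4) + 3%:R / 8%:R / piC R ^+ 4 * sumC (zrow (m.+1%:R * tau)).
  have H := lipschitz (upper_natM m t0); rewrite (ph_ps (upper_natM m t0)) e2piMn in H.
  rewrite -mulrDr -[X in _ * (X + _)]invfM -exprMn [tau * _]mulrC -H.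
  by field.
rewrite /e4 /sE4 (sg3_double q1) (eq_sumC L).
have A : asum (fun m => sumC (zrow (m.+1%:R * tau))).
  have b0 : cIm tau != 0 by apply: lt0r_neq0.
  have [c c0 Hc] := zrow_bound b0.
  apply: asum_le (asum_isq (c * 2)) => m; rewrite cabs_ofR ger0_norm; last by rewrite mulr_ge0 ?mulr_ge0 // invr_ge0 exprn_ge0.
  apply: sumC_le => n.
  apply: (@le_trans _ _ (\sum_(i < n) (c * m.+1%:R ^- 2 * i.+1%:R ^- 2))).
  by apply: ler_sum => i _; case: (Hc m i).
  rewrite -mulr_sumr [c * 2 * _]mulrAC; apply: ler_wpM2l (isq_bound _ _).
  by rewrite mulr_ge0 // invr_ge0 exprn_ge0.
rewrite sumCD ?sumCZ //; [|exact: asumZ|by apply: asumZ; apply: asumZ|by apply: asumZ].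
rewrite Z2 -/(latt tau) mulrDr addrA; congr (1 + _ + _); last by field.
rewrite mulrCA [tau ^- 4 * _]mulrC !mulrA -[RHS]mul1r; congr (_ * _).
by field.
Qed.

(** Inversion exchanges rows and columns; [zrow_bound] justifies the exchange of summations. *)
Lemma latt_inv tau : upper tau -> latt (- tau^-1) = tau ^+ 4 * latt tau.
Proof.
move=> t0; have b0 : cIm tau != 0 by apply: lt0r_neq0.
have tn0 : tau != 0 by apply: contra_neq b0 => ->.
have [c c0 Hc] := zrow_bound b0.
have E m n : zrow (m.+1%:R * - tau^-1) n = tau ^+ 4 * zrow (n.+1%:R * tau) m.
  have [n1 n2 _] := Hc n m; rewrite /zrow addrC mulrDr; congr (_ + _).
    have -> : m.+1%:R * - tau^-1 - n.+1%:R = - ((n.+1%:R * tau + m.+1%:R) / tau) by field.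
    by rewrite -[4%N]/(2 * 2)%N exprM sqrrN -exprM expr_div_n invf_div.
  have -> : m.+1%:R * - tau^-1 + n.+1%:R = (n.+1%:R * tau - m.+1%:R) / tau by field.
  by rewrite expr_div_n invf_div.
have S (m : nat) : sumC (zrow (m.+1%:R * - tau^-1)) = sumC (fun n => tau ^+ 4 * zrow (n.+1%:R * tau) m) by apply: eq_sumC => n; exact: E.
rewrite /latt (eq_sumC S) -sumCZ.
  rewrite (@sumC_fubini _ (fun m n => tau ^+ 4 * zrow (n.+1%:R * tau) m) (fun m => m.+1%:R ^- 2) (fun n => cabs tau ^+ 4 * c * n.+1%:R ^- 2)).
  - apply: eq_sumC => n; rewrite -sumCZ //; apply: zrow_asum.
    by apply: lt0r_neq0; exact: upper_natM.
  - move=> m n; have [_ _ H] := Hc n m; rewrite cabsM cabsX.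
    have -> : m.+1%:R ^- 2 * (cabs tau ^+ 4 * c * n.+1%:R ^- 2) = cabs tau ^+ 4 * (c * n.+1%:R ^- 2 * m.+1%:R ^- 2) by ring.
    by apply: ler_wpM2l => //; rewrite exprn_ge0 ?cabs_ge0.
  - by move=> m; rewrite invr_ge0 exprn_ge0.
  - by move=> n; rewrite mulr_ge0 ?invr_ge0 ?exprn_ge0 // mulr_ge0 // exprn_ge0 ?cabs_ge0.
  - by apply: eq_asum (asum_isq 1) => n; rewrite mul1r.
  - exact: asum_isq.
apply: asum_le (asum_isq (c * 2)) => m; rewrite cabs_ofR ger0_norm; last by rewrite mulr_ge0 ?mulr_ge0 // invr_ge0 exprn_ge0.
apply: sumC_le => n.
apply: (@le_trans _ _ (\sum_(i < n) (c * m.+1%:R ^- 2 * i.+1%:R ^- 2))).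
  by apply: ler_sum => i _; case: (Hc m i).
rewrite -mulr_sumr [c * 2 * _]mulrAC; apply: ler_wpM2l (isq_bound _ _).
by rewrite mulr_ge0 // invr_ge0 exprn_ge0.
Qed.

Lemma upper_inv tau : upper tau -> upper (- tau^-1).
Proof.
rewrite /upper_half_plane; case: tau => x y; rewrite /cIm /= => y0.
by rewrite opprK divr_gt0 // ltr_wpDl ?sqr_ge0 // exprn_gt0.
Qed.

Lemma upper_neq0 tau : upper tau -> tau != 0.
Proof. by move=> t0; apply: contraTneq t0 => ->; rewrite /upper_half_plane ltxx. Qed.

Lemma e4_inv tau : upper tau -> e4 (- tau^-1) = tau ^+ 4 * e4 tau.
Proof.
move=> t0; have tn0 := upper_neq0 t0.
rewrite !e4_lattice ?latt_inv //; last exact: upper_inv.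
have -> : (- tau^-1) ^- 4 = tau ^+ 4 by rewrite -[4%N]/(2 * 2)%N exprM sqrrN -exprM exprVn invrK.
have pn := piC_neq0 R; by field; rewrite pn tn0.
Qed.

Lemma e4_int tau (n : int) : e4 (tau + n%:~R) = e4 tau.
Proof. by rewrite /e4 e2piD e2pi_int mulr1. Qed.

Definition mob a b c d tau : C := (a%:~R * tau + b%:~R) / (c%:~R * tau + d%:~R).

Lemma cocycle_neq0 c d tau : upper tau -> (c != 0) || (d != 0) -> c%:~R * tau + d%:~R != 0.
Proof.
move=> t0 cd; apply/eqP => E.
have I : c%:~R * cIm tau = 0.
  have : cIm (c%:~R * tau + d%:~R : C) = 0 by rewrite E.
  by rewrite cImD cImM cRe_int !cIm_int mul0r !addr0.
have c0 : c = 0.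
  by move/eqP: I; rewrite mulf_eq0 (gt_eqF t0) orbF intr_eq0 => /eqP.
by move: cd; rewrite c0 eqxx /=; apply/negP; move/eqP: E; rewrite c0 mul0r add0r intr_eq0 negbK.
Qed.

Lemma det_neq0 a b c d : a * d - b * c = 1 -> (c != 0) || (d != 0).
Proof. by move=> H; rewrite -negb_and; apply/negP => /andP[/eqP c0 /eqP d0]; move: H; rewrite c0 d0 !mulr0 subr0. Qed.

Lemma cIm_mob a b c d tau : upper tau -> a * d - b * c = 1 ->
  cIm (mob a b c d tau) = cIm tau / cabs (c%:~R * tau + d%:~R) ^+ 2.
Proof.
move=> t0 D; have := cocycle_neq0 t0 (det_neq0 D); rewrite /mob.
have D' : a%:~R * d%:~R - b%:~R * c%:~R = 1 :> R by rewrite -!intrM -intrB D.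
move=> n0; have := n0; rewrite -cabs_gt0 => np.
rewrite /cabs normc_def /= sqr_sqrtr ?addr_ge0 ?sqr_ge0 //.
move: np; rewrite /cabs normc_def /= sqrtr_gt0 => np.
set w := c%:~R * tau + d%:~R in n0 np *.
have wR : complex.Re w = c%:~R * cRe tau + d%:~R.
  by rewrite -/(cRe w) /w cReD cReM !cRe_int cIm_int mul0r subr0.
have wI : complex.Im w = c%:~R * cIm tau.
  by rewrite -/(cIm w) /w cImD cImM !cIm_int cRe_int mul0r !addr0.
have vR : cRe (a%:~R * tau + b%:~R : C) = a%:~R * cRe tau + b%:~R.
  by rewrite cReD cReM !cRe_int cIm_int mul0r subr0.
have vI : cIm (a%:~R * tau + b%:~R : C) = a%:~R * cIm tau.
  by rewrite cImD cImM !cIm_int cRe_int mul0r !addr0.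
rewrite cImM vR vI.
have -> : cRe w^-1 = complex.Re w / (complex.Re w ^+ 2 + complex.Im w ^+ 2) by case: (w).
have -> : cIm w^-1 = - (complex.Im w / (complex.Re w ^+ 2 + complex.Im w ^+ 2)) by case: (w).
set N := _ ^+ 2 + _ in np *.
have -> : cIm tau / N = cIm tau * (a%:~R * d%:~R - b%:~R * c%:~R) / N by rewrite D' mulr1.
rewrite wR wI; ring.
Qed.

Lemma upper_mob a b c d tau : upper tau -> a * d - b * c = 1 -> upper (mob a b c d tau).
Proof.
move=> t0 D; rewrite /upper_half_plane cIm_mob // divr_gt0 // exprn_gt0 // cabs_gt0.
exact: cocycle_neq0 t0 (det_neq0 D).
Qed.

(* Euclid's algorithm on the bottom row. *)
Lemma e4_mob a b c d tau : upper tau -> a * d - b * c = 1 ->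
  e4 (mob a b c d tau) = (c%:~R * tau + d%:~R) ^+ 4 * e4 tau.
Proof.
move: {2}`|c|.+1%N (ltnSn `|c|%N) => n; elim: n a b c d tau => // n IH a b c d tau cn t0 D.
have [c0|c0] := eqVneq c 0.
  have ad : a * d = 1 by rewrite -D c0 mulr0 subr0.
  have [[a1 d1]|[a1 d1]] : (a = 1 /\ d = 1) \/ (a = -1 /\ d = -1).
    have /eqP : absz (a * d) = 1%N by rewrite ad.
    by rewrite abszM muln_eq1 => /andP[/eqP a1 /eqP d1]; nia.
    rewrite /mob a1 c0 d1 !mul0r !add0r mul1r divr1 expr1n mul1r; exact: e4_int.
  rewrite /mob a1 c0 d1 !mul0r !add0r intrN mulN1r.
  have -> : (- tau + b%:~R) / - 1%:~R = tau + (- b)%:~R :> C by rewrite intrN; field.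
  by rewrite e4_int -[4%N]/(2 * 2)%N exprM sqrrN !expr1n mul1r.
(* After tau -> tau + k and tau -> -1/tau the bottom row becomes (-d', c), with |d'| < |c|. *)
pose k := (d %/ c)%Z; pose d' := (d %% c)%Z.
have dE : d = k * c + d' := divz_eq d c.
have d'0 : 0 <= d' by exact: modz_ge0.
have d'c : d' < `|c|%N by exact: ltz_mod.
pose b' := b - k * a.
pose t := tau + k%:~R.
have tu : upper t by rewrite /t /upper_half_plane cImD cIm_int addr0.
have D' : a * d' - b' * c = 1 by rewrite -D dE /b'; ring.
have tn0 := upper_neq0 tu.
have := IH (- b') a (- d') c (- t^-1) _ (upper_inv tu) _.
rewrite (e4_inv tu) => H.
have W : c%:~R * tau + d%:~R = c%:~R * t + d'%:~R :> C by rewrite /t dE intrD intrM; ring.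
have W' : a%:~R * tau + b%:~R = a%:~R * t + b'%:~R :> C by rewrite /t /b' intrB intrM; ring.
have W0 : c%:~R * t + d'%:~R != 0 :> C by apply: cocycle_neq0 tu (det_neq0 D').
have -> : mob a b c d tau = mob (- b') a (- d') c (- t^-1).
  rewrite /mob W W' !intrN; field; rewrite tn0 /=.
  by rewrite mulrN1 opprK addrC.
rewrite H.
- rewrite W mulrA -exprMn -(e4_int tau k) -/t intrN; congr (_ ^+ _ * _); by field.
- by move: cn d'c d'0; rewrite abszN; lia.
- by rewrite -D'; ring.
Qed.
End Modularity.

(** * The forms E, 4 G^2 - E_4 and G on Gamma_0(2) *)

Section Eisenstein.
Variable R : realType.
Local Notation C := (Cfield R).
Implicit Types (z w tau q : C) (a b c d j : int).
Local Notation upper := (@upper_half_plane R).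
Local Notation disc := (@disc R).
Local Notation sg := (@sg R).
Local Notation e4 := (@e4 R).
Local Notation mob := (@mob R).

(** The hypothesis leaves out z = 0, which e^(2 pi i tau) never reaches; u 0 is -z times a bounded
    series, and z is arbitrarily small. *)
Lemma ps_zero0 (r : R) (u : nat -> C) : 0 < r -> PS r u ->
  (forall z, z != 0 -> cabs z < r -> ps u z = 0) -> u 0%N = 0.
Proof.
move=> r0 Hu H; apply/eqP; rewrite -cabs_eq0 eq_le cabs_ge0 andbT.
have r2 : 0 < r / 2 < r by apply/andP; split; lra.
have [K K0 HK] := ps_bound (PS_shift Hu) r2.
apply/ler_addgt0Pr => e e0; rewrite add0r.
pose t := Num.min (r / 2) (e / (K + 1)).
have t0 : 0 < t by rewrite lt_min !divr_gt0 //; lra.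
have ct : cabs (ofR t : C) = t by rewrite cabs_ofR gtr0_norm.
have t2 : t <= r / 2 by rewrite ge_min lexx.
have te : t * (K + 1) <= e by rewrite -ler_pdivlMr ?ge_min ?lexx ?orbT //; lra.
have tr : cabs (ofR t : C) < r by rewrite ct; lra.
have tn : (ofR t : C) != 0 by rewrite -cabs_gt0 ct.
have := H _ tn tr; rewrite (ps_recl Hu tr) => /eqP; rewrite addr_eq0 => /eqP ->.
rewrite cabsN cabsM ct.
have := HK (ofR t) (ltac:(by rewrite ct)) => A.
apply: le_trans (_ : t * K <= _); first by apply: ler_wpM2l => //; exact: ltW.
lra.
Qed.

Lemma ps_zero (r : R) (u : nat -> C) : 0 < r -> PS r u ->
  (forall z, z != 0 -> cabs z < r -> ps u z = 0) -> forall n, u n = 0.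
Proof.
move=> r0 Hu H n; elim: n u Hu H => [|n IH] u Hu H; first exact: (ps_zero0 r0 Hu H).
apply: (IH (fun n => u n.+1)); first exact: PS_shift.
move=> z z0 zr; have := H z z0 zr; rewrite (ps_recl Hu zr) (ps_zero0 r0 Hu H) add0r.
by move/eqP; rewrite mulf_eq0 (negbTE z0) => /eqP.
Qed.

Lemma ps_ext (r : R) (u v : nat -> C) : 0 < r -> PS r u -> PS r v ->
  (forall z, z != 0 -> cabs z < r -> ps u z = ps v z) -> u =1 v.
Proof.
move=> r0 Hu Hv H n; apply/eqP; rewrite -subr_eq0; apply/eqP.
apply: (ps_zero r0 (PSB Hu Hv)) => z z0 zr.
by rewrite (psB Hu Hv zr) H ?subrr.
Qed.

Lemma ps_single (m : nat) (x : C) z : ps (fun n => if n == m then x else 0) z = x * z ^+ m.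
Proof.
rewrite /ps (@sumC_fin _ _ m.+1); last by move=> n mn; rewrite gtn_eqF // mul0r.
rewrite big_ord_recr /= eqxx big1 ?add0r // => i _.
by rewrite ltn_eqF ?mul0r.
Qed.

(** Multiplying by the inverse of the exponential solution gives y with q y' = m y, so only its
    coefficient of q^m survives; that coefficient is the constant in front. *)
Lemma frobenius_solution (u chi : nat -> C) (m : nat) : PS 1 u -> PS 1 chi ->
  (forall q, disc q -> isQD (ps u) q ((m%:R + q * ps chi q) * ps u q)) ->
  forall q, disc q -> ps u q = conv u (expsol (fun n => -1 * chi n)) m * q ^+ m * ps (expsol chi) q.
Proof.
move=> Hu Hc Hode; set chi' := fun n => -1 * chi n.
have Hc' : PS 1 chi' by apply: PSZ.
have He := expsol_PS Hc'; pose y := conv u (expsol chi'); have Hy : PS 1 y := PS_conv Hu He.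
have yE q : disc q -> ps y q = ps u q * ps (expsol chi') q by move=> q1; exact: (ps_conv Hu He q1).
have ny : nps y =1 (fun n => m%:R * y n).
  apply: (ps_ext ltr01 (PS_nps Hy) (PSZ _ Hy)) => q _ q1; rewrite (psZ _ Hy q1).
  apply: (isQD_uniq (isQD_ps Hy q1)).
  apply: (isQD_ext (f := fun x => ps u x * ps (expsol chi') x)) => //; first by move=> x x1; rewrite yE.
  have H : isQD (ps (expsol chi')) q (q * (ps chi' q * ps (expsol chi') q)).
    by exists (ps chi' q * ps (expsol chi') q) => //; exact: expsol_cder.
  apply: isQD_eq (isQD_M (Hode q q1) H) _; rewrite yE // /chi' (psZ _ Hc q1); ring.
have yn n : n != m -> y n = 0.
  move=> nm; have /eqP := ny n; rewrite /nps -subr_eq0 -mulrBl mulf_eq0 => /orP[|/eqP //].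
  by rewrite subr_eq0 eqr_nat (negbTE nm).
move=> q q1.
have -> : conv u (expsol chi') m * q ^+ m = ps y q.
  rewrite -ps_single; apply: eq_sumC => n; rewrite -/y.
  by case: eqP => [-> //|/eqP /yn ->].
by rewrite yE // -mulrA [ps (expsol chi') q * _]mulrC expsol_inv // mulr1.
Qed.

(** This is (J - 1) E. It is nonzero at infinity, and [ee0_odd] shows that it vanishes at the cusp
    0. *)
Definition se0 q : C := 4%:R * sG q ^+ 2 - sE4 q.

(** With [se0E], this reduces the transformation laws of E and 4 G^2 - E_4 to that of E_4. *)
Lemma sEE q : disc q -> sE q = 4%:R / 5%:R * (sE4 q - sE4 (q ^+ 2)).
Proof.
move=> q1; have H := G2_E4 q1; rewrite /sE.
have -> : sG q ^+ 2 = (sE4 q + 4%:R * sE4 (q ^+ 2)) / 5%:R by rewrite -H; field.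
by move: (sE4 q) (sE4 _) => x y; field.
Qed.

Lemma se0E q : disc q -> se0 q = (16%:R * sE4 (q ^+ 2) - sE4 q) / 5%:R.
Proof.
move=> q1; have H := G2_E4 q1; rewrite /se0.
have -> : sG q ^+ 2 = (sE4 q + 4%:R * sE4 (q ^+ 2)) / 5%:R by rewrite -H; field.
by move: (sE4 q) (sE4 _) => x y; field.
Qed.

Lemma isQD_se0 q : disc q -> isQD se0 q ((sE2 q - sG q) / 3%:R * se0 q).
Proof.
move=> q1; have TG := isQD_G q1; have TE := isQD_E q1.
apply: (isQD_ext (f := fun x => 3%:R * (sG x * sG x) - sE x)) => //.
  by move=> x x1; rewrite /se0 /sE; ring.
apply: isQD_eq (isQD_B (isQD_Z 3%:R (isQD_M TG TG)) TE) _.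
by rewrite /se0 /sE; field.
Qed.

(* [q chiE] and [q chie0] are the logarithmic derivatives of [sE / q] and
   [se0], so the exponentials of their integrals are the eta quotients
   [sE / (192 q)] and [se0 / 3]. *)
Definition chiE n : C := 8%:R * sg 1 n.+1 - 32%:R * dil 2 (sg 1) n.+1.
Definition chie0 n : C := -16%:R * sg 1 n.+1 + 16%:R * dil 2 (sg 1) n.+1.
Definition coeE n : C := 192%:R * (sg 3 n - dil 2 (sg 3) n).
Definition coee0 n : C := (if n == 0%N then 3%:R else 0) + 48%:R * (16%:R * dil 2 (sg 3) n - sg 3 n).

Let P (l : nat) : PS 1 (sg l) := @PS_sg R l.
Let Pd (l : nat) : PS 1 (dil 2 (sg l)) := PS_dil (d := 2) (ltn0Sn 1) (P l).

Lemma PS_chiE : PS 1 chiE.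
Proof. exact: PSB (PSZ _ (PS_shift (P 1))) (PSZ _ (PS_shift (Pd 1))). Qed.
Lemma PS_chie0 : PS 1 chie0.
Proof. exact: PSD (PSZ _ (PS_shift (P 1))) (PSZ _ (PS_shift (Pd 1))). Qed.
Lemma PS_coeE : PS 1 coeE.
Proof. exact: PSZ _ (PSB (P 3) (Pd 3)). Qed.
Lemma PS_coee0 : PS 1 coee0.
Proof. exact: PSD (@PS_const _ _ _) (PSZ _ (PSB (PSZ _ (Pd 3)) (P 3))). Qed.

Lemma dil0 l : dil 2 (sg l) 0 = 0. Proof. by rewrite /dil dvdn0 div0n. Qed.

Lemma q_chi (u : nat -> C) q : PS 1 u -> u 0%N = 0 -> disc q -> q * ps (fun n => u n.+1) q = ps u q.
Proof. by move=> Hu u0 q1; rewrite (ps_recl Hu q1) u0 add0r. Qed.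

Lemma q_chiE q : disc q -> q * ps chiE q = 8%:R * ps (sg 1) q - 32%:R * ps (sg 1) (q ^+ 2).
Proof.
move=> q1; rewrite (q_chi (u := fun n => 8%:R * sg 1 n - 32%:R * dil 2 (sg 1) n)) //.
- rewrite (psB (PSZ _ (P 1)) (PSZ _ (Pd 1)) q1) (psZ _ (P 1) q1) (psZ _ (Pd 1) q1) ps_dil //.
- exact: PSB (PSZ _ (P 1)) (PSZ _ (Pd 1)).
- by rewrite dil0 sg0 !mulr0 subr0.
Qed.

Lemma q_chie0 q : disc q -> q * ps chie0 q = -16%:R * ps (sg 1) q + 16%:R * ps (sg 1) (q ^+ 2).
Proof.
move=> q1; rewrite (q_chi (u := fun n => -16%:R * sg 1 n + 16%:R * dil 2 (sg 1) n)) //.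
- rewrite (psD (PSZ _ (P 1)) (PSZ _ (Pd 1)) q1) (psZ _ (P 1) q1) (psZ _ (Pd 1) q1) ps_dil //.
- exact: PSD (PSZ _ (P 1)) (PSZ _ (Pd 1)).
- by rewrite dil0 sg0 !mulr0 addr0.
Qed.

Lemma sE_coe q : disc q -> sE q = ps coeE q.
Proof.
move=> q1; rewrite sEE // /sE4 /coeE (psZ _ (PSB (P 3) (Pd 3)) q1) (psB (P 3) (Pd 3) q1) ps_dil //.
by move: (ps _ q) (ps _ (q ^+ 2)) => x y; field.
Qed.

Lemma se0_coe q : disc q -> se0 q = ps coee0 q.
Proof.
move=> q1; rewrite se0E // /sE4 (psD (@PS_const _ _ _) (PSZ _ (PSB (PSZ _ (Pd 3)) (P 3))) q1).
rewrite (psZ _ (PSB (PSZ _ (Pd 3)) (P 3)) q1) (psB (PSZ _ (Pd 3)) (P 3) q1) (psZ _ (Pd 3) q1) ps_dil // ps_const.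
by move: (ps _ q) (ps _ (q ^+ 2)) => x y; field.
Qed.

Lemma sE_prod q : disc q -> sE q = 192%:R * q * ps (expsol chiE) q.
Proof.
move=> q1; rewrite sE_coe //.
rewrite (frobenius_solution (chi := chiE) (m := 1) PS_coeE PS_chiE) //.
  congr (_ * _ * _); rewrite /conv !big_ord_recr big_ord0 /= /coeE dil0 sg0 subrr mulr0 mul0r !add0r.
  by rewrite expsol0 mulr1 /dil /= subr0 /sg /divisor_sigma big_seq1 exp1n mulr1.
move=> x x1; apply: (isQD_ext (f := @sE R)) => //; first exact: sE_coe.
apply: isQD_eq (isQD_E x1) _; rewrite -sE_coe // q_chiE // /sG /sE2; congr (_ * _); by move: (ps _ x) (ps _ (x ^+ 2)) => y z; field.
Qed.

Lemma se0_prod q : disc q -> se0 q = 3%:R * ps (expsol chie0) q.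
Proof.
move=> q1; rewrite se0_coe //.
rewrite (frobenius_solution (chi := chie0) (m := 0) PS_coee0 PS_chie0) //.
  rewrite expr0 mulr1; congr (_ * _); rewrite /conv big_ord1 /= /coee0 dil0 sg0 mulr0 subrr mulr0 addr0.
  by rewrite expsol0 mulr1.
move=> x x1; apply: (isQD_ext (f := se0)) => //; first exact: se0_coe.
apply: isQD_eq (isQD_se0 x1) _; rewrite -se0_coe // q_chie0 // /sG /sE2; congr (_ * _); by move: (ps _ x) (ps _ (x ^+ 2)) => y z; field.
Qed.

Lemma se0_neq0 q : disc q -> se0 q != 0.
Proof. by move=> q1; rewrite se0_prod // mulf_neq0 ?pnatr_eq0 // expsol_neq0 //; exact: PS_chie0. Qed.
Lemma sE_neq0 q : disc q -> q != 0 -> sE q != 0.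
Proof.
move=> q1 q0; rewrite (sE_prod q1); apply: mulf_neq0; last exact: expsol_neq0 PS_chiE q1.
by apply: mulf_neq0 q0; rewrite pnatr_eq0.
Qed.

Definition eE tau : C := sE (e2pi tau).
Definition ee0 tau : C := se0 (e2pi tau).
Definition eG tau : C := sG (e2pi tau).
Definition eA tau : C := sE2 (e2pi tau).

Lemma eE_neq0 tau : upper tau -> eE tau != 0.
Proof. by move=> t0; apply: sE_neq0; [exact: e2pi_disc | exact: e2pi_neq0]. Qed.
Lemma ee0_neq0 tau : upper tau -> ee0 tau != 0.
Proof. by move=> t0; apply: se0_neq0; exact: e2pi_disc. Qed.

Lemma e2pi_2 tau : e2pi tau ^+ 2 = e2pi (2%:R * tau).
Proof. by rewrite e2piMn. Qed.

Lemma eE_e4 tau : upper tau -> eE tau = 4%:R / 5%:R * (e4 tau - e4 (2%:R * tau)).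
Proof. by move=> t0; rewrite /eE sEE ?e2pi_2 //; exact: e2pi_disc. Qed.
Lemma ee0_e4 tau : upper tau -> ee0 tau = (16%:R * e4 (2%:R * tau) - e4 tau) / 5%:R.
Proof. by move=> t0; rewrite /ee0 se0E ?e2pi_2 //; exact: e2pi_disc. Qed.

Lemma upper_half tau j : upper tau -> upper ((tau + j%:~R) / 2%:R).
Proof.
rewrite /upper_half_plane => t0.
have -> : (2%:R : C)^-1 = ofR 2^-1 by rewrite ofRE fmorphV rmorph_nat.
by rewrite cImM cIm_ofR mulr0 add0r cImD cIm_int addr0 cRe_ofR mulr_gt0 // invr_gt0.
Qed.

Section Transform.
Variables (a b c d : int) (tau : C).
Hypotheses (t0 : upper tau) (D : a * d - b * c = 1).
Local Notation X := (c%:~R * tau + d%:~R).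

(** Conjugation by diag(2, 1) keeps the matrix integral because c is even. *)
Lemma e4_dbl_even c' : c = 2 * c' -> e4 (2%:R * mob a b c d tau) = X ^+ 4 * e4 (2%:R * tau).
Proof.
move=> cE; have n0 := cocycle_neq0 t0 (det_neq0 D).
have D' : a * d - (2 * b) * c' = 1.
  have H : a * d - (2 * b) * c' = a * d - b * (2 * c') by ring.
  by rewrite H -cE.
have -> : 2%:R * mob a b c d tau = mob a (2 * b) c' d (2%:R * tau).
  rewrite /mob mulrA; congr (_ / _); first by rewrite intrM; ring.
  by rewrite cE intrM; ring.
rewrite e4_mob //; last by rewrite -[2%:R]/(1.+1%:R); exact: upper_natM.
by congr (_ ^+ _ * _); rewrite cE intrM; ring.
Qed.

(** When d - j c is even, diag(2, 1) times the matrix factors as an element of SL_2(Z) times the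
    upper triangular matrix with rows (1, j) and (0, 2). *)
Lemma e4_dbl_odd j e : d - j * c = 2 * e ->
  e4 (2%:R * mob a b c d tau) = (X / 2%:R) ^+ 4 * e4 ((tau + j%:~R) / 2%:R).
Proof.
move=> dE; have n0 := cocycle_neq0 t0 (det_neq0 D).
have D' : (2 * a) * e - (b - j * a) * c = 1.
  have -> : 2 * a * e = a * (2 * e) by ring.
  rewrite -dE -[RHS]D; ring.
have dE' : d%:~R = 2%:R * e%:~R + j%:~R * c%:~R :> C by rewrite -(intrM _ 2) -dE intrB intrM; ring.
have W : c%:~R * ((tau + j%:~R) / 2%:R) + e%:~R = X / 2%:R by rewrite dE'; field.
have -> : 2%:R * mob a b c d tau = mob (2 * a) (b - j * a) c e ((tau + j%:~R) / 2%:R).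
  rewrite /mob W intrB !intrM.
  have -> : 2%:~R * a%:~R * ((tau + j%:~R) / 2%:R) + (b%:~R - j%:~R * a%:~R) = a%:~R * tau + b%:~R :> C by field.
  by field.
by rewrite e4_mob //; [rewrite W | exact: upper_half].
Qed.

Lemma eE_even c' : c = 2 * c' -> eE (mob a b c d tau) = X ^+ 4 * eE tau.
Proof.
move=> cE; rewrite !eE_e4 //; last exact: upper_mob.
by rewrite e4_mob // (e4_dbl_even cE); move: (e4 tau) (e4 _) => x y; ring.
Qed.
Lemma ee0_even c' : c = 2 * c' -> ee0 (mob a b c d tau) = X ^+ 4 * ee0 tau.
Proof.
move=> cE; rewrite !ee0_e4 //; last exact: upper_mob.
by rewrite e4_mob // (e4_dbl_even cE); move: (e4 tau) (e4 _) => x y; ring.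
Qed.

Lemma e4_2half j : e4 (2%:R * ((tau + j%:~R) / 2%:R)) = e4 tau.
Proof.
have -> : 2%:R * ((tau + j%:~R) / 2%:R) = tau + j%:~R by field.
exact: e4_int. Qed.

(** At the cusps with c odd E turns into the zero-free [ee0], whose q-series has a nonzero constant
    term, so division by E is harmless there. *)
Lemma eE_odd j e : d - j * c = 2 * e -> eE (mob a b c d tau) = X ^+ 4 * (ee0 ((tau + j%:~R) / 2%:R) / 4%:R).
Proof.
move=> dE; rewrite eE_e4 ?ee0_e4; [|exact: upper_half|exact: upper_mob].
by rewrite e4_mob // (e4_dbl_odd dE) e4_2half; move: (e4 tau) (e4 _) => x y; field.
Qed.
Lemma ee0_odd j e : d - j * c = 2 * e -> ee0 (mob a b c d tau) = X ^+ 4 * (eE ((tau + j%:~R) / 2%:R) / 4%:R).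
Proof.
move=> dE; rewrite eE_e4 ?ee0_e4; [|exact: upper_mob|exact: upper_half].
by rewrite e4_mob // (e4_dbl_odd dE) e4_2half; move: (e4 tau) (e4 _) => x y; field.
Qed.
End Transform.

(* [isD f tau l]: l is the value at tau of (2 pi i)^-1 df/dtau. *)
Definition isD (f : C -> C) tau l := cder f tau (tpi R * l).

Lemma isD_eq f tau l m : isD f tau l -> l = m -> isD f tau m. Proof. by move=> H <-. Qed.
Lemma isD_cst x tau : isD (fun=> x) tau 0.
Proof. by rewrite /isD mulr0; exact: cder_cst. Qed.
Lemma isD_D f g tau l m : isD f tau l -> isD g tau m -> isD (fun x => f x + g x) tau (l + m).
Proof. by rewrite /isD mulrDr; exact: cderD. Qed.
Lemma isD_B f g tau l m : isD f tau l -> isD g tau m -> isD (fun x => f x - g x) tau (l - m).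
Proof. by rewrite /isD mulrBr; exact: cderB. Qed.
Lemma isD_M f g tau l m : isD f tau l -> isD g tau m -> isD (fun x => f x * g x) tau (l * g tau + f tau * m).
Proof. by move=> H1 H2; apply: cder_eq (cderM H1 H2) _; ring. Qed.
Lemma isD_Z x f tau l : isD f tau l -> isD (fun y => x * f y) tau (x * l).
Proof. by move=> H; apply: cder_eq (cderZ x H) _; ring. Qed.
Lemma isD_V f tau l : f tau != 0 -> isD f tau l -> isD (fun x => (f x)^-1) tau (- (l / f tau ^+ 2)).
Proof. by move=> f0 H; apply: cder_eq (cderV f0 H) _; field. Qed.
Lemma isD_uniq f tau l m : isD f tau l -> isD f tau m -> l = m.
Proof. by move=> H1 H2; apply: (mulfI (tpi_neq0 R)); exact: cder_uniq H1 H2. Qed.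
Lemma upper_open tau : upper tau -> exists2 e : R, 0 < e & forall h, cabs h < e -> upper (tau + h).
Proof.
move=> t0; exists (cIm tau) => // h hs; rewrite /upper_half_plane cImD.
by have := cIm_le h; have := ler_norm (- cIm h); rewrite normrN; move: t0; rewrite /upper_half_plane; lra.
Qed.
Lemma isD_ext f g tau l : upper tau -> (forall x, upper x -> f x = g x) -> isD f tau l -> isD g tau l.
Proof.
move=> t0 fg; have [e e0 He] := upper_open t0.
by apply: (cder_local e0) => h hs; apply: fg; exact: He.
Qed.
Lemma isD_q f tau l : isQD f (e2pi tau) l -> isD (fun x => f (e2pi x)) tau l.
Proof.
move=> [m Hm <-]; apply: cder_eq (cder_comp (e2pi_cder tau) Hm) _; ring.
Qed.

Lemma isD_eE tau : upper tau -> isD eE tau ((2%:R * eG tau + eA tau) / 3%:R * eE tau).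
Proof. by move=> t0; apply: (@isD_q (@sE R)); apply: isQD_E; exact: e2pi_disc. Qed.
Lemma isD_ee0 tau : upper tau -> isD ee0 tau ((eA tau - eG tau) / 3%:R * ee0 tau).
Proof. by move=> t0; apply: (@isD_q se0); apply: isQD_se0; exact: e2pi_disc. Qed.

(** This is 1 / (J - 1), with logarithmic derivative G. It is invariant for c even and inverted for
    c odd; differentiating these two laws gives those of G. *)
Definition quo tau : C := eE tau / ee0 tau.
Lemma isD_quo tau : upper tau -> isD quo tau (eG tau * quo tau).
Proof.
move=> t0; have n0 := ee0_neq0 t0.
by apply: isD_eq (isD_M (isD_eE t0) (isD_V n0 (isD_ee0 t0))) _; rewrite /quo; field.
Qed.
Lemma quo_neq0 tau : upper tau -> quo tau != 0.
Proof. by move=> t0; rewrite mulf_neq0 ?invr_eq0 ?eE_neq0 ?ee0_neq0. Qed.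

Lemma mob_cder a b c d tau : upper tau -> a * d - b * c = 1 ->
  cder (mob a b c d) tau ((c%:~R * tau + d%:~R) ^- 2).
Proof.
move=> t0 D; have n0 := cocycle_neq0 t0 (det_neq0 D).
have L (x y : C) : cder (fun t => x * t + y) tau (x * 1 + 0) := cderD (cderZ x (cder_id tau)) (cder_cst y tau).
have V := @cderV R (fun t => c%:~R * t + d%:~R) _ _ n0 (L c%:~R d%:~R).
apply: cder_eq (cderM (L a%:~R b%:~R) V) _.
have D' : a%:~R * d%:~R - b%:~R * c%:~R = 1 :> C by rewrite -!intrM -intrB D.
rewrite -[RHS]mul1r -[X in _ = X * _]D'.
by field.
Qed.

Lemma isD_mob f a b c d tau l : upper tau -> a * d - b * c = 1 -> isD f (mob a b c d tau) l ->
  isD (fun x => f (mob a b c d x)) tau (l * (c%:~R * tau + d%:~R) ^- 2).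
Proof.
by move=> t0 D H; apply: cder_eq (cder_comp (mob_cder t0 D) H) _; rewrite mulrA.
Qed.

Lemma isD_half f j tau l : isD f ((tau + j%:~R) / 2%:R) l ->
  isD (fun x => f ((x + j%:~R) / 2%:R)) tau (l / 2%:R).
Proof.
move=> H; have L : cder (fun x => (x + j%:~R) / 2%:R) tau (2%:R^-1).
  apply: cder_eq (cderM (cderD (cder_id tau) (cder_cst j%:~R tau)) (cder_cst (2%:R^-1) tau)) _.
  by rewrite addr0 mul1r mulr0 addr0.
by apply: cder_eq (cder_comp L H) _; rewrite mulrA.
Qed.

Lemma eG_even a b c d c' tau : upper tau -> a * d - b * c = 1 -> c = 2 * c' ->
  eG (mob a b c d tau) = (c%:~R * tau + d%:~R) ^+ 2 * eG tau.
Proof.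
move=> t0 D cE; have n0 := cocycle_neq0 t0 (det_neq0 D).
have E x : upper x -> quo (mob a b c d x) = quo x.
  move=> x0; rewrite /quo (eE_even x0 D cE) (ee0_even x0 D cE).
  have := cocycle_neq0 x0 (det_neq0 D); have := ee0_neq0 x0.
  by set X := _ + _ => *; field; apply/andP; split.
have H1 := isD_ext t0 E (isD_mob t0 D (isD_quo (upper_mob t0 D))).
have := isD_uniq H1 (isD_quo t0); rewrite E // mulrAC => H.
have := mulIf (quo_neq0 t0) H => <-; by field.
Qed.

Lemma eG_odd a b c d j e tau : upper tau -> a * d - b * c = 1 -> d - j * c = 2 * e ->
  eG (mob a b c d tau) = - (2%:R^-1) * (c%:~R * tau + d%:~R) ^+ 2 * eG ((tau + j%:~R) / 2%:R).
Proof.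
move=> t0 D dE; have n0 := cocycle_neq0 t0 (det_neq0 D).
have h0 := upper_half j t0.
have E x : upper x -> quo (mob a b c d x) = (quo ((x + j%:~R) / 2%:R))^-1.
  move=> x0; rewrite /quo (eE_odd x0 D dE) (ee0_odd x0 D dE).
  have x1 := upper_half j x0; have := eE_neq0 x1; have := ee0_neq0 x1.
  have := cocycle_neq0 x0 (det_neq0 D).
  by set X := _ + d%:~R => *; field; apply/and3P; split.
have H1 := isD_ext t0 E (isD_mob t0 D (isD_quo (upper_mob t0 D))).
have q0 := quo_neq0 h0.
have H2 := isD_half (isD_V q0 (isD_quo h0)).
have := isD_uniq H1 H2; rewrite E // => H.
have : eG (mob a b c d tau) = eG (mob a b c d tau) * (quo ((tau + j%:~R) / 2%:R))^-1 / (c%:~R * tau + d%:~R) ^+ 2 * (quo ((tau + j%:~R) / 2%:R) * (c%:~R * tau + d%:~R) ^+ 2).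
  by field; apply/andP; split.
by rewrite H => ->; field.
Qed.
End Eisenstein.

(** * Separation of q-series at the cusps *)

Section Separation.
Variable R : realType.
Local Notation C := (Cfield R).
Implicit Types (z w tau q lam kap nu : C) (b : nat -> C).
Local Notation upper := (@upper_half_plane R).
Local Notation disc := (@disc R).

(* [annihilated lam u]: u is killed by a product of operators (shift - k) with
   k <> lam, as are the exponential polynomials without lam^n terms. *)
Inductive annihilated lam : (nat -> C) -> Prop :=
| annihilated0 u : (forall n, u n = 0) -> annihilated lam u
| annihilatedS k u : k != lam -> annihilated lam (fun n => u n.+1 - k * u n) -> annihilated lam u.

Lemma annihilated_op lam u c : annihilated lam u -> annihilated lam (fun n => u n.+1 - c * u n).
Proof.
elim=> [v v0|k v kl _ IH].
  by apply: annihilated0 => n; rewrite !v0 mulr0 subrr.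
apply: (annihilatedS kl).
suff -> : (fun n => v n.+2 - c * v n.+1 - k * (v n.+1 - c * v n)) =
  (fun n => v n.+2 - k * v n.+1 - c * (v n.+1 - k * v n)) by [].
by apply/funext => n; ring.
Qed.

Lemma annihilatedD lam u v : annihilated lam u -> annihilated lam v -> annihilated lam (fun n => u n + v n).
Proof.
move=> Hu; elim: Hu v => [u' u0|k u' kl _ IH] v Hv.
  by suff -> : (fun n => u' n + v n) = v by []; apply/funext => n; rewrite u0 add0r.
apply: (annihilatedS kl).
suff -> : (fun n => u' n.+1 + v n.+1 - k * (u' n + v n)) =
  (fun n => u' n.+1 - k * u' n + (v n.+1 - k * v n)) by apply: IH; exact: annihilated_op.
by apply/funext => n; ring.
Qed.

Local Notation X1 := ('X + 1%:P : {poly C}).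

Lemma lead_coef_shift (p : {poly C}) : (p \Po X1)`_(size p).-1 = lead_coef p.
Proof.
have s2 : size X1 = 2%N by rewrite size_XaddC.
rewrite -{1}(size_comp_poly2 p s2) -/(lead_coef (p \Po X1)) lead_coef_comp ?s2 //.
by rewrite lead_coefXaddC expr1n mulr1.
Qed.

Lemma size_diff (p : {poly C}) : p != 0 -> (size (p \Po X1 - p)%R < size p)%N.
Proof.
move=> p0; have sp : (0 < size p)%N by rewrite size_poly_gt0.
rewrite -(prednK sp) ltnS; apply/leq_sizeP => j; rewrite leq_eqVlt coefB => /orP[/eqP <-|].
  by rewrite lead_coef_shift subrr.
rewrite prednK // => sj; rewrite !nth_default ?subrr //.
by rewrite size_comp_poly2 // size_XaddC.
Qed.

(** The operator (shift - k) lowers the degree of the polynomial factor. *)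
Lemma annihilated_exp lam k (p : {poly C}) : k != lam -> annihilated lam (fun n => k ^+ n * p.[n%:R]).
Proof.
move=> kl; move: {2}(size p).+1 (ltnSn (size p)) => m; elim: m p => // m IH p pm.
have [->|p0] := eqVneq p 0; first by apply: annihilated0 => n; rewrite horner0 mulr0.
apply: (annihilatedS kl).
suff -> : (fun n => k ^+ n.+1 * p.[n.+1%:R] - k * (k ^+ n * p.[n%:R])) =
   (fun n => k ^+ n * (k *: (p \Po X1 - p)).[n%:R]).
  apply: IH; apply: leq_ltn_trans (size_scale_leq _ _) _.
  by apply: leq_trans (size_diff p0) _; rewrite -ltnS.
apply/funext => n; rewrite hornerZ hornerD hornerN horner_comp hornerD hornerX hornerC -natr1.
by rewrite exprS; ring.
Qed.

Lemma poly_nat0 (r : {poly C}) : (forall n : nat, r.[n%:R] = 0) -> r = 0.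
Proof.
move=> H; apply/eqP; apply: contraT => r0.
have := @max_poly_roots _ r (mkseq (fun i => i%:R) (size r)) r0; rewrite size_mkseq ltnn; apply.
  by apply/allP => x /mapP [i _ ->]; rewrite /root H.
rewrite map_inj_uniq ?iota_uniq // => i j /eqP; by rewrite eqr_nat => /eqP.
Qed.

(** For k <> lam the operator (shift - k) multiplies the leading coefficient of r by lam - k, so it
    cannot kill lam^n r(n) unless r = 0. *)
Lemma annihilated_poly lam u (r : {poly C}) : lam != 0 -> annihilated lam u ->
  (forall n, u n = lam ^+ n * r.[n%:R]) -> r = 0.
Proof.
move=> l0 Hu; elim: Hu r => [v v0|k v kl _ IH] r Hr.
  apply: poly_nat0 => n; have /eqP := Hr n; rewrite v0 eq_sym mulf_eq0 expf_eq0 (negbTE l0) andbF.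
  by move/eqP.
have E : lam *: (r \Po X1) - k *: r = 0.
  apply: IH => n; rewrite !Hr hornerD hornerN !hornerZ horner_comp hornerD hornerX hornerC -natr1.
  by rewrite exprS; ring.
apply/eqP; rewrite -lead_coef_eq0.
have := congr1 (fun p : {poly C} => p`_(size r).-1) E.
rewrite coefB !coefZ lead_coef_shift coef0 -/(lead_coef r) -mulrBl => /eqP.
by rewrite mulf_eq0 subr_eq0 eq_sym (negbTE kl).
Qed.

(* The lock keeps unification from unfolding the series. *)
Definition qs nu b tau : C := locked (e2pi (nu * tau) * ps b (e2pi tau)).

Lemma qsE nu b tau : qs nu b tau = e2pi (nu * tau) * ps b (e2pi tau).
Proof. by rewrite /qs -lock. Qed.

Lemma qs_fun nu b : qs nu b = fun tau => e2pi (nu * tau) * ps b (e2pi tau).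
Proof. by apply/funext => tau; exact: qsE. Qed.

Lemma isD_qs nu b tau : PS 1 b -> upper tau -> isD (qs nu b) tau (qs nu (fun n => (nu + n%:R) * b n) tau).
Proof.
move=> Hb t0; have q1 := e2pi_disc t0.
have H1 : isD (fun x => e2pi (nu * x)) tau (nu * e2pi (nu * tau)).
  apply: cder_eq (cder_comp (cderZ nu (cder_id tau)) (e2pi_cder (nu * tau))) _; ring.
have H2 := @isD_q R (ps b) tau _ (isQD_ps Hb q1).
rewrite [qs nu b]qs_fun; apply: isD_eq (isD_M H1 H2) _; rewrite !qsE.
have -> : ps (fun n => (nu + n%:R) * b n) (e2pi tau) = nu * ps b (e2pi tau) + ps (nps b) (e2pi tau).
  rewrite -(psZ _ Hb q1) -(psD (PSZ _ Hb) (PS_nps Hb) q1).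
  by apply: eq_sumC => n; rewrite /nps mulrDl.
ring.
Qed.

Lemma PS_lin nu b : PS 1 b -> PS 1 (fun n => (nu + n%:R) * b n).
Proof.
move=> Hb; have -> : (fun n => (nu + n%:R) * b n) = (fun n => nu * b n + nps b n).
  by apply/funext => n; rewrite mulrDl.
exact: PSD (PSZ _ Hb) (PS_nps Hb).
Qed.

Lemma qs_mul nu a b tau : PS 1 a -> PS 1 b -> upper tau -> ps a (e2pi tau) * qs nu b tau = qs nu (conv a b) tau.
Proof.
by move=> Ha Hb t0; rewrite !qsE (ps_conv Ha Hb (e2pi_disc t0)); ring.
Qed.

Lemma qsD nu a b tau : PS 1 a -> PS 1 b -> upper tau -> qs nu (fun n => a n + b n) tau = qs nu a tau + qs nu b tau.
Proof. by move=> Ha Hb t0; rewrite !qsE (psD Ha Hb (e2pi_disc t0)) mulrDr. Qed.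
Lemma qsZ nu c b tau : PS 1 b -> upper tau -> qs nu (fun n => c * b n) tau = c * qs nu b tau.
Proof. by move=> Hb t0; rewrite !qsE (psZ _ Hb (e2pi_disc t0)) mulrCA. Qed.
Lemma ps00 z : ps (fun=> 0 : C) z = 0.
Proof. by rewrite /ps (@sumC_fin _ _ 0%N) ?big_ord0 // => n _; rewrite mul0r. Qed.
Lemma PS0 : PS 1 (fun=> 0 : C).
Proof. by move=> rho _; exists 0 => n; rewrite cabs0 mul0r. Qed.
Lemma qs0 nu tau : qs nu (fun=> 0) tau = 0.
Proof. by rewrite !qsE ps00 mulr0. Qed.

Lemma upper_divN N tau : (0 < N)%N -> upper tau -> upper (tau / N%:R).
Proof.
rewrite /upper_half_plane => N0 t0.
have -> : (N%:R : C)^-1 = ofR (N%:R^-1) by rewrite ofRE fmorphV rmorph_nat.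
by rewrite cImM cIm_ofR mulr0 add0r cRe_ofR mulr_gt0 // invr_gt0 ltr0n.
Qed.

Definition qterm (N j : nat) kap b tau : C := tau ^+ j * qs kap b (tau / N%:R).

Lemma qterm0 N kap b tau : qterm N 0 kap b tau = qs kap b (tau / N%:R).
Proof. exact: mul1r. Qed.

(* The functions allowed by the conditions at a cusp of width N: finite sums of
   tau^j times q-series in tau/N with exponents in S. *)
Inductive qmix (N : nat) (S : C -> Prop) : (C -> C) -> Prop :=
| qmix_zero : qmix N S (fun=> 0)
| qmix_term j kap b : S kap -> PS 1 b -> qmix N S (qterm N j kap b)
| qmix_add f g : qmix N S f -> qmix N S g -> qmix N S (fun x => f x + g x)
| qmix_ext f g : (forall tau, upper tau -> f tau = g tau) -> qmix N S f -> qmix N S g.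

Lemma qmix_mul N S a f : (0 < N)%N -> PS 1 a -> qmix N S f -> qmix N S (fun x => ps a (e2pi (x / N%:R)) * f x).
Proof.
move=> N0 Ha; elim=> [|j kap b Sk Hb|g h _ Hg _ Hh|g h gh _ Hg].
- by apply: qmix_ext (qmix_zero N S) => x _; rewrite mulr0.
- apply: qmix_ext (qmix_term N j Sk (PS_conv Ha Hb)) => x x0.
  by rewrite /qterm -qs_mul //; [rewrite mulrCA | exact: upper_divN].
- by apply: qmix_ext (qmix_add Hg Hh) => x _; rewrite mulrDr.
- by apply: qmix_ext Hg => x x0; rewrite gh.
Qed.

Lemma qmix_Z N S c f : (0 < N)%N -> qmix N S f -> qmix N S (fun x => c * f x).
Proof.
move=> N0 Hf; apply: qmix_ext (qmix_mul N0 (@PS_const _ 1 c) Hf) => x _.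
by rewrite ps_const.
Qed.

Lemma qmix_sum N S (I : Type) (s : seq I) (f : I -> C -> C) : (forall i, qmix N S (f i)) ->
  qmix N S (fun x => \sum_(i <- s) f i x).
Proof.
move=> H; elim: s => [|i s IH]; first by apply: qmix_ext (qmix_zero N S) => x _; rewrite big_nil.
by apply: qmix_ext (qmix_add (H i) IH) => x _; rewrite big_cons.
Qed.

Lemma qmix_D N S f : (0 < N)%N -> qmix N S f ->
  exists2 f', qmix N S f' & forall tau, upper tau -> isD f tau (f' tau).
Proof.
move=> N0; elim=> [|j kap b Sk Hb|g h _ [g' Hg Dg] _ [h' Hh Dh]|g h gh _ [g' Hg Dg]].
- by exists (fun=> 0); [exact: qmix_zero | move=> tau _; exact: isD_cst].
- have Hb' := PS_lin kap Hb; set b' := fun n => _ in Hb'.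
  have D tau : upper tau -> isD (fun x => qs kap b (x / N%:R)) tau (N%:R^-1 * qs kap b' (tau / N%:R)).
    move=> t0; have L : cder (fun x : C => N%:R^-1 * x) tau (N%:R^-1 * 1) := cderZ _ (cder_id tau).
    have H := isD_qs kap Hb (upper_divN N0 t0); rewrite [tau / _]mulrC in H.
    have E : (fun x => qs kap b (x / N%:R)) = (fun x => qs kap b (N%:R^-1 * x)).
      by apply/funext => x; rewrite mulrC.
    rewrite E [tau / _]mulrC; apply: cder_eq (cder_comp L H) _; rewrite /b'; ring.
  case: j => [|j].
    exists (fun x => N%:R^-1 * qterm N 0 kap b' x); first by apply: qmix_Z => //; exact: qmix_term.
    move=> tau t0; rewrite qterm0.
    by apply: isD_ext t0 _ (D _ t0) => x _; rewrite qterm0.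
  exists (fun x => (j.+1%:R / tpi R) * qterm N j kap b x + N%:R^-1 * qterm N j.+1 kap b' x).
    by apply: qmix_add; apply: qmix_Z => //; exact: qmix_term.
  move=> tau t0; have X : isD (fun x => x ^+ j.+1) tau (j.+1%:R * tau ^+ j / tpi R).
    apply: cder_eq (cderX j (cder_id tau)) _; rewrite mulr1 mulrCA mulfV ?mulr1 //; exact: tpi_neq0.
  by apply: isD_eq (isD_M X (D _ t0)) _; rewrite /qterm; ring.
- exists (fun x => g' x + h' x); first exact: qmix_add.
  by move=> tau t0; apply: isD_D; [exact: Dg | exact: Dh].
- by exists g' => // tau t0; apply: isD_ext t0 gh (Dg _ t0).
Qed.

(** Splits off the exponent nu, in preparation for [qmix_separate]. That [c j] vanishes for j >= d
    lets two such sums be brought to a common length. *)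
Lemma qmix_nf N S f nu : (0 < N)%N -> qmix N S f -> exists d (c : nat -> nat -> C) g,
  [/\ forall j, PS 1 (c j), forall j, (d <= j)%N -> c j = (fun=> 0), qmix N (fun kap => S kap /\ kap != nu) g
   & forall tau, upper tau -> f tau = \sum_(j < d) qterm N j nu (c j) tau + g tau].
Proof.
have ext (d e : nat) (c : nat -> nat -> C) tau : (d <= e)%N -> (forall j, (d <= j)%N -> c j = (fun=> 0)) ->
    \sum_(j < d) qterm N j nu (c j) tau = \sum_(j < e) qterm N j nu (c j) tau.
  move=> de c0; rewrite -!(big_mkord xpredT (fun j => qterm N j nu (c j) tau)).
  rewrite [RHS](big_cat_nat _ (n := d)) //= [X in _ + X]big_nat_cond [X in _ + X]big1 ?addr0 //.
  by move=> j /andP[/andP[dj _] _]; rewrite /qterm c0 // qs0 mulr0.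
move=> N0; elim=> [|j kap b Sk Hb|f1 f2 _ [d [c [g [P1 Z1 Q1 E1]]]] _ [d' [c' [g' [P2 Z2 Q2 E2]]]]|f1 f2 f12 _ [d [c [g [P1 Z1 Q1 E1]]]]].
- exists 0%N, (fun _ _ => 0), (fun=> 0); split => //; first by move=> _; exact: PS0.
    exact: qmix_zero.
  by move=> tau _; rewrite big_ord0 addr0.
- have [kn|kn] := eqVneq kap nu; last first.
    exists 0%N, (fun _ _ => 0), (qterm N j kap b); split => //; first by move=> _; exact: PS0.
      by apply: qmix_term.
    by move=> tau _; rewrite big_ord0 add0r.
  exists j.+1, (fun i => if i == j then b else (fun=> 0)), (fun=> 0); split => //.
  + by move=> i; case: eqP => // _; exact: PS0.
  + by move=> i ji; rewrite gtn_eqF.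
  + exact: qmix_zero.
  + move=> tau _; rewrite addr0 big_ord_recr /= eqxx kn big1 ?add0r // => i _.
    by rewrite ltn_eqF // /qterm qs0 mulr0.
- exists (maxn d d'), (fun j n => c j n + c' j n), (fun x => g x + g' x); split.
  + by move=> j; exact: PSD.
  + by move=> j; rewrite geq_max => /andP[dj d'j]; rewrite Z1 // Z2 //; apply/funext => n; rewrite addr0.
  + exact: qmix_add.
  + move=> tau t0; rewrite E1 // E2 // (ext d (maxn d d') c) ?leq_maxl // (ext d' (maxn d d') c') ?leq_maxr //.
    rewrite addrACA -big_split /=; congr (_ + _).
    by apply: eq_bigr => j _; rewrite /qterm qsD ?mulrDr //; exact: upper_divN.
- by exists d, c, g; split => // tau t0; rewrite -f12 // E1.
Qed.

(** The case of a single possible exponent, which occurs at a cusp where rho(h) has a double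
    eigenvalue. *)
Lemma qmix_pure N f nu S : (0 < N)%N -> (forall kap, S kap -> kap = nu) -> qmix N S f ->
  exists d (c : nat -> nat -> C), (forall j, PS 1 (c j)) /\
    forall tau, upper tau -> f tau = \sum_(j < d) qterm N j nu (c j) tau.
Proof.
move=> N0 Sn /(qmix_nf nu N0) [d [c [g [P1 _ Q1 E1]]]]; exists d, c; split => // tau t0.
rewrite E1 //; suff -> : g tau = 0 by rewrite addr0.
elim: Q1 tau t0 {E1} => //.
- by move=> j kap b [/Sn -> /eqP].
- by move=> f1 f2 _ H1 _ H2 tau t0; rewrite H1 // H2 // addr0.
- by move=> f1 f2 E _ H tau t0; rewrite -E // H.
Qed.

Lemma upper_shift tau (x : R) : upper tau -> upper (tau + ofR x).
Proof. by rewrite /upper_half_plane cImD cIm_ofR addr0. Qed.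

Lemma qs_shift nu b tau n : qs nu b (tau + n%:R) = e2pi nu ^+ n * qs nu b tau.
Proof. by rewrite !qsE mulrDr [nu * n%:R]mulrC !e2piD e2piMn -[n%:R]/(n%:~R) e2pi_int mulr1; ring. Qed.

Lemma qmix_annihilated N S g lam tau : (0 < N)%N -> upper tau -> (forall kap, S kap -> e2pi kap != lam) ->
  qmix N S g -> annihilated lam (fun n => g (tau + (N * n)%N%:R)).
Proof.
move=> N0 t0 HS; elim=> [|j kap b Sk Hb|f1 f2 _ H1 _ H2|f1 f2 E _ H].
- exact: annihilated0.
- have -> : (fun n => qterm N j kap b (tau + (N * n)%N%:R)) =
    (fun n => e2pi kap ^+ n * (qs kap b (tau / N%:R) *: (tau%:P + N%:R *: 'X) ^+ j).[n%:R]).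
    apply/funext => n; rewrite hornerZ horner_exp hornerD hornerC hornerZ hornerX /qterm natrM.
    have -> : (tau + N%:R * n%:R) / N%:R = tau / N%:R + n%:R.
      by rewrite mulrDl [N%:R * _]mulrC mulfK // pnatr_eq0 -lt0n.
    by rewrite qs_shift; ring.
  apply: annihilated_exp; exact: HS.
- exact: annihilatedD.
- suff -> : (fun n => f2 (tau + (N * n)%N%:R)) = (fun n => f1 (tau + (N * n)%N%:R)) by [].
  by apply/funext => n; rewrite E // -ofR_nat; exact: upper_shift.
Qed.

(* Both sides being exponential polynomials in n when tau is replaced by
   tau + N n, only the terms in lam^n survive. *)
Lemma qmix_separate N S f lam nu : (0 < N)%N ->
  (forall kap, S kap -> 0 <= cRe kap < 1) -> e2pi nu = lam -> 0 <= cRe nu < 1 ->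
  (forall tau, upper tau -> f (tau + N%:R) = lam * f tau) -> qmix N S f ->
  exists2 b, PS 1 b & forall tau, upper tau -> f tau = qs nu b (tau / N%:R).
Proof.
move=> N0 HS nl Hnu fN Hf; have [d [c [g [P1 Z1 Q1 E1]]]] := qmix_nf nu N0 Hf.
have l0 : lam != 0 by rewrite -nl e2pi_neq0.
have NC : N%:R != 0 :> C by rewrite pnatr_eq0 -lt0n.
exists (c 0%N) => // tau t0.
have up n : upper (tau + (N * n)%N%:R) by rewrite -ofR_nat; exact: upper_shift.
have fn n : f (tau + (N * n)%N%:R) = lam ^+ n * f tau.
  elim: n => [|n IH]; first by rewrite muln0 addr0 mul1r.
  by rewrite mulnS natrD addrCA addrC fN // IH mulrA exprS.
have An : annihilated lam (fun n => g (tau + (N * n)%N%:R)).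
  (* Two distinct exponents with real parts in [0, 1) cannot differ by an integer, so their [e2pi]
     differ. *)
  apply: qmix_annihilated t0 _ Q1 => // kap [Sk kn]; rewrite -nl.
  apply: contra kn => /eqP E.
  have E' : e2pi (kap - nu) = 1 by rewrite e2piD e2piN E mulfV // e2pi_neq0.
  have [m mE] := e2pi_eq1 E'.
  have mR : m%:~R = cRe kap - cRe nu by rewrite -cReN -cReD mE cRe_int.
  have /andP[a1 a2] := HS _ Sk; have /andP[b1 b2] := Hnu.
  have m0 : m = 0.
    have h1 : m%:~R < 1%:~R :> R by rewrite mR; lra.
    have h2 : (-1)%:~R < m%:~R :> R by rewrite mR rmorphN /=; lra.
    by move: h1 h2; rewrite !ltr_int; lia.
  by rewrite -subr_eq0 mE m0.
pose Psi j := qs nu (c j) (tau / N%:R).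
pose r : {poly C} := (f tau)%:P - \sum_(j < d) Psi j *: (tau%:P + N%:R *: 'X) ^+ j.
have rE : r = 0.
  apply: (annihilated_poly l0 An) => n.
  have -> : g (tau + (N * n)%N%:R) = f (tau + (N * n)%N%:R) - \sum_(j < d) qterm N j nu (c j) (tau + (N * n)%N%:R).
    by rewrite (E1 _ (up n)) [X in X - _]addrC addrK.
  rewrite fn /r hornerD hornerN hornerC horner_sum mulrBr; congr (_ - _).
  rewrite mulr_sumr; apply: eq_bigr => j _.
  rewrite hornerZ horner_exp hornerD hornerC hornerZ hornerX /qterm natrM.
  have -> : (tau + N%:R * n%:R) / N%:R = tau / N%:R + n%:R.
    by rewrite mulrDl [N%:R * _]mulrC mulfK.
  by rewrite qs_shift nl /Psi; ring.
(* The polynomial identity in n extends to n = -tau / N, where tau + N n = 0 removes every term with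
   j > 0. *)
have := congr1 (fun p : {poly C} => p.[- (tau / N%:R)]) rE.
rewrite horner0 /r hornerD hornerN hornerC horner_sum => /eqP; rewrite subr_eq0 => /eqP ->.
have H (j : nat) : (Psi j *: (tau%:P + N%:R *: 'X) ^+ j).[- (tau / N%:R)] = if j == 0%N then Psi 0%N else 0.
  rewrite hornerZ horner_exp hornerD hornerC hornerZ hornerX mulrN.
  have -> : tau - N%:R * (tau / N%:R) = 0 by rewrite mulrC divfK // subrr.
  by case: j => [|j] /=; rewrite ?expr0 ?mulr1 // expr0n mulr0.
under eq_bigr do rewrite H.
case: d Z1 {E1 r rE} => [|d] Z1.
  by rewrite big_ord0 Z1 // qs0.
by rewrite big_ord_recl /= big1 ?addr0.
Qed.

Lemma PS_double (e : nat) b : PS 1 b -> PS 1 (fun n => b (2 * n + e)%N).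
Proof.
move=> Hb; elim: e b Hb => [|e IH] b Hb; last first.
  have -> : (fun n => b (2 * n + e.+1)%N) = (fun n => (fun m => b m.+1) (2 * n + e)%N).
    by apply/funext => n; rewrite addnS.
  exact: (IH _ (PS_shift Hb)).
move=> rho /andP[r0 r1]; pose s := Num.sqrt rho.
have s2 : s ^+ 2 = rho by rewrite sqr_sqrtr // ltW.
have s0 : 0 < s by rewrite sqrtr_gt0.
have s1 : s < 1 by rewrite -sqrtr1 ltr_sqrt.
have [K HK] := Hb s (ltac:(by rewrite s0)).
by exists K => n; rewrite addn0 -s2 -exprM; exact: HK.
Qed.

Lemma ps_even_odd b z : PS 1 b -> disc z ->
  ps b z = ps (fun n => b (2 * n + 0)%N) (z ^+ 2) + z * ps (fun n => b (2 * n + 1)%N) (z ^+ 2).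
Proof.
move=> Hb z1; have Pe := PS_double 0 Hb; have Po := PS_double 1 Hb.
set be := fun n => _ in Pe *; set bo := fun n => _ in Po *.
have De := PS_dil (ltn0Sn 1) Pe; have Do := PS_dil (ltn0Sn 1) Po.
pose so n : C := if n is m.+1 then dil 2 bo m else 0.
have soE m : so (2 * m)%N = 0.
  case: m => [|m]; first by rewrite muln0.
  have -> : (2 * m.+1)%N = ((2 * m).+1).+1 by rewrite mulnS.
  by rewrite /so /dil dvdn2 oddS oddM.
have Pso : PS 1 so by apply: PS_unshift.
have -> : b = (fun n => dil 2 be n + so n).
  apply/funext => n; rewrite /so /dil /be /bo.
  have := odd_double_half n; case: (odd n) => <-; rewrite -muln2.
    rewrite add1n dvdn_mull // mulnK // dvdn2 /= oddM andbF /= add0r.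
    by rewrite mulnC addn1.
  rewrite add0n dvdn_mull // mulnK // addn0 mulnC.
  by move: (_./2) => m; rewrite -/(so (2 * m)%N) soE addr0.
rewrite (psD De Pso z1) (ps_dil (ltn0Sn 1) Pe z1) (ps_recl Pso z1) /= add0r.
by rewrite (ps_dil (ltn0Sn 1) Po z1).
Qed.

(** The even and odd coefficients of a series in q^(1/2) give two series in q, with exponents kap /
    2 and (kap + 1) / 2. The cusp condition at infinity speaks of T^2, while a q-series for T is
    wanted. *)
Lemma qmix_split2 S f : (forall kap, S kap -> 0 <= cRe kap < 1) -> qmix 2 S f ->
  qmix 1 (fun kap => 0 <= cRe kap < 1) f.
Proof.
move=> HS; elim=> [|j kap b Sk Hb|g h _ Hg _ Hh|g h gh _ Hg].
- exact: qmix_zero.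
- have Hk := HS _ Sk.
  have i2 : (2%:R : C)^-1 = ofR 2^-1 by rewrite ofRE fmorphV rmorph_nat.
  have R1 : 0 <= cRe (kap / 2%:R) < 1.
    by rewrite i2 cReM cRe_ofR cIm_ofR mulr0 subr0; move: Hk => /andP[? ?]; apply/andP; split; lra.
  have R2 : 0 <= cRe ((kap + 1) / 2%:R) < 1.
    by rewrite i2 cReM cRe_ofR cIm_ofR mulr0 subr0 cReD (cRe_nat R 1); move: Hk => /andP[? ?]; apply/andP; split; lra.
  have Pe := PS_double 0 Hb; have Po := PS_double 1 Hb.
  have T1 := qmix_term 1 j (S := fun kap => 0 <= cRe kap < 1) R1 Pe.
  have T2 := qmix_term 1 j (S := fun kap => 0 <= cRe kap < 1) R2 Po.
  apply: qmix_ext (qmix_add T1 T2) => tau t0.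
  have h0 : upper (tau / 2%:R) by exact: upper_divN.
  rewrite /qterm -mulrDr; congr (_ * _).
  rewrite !qsE divr1 (ps_even_odd Hb (e2pi_disc h0)) -e2piMn [2%:R * _]mulrC divfK ?pnatr_eq0 //.
  rewrite mulrDr; congr (e2pi _ * _ + _); first by rewrite mulrAC mulrA.
  rewrite mulrA -e2piD; by congr (e2pi _ * _); field.
- exact: qmix_add.
- exact: qmix_ext gh Hg.
Qed.
End Separation.

(** * Two-sided expansions at a cusp as q-series *)

Section CuspExpansions.
Variable R : realType.
Local Notation C := (Cfield R).
Implicit Types (z w tau q lam kap nu mu : C) (b : nat -> C).
Local Notation upper := (@upper_half_plane R).
Local Notation disc := (@disc R).

Lemma qs_term nu tau n : e2pi ((n%:R + nu) * tau) = e2pi (nu * tau) * e2pi tau ^+ n :> C.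
Proof. by rewrite mulrDl e2piD e2piMn mulrC. Qed.

Lemma cusp_expansion_qs N nu b : (0 < N)%N -> 0 <= cRe nu -> PS 1 b ->
  cusp_expansion N nu (fun tau => qs nu b (tau / N%:R)).
Proof.
move=> N0 nu0 Hb; exists (fun n => if n is Posz m then b m else 0); split.
  by case=> n //; rewrite cReD cRe_int => H; exfalso; move: H; rewrite ltNge addr_ge0 // ler0z.
move=> tau t0; have u0 := upper_divN N0 t0.
exists (qs nu b (tau / N%:R)), 0; split; last by rewrite addr0.
  have E : (fun n : nat => b n * e2pi (((n%:Z)%:~R + nu) * tau / N%:R)) =
     (fun n => e2pi (nu * (tau / N%:R)) * (b n * e2pi (tau / N%:R) ^+ n)).
    by apply/funext => n; rewrite -mulrA qs_term; ring.
  rewrite E; have A := PS_asum Hb (e2pi_disc u0).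
  have := asum_cvg (asumZ (e2pi (nu * (tau / N%:R))) A); rewrite (sumCZ _ A) qsE; exact.
apply/cvgC_P => e e0; exists 0%N => n _.
rewrite seriesE big1 ?subrr ?cabs0 // => i _; by rewrite mul0r.
Qed.

Lemma has_sum_Z_shift (u : int -> C) (s : C) (n0 : int) : has_sum_Z u s ->
  (forall n : int, n < n0 -> u n = 0) -> series (fun m : nat => u (n0 + m%:Z)) @ \oo --> s.
Proof.
move=> [s1 [s2 [H1 H2 ->]]] u0; apply/cvgC_P => e e0.
have e2 : 0 < e / 2 by rewrite divr_gt0.
have [N1 HN1] := (cvgC_P _ _).1 H1 _ e2; have [N2 HN2] := (cvgC_P _ _).1 H2 _ e2.
case: n0 u0 => m u0.
  exists (maxn N1 N2) => n; rewrite geq_max => /andP[n1 n2].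
  have A := HN1 (m + n)%N (leq_trans n1 (leq_addl _ _)); have B := HN2 n n2.
  rewrite seriesE big_split_ord /= big1 ?add0r in A; last by move=> i _; apply: u0; rewrite ltz_nat.
  rewrite seriesE big1 ?sub0r in B; last by move=> i _; apply: u0; lia.
  rewrite seriesE; under eq_bigr do rewrite -PoszD.
  set S := \sum_(i < n) _ in A *.
  have -> : S - (s1 + s2) = (S - s1) + (- s2) by ring.
  by apply: le_lt_trans (cabsD _ _) _; lra.
exists (m.+1 + maxn N1 N2)%N => n Hn.
have Hm : (m.+1 <= n)%N by apply: leq_trans Hn; rewrite leq_addr.
have A := HN1 (n - m.+1)%N (ltac:(lia)); have B := HN2 (m.+1 + N2)%N (leq_addl _ _).
rewrite seriesE big_split_ord /= in B.
rewrite [X in _ + X - _]big1 ?addr0 in B; last by move=> i _; apply: u0; lia.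
rewrite seriesE in A; rewrite seriesE.
rewrite -(subnKC Hm) big_split_ord /=.
have -> : \sum_(i < m.+1) u (Negz m + i%:Z) = \sum_(i < m.+1) u (- (i.+1)%:Z).
  rewrite (reindex_inj rev_ord_inj) /=; apply: eq_bigr => i _; congr u; have := ltn_ord i; lia.
have -> : \sum_(i < n - m.+1) u (Negz m + (m.+1 + i)%N%:Z) = \sum_(i < n - m.+1) u i%:Z.
  by apply: eq_bigr => i _; congr u; lia.
set S := \sum_(i < m.+1) _ in B *; set S' := \sum_(i < n - m.+1) _ in A *.
have -> : S + S' - (s1 + s2) = (S' - s1) + (S - s2) by ring.
by apply: le_lt_trans (cabsD _ _) _; lra.
Qed.

Lemma cvg_series_bounded (v : nat -> C) (l : C) : series v @ \oo --> l -> exists K : R, forall n, cabs (v n) <= K.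
Proof.
move=> /cvgC_P /(_ 1 ltr01) [N HN]; exists (2 + \sum_(i < N) cabs (v i)) => n.
have P : 0 <= \sum_(i < N) cabs (v i) by apply: sumr_ge0 => i _; exact: cabs_ge0.
have [nN|nN] := ltnP n N.
  rewrite (bigD1 (Ordinal nN)) //=; have : 0 <= \sum_(i < N | i != Ordinal nN) cabs (v i).
    by apply: sumr_ge0 => i _; exact: cabs_ge0.
  lra.
have A := HN n nN; have B := HN n.+1 (leq_trans nN (leqnSn _)).
rewrite !seriesE big_ord_recr /= in A B.
have -> : v n = (\sum_(i < n) v i + v n - l) + (- (\sum_(i < n) v i - l)) by ring.
apply: le_trans (cabsD _ _) _; rewrite cabsN; lra.
Qed.

(** The shift n0 moves mu into 0 <= Re < 1, and the cusp condition kills the coefficients below n0.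
    Convergence at one point of each modulus less than 1 gives the Cauchy bounds. *)
Lemma cusp_expansion_inv N mu f : (0 < N)%N -> cusp_expansion N mu f ->
  exists nu b, [/\ e2pi nu = e2pi mu, 0 <= cRe nu < 1, PS 1 b &
    forall tau, upper tau -> f tau = qs nu b (tau / N%:R)].
Proof.
move=> N0 [a [a0 Ha]]; pose n0 : int := - Num.floor (cRe mu).
have NC : N%:R != 0 :> C by rewrite pnatr_eq0 -lt0n.
pose nu := n0%:~R + mu; pose b m := a (n0 + m%:Z).
have nuR : 0 <= cRe nu < 1.
  rewrite /nu /n0 cReD cRe_int rmorphN /=; have /andP[] := floor_itv (cRe mu).
  by rewrite intrD => ? ?; apply/andP; split; lra.
have z0 n : n < n0 -> a n = 0.
  move=> nn; apply: a0; move: nuR; rewrite /nu !cReD !cRe_int => /andP[_ h].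
  have : (n + 1)%:~R <= n0%:~R :> R by rewrite ler_int; lia.
  by rewrite intrD; lra.
have key tau : upper tau -> series (fun m => b m * e2pi (tau / N%:R) ^+ m) @ \oo --> e2pi (- (nu * (tau / N%:R))) * f tau.
  move=> t0; have Z n : n < n0 -> a n * e2pi ((n%:~R + mu) * tau / N%:R) = 0 by move=> /z0 ->; rewrite mul0r.
  have := cvgCZ (c := e2pi (- (nu * (tau / N%:R)))) (has_sum_Z_shift (Ha _ t0) Z).
  set u := (X in X @ \oo --> _ -> _).
  suff -> : u = series (fun m => b m * e2pi (tau / N%:R) ^+ m) by [].
  apply/funext => n; rewrite /u !seriesE mulr_sumr; apply: eq_bigr => i _.
  have -> : ((n0 + i%:Z)%:~R + mu) * tau / N%:R = (i%:R + nu) * (tau / N%:R).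
    by rewrite /nu intrD mulrA; congr (_ * _ / _); rewrite addrAC addrC.
  by rewrite qs_term e2piN /b; field; exact: e2pi_neq0.
have Hb : PS 1 b.
  move=> rho /andP[r0 r1].
  have rn : (ofR rho : C) != 0 by rewrite -cabs_gt0 cabs_ofR gtr0_norm.
  have [w Hw] := e2pi_surj rn.
  have w0 : upper w.
    have : expR (- (2 * pi * cIm w)) < expR 0 :> R by rewrite -cabs_e2pi Hw cabs_ofR gtr0_norm // expR0.
    rewrite ltr_expR oppr_lt0 pmulr_rgt0 //; apply: mulr_gt0 => //; exact: pi_gt0.
  have wN : upper (N%:R * w) by case: (N) N0 => // n _; exact: upper_natM.
  have := key _ wN; rewrite [N%:R * w]mulrC mulfK // Hw => /cvg_series_bounded [K HK].
  by exists K => n; have := HK n; rewrite cabsM cabsX cabs_ofR (gtr0_norm r0).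
exists nu, b; split => //; first by rewrite /nu e2piD e2pi_int mul1r.
move=> tau t0; have u0 := upper_divN N0 t0.
have := cvgC_uniq (key _ t0) (asum_cvg (PS_asum Hb (e2pi_disc u0))).
by rewrite qsE /ps => <-; rewrite mulrA -e2piD subrr e2pi0 mul1r.
Qed.
End CuspExpansions.

Section Matrices2.
Lemma det2 (K : comNzRingType) (g : 'M[K]_2) : \det g = g 0 0 * g 1 1 - g 0 1 * g 1 0.
Proof.
rewrite (expand_det_row _ 0) big_ord_recl big_ord1 /cofactor !det_mx11 !mxE /=.
rewrite expr0 expr1 mul1r mulN1r mulrN.
by congr (_ * g _ _ - g _ _ * g _ _); apply: val_inj.
Qed.

Lemma sum2 (K : nmodType) (f : 'I_2 -> K) : \sum_i f i = f 0 + f 1.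
Proof. by rewrite big_ord_recl big_ord1; congr (_ + f _); apply: val_inj. Qed.

Lemma ord2 (i : 'I_2) : i = 0 \/ i = 1.
Proof. by case: i => [[|[|n]] Hn] //; [left | right]; apply: val_inj. Qed.

Lemma eigenvalue_det (K : fieldType) n (A : 'M[K]_n) a : eigenvalue A a = (\det (A - a%:M) == 0).
Proof.
by rewrite /eigenvalue /eigenspace kermx_eq0 row_free_unit unitmxE unitfE negbK.
Qed.

Lemma eigenvalue_conj (K : fieldType) (P A : 'M[K]_2) a : P \in unitmx -> (P *m A *m invmx P) 1 0 = 0 ->
  eigenvalue A a = (a == (P *m A *m invmx P) 0 0) || (a == (P *m A *m invmx P) 1 1).
Proof.
move=> Pu; set J := _ *m invmx P => J0; rewrite eigenvalue_det.
have -> : \det (A - a%:M) = \det (J - a%:M).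
  have -> : J - a%:M = P *m (A - a%:M) *m invmx P.
    by rewrite mulmxBr mulmxBl -scalemx1 -scalemxAr mulmx1 -scalemxAl mulmxV.
  by rewrite !det_mulmx mulrAC -det_mulmx mulmxV // det1 mul1r.
clearbody J; rewrite det2 !mxE /= J0 !mulr0n !mulr1n !(subr0, mulr0) mulf_eq0 !subr_eq0.
by rewrite eq_sym [J 1 1 == a]eq_sym.
Qed.
End Matrices2.

(** * Vector-valued forms as pairs of q-series *)

Section Slash.
Variable R : realType.
Local Notation C := (Cfield R).
Implicit Types (z w tau q lam kap mu : C) (g h : 'M[int]_2).
Local Notation upper := (@upper_half_plane R).

Definition aut g tau : C := (g 1 0)%:~R * tau + (g 1 1)%:~R.

Lemma SL2Z_det g : SL2Z g -> g 0 0 * g 1 1 - g 0 1 * g 1 0 = 1.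
Proof. by rewrite /SL2Z det2. Qed.

Lemma aut_neq0 g tau : SL2Z g -> upper tau -> aut g tau != 0.
Proof. by move=> /SL2Z_det Hg t0; exact: cocycle_neq0 t0 (det_neq0 Hg). Qed.

Lemma upper_moebius g tau : SL2Z g -> upper tau -> upper (moebius g tau).
Proof. by move=> /SL2Z_det Hg t0; exact: upper_mob t0 Hg. Qed.

Lemma mul2mx (g h : 'M[int]_2) i j : (g * h) i j = g i 0 * h 0 j + g i 1 * h 1 j.
Proof. by rewrite -mulmxE mxE sum2. Qed.

Lemma aut_mul g h tau : SL2Z h -> upper tau -> aut (g * h) tau = aut g (moebius h tau) * aut h tau.
Proof.
move=> Hh t0; have n0 := aut_neq0 Hh t0; move: n0; rewrite /aut /moebius !mul2mx !intrD !intrM => n0.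
by field.
Qed.

Lemma moebius_mul g h tau : SL2Z g -> SL2Z h -> upper tau ->
  moebius (g * h) tau = moebius g (moebius h tau).
Proof.
move=> Hg Hh t0; have n0 := aut_neq0 Hh t0; have n1 := aut_neq0 Hg (upper_moebius Hh t0).
have n2 : aut (g * h) tau != 0 by rewrite aut_mul // mulf_neq0 // aut_neq0 // upper_moebius.
have E := aut_mul g Hh t0.
rewrite /moebius -/(aut (g * h) tau) -/(aut h tau) E.
rewrite -[X in _ = _ / X]/(aut g (moebius h tau)).
rewrite !mul2mx !intrD !intrM; move: (aut g _) n1 => x n3.
by rewrite /aut in n0 *; field; rewrite n3 n0.
Qed.

Lemma slash_mul k g h F tau : SL2Z g -> SL2Z h -> upper tau ->
  slash k (g * h) F tau = aut h tau ^ (- k) *: slash k g F (moebius h tau).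
Proof.
move=> Hg Hh t0; rewrite /slash -!/(aut _ _) aut_mul // moebius_mul // scalerA.
by rewrite expfzMl mulrC.
Qed.

Lemma slash_ext k g (F F' : C -> 'cV[C]_2) tau : SL2Z g -> (forall x, upper x -> F x = F' x) -> upper tau ->
  slash k g F tau = slash k g F' tau.
Proof. by move=> Hg FF t0; rewrite /slash FF //; exact: upper_moebius. Qed.

Lemma TmxE (N : nat) : [/\ (Tmx ^+ N) 0 0 = 1, (Tmx ^+ N) 0 1 = N%:Z, (Tmx ^+ N) 1 0 = 0 & (Tmx ^+ N) 1 1 = 1].
Proof. by rewrite TmxX !mxE /= mulr1 !mulr0 !addr0 !add0r. Qed.

Lemma Gamma02_Tmx N : Gamma02 (Tmx ^+ N).
Proof. by have [a b c d] := TmxE N; rewrite /Gamma02 /SL2Z det2 a b c d mulr0 subr0 dvdz0. Qed.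

Lemma slash_Tmx k g F tau N : SL2Z g -> upper tau ->
  slash k (g * Tmx ^+ N) F tau = slash k g F (tau + N%:R).
Proof.
move=> Hg t0; have [a b c d] := TmxE N; have [HT _] := Gamma02_Tmx N.
rewrite slash_mul // /aut /moebius a b c d !mul0r !add0r mul1r exp1rz scale1r divr1.
by rewrite -pmulrn.
Qed.

Lemma SL2Z1 : SL2Z 1. Proof. by rewrite /SL2Z det1. Qed.

Lemma slash1 k F tau : slash k 1 F tau = F tau.
Proof.
have [a b c d] := TmxE 0; rewrite expr0 in a b c d.
by rewrite /slash /moebius a b c d !mul0r !add0r exp1rz scale1r addr0 mul1r divr1.
Qed.

Lemma e2pi_inj01 kap mu : 0 <= cRe kap < 1 -> 0 <= cRe mu < 1 -> e2pi kap = e2pi mu -> kap = mu.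
Proof.
move=> /andP[a1 a2] /andP[b1 b2] E.
have E' : e2pi (kap - mu) = 1 by rewrite e2piD e2piN E mulfV // e2pi_neq0.
have [m mE] := e2pi_eq1 E'.
have mR : m%:~R = cRe kap - cRe mu by rewrite -cReN -cReD mE cRe_int.
have m0 : m = 0.
  have h1 : m%:~R < 1%:~R :> R by rewrite mR; lra.
  have h2 : (-1)%:~R < m%:~R :> R by rewrite mR rmorphN /=; lra.
  by move: h1 h2; rewrite !ltr_int; lia.
by apply/eqP; rewrite -subr_eq0 mE m0.
Qed.

Lemma cusp_expansion_ext N mu (f f' : C -> C) : (forall tau, upper tau -> f tau = f' tau) ->
  cusp_expansion N mu f -> cusp_expansion N mu f'.
Proof. by move=> ff [a [a0 Ha]]; exists a; split => // tau t0; rewrite -ff //; exact: Ha. Qed.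
End Slash.

(** * Modular forms and their coefficient pairs *)

Section Good.
Variables (R : realType).
Local Notation C := (Cfield R).
Variables (rho : 'M[int]_2 -> 'M[C]_2) (P0 : 'M[C]_2) (nu : 'I_2 -> C).
Hypotheses (rho_rep : representation rho) (P0u : P0 \in unitmx).
Hypothesis nuR : forall i, 0 <= cRe (nu i) < 1.
Hypothesis P0T : P0 *m rho Tmx *m invmx P0 = diag_mx (\row_i e2pi (nu i)).
Implicit Types (tau kap mu : C) (g h : 'M[int]_2) (b : 'I_2 -> nat -> C) (k : int).
Local Notation upper := (@upper_half_plane R).

Definition vecq b tau : 'cV[C]_2 := \col_i qs (nu i) (b i) tau.
Lemma vecqE b tau i : vecq b tau i 0 = qs (nu i) (b i) tau.
Proof. exact: mxE. Qed.

Definition form b tau : 'cV[C]_2 := locked (invmx P0 *m vecq b tau).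
Lemma formV b tau : form b tau = invmx P0 *m vecq b tau.
Proof. by rewrite /form -lock. Qed.
(** Restricting the exponents to 0 <= Re < 1 builds holomorphy at the cusp into the set. *)
Definition cuspexp h kap := eigenvalue (rho h) (e2pi kap) /\ 0 <= cRe kap < 1.

(* Modularity of the form with coefficients b.  At the cusps where c is even
   the expansion is automatic. *)
Record good k b : Prop := Good {
  good_PS : forall i, PS 1 (b i);
  good_eqv : forall g tau, Gamma02 g -> upper tau -> slash k g (form b) tau = rho g *m form b tau;
  good_odd : forall g h, SL2Z g -> Gamma02 h -> g * Tmx ^+ 2 = h * g -> ~~ (2 %| (g 1 0)%R)%Z ->
    forall i, qmix 2 (cuspexp h) (fun tau => slash k g (form b) tau i 0) }.

(** The class [qmix] is stable under linear combinations, so the conjugation by P can be undone and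
    the Jordan form leaves the condition. *)
Lemma expansions_qmix k F g h : holomorphic_at_cusps k rho F -> SL2Z g -> Gamma02 h -> g * Tmx ^+ 2 = h * g ->
  forall i, qmix 2 (cuspexp h) (fun tau => slash k g F tau i 0).
Proof.
move=> HF Hg Hh E; have per : is_cusp_period 2 by apply/is_cusp_periodP.
have [P [Pu _ HP]] := HF _ _ _ per Hg Hh E.
have Q l : qmix 2 (cuspexp h) (fun tau => (P *m slash k g F tau) l 0).
  have [mu emu [d [f [Hf Ef]]]] := HP l.
  have QQ : forall j : 'I_d, qmix 2 (cuspexp h) (fun tau => f j tau * tau ^+ j).
    move=> j; have [ka [b [e1 e2 e3 e4]]] := cusp_expansion_inv (isT : (0 < 2)%N) (Hf j).
    have S : cuspexp h ka by split; rewrite ?e1.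
    by apply: qmix_ext (qmix_term 2 j S e3) => tau t0; rewrite /qterm e4 // mulrC.
  by apply: qmix_ext (qmix_sum (index_enum 'I_d) QQ) => tau t0; rewrite Ef.
move=> i; have QQ : forall l : 'I_2, qmix 2 (cuspexp h) (fun tau => invmx P i l * (P *m slash k g F tau) l 0).
  by move=> l; apply: qmix_Z.
apply: qmix_ext (qmix_sum (index_enum 'I_2) QQ) => tau t0.
by rewrite -[in RHS](mulKmx Pu (slash k g F tau)) [in RHS]mxE.
Qed.

(** At infinity [qmix_split2] passes from T^2 to T; then F(tau + 1) = rho(T) F(tau), diagonal in the
    basis P0, lets [qmix_separate] remove all powers of tau. *)
Lemma mf_good k F : modular_form k rho F ->
  exists2 b, good k b & forall tau, upper tau -> F tau = form b tau.
Proof.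
move=> [_ Feqv Fcusp].
have Q i : qmix 2 (cuspexp (Tmx ^+ 2)) (fun tau => (P0 *m F tau) i 0).
  have E : 1 * Tmx ^+ 2 = Tmx ^+ 2 * 1 :> 'M[int]_2 by rewrite mul1r mulr1.
  have Q := expansions_qmix Fcusp SL2Z1 (Gamma02_Tmx 2) E.
  have QQ : forall l : 'I_2, qmix 2 (cuspexp (Tmx ^+ 2)) (fun tau => P0 i l * slash k 1 F tau l 0).
    by move=> l; apply: qmix_Z.
  apply: qmix_ext (qmix_sum (index_enum 'I_2) QQ) => tau t0.
  by rewrite mxE; apply: eq_bigr => l _; rewrite slash1.
have Fper tau : upper tau -> F (tau + 1) = rho Tmx *m F tau.
  move=> t0; have := Feqv Tmx tau (Gamma02_Tmx 1) t0.
  by rewrite -[Tmx]mul1r -{1}[Tmx]expr1 (slash_Tmx _ _ 1 SL2Z1 t0) slash1 mul1r.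
have Y i : exists2 c, PS 1 c & forall tau, upper tau -> (P0 *m F tau) i 0 = qs (nu i) c tau.
  have Q1 := qmix_split2 (fun kap (H : cuspexp (Tmx ^+ 2) kap) => H.2) (Q i).
  have [|c Hc Ec] := qmix_separate (isT : (0 < 1)%N) (fun kap H => H) (erefl (e2pi (nu i))) (nuR i) _ Q1.
    move=> tau t0; rewrite Fper // mulmxA -[P0 *m rho Tmx](mulmxKV P0u) P0T -mulmxA.
    by rewrite mul_diag_mx !mxE.
  exists c; first exact: Hc.
  move=> tau t0; by rewrite (Ec _ t0) [tau / _]divr1.
have [c0 P0' E0] := Y 0; have [c1 P1' E1] := Y 1.
pose b (i : 'I_2) := if i == 0 then c0 else c1.
have FE tau : upper tau -> F tau = form b tau.
  move=> t0; rewrite -[LHS](mulKmx P0u) formV; congr (_ *m _); apply/matrixP => i j.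
  by rewrite ord1 [RHS]mxE; case: (ord2 i) => ->; rewrite /b /= ?E0 ?E1.
exists b; last exact: FE.
split.
- by move=> i; rewrite /b; case: eqP.
- move=> g tau Hg t0; rewrite -FE // -Feqv //; apply: slash_ext => //; first by case: Hg.
  by move=> x x0; rewrite FE.
- move=> g h Hg Hh E _ i; apply: qmix_ext (expansions_qmix Fcusp Hg Hh E i) => tau t0.
  by congr (_ _ i 0); apply: slash_ext.
Qed.

Lemma form_isD b i tau : (forall i, PS 1 (b i)) -> upper tau ->
  isD (fun x => form b x i 0) tau (form (fun i n => (nu i + n%:R) * b i n) tau i 0).
Proof.
move=> Hb t0.
have D l : isD (fun x => invmx P0 i l * vecq b x l 0) tau (invmx P0 i l * vecq (fun i n => (nu i + n%:R) * b i n) tau l 0).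
  have E : (fun x => vecq b x l 0) = qs (nu l) (b l) by apply/funext => x; exact: vecqE.
  by apply: isD_Z; rewrite E (vecqE _ _ l); exact: isD_qs (Hb l) t0.
have E (c : 'I_2 -> nat -> C) x : form c x i 0 = invmx P0 i 0 * vecq c x 0 0 + invmx P0 i 1 * vecq c x 1 0.
  by rewrite formV mxE sum2.
have -> : (fun x => form b x i 0) = (fun x => invmx P0 i 0 * vecq b x 0 0 + invmx P0 i 1 * vecq b x 1 0).
  by apply/funext => x; exact: E.
rewrite E; exact: isD_D (D 0) (D 1).
Qed.

Lemma slash_Tmx2 k b g h tau : good k b -> SL2Z g -> Gamma02 h -> g * Tmx ^+ 2 = h * g -> upper tau ->
  slash k g (form b) (tau + 2%:R) = rho h *m slash k g (form b) tau.
Proof.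
move=> Gb Hg Hh E t0; rewrite -(slash_Tmx _ _ 2 Hg t0) E slash_mul //; last by case: Hh.
rewrite (good_eqv Gb Hh); last exact: upper_moebius.
by rewrite -scalemxAr.
Qed.

Lemma diag_conj (P : 'M[C]_2) (d : 'rV[C]_2) (A : 'M[C]_2) : P \in unitmx -> P *m A *m invmx P = diag_mx d ->
  P *m A = diag_mx d *m P.
Proof. by move=> Pu <-; rewrite mulmxKV. Qed.

(** The way back to modular forms, through which the minimality of k_0 is applied to coefficient
    pairs. *)
Lemma good_mf k k1 F1 b : holomorphic_at_cusps k1 rho F1 -> good k b -> modular_form k rho (form b).
Proof.
move=> H1 Gb; split; [|exact: good_eqv Gb|].
  by move=> i tau t0; exact: cder_derivable (form_isD i (good_PS Gb) t0).
move=> N g h per Hg Hh E; have N2 := (is_cusp_periodP N).1 per.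
(* Only the change of basis to a Jordan form of rho(h) is taken from F1; it does not involve the
   weight. *)
have [P1 [P1u J1 _]] := H1 N g h per Hg Hh E; rewrite N2 in E *.
have [ge|go] := boolP (2 %| (g 1 0)%R)%Z.
  have Gg : Gamma02 g by [].
  have gu : rho g \in unitmx := rho_rep.1 _ Gg.
  (* Here rho(h) is the conjugate of rho(T)^2 by rho(g), so P diagonalizes it with eigenvalues e2pi
     (2 nu i). *)
  pose P := P0 *m invmx (rho g).
  have Pu : P \in unitmx by rewrite unitmx_mul P0u unitmx_inv.
  have HT : P0 *m rho Tmx = diag_mx (\row_i e2pi (nu i)) *m P0 by exact: diag_conj.
  have PJ : P *m rho h *m invmx P = diag_mx (\row_i e2pi (2%:R * nu i)).
    have gT : rho g *m rho (Tmx ^+ 2) = rho h *m rho g.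
      by rewrite -rho_rep.2 ?E ?rho_rep.2 //; exact: (Gamma02_Tmx 2).
    have TT : rho (Tmx ^+ 2) = rho Tmx *m rho Tmx by rewrite expr2 rho_rep.2 //; exact: (Gamma02_Tmx 1).
    have HP : P *m rho h = diag_mx (\row_i e2pi (2%:R * nu i)) *m P.
      apply: (can_inj (mulmxK gu)); rewrite -mulmxA -gT TT /P !mulmxA !mulmxKV //.
      rewrite HT -mulmxA HT mulmxA mulmx_diag; congr (diag_mx _ *m _).
      by apply/rowP => i; rewrite !mxE e2piMn expr2.
    by rewrite HP mulmxK.
  exists P; split; first exact: Pu.
    by rewrite PJ; split; [rewrite !mxE | left; rewrite !mxE].
  move=> i; exists (2%:R * nu i).
    rewrite (eigenvalue_conj _ Pu) PJ; last by rewrite !mxE.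
    by case: (ord2 i) => ->; rewrite !mxE /= !mulr1n eqxx ?orbT.
  (* The expansion is in q^(1/2), so the exponent doubles and the coefficients are dilated by 2. *)
  exists 1%N, (fun _ tau => qs (nu i) (b i) tau); split => [_|tau t0].
    have PD := PS_dil (ltn0Sn 1) (good_PS Gb i).
    have nu2 : 0 <= cRe (2%:R * nu i).
      by rewrite cReM cRe_nat cIm_nat mul0r subr0 mulr_ge0 //; case/andP: (nuR i).
    apply: cusp_expansion_ext (cusp_expansion_qs (ltn0Sn 1) nu2 PD) => tau t0.
    have u0 := upper_divN (ltn0Sn 1) t0.
    rewrite !qsE (ps_dil (ltn0Sn 1) (good_PS Gb i) (e2pi_disc u0)) -e2piMn.
    have -> : 2%:R * (tau / 2%:R) = tau by field.
    by have -> : 2%:R * nu i * (tau / 2%:R) = nu i * tau by field.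
  rewrite big_ord1 expr0 mulr1 (good_eqv Gb Gg t0) /P formV !mulmxA mulmxKV // mulmxV // mul1mx.
  exact: vecqE.
exists P1; split => // i; have [J10 J01] := J1.
have Q := good_odd Gb Hg Hh E go.
pose Y tau := (P1 *m slash k g (form b) tau) i 0.
have QY : qmix 2 (cuspexp h) Y.
  have QQ : forall l : 'I_2, qmix 2 (cuspexp h) (fun tau => P1 i l * slash k g (form b) tau l 0).
    by move=> l; apply: qmix_Z.
  by apply: qmix_ext (qmix_sum (index_enum 'I_2) QQ) => tau t0; rewrite /Y mxE.
have hu : rho h \in unitmx := rho_rep.1 _ Hh.
set J := P1 *m rho h *m invmx P1 in J10 J01.
have evJ a : eigenvalue (rho h) a = (a == J 0 0) || (a == J 1 1) by exact: eigenvalue_conj.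
have Jn : J i i != 0.
  have : \det J != 0.
    by rewrite !det_mulmx mulf_neq0 ?mulf_neq0 // -unitfE -unitmxE ?unitmx_inv.
  by rewrite det2 J10 mulr0 subr0 mulf_eq0 negb_or => /andP[? ?]; case: (ord2 i) => ->.
have [mu emu muR] := e2pi_surj01 Jn.
exists mu; first by rewrite evJ emu; case: (ord2 i) => ->; rewrite eqxx ?orbT.
have mu0 : 0 <= cRe mu by case/andP: muR.
(* A double eigenvalue leaves a single exponent, and powers of tau may remain. *)
have [JJ|JJ] := eqVneq (J 0 0) (J 1 1).
  have Sk kap : cuspexp h kap -> kap = mu.
    move=> [ek kR]; apply: e2pi_inj01 => //; move: ek; rewrite evJ JJ orbb => /eqP ->.
    by rewrite emu; case: (ord2 i) => ->; rewrite ?JJ.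
  have [d [c [Pc Ec]]] := qmix_pure (ltn0Sn 1) Sk QY.
  exists d, (fun j tau => qs mu (c j) (tau / 2%:R)); split => [j|tau t0].
    exact: cusp_expansion_qs.
  by rewrite -/(Y tau) Ec //; apply: eq_bigr => j _; rewrite /qterm mulrC.
(* Distinct eigenvalues make J diagonal; then tau -> tau + 2 multiplies Y by J i i, which excludes
   powers of tau. *)
have J0 : J 0 1 = 0 by case: J01 => // -[_ /eqP]; rewrite (negbTE JJ).
have Yper tau : upper tau -> Y (tau + 2%:R) = J i i * Y tau.
  move=> t0; rewrite /Y (slash_Tmx2 Gb Hg Hh E t0) mulmxA.
  rewrite -[P1 *m rho h](mulmxKV P1u) -/J -mulmxA mxE sum2.
  by case: (ord2 i) => ->; rewrite ?J0 ?J10 mul0r ?addr0 ?add0r.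
have [c Pc Ec] := qmix_separate (ltn0Sn 1) (fun kap (H : cuspexp h kap) => H.2) emu muR Yper QY.
exists 1%N, (fun _ tau => qs mu c (tau / 2%:R)); split => [j|tau t0].
  exact: cusp_expansion_qs.
by rewrite big_ord1 expr0 mulr1 -/(Y tau) Ec.
Qed.
End Good.

(** * Quasimodularity of E_2 and expansions at the cusps with c odd *)

Section Quasimodular.
Variable R : realType.
Local Notation C := (Cfield R).
Implicit Types (z w tau q : C) (g h : 'M[int]_2) (k : int) (u : nat -> C).
Local Notation upper := (@upper_half_plane R).
Local Notation disc := (@disc R).
Local Notation sg := (@sg R).
Local Notation eG := (@eG R).
Local Notation eA := (@eA R).
Local Notation eE := (@eE R).
Local Notation ee0 := (@ee0 R).
Local Notation tpi := (tpi R).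

Definition coeA n : C := (if n == 0%N then 1 else 0) - 24%:R * sg 1 n.
Definition coeG n : C := (if n == 0%N then 1 else 0) + (24%:R * sg 1 n - 48%:R * dil 2 (sg 1) n).

Lemma PS_coeA : PS 1 coeA.
Proof. exact: PSB (@PS_const _ _ _) (PSZ _ (@PS_sg R 1)). Qed.
Lemma PS_coeG : PS 1 coeG.
Proof.
exact: PSD (@PS_const _ _ _) (PSB (PSZ _ (@PS_sg R 1)) (PSZ _ (PS_dil (d := 2) (ltn0Sn 1) (@PS_sg R 1)))).
Qed.
Lemma coeA0 : coeA 0 = 1. Proof. by rewrite /coeA sg0 mulr0 subr0. Qed.
Lemma coeG0 : coeG 0 = 1. Proof. by rewrite /coeG dil0 sg0 !mulr0 subr0 addr0. Qed.

Lemma sE2_coe q : disc q -> sE2 q = ps coeA q.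
Proof.
move=> q1; rewrite (psB (@PS_const _ _ _) (PSZ _ (@PS_sg R 1)) q1) ps_const.
by rewrite (psZ _ (@PS_sg R 1) q1).
Qed.
Lemma sG_coe q : disc q -> sG q = ps coeG q.
Proof.
move=> q1; have P := @PS_sg R 1; have Pd := PS_dil (d := 2) (ltn0Sn 1) P.
rewrite (psD (@PS_const _ _ _) (PSB (PSZ _ P) (PSZ _ Pd)) q1) ps_const.
rewrite (psB (PSZ _ P) (PSZ _ Pd) q1) (psZ _ P q1) (psZ _ Pd q1) ps_dil //.
rewrite /sG /sE2; move: (ps _ q) (ps _ (q ^+ 2)) => x y; ring.
Qed.

Lemma eA_coe tau : upper tau -> eA tau = ps coeA (e2pi tau).
Proof. by move=> t0; rewrite /eA sE2_coe //; exact: e2pi_disc. Qed.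
Lemma eG_coe tau : upper tau -> eG tau = ps coeG (e2pi tau).
Proof. by move=> t0; rewrite /eG sG_coe //; exact: e2pi_disc. Qed.

Lemma isD_aut g (n : int) tau : aut g tau != 0 ->
  isD (fun x => aut g x ^ n) tau (n%:~R * (g 1 0)%:~R / tpi * aut g tau ^ (n - 1)).
Proof.
move=> n0; have L : cder (aut g) tau (g 1 0)%:~R.
  apply: cder_eq (cderD (cderZ _ (cder_id tau)) (cder_cst _ tau)) _; by rewrite mulr1 addr0.
have tn := tpi_neq0 R.
case: n => [[|n]|n].
- by apply: isD_eq (isD_cst 1 tau) _; rewrite !mul0r.
- apply: cder_eq (cderX n L) _; have -> : n.+1%:Z - 1 = n%:Z by lia.
  by rewrite -exprnP -[n.+1%:~R]/(n.+1%:R); move: (n.+1%:R : C) => m; field.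
- have X0 : aut g tau ^+ n.+1 != 0 by rewrite expf_neq0.
  apply: cder_eq (cderV (f := fun x => aut g x ^+ n.+1) X0 (cderX n L)) _.
  have -> : Negz n - 1 = - (n.+2)%:Z by rewrite NegzE; lia.
  have -> : aut g tau ^ (- (n.+2)%:Z) = (aut g tau ^+ n.+2)^-1 by rewrite -exprz_inv -exprnP exprVn.
  rewrite NegzE mulrNz -[n.+1%:~R]/(n.+1%:R).
  move: (n.+1%:R : C) => m; rewrite !exprS in X0 *; move: X0; rewrite mulf_eq0 negb_or => /andP[_ Y0].
  by field; rewrite tn Y0 n0.
Qed.

(** The logarithmic derivative of E. As E_2 = 3 phi - 2 G, the law of E_2 follows by differentiating
    that of E and using that of G. *)
Definition phi tau : C := (2%:R * eG tau + eA tau) / 3%:R.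

Lemma even_c g : (2 %| (g 1 0)%R)%Z -> exists c' : int, g 1 0 = 2 * c'.
Proof. by move=> /dvdzP [m ->]; exists m; rewrite mulrC. Qed.
(** For c odd the choice j = d works in [e4_dbl_odd], since d - d c = d (1 - c) is even. *)
Lemma odd_c g : ~~ (2 %| (g 1 0)%R)%Z -> exists e : int, g 1 1 - g 1 1 * g 1 0 = 2 * e.
Proof.
move=> H; exists (- g 1 1 * ((g 1 0)%R %/ 2)%Z).
move: H; move: (g 1 0) (g 1 1) => x y H.
have H1 : (x %% 2)%Z = 1.
  have a := modz_ge0 x (isT : 2 != 0 :> int); have b := ltz_mod x (isT : 2 != 0 :> int).
  have n : (x %% 2)%Z <> 0 by move/dvdz_mod0P; exact/negP.
  by move: a b n; move: (x %% 2)%Z; lia.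
by rewrite {1}(divz_eq x 2) H1; ring.
Qed.

Section Aut.
Variables (g : 'M[int]_2) (tau : C).
Hypotheses (Hg : SL2Z g) (t0 : upper tau).
Local Notation X := (aut g tau).
Local Notation c := ((g 1 0)%:~R : C).

Lemma isD_moebius f l : isD f (moebius g tau) l -> isD (fun x => f (moebius g x)) tau (l * X ^- 2).
Proof. exact: isD_mob t0 (SL2Z_det Hg). Qed.

Lemma eG_Gamma02 : (2 %| (g 1 0)%R)%Z -> eG (moebius g tau) = X ^+ 2 * eG tau.
Proof. by move=> /even_c [c' E]; exact: eG_even t0 (SL2Z_det Hg) E. Qed.
Lemma eE_Gamma02 : (2 %| (g 1 0)%R)%Z -> eE (moebius g tau) = X ^+ 4 * eE tau.
Proof. by move=> /even_c [c' E]; rewrite -[eE (moebius g tau)]/(eE (mob _ _ _ _ tau)) (eE_even t0 (SL2Z_det Hg) E). Qed.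

Lemma phi_eE x : upper x -> isD eE x (phi x * eE x).
Proof. exact: isD_eE. Qed.

Lemma isD_aut4 x : upper x -> isD (fun x => aut g x ^+ 4) x (4%:R * c / tpi * aut g x ^+ 3).
Proof. by move=> x0; exact: isD_aut (4 : int) x (aut_neq0 Hg x0). Qed.
End Aut.

Lemma eA_phi tau : eA tau = 3%:R * phi tau - 2%:R * eG tau.
Proof. by rewrite /phi; field. Qed.

Lemma eA_Gamma02 g tau : SL2Z g -> upper tau -> (2 %| (g 1 0)%R)%Z ->
  eA (moebius g tau) = aut g tau ^+ 2 * eA tau + 12%:R * (g 1 0)%:~R / tpi * aut g tau.
Proof.
move=> Hg t0 ge; have X0 := aut_neq0 Hg t0; have tn := tpi_neq0 R.
have H1 := isD_moebius Hg t0 (phi_eE (upper_moebius Hg t0)).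
have H2 := isD_M (isD_aut4 Hg t0) (phi_eE t0).
have H3 := isD_ext t0 (fun x x0 => eE_Gamma02 Hg x0 ge) H1.
have := isD_uniq H3 H2; rewrite eE_Gamma02 // => E.
have e0 := eE_neq0 t0.
suff P : phi (moebius g tau) = aut g tau ^+ 2 * phi tau + 4%:R * (g 1 0)%:~R / tpi * aut g tau.
  by rewrite !eA_phi P eG_Gamma02 //; field.
have N0 : aut g tau ^+ 2 * eE tau != 0 by rewrite mulf_neq0 ?expf_neq0.
apply: (mulIf N0); move: E; move: (phi (moebius g tau)) (phi tau) (eE tau) e0 {N0 H1 H2 H3} => p p' e e0 E.
have -> : p * (aut g tau ^+ 2 * e) = p * (aut g tau ^+ 4 * e) * aut g tau ^- 2 by field.
by rewrite E; field.
Qed.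

(** As for c even, except that E becomes a multiple of [ee0] at (tau + d) / 2, whose logarithmic
    derivative is (E_2 - G) / 3 up to the factor 1/2 of the inner map. *)
Lemma eA_odd g tau : SL2Z g -> upper tau -> ~~ (2 %| (g 1 0)%R)%Z ->
  eA (moebius g tau) = aut g tau ^+ 2 * ((eA ((tau + (g 1 1)%:~R) / 2%:R) + eG ((tau + (g 1 1)%:~R) / 2%:R)) / 2%:R)
     + 12%:R * (g 1 0)%:~R / tpi * aut g tau.
Proof.
move=> Hg t0 /odd_c [e dE]; have X0 := aut_neq0 Hg t0; have tn := tpi_neq0 R.
have h0 := upper_half (g 1 1) t0; have D := SL2Z_det Hg.
have H1 := isD_moebius Hg t0 (phi_eE (upper_moebius Hg t0)).
have H2 := isD_M (isD_aut4 Hg t0) (isD_Z (4%:R^-1) (isD_half (isD_ee0 h0))).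
have EE x : upper x -> eE (moebius g x) = aut g x ^+ 4 * (4%:R^-1 * ee0 ((x + (g 1 1)%:~R) / 2%:R)).
  by move=> x0; rewrite [4%:R^-1 * _]mulrC -[eE (moebius g x)]/(eE (mob _ _ _ _ x)) (eE_odd x0 D dE).
have H3 := isD_ext t0 EE H1.
have := isD_uniq H3 H2; rewrite EE // => E.
have e0 := ee0_neq0 h0.
have GE : eG (moebius g tau) = - 2%:R^-1 * aut g tau ^+ 2 * eG ((tau + (g 1 1)%:~R) / 2%:R) := eG_odd t0 D dE.
rewrite eA_phi GE.
set t := (tau + _) / _ in E e0 *.
suff -> : phi (moebius g tau) = aut g tau ^+ 2 * ((eA t - eG t) / 3%:R / 2%:R) + 4%:R * (g 1 0)%:~R / tpi * aut g tau.
  by move: (eA t) (eG t) => a b; field.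
have N0 : aut g tau ^+ 2 * ee0 t != 0 by rewrite mulf_neq0 ?expf_neq0.
apply: (mulIf N0); move: E; move: (phi (moebius g tau)) (eA t) (eG t) (ee0 t) e0 {N0 H1 H2 H3 GE EE} => p a b e1 e1n E.
have -> : p * (aut g tau ^+ 2 * e1) = 4%:R * (p * (aut g tau ^+ 4 * (4%:R^-1 * e1)) * aut g tau ^- 2) by field.
by rewrite E; field.
Qed.

(** Replaces q by x q; with x = e2pi (d / 2) it realizes tau -> tau + d in a series in q^(1/2). *)
Definition twist (x : C) u n : C := x ^+ n * u n.
Lemma ps_twist x u z : ps (twist x u) z = ps u (x * z).
Proof. by apply: eq_sumC => n; rewrite /twist exprMn; ring. Qed.
Lemma PS_twist x u : cabs x = 1 -> PS 1 u -> PS 1 (twist x u).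
Proof. by move=> x1; apply: PS_le => n; rewrite /twist cabsM cabsX x1 expr1n mul1r. Qed.

Lemma cabs_halfint (d : int) : cabs (e2pi (d%:~R / 2%:R) : C) = 1.
Proof.
have E : e2pi (d%:~R / 2%:R) ^+ 2 = 1 :> C by rewrite -e2piMn mulrC divfK ?pnatr_eq0 // e2pi_int.
have := congr1 (@cabs R) E; rewrite cabsX cabs1 => /eqP; rewrite sqrf_eq1 => /orP[/eqP //|/eqP H].
by have := cabs_ge0 (e2pi (d%:~R / 2%:R) : C); rewrite H; lra.
Qed.

Lemma e2pi_half_shift (d : int) tau : e2pi ((tau + d%:~R) / 2%:R) = e2pi (d%:~R / 2%:R) * e2pi (tau / 2%:R) :> C.
Proof. by rewrite addrC mulrDl e2piD. Qed.

Lemma eG_odd_ps g : SL2Z g -> ~~ (2 %| (g 1 0)%R)%Z ->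
  exists2 u, PS 1 u & forall tau, upper tau -> aut g tau ^- 2 * eG (moebius g tau) = ps u (e2pi (tau / 2%:R)).
Proof.
move=> Hg /odd_c [e dE]; have Pt := PS_twist (cabs_halfint (g 1 1)) PS_coeG.
exists (fun n => - 2%:R^-1 * twist (e2pi ((g 1 1)%:~R / 2%:R)) coeG n); first exact: PSZ.
move=> tau t0; have X0 := aut_neq0 Hg t0; have h0 := upper_half (g 1 1) t0.
have GE : eG (moebius g tau) = - 2%:R^-1 * aut g tau ^+ 2 * eG ((tau + (g 1 1)%:~R) / 2%:R) := eG_odd t0 (SL2Z_det Hg) dE.
rewrite (psZ _ Pt (e2pi_disc (upper_divN (ltn0Sn 1) t0))) ps_twist -e2pi_half_shift -(eG_coe h0) GE.
by field.
Qed.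

(** E becomes a multiple of the product [ee0], whose inverse is the exponential solution for
    -[chie0]. *)
Lemma eEV_odd_ps g : SL2Z g -> ~~ (2 %| (g 1 0)%R)%Z ->
  exists2 u, PS 1 u & forall tau, upper tau -> aut g tau ^+ 4 * (eE (moebius g tau))^-1 = ps u (e2pi (tau / 2%:R)).
Proof.
move=> Hg /odd_c [e dE]; pose v := expsol (fun n => -1 * @chie0 R n).
have Pv : PS 1 v by apply: expsol_PS; apply: PSZ; exact: PS_chie0.
have Pt := PS_twist (cabs_halfint (g 1 1)) Pv.
exists (fun n => 4%:R / 3%:R * twist (e2pi ((g 1 1)%:~R / 2%:R)) v n); first exact: PSZ.
move=> tau t0; have X0 := aut_neq0 Hg t0; have h0 := upper_half (g 1 1) t0.
have EE : eE (moebius g tau) = aut g tau ^+ 4 * (ee0 ((tau + (g 1 1)%:~R) / 2%:R) / 4%:R).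
  by rewrite -[eE (moebius g tau)]/(eE (mob _ _ _ _ tau)) (eE_odd t0 (SL2Z_det Hg) dE).
rewrite (psZ _ Pt (e2pi_disc (upper_divN (ltn0Sn 1) t0))) ps_twist -e2pi_half_shift EE.
have e0n := ee0_neq0 h0; move: e0n; rewrite /ee0 (se0_prod (e2pi_disc h0)) => e0n.
have := expsol_inv (@PS_chie0 R) (e2pi_disc h0); rewrite -/v => I.
have un : ps (expsol (@chie0 R)) (e2pi ((tau + (g 1 1)%:~R) / 2%:R)) != 0 by move: e0n; rewrite mulf_eq0 negb_or => /andP[].
have -> : ps v (e2pi ((tau + (g 1 1)%:~R) / 2%:R)) = (ps (expsol (@chie0 R)) (e2pi ((tau + (g 1 1)%:~R) / 2%:R)))^-1.
  by apply: (mulfI un); rewrite I mulfV.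
move: (ps _ _) un => x un; by field; rewrite X0 un.
Qed.

(** Solves (2 pi i)^-1 f' = p f: the constant term of p gives the power of q, the other coefficients
    the power series factor. *)
Definition linsol (p : nat -> C) : C -> C := qs (p 0%N) (expsol (fun n => p n.+1)).

Lemma linsol_isD p tau : PS 1 p -> upper tau -> isD (linsol p) tau (ps p (e2pi tau) * linsol p tau).
Proof.
move=> Hp t0; have q1 := e2pi_disc t0; have Hs := PS_shift Hp.
have H1 : isD (fun x => e2pi (p 0%N * x)) tau (p 0%N * e2pi (p 0%N * tau)).
  apply: cder_eq (cder_comp (cderZ (p 0%N) (cder_id tau)) (e2pi_cder (p 0%N * tau))) _; ring.
have H2 : isQD (ps (expsol (fun n => p n.+1))) (e2pi tau) (e2pi tau * (ps (fun n => p n.+1) (e2pi tau) * ps (expsol (fun n => p n.+1)) (e2pi tau))).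
  by exists (ps (fun n => p n.+1) (e2pi tau) * ps (expsol (fun n => p n.+1)) (e2pi tau)); first exact: expsol_cder.
rewrite /linsol [X in isD X]qs_fun; apply: isD_eq (isD_M H1 (isD_q H2)) _; rewrite qsE (ps_recl Hp q1).
move: (e2pi _) (ps _ _) (ps _ _) (e2pi _) => a b c d; ring.
Qed.

Lemma linsol_neq0 p tau : PS 1 p -> upper tau -> linsol p tau != 0.
Proof.
move=> Hp t0; rewrite /linsol qsE; apply: mulf_neq0; first exact: e2pi_neq0.
by apply: expsol_neq0; [exact: PS_shift | exact: e2pi_disc].
Qed.

Lemma upper_convex (x y : C) (t : R) : upper x -> upper y -> 0 <= t <= 1 -> upper (x + ofR t * (y - x)).
Proof.
rewrite /upper_half_plane cImD cImM cRe_ofR cIm_ofR mul0r addr0 cImD cImN => x0 y0 /andP[a b].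
have : 0 <= t * cIm y by apply: mulr_ge0 => //; exact: ltW.
have [t1|t1] := ltrP t 1; first by have : 0 < (1 - t) * cIm x by [apply: mulr_gt0 => //; lra]; lra.
by have -> : t = 1 by [lra]; lra.
Qed.

Lemma upper_i : upper (iC R). Proof. by rewrite /upper_half_plane /cIm /= ltr01. Qed.

Lemma linear_ode p f : PS 1 p -> (forall tau, upper tau -> isD f tau (ps p (e2pi tau) * f tau)) ->
  exists s, forall tau, upper tau -> f tau = s * linsol p tau.
Proof.
move=> Hp Hf; exists (f (iC R) / linsol p (iC R)) => tau t0.
have D x : upper x -> cder (fun x => f x / linsol p x) x 0.
  move=> x0; have n0 := linsol_neq0 Hp x0.
  apply: cder_eq (isD_M (Hf _ x0) (isD_V n0 (linsol_isD Hp x0))) _.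
  move: (linsol p x) n0 (f x) (ps _ _) => a a0 b c; field; exact: a0.
rewrite -(cder0_cst upper_convex D t0 upper_i); have n0 := linsol_neq0 Hp t0.
by rewrite divfK.
Qed.
End Quasimodular.

(** * Forms of least weight *)

Section Components.
Variable R : realType.
Local Notation C := (Cfield R).
Variables (rho : 'M[int]_2 -> 'M[C]_2) (P0 : 'M[C]_2) (nu : 'I_2 -> C).
Implicit Types (tau : C) (g : 'M[int]_2) (k : int) (b : 'I_2 -> nat -> C).
Local Notation upper := (@upper_half_plane R).

(* Scalar versions of form and good; the locks keep unification from
   unfolding matrices and power series. *)
Definition invcoef (i j : 'I_2) : C := locked (invmx P0 i j).
Definition fc b tau i : C := locked (form P0 nu b tau i 0).

Lemma fc_form b tau i : fc b tau i = form P0 nu b tau i 0.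
Proof. by rewrite /fc -lock. Qed.
Lemma invcoefE i j : invcoef i j = invmx P0 i j.
Proof. by rewrite /invcoef -lock. Qed.

Lemma fcE b tau i : fc b tau i = invcoef i 0 * qs (nu 0) (b 0) tau + invcoef i 1 * qs (nu 1) (b 1) tau.
Proof. by rewrite fc_form formV mxE sum2 -!invcoefE !vecqE. Qed.

Record goodc k b : Prop := Goodc {
  goodc_PS : forall i, PS 1 (b i);
  goodc_eqv : forall g tau i, Gamma02 g -> upper tau ->
    aut g tau ^ (- k) * fc b (moebius g tau) i = rho g i 0 * fc b tau 0 + rho g i 1 * fc b tau 1;
  goodc_odd : forall g h, SL2Z g -> Gamma02 h -> g * Tmx ^+ 2 = h * g -> ~~ (2 %| (g 1 0)%R)%Z ->
    forall i, qmix 2 (cuspexp rho h) (fun tau => aut g tau ^ (- k) * fc b (moebius g tau) i) }.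

Lemma slash_fc k g b tau i : slash k g (form P0 nu b) tau i 0 = aut g tau ^ (- k) * fc b (moebius g tau) i.
Proof. rewrite fc_form; exact: mxE. Qed.

Lemma goodP k b : good rho P0 nu k b <-> goodc k b.
Proof.
have E g i : (fun tau => slash k g (form P0 nu b) tau i 0) = (fun tau => aut g tau ^ (- k) * fc b (moebius g tau) i).
  by apply/funext => tau; exact: slash_fc.
have M g tau i : (rho g *m form P0 nu b tau) i 0 = rho g i 0 * fc b tau 0 + rho g i 1 * fc b tau 1.
  by rewrite !fc_form mxE sum2.
split=> -[H1 H2 H3]; split => //.
- by move=> g tau i Hg t0; rewrite -slash_fc -M; congr (_ _ i 0); exact: H2.
- by move=> g h Hg Hh Egh go i; rewrite -E; exact: (H3 g h).
- by move=> g tau Hg t0; apply/colP => i; apply: etrans (slash_fc k g b tau i) (etrans (H2 g tau i Hg t0) _); rewrite M.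
- by move=> g h Hg Hh Egh go i; rewrite E; exact: (H3 g h).
Qed.
End Components.

(** * Operations on coefficient pairs and the second order equation *)

Section MinimalWeight.
Variables (R : realType).
Local Notation C := (Cfield R).
Variables (rho : 'M[int]_2 -> 'M[C]_2) (P0 : 'M[C]_2) (nu : 'I_2 -> C).
Hypotheses (rho_rep : representation rho) (rho_irr : irreducible rho) (P0u : P0 \in unitmx).
Implicit Types (tau kap mu x y : C) (g h : 'M[int]_2) (b : 'I_2 -> nat -> C) (k : int).
Local Notation upper := (@upper_half_plane R).
Local Notation good := (goodc rho P0 nu).
Local Notation fc := (fc P0 nu).
Local Notation invcoef := (invcoef P0).
Local Notation eG := (@eG R).
Local Notation eA := (@eA R).
Local Notation eE := (@eE R).
Local Notation tpi := (tpi R).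
Local Notation cuspexp := (cuspexp rho).

Lemma eE_prod tau : upper tau -> eE tau = 192%:R * e2pi tau * ps (expsol (@chiE R)) (e2pi tau).
Proof. by move=> t0; rewrite /eE sE_prod //; exact: e2pi_disc. Qed.

Lemma qs_eq0 (n : C) (u : nat -> C) : PS 1 u -> (forall tau, upper tau -> qs n u tau = 0) -> forall m, u m = 0.
Proof.
move=> Hu H; apply: (ps_zero ltr01 Hu) => z z0 z1.
have [w Hw] := e2pi_surj z0.
have w0 : upper w.
  have : expR (- (2 * pi * cIm w)) < expR 0 :> R by rewrite -cabs_e2pi Hw expR0.
  rewrite ltr_expR oppr_lt0 pmulr_rgt0 //; apply: mulr_gt0 => //; exact: pi_gt0.
have /eqP := H w w0; rewrite qsE Hw mulf_eq0 (negbTE (e2pi_neq0 _)) => /eqP; exact.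
Qed.

Lemma good_lin k b b' x y : good k b -> good k b' -> good k (fun i n => x * b i n + y * b' i n).
Proof.
move=> G1 G2; have P1 := goodc_PS G1; have P2 := goodc_PS G2.
set b'' := fun i => _.
have FL tau i : upper tau -> fc b'' tau i = x * fc b tau i + y * fc b' tau i.
  move=> t0; have E j : qs (nu j) (b'' j) tau = x * qs (nu j) (b j) tau + y * qs (nu j) (b' j) tau.
    rewrite /b'' qsD; [|exact: PSZ|exact: PSZ|exact: t0].
    by rewrite (qsZ _ _ (P1 j) t0) (qsZ _ _ (P2 j) t0).
  by rewrite !fcE !E; ring.
split.
- by move=> i; apply: PSD; apply: PSZ.
- move=> g tau i Hg t0; rewrite !FL //; last by apply: upper_moebius => //; case: Hg.
  have e1 := goodc_eqv G1 i Hg t0; have e2 := goodc_eqv G2 i Hg t0.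
  move: (aut g tau ^ _) (fc b (moebius g tau) i) (fc b' (moebius g tau) i) (fc b tau 0) (fc b tau 1)
    (fc b' tau 0) (fc b' tau 1) (rho g i 0) (rho g i 1) e1 e2 => X p p' p0 p1 p0' p1' r0 r1 e1 e2.
  transitivity (x * (X * p) + y * (X * p')); first by ring.
  by rewrite e1 e2; ring.
- move=> g h Hg Hh E go i.
  have Q1 := qmix_Z x (ltn0Sn 1) (goodc_odd G1 Hg Hh E go i).
  have Q2 := qmix_Z y (ltn0Sn 1) (goodc_odd G2 Hg Hh E go i).
  apply: qmix_ext (qmix_add Q1 Q2) => tau t0; rewrite FL; last exact: upper_moebius.
  by move: (aut _ _ ^ _) (fc b _ _) (fc b' _ _) => X p p'; ring.
Qed.

(** Common to multiplication by G, with w = 2, and division by E, with w = -4. *)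
Lemma good_mul k (w : int) b b' (m : C -> C) : good k b -> (forall i, PS 1 (b' i)) ->
  (forall i tau, upper tau -> qs (nu i) (b' i) tau = m tau * qs (nu i) (b i) tau) ->
  (forall g tau, SL2Z g -> upper tau -> (2 %| (g 1 0)%R)%Z -> m (moebius g tau) = aut g tau ^ w * m tau) ->
  (forall g, SL2Z g -> ~~ (2 %| (g 1 0)%R)%Z -> exists2 u, PS 1 u &
     forall tau, upper tau -> aut g tau ^ (- w) * m (moebius g tau) = ps u (e2pi (tau / 2%:R))) ->
  good (k + w) b'.
Proof.
move=> Gb P' Hb me mo.
have FL tau i : upper tau -> fc b' tau i = m tau * fc b tau i.
  by move=> t0; rewrite !fcE !Hb //; ring.
have SL g tau i : SL2Z g -> upper tau -> aut g tau ^ (- (k + w)) * fc b' (moebius g tau) i =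
    (aut g tau ^ (- w) * m (moebius g tau)) * (aut g tau ^ (- k) * fc b (moebius g tau) i).
  move=> Hg t0; rewrite FL; last exact: upper_moebius.
  by rewrite opprD expfzDr; [ring | exact: aut_neq0].
split; first exact: P'.
- move=> g tau i Hg t0; have [Hg1 Hg2] := Hg; have e := goodc_eqv Gb i Hg t0.
  have W : aut g tau ^ (- w) * aut g tau ^ w = 1 by rewrite -expfzDr ?aut_neq0 // addNr expr0z.
  by rewrite (SL _ _ _ Hg1 t0) e (me _ _ Hg1 t0 Hg2) mulrA W mul1r !FL //; ring.
- move=> g h Hg Hh E go i; have [u Pu Eu] := mo g Hg go.
  apply: qmix_ext (qmix_mul (ltn0Sn 1) Pu (goodc_odd Gb Hg Hh E go i)) => tau t0.
  by rewrite (SL _ _ _ Hg t0) (Eu _ t0).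
Qed.

Definition mulG b i := conv (@coeG R) (b i).

Lemma mulG_qs b i tau : PS 1 (b i) -> upper tau -> qs (nu i) (mulG b i) tau = eG tau * qs (nu i) (b i) tau.
Proof. by move=> Hb t0; rewrite eG_coe // qs_mul //; exact: PS_coeG. Qed.

Lemma good_mulG k b : good k b -> good (k + 2) (mulG b).
Proof.
move=> Gb; have Pb := goodc_PS Gb; apply: (good_mul (m := eG) Gb).
- by move=> i; exact: PS_conv (@PS_coeG R) (Pb i).
- by move=> i tau t0; exact: mulG_qs.
- by move=> g tau Hg t0 ge; exact: eG_Gamma02.
- move=> g Hg go; have [u Pu Eu] := eG_odd_ps R Hg go; exists u => // tau t0; rewrite -Eu //.
Qed.

Definition uinv : nat -> C := expsol (fun n => -1 * @chiE R n).
Lemma PS_uinv : PS 1 uinv.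
Proof. by apply: expsol_PS; apply: PSZ; exact: PS_chiE. Qed.

(* Division by E, which starts with 192 q; meaningful if b i 0 = 0. *)
Definition divE b i n : C := 192%:R^-1 * conv uinv (fun m => b i m.+1) n.

Lemma PS_divE b i : PS 1 (b i) -> PS 1 (divE b i).
Proof. by move=> Hb; apply: PSZ; apply: PS_conv; [exact: PS_uinv | exact: PS_shift]. Qed.

Lemma divE_qs b i tau : PS 1 (b i) -> b i 0%N = 0 -> upper tau ->
  qs (nu i) (divE b i) tau = (eE tau)^-1 * qs (nu i) (b i) tau.
Proof.
move=> Hb b0 t0; have q1 := e2pi_disc t0; have Hs := PS_shift Hb.
rewrite /divE qsZ; [|exact: PS_conv PS_uinv Hs|exact: t0].
rewrite -(qs_mul _ PS_uinv Hs t0) !qsE (ps_recl Hb q1) b0 add0r.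
have := expsol_inv (@PS_chiE R) q1; rewrite -/uinv => I.
have en := eE_neq0 t0; move: en; rewrite (eE_prod t0) => en.
move: en I; move: (ps (expsol _) _) (ps uinv _) (e2pi_neq0 tau) => a b' q0 en I.
have [a0 b'E] : a != 0 /\ b' = a^-1.
  have a0 : a != 0 by move: en; rewrite mulf_eq0 negb_or => /andP[].
  by split => //; apply: (mulfI a0); rewrite I mulfV.
rewrite b'E; move: (e2pi (nu i * tau)) (e2pi tau) q0 {q1 en} => s t q0.
move: (ps _ t) => p.
by field; rewrite q0 a0.
Qed.

Lemma good_divE k b : good k b -> (forall i, b i 0%N = 0) -> good (k - 4) (divE b).
Proof.
move=> Gb b0; have Pb := goodc_PS Gb; apply: (good_mul (m := fun tau => (eE tau)^-1) Gb).
- by move=> i; exact: PS_divE.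
- by move=> i tau t0; exact: divE_qs.
- move=> g tau Hg t0 ge; rewrite eE_Gamma02 // invfM -exprz_inv -[4]/(4%:Z) -exprnP exprVn //.
- move=> g Hg go; have [u Pu Eu] := eEV_odd_ps R Hg go; exists u => // tau t0; rewrite -Eu //.
Qed.

(* The Serre derivative on coefficients. *)
Definition theta k b i n : C := (nu i + n%:R) * b i n - (k%:~R / 12%:R) * conv (@coeA R) (b i) n.

Lemma PS_theta k b i : PS 1 (b i) -> PS 1 (theta k b i).
Proof.
by move=> Hb; apply: PSB; [exact: PS_lin | apply: PSZ; exact: PS_conv (@PS_coeA R) Hb].
Qed.

Lemma theta_qs k b i tau : PS 1 (b i) -> upper tau ->
  qs (nu i) (theta k b i) tau = qs (nu i) (fun n => (nu i + n%:R) * b i n) tau - k%:~R / 12%:R * eA tau * qs (nu i) (b i) tau.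
Proof.
move=> Hb t0; have Pc := PS_conv (@PS_coeA R) Hb.
rewrite /theta !qsE (psB (PS_lin _ Hb) (PSZ _ Pc) (e2pi_disc t0)) (psZ _ Pc (e2pi_disc t0)).
by rewrite (ps_conv (@PS_coeA R) Hb (e2pi_disc t0)) -eA_coe // ; ring.
Qed.

Lemma qs_isD k b i tau : PS 1 (b i) -> upper tau ->
  isD (qs (nu i) (b i)) tau (qs (nu i) (theta k b i) tau + k%:~R / 12%:R * eA tau * qs (nu i) (b i) tau).
Proof. by move=> Hb t0; apply: isD_eq (isD_qs (nu i) Hb t0) _; rewrite theta_qs // subrK. Qed.

Lemma fc_isD_theta k b i tau : (forall i, PS 1 (b i)) -> upper tau ->
  isD (fun x => fc b x i) tau (fc (theta k b) tau i + k%:~R / 12%:R * eA tau * fc b tau i).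
Proof.
move=> Hb t0; have -> : (fun x => fc b x i) = (fun x => invcoef i 0 * qs (nu 0) (b 0) x + invcoef i 1 * qs (nu 1) (b 1) x).
  by apply/funext => x; exact: fcE.
apply: isD_eq (isD_D (isD_Z (invcoef i 0) (qs_isD k (Hb 0) t0)) (isD_Z (invcoef i 1) (qs_isD k (Hb 1) t0))) _.
by rewrite !fcE; ring.
Qed.

(** The bracket is E_2 at the image point, rescaled and freed of its quasimodular term. For c even
    it is E_2(tau) again, so that the Serre derivative respects the slash action. *)
Lemma slash_isD k b g tau i : SL2Z g -> (forall i, PS 1 (b i)) -> upper tau ->
  isD (fun x => aut g x ^ (- k) * fc b (moebius g x) i) tau
   (aut g tau ^ (- (k + 2)) * fc (theta k b) (moebius g tau) i +
     k%:~R / 12%:R * (aut g tau ^- 2 * eA (moebius g tau) - 12%:R * (g 1 0)%:~R / tpi / aut g tau) * (aut g tau ^ (- k) * fc b (moebius g tau) i)).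
Proof.
move=> Hg Hb t0; have X0 := aut_neq0 Hg t0; have tn := tpi_neq0 R.
have H1 := isD_moebius Hg t0 (fc_isD_theta k i Hb (upper_moebius Hg t0)).
apply: isD_eq (isD_M (isD_aut (- k) X0) H1) _.
rewrite opprD !expfzDr // rmorphN /=.
have -> : aut g tau ^ (-2) = aut g tau ^- 2 by rewrite -exprz_inv -[2]/(2%:Z) -exprnP exprVn.
have -> : aut g tau ^ (-1) = (aut g tau)^-1 by rewrite -exprz_inv expr1z.
move: (aut g tau ^ _) (fc _ _ i) (fc _ _ i) (eA _) => a b' c d.
by field; rewrite tn X0.
Qed.

Lemma good_theta k b : good k b -> good (k + 2) (theta k b).
Proof.
move=> Gb; have Pb := goodc_PS Gb.
split.
- by move=> i; exact: PS_theta.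
- move=> g tau i Hg t0; have [Hg1 Hg2] := Hg.
  have X0 := aut_neq0 Hg1 t0; have tn := tpi_neq0 R.
  have H := slash_isD k i Hg1 Pb t0.
  have H2 : isD (fun x => aut g x ^ (- k) * fc b (moebius g x) i) tau
     (rho g i 0 * (fc (theta k b) tau 0 + k%:~R / 12%:R * eA tau * fc b tau 0) +
      rho g i 1 * (fc (theta k b) tau 1 + k%:~R / 12%:R * eA tau * fc b tau 1)).
    apply: isD_ext t0 _ (isD_D (isD_Z (rho g i 0) (fc_isD_theta k 0 Pb t0)) (isD_Z (rho g i 1) (fc_isD_theta k 1 Pb t0))) => x x0.
    by rewrite (goodc_eqv Gb i Hg x0).
  have := isD_uniq H H2; rewrite (goodc_eqv Gb i Hg t0).
  have -> : aut g tau ^- 2 * eA (moebius g tau) - 12%:R * (g 1 0)%:~R / tpi / aut g tau = eA tau.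
    by rewrite eA_Gamma02 //; move: (eA tau) => a; field; rewrite tn X0.
  move: (aut g tau ^ _ * _) (rho g i 0) (rho g i 1) => a r0 r1.
  move: (fc _ tau 0) (fc _ tau 1) (fc _ tau 0) (fc _ tau 1) (eA tau) => c d c' d' e E.
  apply: (addIr (k%:~R / 12%:R * e * (r0 * c' + r1 * d'))).
  by rewrite E; ring.
- move=> g h Hg Hh E go i; have Q := goodc_odd Gb Hg Hh E go i.
  (* For c odd [eA_odd] turns the E_2 correction into a twisted power series in q^(1/2), whose
     factor 1/2 makes k / 12 into k / 24. *)
  have [f' Qf Df] := qmix_D (ltn0Sn 1) Q.
  have Pt := PS_twist (cabs_halfint R (g 1 1)) (PSD (@PS_coeA R) (@PS_coeG R)).
  set v := twist _ _ in Pt.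
  have Qv := qmix_Z (- (k%:~R / 24%:R)) (ltn0Sn 1) (qmix_mul (ltn0Sn 1) Pt Q).
  apply: qmix_ext (qmix_add Qf Qv) => tau t0.
  have X0 := aut_neq0 Hg t0; have tn := tpi_neq0 R.
  have h0 := upper_half (g 1 1) t0.
  have D := isD_uniq (Df tau t0) (slash_isD k i Hg Pb t0).
  rewrite D /v ps_twist -e2pi_half_shift (psD (@PS_coeA R) (@PS_coeG R) (e2pi_disc h0)).
  rewrite -(eA_coe h0) -(eG_coe h0) eA_odd //.
  move: (aut g tau ^ _ * _) (aut g tau ^ _ * _) (eA _) (eG _) => a c d e.
  by field; rewrite tn X0.
Qed.

Variable k0 : int.
Hypothesis k0_min : forall k b, good k b -> k < k0 -> forall i n, b i n = 0.

(* Division by E lowers the weight by 4. *)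
Lemma vanish_at_infinity k b : good k b -> k < k0 + 4 -> (forall i, b i 0%N = 0) -> forall i n, b i n = 0.
Proof.
move=> Gb kk b0 i; have Pb := goodc_PS Gb i; apply: (qs_eq0 (n := nu i) Pb) => tau t0.
have Z : divE b i = fun=> 0 by apply/funext => n; apply: (k0_min (good_divE Gb b0)); lia.
have := divE_qs Pb (b0 i) t0; rewrite Z qs0 => /esym /eqP.
by rewrite mulf_eq0 invr_eq0 (negbTE (eE_neq0 t0)) => /eqP.
Qed.

Lemma conv0 u v : conv u v 0 = u 0%N * v 0%N :> C.
Proof. by rewrite /conv big_ord1. Qed.

Lemma theta_at0 k b i : theta k b i 0 = (nu i - k%:~R / 12%:R) * b i 0%N.
Proof. by rewrite /theta conv0 coeA0 addr0; ring. Qed.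
Lemma mulG_at0 b i : mulG b i 0 = b i 0%N.
Proof. by rewrite /mulG conv0 coeG0 mul1r. Qed.

(** Gamma_0(2) would preserve the line spanned by w, against irreducibility. *)
Lemma no_common_line (f : C -> C) (w : 'I_2 -> C) k b : good k b -> (exists i, w i != 0) ->
  (forall tau, upper tau -> f tau != 0) -> (forall tau i, upper tau -> fc b tau i = f tau * w i) -> False.
Proof.
move=> Gb [i0 wi0] f0 H; pose v : 'cV[C]_2 := \col_i w i.
have v0 : v != 0 by apply: contraNneq wi0 => /colP /(_ i0); rewrite !mxE => ->.
have [] := rho_irr (W := <[v]>%VS).
- move=> g v' Hg /vlineP [a ->]; have t0 := upper_i R.
  rewrite -scalemxAr; apply: rpredZ; apply/vlineP.
  exists ((f (iC R))^-1 * (aut g (iC R) ^ (- k) * f (moebius g (iC R)))).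
  apply/colP => i; have := goodc_eqv Gb i Hg t0; rewrite !H //; last exact: upper_moebius Hg.1 t0.
  move=> E; rewrite [LHS]mxE sum2 [RHS]mxE ![v _ _]mxE.
  have fi := f0 _ t0; apply: (mulfI fi).
  by rewrite mulrDr !mulrA divff // mul1r -[_ * f (moebius _ _) * _]mulrA E; ring.
- by move/eqP; rewrite -subv0 -memvE memv0 (negbTE v0).
- by move=> E; have := dim_vline v; rewrite E dimvf /dim /= v0.
Qed.

(* Otherwise D b - c G b vanishes at infinity for some c, hence is zero, and
   both components are multiples of one function. *)
Lemma leading_nonzero b : good k0 b -> (exists i n, b i n != 0) ->
  [/\ b 0 0%N != 0, b 1 0%N != 0 & nu 0 != nu 1].
Proof.
move=> Gb [i0 [n0 bn]]; have Pb := goodc_PS Gb.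
(* Each of the three failures provides a c equal to nu i - k0 / 12 for every i with b i 0
   nonzero. *)
suff NC c : (forall i, (nu i - k0%:~R / 12%:R) * b i 0%N = c * b i 0%N) -> False.
  split; apply/negP => /eqP Z.
  - by apply: (NC (nu 1 - k0%:~R / 12%:R)) => i; case: (ord2 i) => -> //; rewrite Z !mulr0.
  - by apply: (NC (nu 0 - k0%:~R / 12%:R)) => i; case: (ord2 i) => -> //; rewrite Z !mulr0.
  - by apply: (NC (nu 0 - k0%:~R / 12%:R)) => i; case: (ord2 i) => -> //; rewrite Z.
move=> Hc.
have Z := vanish_at_infinity (good_lin 1 (- c) (good_theta Gb) (good_mulG Gb)).
have {}Z i n : 1 * theta k0 b i n + - c * mulG b i n = 0.
  apply: Z; first by lia.
  by move=> j; rewrite theta_at0 mulG_at0 mul1r Hc; ring.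
(* The relation D b = c G b is a first order equation with coefficient p, whose E_2 term undoes the
   Serre correction. *)
pose p n := k0%:~R / 12%:R * coeA R n + c * coeG R n.
have Pp : PS 1 p by exact: PSD (PSZ _ (@PS_coeA R)) (PSZ _ (@PS_coeG R)).
have ode i : exists s, forall tau, upper tau -> qs (nu i) (b i) tau = s * linsol p tau.
  apply: (linear_ode Pp) => tau t0; apply: isD_eq (qs_isD k0 (Pb i) t0) _.
  have -> : qs (nu i) (theta k0 b i) tau = c * (eG tau * qs (nu i) (b i) tau).
    rewrite -mulG_qs // -qsZ //; last exact: PS_conv (@PS_coeG R) (Pb i).
    congr (qs _ _ tau); apply/funext => n; have := Z i n; rewrite mul1r mulNr => /eqP.
    by rewrite subr_eq0 => /eqP.
  rewrite /p (psD (PSZ _ (@PS_coeA R)) (PSZ _ (@PS_coeG R)) (e2pi_disc t0)).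
  rewrite (psZ _ (@PS_coeA R) (e2pi_disc t0)) (psZ _ (@PS_coeG R) (e2pi_disc t0)) -eA_coe // -eG_coe //.
  ring.
have [s0 E0] := ode 0; have [s1 E1] := ode 1.
pose s i := if i == 0 :> 'I_2 then s0 else s1.
have Es i tau : upper tau -> qs (nu i) (b i) tau = s i * linsol p tau.
  by move=> t0; case: (ord2 i) => ->; rewrite /s /= ?E0 ?E1.
pose w i := invcoef i 0 * s0 + invcoef i 1 * s1.
apply: (no_common_line Gb (w := w) (f := linsol p)).
- apply/existsP; rewrite -negb_forall; apply/negP => /forallP w0.
  have S : \col_i s i = 0 :> 'cV[C]_2.
    rewrite -[LHS](mulKVmx P0u) (_ : invmx P0 *m _ = 0) ?mulmx0 //.
    by apply/colP => i; rewrite [LHS]mxE sum2 !mxE /= -!invcoefE; exact/eqP/w0.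
  have Si : s i0 = 0 by move/colP: S => /(_ i0); rewrite !mxE.
  move/negP: bn; apply; apply/eqP; apply: (qs_eq0 (n := nu i0) (Pb i0)) => tau t0.
  by rewrite Es // Si mul0r.
- by move=> tau t0; exact: linsol_neq0.
- by move=> tau i t0; rewrite fcE !Es // /w /s /=; ring.
Qed.

(** Subtracting the multiple of b that cancels the leading coefficient of the component 0 leaves a
    form that [leading_nonzero] forces to be zero. *)
Lemma proportional b b' : good k0 b -> (exists i n, b i n != 0) -> good k0 b' ->
  exists s, forall i n, b' i n = s * b i n.
Proof.
move=> Gb bn Gb'; have [b00 _ _] := leading_nonzero Gb bn.
exists (b' 0 0%N / b 0 0%N); set s := _ / _ => i n.
have Gl := good_lin 1 (- s) Gb' Gb.
apply/eqP; rewrite -subr_eq0; apply/negPn/negP => H.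
have [] := leading_nonzero Gl.
  by exists i, n; rewrite mul1r mulNr.
by rewrite mul1r mulNr /s divfK // subrr eqxx.
Qed.

(** With a_i = nu i - k0 / 12 the combination has leading factors (a_i - 1/6) a_i - x a_i + a_0 a_1,
    where 1/6 comes from the weight k0 + 2 of the second derivation; x = a_0 + a_1 - 1/6 makes both
    vanish. The quotient by E has weight k0, hence is beta b. *)
Lemma ode_system b : good k0 b -> (exists i n, b i n != 0) -> exists beta, forall i tau, upper tau ->
  isD (qs (nu i) (theta k0 b i)) tau
    ((nu 0 - k0%:~R / 12%:R + (nu 1 - k0%:~R / 12%:R) - 6%:R^-1) * eG tau * qs (nu i) (theta k0 b i) tau
     - (nu 0 - k0%:~R / 12%:R) * (nu 1 - k0%:~R / 12%:R) * eG tau ^+ 2 * qs (nu i) (b i) tau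
     + beta * eE tau * qs (nu i) (b i) tau
     + (k0 + 2)%:~R / 12%:R * eA tau * qs (nu i) (theta k0 b i) tau).
Proof.
move=> Gb bn; have Pb := goodc_PS Gb.
set x := _ - 6%:R^-1; set al := _ * (nu 1 - _).
have Gt := good_theta Gb; have Pt := goodc_PS Gt.
have Gm := good_lin 1 al (good_lin 1 (- x) (good_theta Gt) (good_mulG Gt)) (good_mulG (good_mulG Gb)).
set b2 := fun i n => _ in Gm.
have b20 i : b2 i 0%N = 0.
  rewrite /b2 !mulG_at0 !theta_at0 intrD /x /al; case: (ord2 i) => ->; by field.
have Pm := goodc_PS Gm.
have Gd := good_divE Gm b20.
have Gd' : good k0 (divE b2) by move: Gd; congr good; lia.
have [beta Hb] := proportional Gb bn Gd'; exists beta => i tau t0.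
apply: isD_eq (qs_isD (k0 + 2) (Pt i) t0) _; congr (_ + _).
have : qs (nu i) (b2 i) tau = beta * eE tau * qs (nu i) (b i) tau.
  have := divE_qs (Pm i) (b20 i) t0.
  have -> : divE b2 i = (fun n => beta * b i n) by apply/funext => n; exact: Hb.
  rewrite (qsZ _ _ (Pb i) t0).
  move=> E; apply: (mulfI (x := (eE tau)^-1)); first by rewrite invr_eq0 eE_neq0.
  rewrite -E; have := eE_neq0 t0; move: (eE tau) (qs _ _ _) => e q e0; by field.
have P1 := goodc_PS (good_theta Gt); have P2 := goodc_PS (good_mulG Gt).
have P3 := goodc_PS (good_mulG Gb); have P4 := goodc_PS (good_mulG (good_mulG Gb)).
have E1 := mulG_qs (Pt i) t0; have E2 := mulG_qs (P3 i) t0; have E3 := mulG_qs (Pb i) t0.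
have S1 : PS 1 (fun n => 1 * theta (k0 + 2) (theta k0 b) i n) := PSZ 1 (P1 i).
have S2 : PS 1 (fun n => - x * mulG (theta k0 b) i n) := PSZ (- x) (P2 i).
have S3 : PS 1 (fun n => 1 * (1 * theta (k0 + 2) (theta k0 b) i n + - x * mulG (theta k0 b) i n)) := PSZ 1 (PSD S1 S2).
have S4 : PS 1 (fun n => al * mulG (mulG b) i n) := PSZ al (P4 i).
rewrite /b2 (qsD _ S3 S4 t0) (qsZ _ _ (PSD S1 S2) t0) (qsD _ S1 S2 t0) (qsZ _ _ (P1 i) t0) (qsZ _ _ (P2 i) t0) (qsZ _ _ (P4 i) t0).
rewrite E1 E2 E3 => E.
apply/eqP; rewrite -subr_eq; apply/eqP; rewrite -E; ring.
Qed.
End MinimalWeight.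

(** * The eta product and the closed form *)

Section EtaProduct.
Variable R : realType.
Local Notation C := (Cfield R).
Implicit Types (z w q : C) (u v chi : nat -> C).
Local Notation disc := (@disc R).
Local Notation sg := (@sg R).

Lemma expsolD chi1 chi2 q : PS 1 chi1 -> PS 1 chi2 -> disc q ->
  ps (expsol (fun n => chi1 n + chi2 n)) q = ps (expsol chi1) q * ps (expsol chi2) q.
Proof.
move=> H1 H2 q1; symmetry; rewrite (expsol_uniq (f := fun z => ps (expsol chi1) z * ps (expsol chi2) z) (PSD H1 H2) _ q1).
  by rewrite !ps0 !expsol0 !mul1r.
move=> z z1; apply: cder_eq (cderM (expsol_cder H1 z1) (expsol_cder H2 z1)) _.
by rewrite (psD H1 H2 z1); ring.
Qed.

(** The coefficients of the logarithmic derivative of 1 - q^d. *)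
Definition eta_factor (d m : nat) : C := - d%:R * dil d (fun=> 1) m.+1.

Lemma PS_eta_factor d : (0 < d)%N -> PS 1 (eta_factor d).
Proof. by move=> d0; apply: PSZ; exact: PS_shift (PS_dil d0 (@PS_1 R)). Qed.

Lemma geo_shift d z : (0 < d)%N -> disc z -> z ^+ d.-1 = ps (fun m => dil d (fun=> 1) m.+1) z * (1 - z ^+ d).
Proof.
move=> d0 z1; have Pd := PS_dil d0 (@PS_1 R).
have [->|z0] := eqVneq z 0.
  rewrite ps0 [0 ^+ d]expr0n gtn_eqF // subr0 mulr1 expr0n /dil dvdn1.
  by case: d d0 {Pd} => [|[|d]].
have z2 := disc_exp d0 z1.
have n1 : 1 - z ^+ d != 0 by rewrite subr_eq0; apply: contraTneq z2 => <-; rewrite cabs1 ltxx.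
have := ps_recl Pd z1; rewrite (ps_dil d0 (@PS_1 R) z1) (ps_1 z2) /dil dvdn0 => E.
apply: (mulfI z0); rewrite mulrA -exprS prednK //.
have -> : z * ps (fun m => if (d %| m.+1)%N then 1 else 0) z = (1 - z ^+ d)^-1 - 1 by rewrite E addrC addKr.
by rewrite mulrBl mulVf // mul1r opprB addrCA subrr addr0.
Qed.

Lemma one_sub_pow d q : (0 < d)%N -> disc q -> 1 - q ^+ d = ps (expsol (eta_factor d)) q.
Proof.
move=> d0 q1; rewrite (expsol_uniq (f := fun z => 1 - z ^+ d) (PS_eta_factor d0) _ q1).
  by rewrite expr0n gtn_eqF // subr0 mul1r.
move=> z z1; have H := cderB (cder_cst 1 z) (cderX d.-1 (cder_id z)).
rewrite prednK // in H; apply: cder_eq H _.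
have E : ps (eta_factor d) z = - d%:R * ps (fun m => dil d (fun=> 1) m.+1) z := psZ _ (PS_shift (PS_dil d0 (@PS_1 R))) z1.
transitivity (- d%:R * z ^+ d.-1); first by ring.
by rewrite E (geo_shift d0 z1); ring.
Qed.

(** The logarithmic derivative of the product over d >= N; in degree m only d <= m + 1 contribute,
    so the sum is finite. *)
Definition eta_tail (N m : nat) : C := \sum_(N <= d < m.+2) eta_factor d m.

Lemma eta_tail_le N m : (0 < N)%N -> cabs (eta_tail N m) <= cabs (sg 1 m.+1).
Proof.
move=> N0; rewrite (@sg_sum R 1 m.+1 m.+2) //.
have E d : eta_factor d m = - ((d %| m.+1)%N%:R * d%:R ^+ 1).
  by rewrite /eta_factor /dil expr1; case: (d %| m.+1)%N => /=; ring.
have En : \sum_(1 <= d < m.+2) (d %| m.+1)%N%:R * d%:R ^+ 1 = (\sum_(1 <= d < m.+2) (d %| m.+1)%N * d)%N%:R :> C.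
  by rewrite natr_sum; apply: eq_bigr => d _; rewrite natrM expr1.
have En' : eta_tail N m = - (\sum_(N <= d < m.+2) (d %| m.+1)%N * d)%N%:R :> C.
  by rewrite natr_sum -sumrN; apply: eq_bigr => d _; rewrite E natrM expr1.
rewrite En En' cabsN !cabs_nat ler_nat.
have [Nm|Nm] := leqP N m.+2; last by rewrite big_geq // ltnW.
by rewrite [X in (_ <= X)%N](big_cat_nat _ (n := N)) //= leq_addl.
Qed.

Lemma PS_eta_tail N : (0 < N)%N -> PS 1 (eta_tail N).
Proof. by move=> N0; apply: PS_le (PS_shift (@PS_sg R 1)) => m; exact: eta_tail_le. Qed.

Lemma eta_tail_recl N : eta_tail N = (fun m => eta_factor N m + eta_tail N.+1 m).
Proof.
apply/funext => m; rewrite /eta_tail; have [Nm|Nm] := ltnP N m.+2; first by rewrite big_ltn.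
rewrite !big_geq //; last exact: leq_trans Nm _.
by rewrite addr0 /eta_factor /dil gtnNdvd ?mulr0.
Qed.

Definition eta_chi (m : nat) : C := - sg 1 m.+1.
Lemma eta_tail1 : eta_tail 1 = eta_chi.
Proof.
apply/funext => m; rewrite /eta_chi (@sg_sum R 1 m.+1 m.+2) // -sumrN; apply: eq_bigr => d _.
by rewrite /eta_factor /dil expr1; case: (d %| m.+1)%N => /=; ring.
Qed.

Lemma eta_product q N : disc q ->
  ps (expsol eta_chi) q = (\prod_(1 <= n < N.+1) (1 - q ^+ n)) * ps (expsol (eta_tail N.+1)) q.
Proof.
move=> q1; elim: N => [|N IH]; first by rewrite big_geq // mul1r eta_tail1.
rewrite IH eta_tail_recl (expsolD (PS_eta_factor (ltn0Sn N)) (PS_eta_tail (ltn0Sn N.+1)) q1).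
by rewrite -one_sub_pow // [in RHS]big_nat_recr //= mulrA.
Qed.

(** [eta_tail N.+1] has no coefficient below N and is dominated by sigma_1, so [expsol_bound] sends
    the remaining product to 1. *)
Lemma eta_limit q : disc q -> limn (fun N => \prod_(1 <= n < N) (1 - q ^+ n)) = ps (expsol eta_chi) q.
Proof.
move=> q1; have q0 := cabs_ge0 q; set e := ps _ q.
have Pe : PS 1 eta_chi by rewrite -eta_tail1; exact: PS_eta_tail.
have en : e != 0 := expsol_neq0 Pe q1.
pose rho := (cabs q + 1) / 2.
have [r0 r1 rq] : [/\ 0 < rho, rho < 1 & cabs q < rho].
  by move: q1; rewrite /disc /rho => q1; split; lra.
pose t := cabs q / rho; have t01 : 0 <= t < 1 by rewrite divr_ge0 ?ltr_pdivrMr ?mul1r //= ltW.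
have As : asum (fun m => ofR (cabs (sg 1 m.+1) * rho ^+ m.+1) : C).
  have Ar : cabs (ofR rho : C) < 1 by rewrite cabs_ofR gtr0_norm.
  have := PS_asum (@PS_sg R 1) Ar => /(asum_shift _ 1).
  apply: asum_le => m; rewrite addn1 cabs_ofR cabsM cabsX cabs_ofR (gtr0_norm r0) ger0_norm //.
  by rewrite mulr_ge0 ?cabs_ge0 // exprn_ge0 // ltW.
have tail (eps : R) : 0 < eps -> exists N0, forall N, (N0 <= N)%N -> cabs (ps (expsol (eta_tail N.+1)) q - 1) <= eps.
  move=> e0; have [_ /andP[_ t1]] := (t01, t01).
  pose S := Num.min 1 (eps * (1 - t)).
  have S0 : 0 < S by rewrite lt_min ltr01 mulr_gt0 // subr_gt0.
  have [N0 HN] := asum_tail As S0; exists N0 => N N0N.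
  have bd n : \sum_(k < n) cabs (eta_tail N.+1 k) * rho ^+ k.+1 <= S.
    have [nN|nN] := leqP n N.
      rewrite big1 ?ltW // => k _; rewrite /eta_tail big_geq ?cabs0 ?mul0r //.
      by move: nN (ltn_ord k); clear; lia.
    apply: le_trans (HN N n N0N).
    rewrite -(big_mkord xpredT (fun k => cabs (eta_tail N.+1 k) * rho ^+ k.+1)).
    rewrite (big_cat_nat _ (n := N)) //=; last exact: ltnW.
    rewrite big_nat_cond big1 ?add0r; last first.
      by move=> k /andP[/andP[_ kN] _]; rewrite /eta_tail big_geq ?cabs0 ?mul0r //; lia.
    apply: ler_sum => k _; rewrite cabs_ofR ger0_norm; last by rewrite mulr_ge0 ?cabs_ge0 // exprn_ge0 // ltW.
    by rewrite ler_wpM2r ?eta_tail_le // exprn_ge0 // ltW.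
  have S1 : S <= 1 by rewrite ge_min lexx.
  have B n := expsol_bound n r0 S1 bd.
  have Px := expsol_PS (PS_eta_tail (ltn0Sn N)).
  rewrite (ps_recl Px q1) expsol0 addrC addKr cabsM.
  apply: (@le_trans _ _ (S / (1 - t))); last first.
    by rewrite ler_pdivrMr ?subr_gt0 // ge_min lexx orbT.
  have Pz : PS 1 (fun n => if n is m.+1 then expsol (eta_tail N.+1) n else 0 : C).
    by apply: PS_le Px => -[|n]; rewrite ?cabs0 ?cabs_ge0.
  have E := ps_recl Pz q1; rewrite add0r in E; rewrite -cabsM -E.
  have Bd m : cabs ((if m is p.+1 then expsol (eta_tail N.+1) m else 0) * q ^+ m) <= S * t ^+ m.
    case: m => [|m]; first by rewrite mul0r cabs0 mulr_ge0 // ltW.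
    rewrite cabsM cabsX /t exprMn exprVn mulrA ler_pdivlMr ?exprn_gt0 //.
    by rewrite mulrAC; apply: ler_wpM2r => //; rewrite exprn_ge0.
  exact: sumC_le (asum_geo t01 Bd).1.
apply: cvgC_lim; apply/cvgC_P => eps e0.
have ce : 0 < cabs e by rewrite cabs_gt0.
pose d := Num.min 2^-1 (eps / (4 * cabs e)).
have d0 : 0 < d by rewrite lt_min invr_gt0 ltr0n /= divr_gt0 // mulr_gt0.
have [N0 HN] := tail _ d0; exists N0.+1 => -[//|N] N0N.
have H := HN N N0N; have := eta_product N q1; rewrite -/e.
set p := \prod_(_ <= _ < _) _; set s := ps _ _ in H * => E.
have d1 : d <= 2^-1 by rewrite ge_min lexx.
have d2 : d * (4 * cabs e) <= eps by rewrite -ler_pdivlMr ?mulr_gt0 // ge_min lexx orbT.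
have s2 : 2^-1 <= cabs s.
  have := cabsBl 1 (1 - s); have -> : 1 - (1 - s) = s by ring.
  by rewrite cabs1 cabsB; lra.
have sn : s != 0 by rewrite -cabs_gt0; lra.
have -> : p - e = - (e * (s - 1) / s).
  by rewrite E; move: (p) => x; field.
rewrite cabsN !cabsM cabsV ltr_pdivrMr; last by lra.
have A1 : cabs e * cabs (s - 1) <= cabs e * d by apply: ler_wpM2l => //; exact: ltW.
have A2 : eps * 2^-1 <= eps * cabs s by apply: ler_wpM2l => //; exact: ltW.
lra.
Qed.
End EtaProduct.

(** * Binomial and hypergeometric series *)

Section SpecialSeries.
Variable R : realType.
Local Notation C := (Cfield R).
Implicit Types (z w q a b c r : C) (u : nat -> C).

Lemma PS_ratio (K : R) u : 0 < K -> (forall n, cabs (u n.+1) <= K * cabs (u n)) -> PS K^-1 u.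
Proof.
move=> K0 H rho /andP[r0 r1]; exists (cabs (u 0%N)) => n.
have Kr : K * rho <= 1 by rewrite mulrC -ler_pdivlMr // mul1r ltW.
elim: n => [|n IH]; first by rewrite expr0 mulr1.
apply: le_trans IH; rewrite exprSr mulrA [_ * rho]mulrC.
apply: (@le_trans _ _ (rho * (K * cabs (u n) * rho ^+ n))).
  by apply: ler_wpM2l; [exact: ltW | apply: ler_wpM2r => //; rewrite exprn_ge0 // ltW].
have -> : rho * (K * cabs (u n) * rho ^+ n) = (K * rho) * (cabs (u n) * rho ^+ n) by ring.
apply: ler_piMl => //.
by rewrite mulr_ge0 ?cabs_ge0 // exprn_ge0 // ltW.
Qed.

Lemma binomS r n : n.+1%:R * binom r n.+1 = (r - n%:R) * binom r n.
Proof.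
rewrite /binom big_ord_recr /= factS natrM; have n1 : n.+1%:R != 0 :> C by rewrite pnatr_eq0.
have nf : n`!%:R != 0 :> C by rewrite pnatr_eq0 -lt0n fact_gt0.
move: (n.+1%:R : C) (n`!%:R : C) n1 nf (\prod_(i < n) _) (n%:R : C) => x y x0 y0 p t.
by field; rewrite x0 y0.
Qed.

Lemma binom0 r : binom r 0 = 1.
Proof. by rewrite /binom big_ord0 fact0 invr1 mulr1. Qed.

(** Any positive radius suffices, since the closed form is only evaluated for Im tau large, where 64
    q J - 1 and 1/J are small. *)
Lemma PS_binom r : exists2 rad : R, 0 < rad & PS rad (binom r).
Proof.
pose K := cabs r + 1; have K0 : 0 < K by have := cabs_ge0 r; rewrite /K; lra.
exists K^-1; first by rewrite invr_gt0.
apply: PS_ratio => // n; have n1 : 0 < n.+1%:R :> R by rewrite ltr0n.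
rewrite -(ler_pM2l n1).
have -> : n.+1%:R * cabs (binom r n.+1) = cabs ((r - n%:R) * binom r n).
  by rewrite -binomS cabsM cabs_nat.
rewrite cabsM mulrA; apply: ler_wpM2r; first exact: cabs_ge0.
apply: le_trans (cabsD _ _) _; rewrite cabsN cabs_nat /K -natr1.
have := cabs_ge0 r; have : 0 <= n%:R :> R by []. nra.
Qed.

Lemma binom_ode r (rad : R) z : PS rad (binom r) -> cabs z < rad ->
  (1 + z) * ps (fun n => nps (binom r) n.+1) z = r * ps (binom r) z.
Proof.
move=> Hb zr; have Pn := PS_nps Hb; have Ps := PS_shift Pn.
rewrite mulrDl mul1r; have <- : ps (nps (binom r)) z = z * ps (fun n => nps (binom r) n.+1) z.
  by rewrite (ps_recl Pn zr) /nps mul0r add0r.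
rewrite -(psD Ps Pn zr) -(psZ _ Hb zr); apply: eq_sumC => n; congr (_ * _).
by rewrite /nps binomS; ring.
Qed.

Definition hypc a b c n : C := pochhammer a n * pochhammer b n / pochhammer c n / (n`!)%:R.

Lemma hyp2F1E a b c z : hyp2F1 a b c z = ps (hypc a b c) z.
Proof.
rewrite /hyp2F1 /ps /sumC; set u := (X in limn (series X) = _); suff -> : u = (fun n => hypc a b c n * z ^+ n) by [].
apply/funext => i; rewrite /u;
by rewrite /hypc; move: (pochhammer _ _) (pochhammer _ _) (pochhammer _ _)^-1 => x y t; rewrite mulrA -[RHS]mulrAC.
Qed.

Lemma hypc0 a b c : hypc a b c 0 = 1.
Proof. by rewrite /hypc /pochhammer !big_ord0 fact0 invr1 !mulr1. Qed.

Lemma hypcS a b c n : (forall m : nat, c + m%:R != 0) ->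
  n.+1%:R * (c + n%:R) * hypc a b c n.+1 = (a + n%:R) * (b + n%:R) * hypc a b c n.
Proof.
move=> Hc; have c0 := Hc n.
have p0 : pochhammer c n != 0 by apply/prodf_neq0 => i _; exact: Hc.
rewrite /hypc /pochhammer !big_ord_recr /= factS natrM -!/(pochhammer _ _).
have n1 : n.+1%:R != 0 :> C by rewrite pnatr_eq0.
have nf : n`!%:R != 0 :> C by rewrite pnatr_eq0 -lt0n fact_gt0.
move: (n.+1%:R : C) (n`!%:R : C) (pochhammer a n) (pochhammer b n) (pochhammer c n) (n%:R : C) n1 nf p0 c0 => x y p1 p2 p3 t x0 y0 p0 c0.
by field; rewrite x0 y0 p0 c0.
Qed.

(** A bound linear in n keeps the ratio of consecutive hypergeometric coefficients bounded. It is a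
    minimum over small n, and follows from |c| < n / 2 for the others. *)
Lemma linear_lower_bound c : (forall m : nat, c + m%:R != 0) ->
  exists2 d : R, 0 < d & forall n, d * n.+1%:R <= cabs (c + n%:R).
Proof.
move=> Hc; pose N := (Num.truncn (2 * cabs c + 1)).+1.
have NB n : (N <= n)%N -> 2^-1 * n.+1%:R - 2^-1 * 2 <= cabs (c + n%:R) /\ 2 * cabs c + 1 < n%:R.
  move=> Nn; have /andP[_ A] := truncn_itv (ltac:(have := cabs_ge0 c; lra) : 0 <= 2 * cabs c + 1).
  have B : 2 * cabs c + 1 < n%:R by apply: lt_le_trans A _; rewrite ler_nat.
  split => //; have := cabsBl n%:R (- c); rewrite opprK cabs_nat cabsN [n%:R + c]addrC -[n.+1%:R]natr1; lra.
have [d0 d00 Hd0] : exists2 d0 : R, 0 < d0 & forall n, (n < N)%N -> d0 * n.+1%:R <= cabs (c + n%:R).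
  elim: N {NB} => [|N [d d0 Hd]]; first by exists 1.
  have cn : 0 < cabs (c + N%:R) by rewrite cabs_gt0.
  exists (Num.min d (cabs (c + N%:R) / N.+1%:R)); first by rewrite lt_min d0 divr_gt0.
  move=> n; rewrite ltnS leq_eqVlt => /orP[/eqP ->|nN].
    by rewrite -ler_pdivlMr ?ltr0n // ge_min lexx orbT.
  apply: le_trans (Hd n nN); apply: ler_wpM2r => //; by rewrite ge_min lexx.
exists (Num.min d0 4^-1); first by rewrite lt_min d00 invr_gt0 ltr0n.
move=> n; have [nN|nN] := ltnP n N.
  by apply: le_trans (Hd0 n nN); apply: ler_wpM2r => //; rewrite ge_min lexx.
have [A B] := NB n nN; have c0 := cabs_ge0 c.
apply: (@le_trans _ _ (4^-1 * n.+1%:R)); first by apply: ler_wpM2r => //; rewrite ge_min lexx orbT.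
have := cabsBl n%:R (- c); rewrite opprK cabs_nat cabsN [n%:R + c]addrC -[n.+1%:R]natr1; lra.
Qed.

Lemma PS_hypc a b c : (forall m : nat, c + m%:R != 0) -> exists2 rad : R, 0 < rad & PS rad (hypc a b c).
Proof.
move=> Hc; have [d d0 Hd] := linear_lower_bound Hc.
have [a0 b0] := (cabs_ge0 a, cabs_ge0 b).
pose K := (cabs a + 1) * (cabs b + 1) / d; have K0 : 0 < K by rewrite divr_gt0 // mulr_gt0 //; lra.
exists K^-1; first by rewrite invr_gt0.
apply: PS_ratio => // n; have n1 : 0 < n.+1%:R :> R by rewrite ltr0n.
have cn : 0 < cabs (c + n%:R) by rewrite cabs_gt0.
have P : 0 < n.+1%:R * cabs (c + n%:R) by rewrite mulr_gt0.
rewrite -(ler_pM2l P).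
have -> : n.+1%:R * cabs (c + n%:R) * cabs (hypc a b c n.+1) = cabs (a + n%:R) * cabs (b + n%:R) * cabs (hypc a b c n).
  by rewrite -!cabsM -hypcS // !cabsM cabs_nat.
rewrite mulrA; apply: ler_wpM2r; first exact: cabs_ge0.
have B x : cabs (x + n%:R : C) <= (cabs x + 1) * n.+1%:R.
  apply: le_trans (cabsD _ _) _; rewrite cabs_nat -natr1; have := cabs_ge0 x.
  have : 0 <= n%:R :> R by []. nra.
apply: (@le_trans _ _ ((cabs a + 1) * n.+1%:R * ((cabs b + 1) * n.+1%:R))).
  by apply: ler_pM; rewrite ?cabs_ge0.
have -> : (cabs a + 1) * n.+1%:R * ((cabs b + 1) * n.+1%:R) = n.+1%:R * (d * n.+1%:R) * K.
  by rewrite /K; field; apply: lt0r_neq0.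
by apply: ler_wpM2r; [exact: ltW | apply: ler_wpM2l => //; exact: ltW].
Qed.

(** The hypergeometric equation in terms of z d/dz, which acts on coefficients as [nps]. *)
Lemma hyp_ode a b c (rad : R) z : (forall m : nat, c + m%:R != 0) -> PS rad (hypc a b c) -> cabs z < rad ->
  let f := ps (hypc a b c) z in let k1 := ps (nps (hypc a b c)) z in let k2 := ps (nps (nps (hypc a b c))) z in
  k2 + (c - 1) * k1 = z * (k2 + (a + b) * k1 + a * b * f).
Proof.
move=> Hc Hb zr f k1 k2; have P1 := PS_nps Hb; have P2 := PS_nps P1.
have PL := PSD P2 (PSZ (c - 1) P1).
rewrite /k2 /k1 /f -(psZ _ P1 zr) -(psD P2 (PSZ (c - 1) P1) zr) (ps_recl PL zr) /nps !mul0r !mulr0 addr0 add0r.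
congr (z * _).
rewrite -(psZ _ P1 zr) -(psZ _ Hb zr) -(psD P2 (PSZ (a + b) P1) zr) -(psD (PSD P2 (PSZ (a + b) P1)) (PSZ (a * b) Hb) zr).
apply: eq_sumC => n; congr (_ * _); rewrite /nps.
transitivity (n.+1%:R * (c + n%:R) * hypc a b c n.+1); first by rewrite -natr1; ring.
by rewrite hypcS //; ring.
Qed.
End SpecialSeries.

(** * The closed form near infinity and its differential equations *)

Section NearInfinity.
Variable R : realType.
Local Notation C := (Cfield R).
Implicit Types (z q l m : C) (u : nat -> C) (f g : C -> C).
Local Notation disc := (@disc R).
Local Notation sG := (@sG R).
Local Notation sE := (@sE R).
Local Notation sE2 := (@sE2 R).

Lemma cderXz f z l (n : int) : f z != 0 -> cder f z l -> cder (fun x => f x ^ n) z (n%:~R * f z ^ (n - 1) * l).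
Proof.
move=> n0 L; case: n => [[|n]|n].
- by apply: cder_eq (cder_cst 1 z) _; rewrite !mul0r.
- apply: cder_eq (cderX n L) _; have -> : n.+1%:Z - 1 = n%:Z by lia.
  by rewrite -exprnP.
- have X0 : f z ^+ n.+1 != 0 by rewrite expf_neq0.
  apply: cder_eq (cderV (f := fun x => f x ^+ n.+1) X0 (cderX n L)) _.
  have -> : Negz n - 1 = - (n.+2)%:Z by rewrite NegzE; lia.
  have -> : f z ^ (- (n.+2)%:Z) = (f z ^+ n.+2)^-1 by rewrite -exprz_inv -exprnP exprVn.
  rewrite NegzE mulrNz -[n.+1%:~R]/(n.+1%:R).
  move: (n.+1%:R : C) => m; rewrite !exprS in X0 *; move: X0; rewrite mulf_eq0 negb_or => /andP[_ Y0].
  by field; rewrite Y0 n0.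
Qed.

Lemma cder_lip f z l : cder f z l -> exists d M : R, [/\ 0 < d, 0 <= M &
  forall h, cabs h < d -> cabs (f (z + h) - f z) <= M * cabs h].
Proof.
move=> H; have [d d0 Hd] := H 1 ltr01.
exists d, (1 + cabs l); split => //; first by have := cabs_ge0 l; lra.
move=> h hd; have -> : f (z + h) - f z = (f (z + h) - f z - l * h) + l * h by ring.
apply: le_trans (cabsD _ _) _; rewrite cabsM mulrDl; apply: lerD => //; exact: Hd.
Qed.

Lemma cder_small f l (e : R) : cder f 0 l -> 0 < e ->
  exists2 d : R, 0 < d & forall q, cabs q < d -> cabs (f q - f 0) < e.
Proof.
move=> /cder_lip [d [M [d0 M0 H]]] e0.
exists (Num.min d (e / (M + 1))).
  by rewrite lt_min d0 divr_gt0 //; lra.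
move=> q; rewrite lt_min => /andP[q1 q2].
have := H q q1; rewrite add0r => A; apply: le_lt_trans A _.
move: q2; rewrite ltr_pdivlMr; last by lra.
have := cabs_ge0 q; lra.
Qed.

Lemma isQD_comp g q l rad u : isQD g q l -> PS rad u -> cabs (g q) < rad ->
  isQD (fun x => ps u (g x)) q (l * ps (fun n => nps u n.+1) (g q)).
Proof.
move=> [m Hm <-] Hu gr; exists (ps (fun n => nps u n.+1) (g q) * m); last by ring.
exact: cder_comp Hm (ps_cder Hu gr).
Qed.

Lemma isQD_V f q l : f q != 0 -> isQD f q l -> isQD (fun x => (f x)^-1) q (- (l / f q ^+ 2)).
Proof. by move=> f0 [m Hm <-]; exists (- (f q) ^- 2 * m); [exact: cderV | ring]. Qed.

Lemma isQD_fun_eq f g q l : f = g -> isQD f q l -> isQD g q l.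
Proof. by move=> ->. Qed.

Lemma phi_chi q : disc q -> q * ps (@chiE R) q = (2%:R * sG q + sE2 q) / 3%:R - 1.
Proof.
by move=> q1; rewrite q_chiE // /sG /sE2; move: (ps _ q) (ps _ (q ^+ 2)) => x y; field.
Qed.

(** By [sE_prod] this is 192 q / E, with value 1 at q = 0. *)
Definition uinvq q : C := ps (expsol (fun n => -1 * @chiE R n)) q.

Lemma isQD_uinv q : disc q -> isQD uinvq q ((1 - (2%:R * sG q + sE2 q) / 3%:R) * uinvq q).
Proof.
move=> q1; have Pc := PSZ (-1) (@PS_chiE R).
exists (ps (fun n => -1 * @chiE R n) q * uinvq q); first exact: expsol_cder.
by rewrite (psZ _ (@PS_chiE R) q1) -[1 - _]opprB -phi_chi //; ring.
Qed.

(* [vq] is 64 q J - 1 and [zq] is 1 / J. *)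
Definition vq q : C := sG q * sG q * uinvq q - 1.
Definition zq q : C := sE q * (3%:R * (sG q * sG q))^-1.

Lemma sG0 : sG 0 = 1.
Proof. by rewrite sG_coe ?disc0 // ps0 coeG0. Qed.
Lemma sE0 : sE 0 = 0.
Proof. by rewrite sE_prod ?disc0 // mulr0 mul0r. Qed.
Lemma vq0 : vq 0 = 0.
Proof. by rewrite /vq sG0 !mul1r /uinvq ps0 expsol0 subrr. Qed.
Lemma zq0 : zq 0 = 0.
Proof. by rewrite /zq sE0 mul0r. Qed.

Section AtPoint.
Variable q : C.
Hypotheses (q1 : disc q) (G0 : sG q != 0).

Lemma sE_zq : sE q = 3%:R * sG q ^+ 2 * zq q.
Proof. by rewrite /zq; field. Qed.

(** Hence q d/dq acts on functions of z = 1/J as G (1 - z) z d/dz, which links the modular equation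
    to the hypergeometric one. *)
Lemma isQD_zq : isQD zq q (sG q * (1 - zq q) * zq q).
Proof.
have N0 : 3%:R * (sG q * sG q) != 0 by rewrite !mulf_neq0 ?pnatr_eq0.
have TG := isQD_G q1.
have TN := isQD_Z 3%:R (isQD_M TG TG).
apply: isQD_eq (isQD_M (isQD_E q1) (isQD_V (f := fun x => 3%:R * (sG x * sG x)) N0 TN)) _.
rewrite sE_zq; move: (zq q) (sG q) (sE2 q) G0 => z g a g0.
by field.
Qed.

Lemma isQD_vq : isQD vq q ((1 - sG q * (1 - zq q)) * (1 + vq q)).
Proof.
have TG := isQD_G q1.
apply: isQD_eq (isQD_B (isQD_M (isQD_M TG TG) (isQD_uinv q1)) (isQD_cst 1 q)) _.
rewrite /vq; have := sE_zq; move: (zq q) (sE q) (sG q) (sE2 q) (uinvq q) => z e g a y ->.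
by field.
Qed.
End AtPoint.

Definition etaq q : C := ps (expsol (@eta_chi R)) q.

Lemma PS_eta_chi : PS 1 (@eta_chi R).
Proof. by rewrite -eta_tail1; exact: PS_eta_tail. Qed.

Lemma etaq_neq0 q : disc q -> etaq q != 0.
Proof. exact: expsol_neq0 PS_eta_chi. Qed.

Lemma isQD_etaq q : disc q -> isQD etaq q ((sE2 q - 1) / 24%:R * etaq q).
Proof.
move=> q1; exists (ps (@eta_chi R) q * etaq q); first exact: (expsol_cder PS_eta_chi q1).
have E : q * ps (@eta_chi R) q = (sE2 q - 1) / 24%:R.
  rewrite /sE2 -(q_chi (@PS_sg R 1) (sg0 R 1) q1).
  have -> : ps (@eta_chi R) q = - ps (fun n => sg R 1 n.+1) q.
    rewrite -mulN1r -(psZ _ (PS_shift (@PS_sg R 1)) q1); apply: eq_sumC => n.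
    by rewrite /eta_chi mulN1r.
  by field.
by rewrite mulrA E.
Qed.

Lemma isQD_etaqz q (n : int) : disc q -> isQD (fun x => etaq x ^ n) q (n%:~R * (sE2 q - 1) / 24%:R * etaq q ^ n).
Proof.
move=> q1; have e0 := etaq_neq0 q1; have [m Hm mE] := isQD_etaq q1.
exists (n%:~R * etaq q ^ (n - 1) * m); first exact: cderXz.
have -> : q * (n%:~R * etaq q ^ (n - 1) * m) = n%:~R * etaq q ^ (n - 1) * (q * m) by ring.
rewrite mE expfzDr //; have -> : etaq q ^ (-1) = (etaq q)^-1 by rewrite -exprz_inv expr1z.
by move: (etaq q ^ n) (etaq q) e0 => y e e0; field.
Qed.

Section Solution.
Variables (k : int) (n0 n1 be r A B : C).
Local Notation k12 := (k%:~R / 12%:R).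
Hypotheses (n0E : n0 = A - r + k12) (n1E : n1 = B - r + k12).
Local Notation x := (n0 - k12 + (n1 - k12) - 6%:R^-1).
Local Notation al := (- ((n0 - k12) * (n1 - k12))).
Hypothesis r_eq : r ^+ 2 + r * (x - 3%:R^-1) - (al + 3%:R * be) = 0.
Hypothesis c_neq : forall m : nat, 1 + A - B + m%:R != 0.

Local Notation hc := (hypc A (2%:R^-1 + A) (1 + A - B)).
(** The factor eta^(2k) (J - 1)^r J^-A, stripped of its powers of q and of 64. *)
Definition PiQ q : C := etaq q ^ (2 * k) * ps (binom (r - A)) (vq q) * ps (binom r) (- zq q).
Definition hypz q : C := ps hc (zq q).
Definition hypz1 q : C := ps (nps hc) (zq q).
Definition hypz2 q : C := ps (nps (nps hc)) (zq q).
Definition hypS q : C := (A - r - A * zq q) * hypz q + (1 - zq q) * hypz1 q.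
(* Up to the factor q^n0 and a constant, HQ is the closed form and HQ1 its
   Serre derivative. *)
Definition HQ q : C := PiQ q * hypz q.
Definition HQ1 q : C := PiQ q * (sG q * hypS q).

Variables (rad : R).
Hypotheses (P1 : PS rad (binom (r - A))) (P2 : PS rad (binom r)) (P3 : PS rad hc).

Definition small q := [/\ disc q, sG q != 0, cabs (vq q) < rad & cabs (zq q) < rad].

Lemma isQD_binv q : small q -> isQD (fun y => ps (binom (r - A)) (vq y)) q
  ((r - A) * (1 - sG q * (1 - zq q)) * ps (binom (r - A)) (vq q)).
Proof.
move=> [q1 G0 vr zr]; apply: isQD_eq (isQD_comp (isQD_vq q1 G0) P1 vr) _.
have := binom_ode P1 vr; move: (ps _ (vq q)) (ps (binom _) (vq q)) => s t E.
transitivity ((1 - sG q * (1 - zq q)) * ((1 + vq q) * s)); first by ring.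
by rewrite E; ring.
Qed.

Lemma isQD_binz q : small q -> isQD (fun y => ps (binom r) (- zq y)) q
  (- (r * sG q * zq q) * ps (binom r) (- zq q)).
Proof.
move=> [q1 G0 vr zr].
have zr' : cabs (- zq q) < rad by rewrite cabsN.
have T : isQD (fun y => - zq y) q (-1 * (sG q * (1 - zq q) * zq q)).
  by apply: isQD_fun_eq (isQD_Z (-1) (isQD_zq q1 G0)); apply/funext => y; rewrite mulN1r.
apply: isQD_eq (isQD_comp T P2 zr') _.
have := binom_ode P2 zr'; move: (ps _ (- zq q)) (ps (binom r) (- zq q)) => s t E.
transitivity (- (sG q * zq q) * ((1 + - zq q) * s)); first by ring.
by rewrite E; ring.
Qed.

Lemma isQD_Pi q : small q -> isQD PiQ q ((k12 * sE2 q - n0 + sG q * (A - r - A * zq q)) * PiQ q).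
Proof.
move=> sq; have [q1 _ _ _] := sq.
apply: isQD_eq (isQD_M (isQD_M (isQD_etaqz (2 * k) q1) (isQD_binv sq)) (isQD_binz sq)) _.
rewrite /PiQ intrM n0E; move: (etaq q ^ _) (ps (binom (r - A)) (vq q)) (ps (binom r) (- zq q)) (sG q) (sE2 q) (zq q) => e b1 b2 g a z.
by field.
Qed.

Lemma isQD_psz q u : small q -> PS rad u ->
  isQD (fun y => ps u (zq y)) q (sG q * (1 - zq q) * ps (nps u) (zq q)).
Proof.
move=> [q1 G0 vr zr] Pu; apply: isQD_eq (isQD_comp (isQD_zq q1 G0) Pu zr) _.
by rewrite -mulrA (q_ps_sh_nps Pu zr).
Qed.

Lemma isQD_HQ q : small q -> isQD HQ q (HQ1 q + (k12 * sE2 q - n0) * HQ q).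
Proof.
move=> sq; apply: isQD_eq (isQD_M (isQD_Pi sq) (isQD_psz sq P3)) _.
rewrite /HQ1 /HQ /hypS -/(hypz q) -/(hypz1 q); move: (PiQ q) (hypz q) (hypz1 q) (sG q) (sE2 q) (zq q) => p f0 f1 g a z.
ring.
Qed.

Lemma isQD_HQ1 q : small q -> isQD HQ1 q (x * sG q * HQ1 q + al * sG q ^+ 2 * HQ q + be * sE q * HQ q
   + ((k + 2)%:~R / 12%:R * sE2 q - n0) * HQ1 q).
Proof.
move=> sq; have [q1 G0 vr zr] := sq.
have TF0 : isQD hypz q (sG q * (1 - zq q) * hypz1 q) := isQD_psz sq P3.
have TF1 : isQD hypz1 q (sG q * (1 - zq q) * hypz2 q) := isQD_psz sq (PS_nps P3).
have Tz := isQD_zq q1 G0.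
have TS1 := isQD_D (isQD_M (isQD_B (isQD_cst (A - r) q) (isQD_Z A Tz)) TF0) (isQD_M (isQD_B (isQD_cst 1 q) Tz) TF1).
apply: isQD_eq (isQD_M (isQD_Pi sq) (isQD_M (isQD_G q1) TS1)) _.
have := hyp_ode c_neq P3 zr; rewrite /= -/(hypz q) -/(hypz1 q) -/(hypz2 q).
rewrite /HQ1 /HQ /hypS (sE_zq G0) intrD; move: r_eq; rewrite n0E n1E.
move: (PiQ q) (hypz q) (hypz1 q) (hypz2 q) (sG q) (sE2 q) (zq q) => p f0 f1 f2 g a z rE E.
apply/eqP; rewrite -subr_eq0; apply/eqP.
(* The difference of the two sides is (1 - z) times the hypergeometric equation plus z times the
   quadratic equation of r. *)
transitivity (p * g ^+ 2 * ((1 - z) * (f2 + (1 + A - B - 1) * f1 - z * (f2 + (A + (2%:R^-1 + A)) * f1 + A * (2%:R^-1 + A) * f0))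
  + z * f0 * (r ^+ 2 + r * (A - r + k12 - k12 + (B - r + k12 - k12) - 6%:R^-1 - 3%:R^-1) - (- ((A - r + k12 - k12) * (B - r + k12 - k12)) + 3%:R * be)))); first by field.
by rewrite E rE; ring.
Qed.

Lemma HQ_at0 : HQ 0 = 1.
Proof.
rewrite /HQ /PiQ /hypz /etaq vq0 zq0 oppr0 !ps0 !binom0 hypc0 expsol0.
by rewrite exp1rz !mulr1.
Qed.
Lemma HQ1_at0 : HQ1 0 = n0 - k12.
Proof.
rewrite /HQ1 /hypS /PiQ /hypz /hypz1 /etaq vq0 zq0 sG0 oppr0 !ps0 !binom0 hypc0 expsol0 /nps.
by rewrite exp1rz n0E; field.
Qed.
End Solution.

Lemma small_exists (rad : R) : 0 < rad -> exists2 d : R, 0 < d & forall q, cabs q < d -> small rad q.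
Proof.
move=> r0; have d1 := @disc0 R; have G1 : sG 0 != 0 by rewrite sG0 oner_eq0.
have [lG HG _] := isQD_G d1; have [lz Hz _] := isQD_zq d1 G1; have [lv Hv _] := isQD_vq d1 G1.
pose e := Num.min rad 2^-1; have e0 : 0 < e by rewrite lt_min r0 invr_gt0 ltr0n.
have [dG dG0 BG] := cder_small HG e0; have [dz dz0 Bz] := cder_small Hz e0; have [dv dv0 Bv] := cder_small Hv e0.
exists (Num.min 1 (Num.min dG (Num.min dz dv))); first by rewrite !lt_min ltr01 dG0 dz0 dv0.
move=> q; rewrite !lt_min => /and4P[q1 qG qz qv].
have := BG q qG; have := Bz q qz; have := Bv q qv.
rewrite sG0 vq0 zq0 !subr0 /e !lt_min => /andP[v1 v2] /andP[z1 z2] /andP[g1 g2].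
have ne (y : C) : cabs (y - 1) < 2^-1 -> y != 0.
  by move=> H; apply: contraTneq H => ->; rewrite sub0r cabsN cabs1; lra.
by split; [exact: q1 | exact: ne | exact: v1 | exact: z1].
Qed.
End NearInfinity.

(** * Comparison with the closed form *)

Section Comparison.
Variable R : realType.
Local Notation C := (Cfield R).
Implicit Types (z q tau l m : C) (u b : nat -> C) (f g : C -> C).
Local Notation disc := (@disc R).
Local Notation upper := (@upper_half_plane R).
Local Notation eG := (@eG R).
Local Notation eA := (@eA R).
Local Notation eE := (@eE R).

Definition height (d : R) : R := - ln d / (2 * pi).

Lemma heightP (d : R) tau : 0 < d -> (cabs (e2pi tau) < d) = (height d < cIm tau).
Proof.
move=> d0; have p0 := pi_gt0 R.
rewrite cabs_e2pi -{1}(@lnK _ d) ?posrE // ltr_expR /height ltr_pdivrMr; last by rewrite mulr_gt0.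
by rewrite ltrNl [cIm tau * _]mulrC.
Qed.

Lemma isD_e2pi (n : C) tau : isD (fun x => e2pi (n * x)) tau (n * e2pi (n * tau)).
Proof. by apply: cder_eq (cder_comp (cderZ n (cder_id tau)) (e2pi_cder (n * tau))) _; ring. Qed.

Lemma height_convex (Y : R) (x y : C) (t : R) : Y < cIm x -> Y < cIm y -> 0 <= t <= 1 -> Y < cIm (x + ofR t * (y - x)).
Proof.
rewrite cImD cImM cRe_ofR cIm_ofR mul0r addr0 cImD cImN => x0 y0 /andP[a b].
have H1 : 0 <= t * (cIm y - Y) by apply: mulr_ge0 => //; lra.
have [t1|t1] := ltrP t 1.
  have H2 : 0 < (1 - t) * (cIm x - Y) by apply: mulr_gt0; lra.
  lra.
have -> : t = 1 by lra.
lra.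
Qed.

Lemma exp_decay (s K e : R) : 0 < s -> 0 < e -> exists t0 : R, forall t, t0 < t -> K * expR (- (s * t)) < e.
Proof.
move=> s0 e0; exists (`|K| / (e * s)) => t Ht.
have t0 : 0 < t by apply: le_lt_trans Ht; rewrite divr_ge0 // mulr_ge0 // ltW.
have st : 0 < s * t by rewrite mulr_gt0.
move: Ht; rewrite ltr_pdivrMr ?mulr_gt0 // => Ht.
have E1 : 1 + s * t <= expR (s * t) by exact: expR_ge1Dx.
have ep : 0 < expR (s * t) by exact: expR_gt0.
rewrite expRN ltr_pdivrMr //; apply: (@le_lt_trans _ _ `|K|); first exact: ler_norm.
apply: lt_le_trans Ht _.
have -> : t * (e * s) = e * (s * t) by ring.
apply: ler_wpM2l; [exact: ltW | lra].
Qed.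

Lemma ratio_bound (E c e v n M : R) : 0 < E -> 0 < c -> 0 < e -> 2^-1 < v -> n <= M * e -> 0 <= M ->
  E * c / e * n / (c * v) <= 2 * M * E.
Proof.
move=> E0 c0 e0 v2 nM M0.
have -> : E * c / e * n / (c * v) = E * (n / e) * v^-1 by field; apply/and3P; split; apply: lt0r_neq0; lra.
have A1 : n / e <= M by rewrite ler_pdivrMr.
have A2 : v^-1 <= 2 by rewrite invf_ple ?posrE; lra.
have A3 : 0 <= v^-1 by rewrite invr_ge0; lra.
apply: (@le_trans _ _ (E * M * v^-1)).
  by apply: ler_wpM2r => //; apply: ler_wpM2l => //; exact: ltW.
have -> : 2 * M * E = E * M * 2 by ring.
by apply: ler_wpM2l => //; rewrite mulr_ge0 // ltW.
Qed.

Section Wronskian.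
Variables (k : int) (n0 n1 be r A B : C) (b b1 : nat -> C).
Local Notation k12 := (k%:~R / 12%:R).
Local Notation x := (n0 - k12 + (n1 - k12) - 6%:R^-1).
Local Notation al := (- ((n0 - k12) * (n1 - k12))).
Hypotheses (n0E : n0 = A - r + k12) (n1E : n1 = B - r + k12).
Hypothesis r_eq : r ^+ 2 + r * (x - 3%:R^-1) - (al + 3%:R * be) = 0.
Hypothesis c_neq : forall m : nat, 1 + A - B + m%:R != 0.
Hypothesis n01 : - 1 < cRe n0 - cRe n1.
Hypotheses (Pb : PS 1 b) (Pb1 : PS 1 b1) (b10 : b1 0%N = (n0 - k12) * b 0%N) (b0 : b 0%N != 0).
Hypothesis Dy : forall tau, upper tau -> isD (qs n0 b) tau (qs n0 b1 tau + k12 * eA tau * qs n0 b tau).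
Hypothesis Dy1 : forall tau, upper tau -> isD (qs n0 b1) tau (x * eG tau * qs n0 b1 tau + al * eG tau ^+ 2 * qs n0 b tau
   + be * eE tau * qs n0 b tau + (k + 2)%:~R / 12%:R * eA tau * qs n0 b1 tau).
Local Notation HQ := (HQ k r A B).
Local Notation HQ1 := (HQ1 k r A B).

Let h tau : C := e2pi (n0 * tau) * HQ (e2pi tau).
Let h1 tau : C := e2pi (n0 * tau) * HQ1 (e2pi tau).
Let w tau : C := qs n0 b tau * h1 tau - h tau * qs n0 b1 tau.
Let p n : C := x * @coeG R n + (k12 + (k + 2)%:~R / 12%:R) * @coeA R n.

Lemma wronskian_PS : PS 1 p.
Proof. exact: PSD (PSZ _ (@PS_coeG R)) (PSZ _ (@PS_coeA R)). Qed.

(* The Wronskian w satisfies w' = p w with p 0 = n0 + n1, but it is O(q^(2 n0 + 1));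
   as -1 < Re (n0 - n1) it vanishes. *)
Lemma frobenius_proportional : exists c Y : _, c != 0 :> C /\
  forall tau, upper tau -> (Y : R) < cIm tau -> qs n0 b tau = c * (e2pi (n0 * tau) * HQ (e2pi tau)).
Proof.
have [ra ra0 Pa] := PS_binom (r - A); have [rr rr0 Pr] := PS_binom r.
have [rh rh0 Ph] := PS_hypc A (2%:R^-1 + A) c_neq.
pose rad := Num.min ra (Num.min rr rh).
have rad0 : 0 < rad by rewrite !lt_min ra0 rr0.
have P1 : PS rad (binom (r - A)) by apply: PS_mono Pa; rewrite ge_min lexx.
have P2 : PS rad (binom r) by apply: PS_mono Pr; rewrite !ge_min lexx orbT.
have P3 : PS rad (hypc A (2%:R^-1 + A) (1 + A - B)) by apply: PS_mono Ph; rewrite !ge_min lexx !orbT.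
have [d1 d10 S1] := small_exists rad0.
have s0 : small rad 0 by apply: S1; rewrite cabs0.
have TH := isQD_HQ n0E P1 P2 P3; have TH1 := isQD_HQ1 n0E n1E r_eq c_neq P1 P2 P3.
have [lH cH _] := TH 0 s0; have [lH1 cH1 _] := TH1 0 s0.
have d00 := @disc0 R.
have cb := ps_cder_disc Pb d00; have cb1 := ps_cder_disc Pb1 d00.
pose N q := ps b q * HQ1 q - HQ q * ps b1 q.
have cN : cder N 0 _ := cderB (cderM cb cH1) (cderM cH cb1).
(* Both solutions start with the exponent n0, so the leading terms cancel; this gains one order in
   q. *)
have N0 : N 0 = 0.
  by rewrite /N !ps0 (HQ_at0 k r A B) (HQ1_at0 B n0E) b10; ring.
have [d2 [M [d20 M0 HN0]]] := cder_lip cN.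
have HN q : cabs q < d2 -> cabs (N q) <= M * cabs q.
  by move=> qd; have := HN0 q qd; rewrite [N 0]N0 subr0 add0r.
have h2 : 0 < 2^-1 :> R by rewrite invr_gt0 ltr0n.
have [d3 d30 HH] := cder_small cH h2.
have Pp := wronskian_PS; have Pe := expsol_PS (PS_shift Pp).
have [d4 d40 HV] := cder_small (ps_cder_disc Pe d00) h2.
pose d := Num.min (Num.min d1 d2) (Num.min (Num.min d3 d4) 1).
have dp : 0 < d by rewrite !lt_min d10 d20 d30 d40 ltr01.
pose Y := height d.
have UP tau : Y < cIm tau -> [/\ cabs (e2pi tau) < d1, cabs (e2pi tau) < d2, cabs (e2pi tau) < d3, cabs (e2pi tau) < d4 & upper tau].
  rewrite -heightP // !lt_min => /andP[/andP[? ?] /andP[/andP[? ?] e1]]; split => //.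
  by move: e1; rewrite cabs_e2pi -expR0 ltr_expR oppr_lt0 pmulr_rgt0 // mulr_gt0 // pi_gt0.
have Hn tau : Y < cIm tau -> h tau != 0.
  move=> /UP [_ _ q3 _ _]; rewrite /h mulf_neq0 ?e2pi_neq0 //.
  have := HH _ q3; rewrite HQ_at0; apply: contraTneq => ->.
  by rewrite sub0r cabsN cabs1; lra.
have Dh tau : Y < cIm tau -> isD h tau (h1 tau + k12 * eA tau * h tau).
  move=> /UP [q1 _ _ _ t0]; apply: isD_eq (isD_M (isD_e2pi n0 tau) (isD_q (TH _ (S1 _ q1)))) _.
  by rewrite /h1 /h -/(eA tau); move: (e2pi (n0 * tau)) (HQ _) (HQ1 _) (eA tau) => e a a1 c; ring.
have Dh1 tau : Y < cIm tau -> isD h1 tau (x * eG tau * h1 tau + al * eG tau ^+ 2 * h tau + be * eE tau * h tau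
     + (k + 2)%:~R / 12%:R * eA tau * h1 tau).
  move=> /UP [q1 _ _ _ t0]; apply: isD_eq (isD_M (isD_e2pi n0 tau) (isD_q (TH1 _ (S1 _ q1)))) _.
  rewrite /h1 /h -/(eA tau) -/(eG tau) -/(eE tau).
  by move: (e2pi (n0 * tau)) (HQ _) (HQ1 _) (eA tau) (eG tau) (eE tau) => e a a1 c g ee; ring.
have Dw tau : Y < cIm tau -> isD w tau (ps p (e2pi tau) * w tau).
  move=> Ht; have [_ _ _ _ t0] := UP _ Ht.
  apply: isD_eq (isD_B (isD_M (Dy t0) (Dh1 _ Ht)) (isD_M (Dh _ Ht) (Dy1 t0))) _.
  rewrite /p (psD (PSZ _ (@PS_coeG R)) (PSZ _ (@PS_coeA R)) (e2pi_disc t0)).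
  rewrite (psZ _ (@PS_coeG R) (e2pi_disc t0)) (psZ _ (@PS_coeA R) (e2pi_disc t0)) -(eA_coe t0) -(eG_coe t0).
  rewrite /w; move: (qs n0 b tau) (qs n0 b1 tau) (h tau) (h1 tau) (eA tau) (eG tau) (eE tau) => y y1 hh hh1 a g ee.
  ring.
have Dq tau : Y < cIm tau -> cder (fun t => w t / linsol p t) tau 0.
  move=> Ht; have [_ _ _ _ t0] := UP _ Ht; have ln := linsol_neq0 Pp t0.
  apply: cder_eq (isD_M (Dw _ Ht) (isD_V ln (linsol_isD Pp t0))) _.
  by move: (linsol p tau) ln (w tau) (ps p _) => a a0 c e; field.
have p0E : p 0%N = n0 + n1.
  by rewrite /p coeG0 coeA0 intrD; field.
have wE tau : w tau = e2pi (2%:R * n0 * tau) * N (e2pi tau).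
  have E2 : e2pi (2%:R * n0 * tau) = e2pi (n0 * tau) * e2pi (n0 * tau) by rewrite -e2piD; congr e2pi; ring.
  rewrite E2 /w /h /h1 !qsE /N.
  by move: (e2pi (n0 * tau)) (ps b _) (ps b1 _) (HQ _) (HQ1 _) => e y y1 a a1; ring.
(* The decay rate of w / linsol p up the imaginary axis: w has order at least 2 n0 + 1, linsol p has
   order n0 + n1. *)
pose sg := 2 * pi * (cRe n0 - cRe n1 + 1).
have sg0 : 0 < sg.
  apply: mulr_gt0; first by apply: mulr_gt0 => //; exact: pi_gt0.
  by rewrite -ltrBlDr sub0r.
have bound tau : Y < cIm tau -> cRe tau = 0 -> cabs (w tau / linsol p tau) <= 2 * M * expR (- (sg * cIm tau)).
  move=> Ht tR; have [_ q2 _ q4 t0] := UP _ Ht.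
  have AN := HN _ q2.
  have := HV _ q4; rewrite ps0 expsol0 => AV.
  set v := ps (expsol _) _ in AV.
  have v2 : 2^-1 < cabs v.
    have := cabsBl 1 (1 - v); have -> : 1 - (1 - v) = v by ring.
    by rewrite cabs1 cabsB; lra.
  rewrite wE /linsol qsE p0E -/v [cabs (_ / _)]cabsM cabsV (cabsM (e2pi _) (N _)) (cabsM (e2pi _) v).
  have eq1 : cabs (e2pi (2%:R * n0 * tau)) = expR (- (sg * cIm tau)) * cabs (e2pi ((n0 + n1) * tau)) / cabs (e2pi tau).
    rewrite !cabs_e2pi -expRD -expRN -expRD; congr expR.
    rewrite !cImM tR !mulr0 !addr0 cReM cRe_nat cIm_nat mul0r subr0 cReD /sg; ring.
  have c1 : 0 < cabs (e2pi ((n0 + n1) * tau)) by rewrite cabs_gt0 e2pi_neq0.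
  have c2 : 0 < cabs (e2pi tau) by rewrite cabs_gt0 e2pi_neq0.
  have E0 := expR_gt0 (- (sg * cIm tau)).
  rewrite eq1; exact: ratio_bound.
pose t1 (t : R) : C := iC R * ofR t.
have t1I t : cIm (t1 t) = t by rewrite /t1 cImM cIm_ofR cRe_ofR /cRe /cIm /=; ring.
have t1R t : cRe (t1 t) = 0 by rewrite /t1 cReM cIm_ofR cRe_ofR /cRe /cIm /=; ring.
(* The quotient w / linsol p is constant, so its decay at tau = i t forces it to vanish
   everywhere. *)
have w0 tau : Y < cIm tau -> w tau = 0.
  move=> Ht; have [_ _ _ _ t0] := UP _ Ht; have ln := linsol_neq0 Pp t0.
  suff E : w tau / linsol p tau = 0 by rewrite -[w tau](divfK ln) E mul0r.
  apply/eqP; rewrite -cabs_eq0 eq_le cabs_ge0 andbT; apply/ler_addgt0Pr => e e0; rewrite add0r.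
  have [T HT] := exp_decay (2 * M) sg0 e0.
  pose t := Num.max T Y + 1.
  have tT : T < t by rewrite ltr_pwDr // le_max lexx.
  have tY : Y < t by rewrite ltr_pwDr // le_max lexx orbT.
  have Yt : Y < cIm (t1 t) by rewrite t1I.
  rewrite (cder0_cst (@height_convex Y) Dq Ht Yt).
  apply: le_trans (bound _ Yt (t1R t)) _; rewrite t1I; apply: ltW; exact: HT.
have Dc tau : Y < cIm tau -> cder (fun t => qs n0 b t / h t) tau 0.
  move=> Ht; have [_ _ _ _ t0] := UP _ Ht; have hn := Hn _ Ht; have := w0 _ Ht; rewrite /w => /eqP.
  rewrite subr_eq0 => /eqP W.
  apply: cder_eq (isD_M (Dy t0) (isD_V hn (Dh _ Ht))) _.
  have E1 : qs n0 b1 tau = qs n0 b tau * h1 tau / h tau by rewrite W mulrAC divff ?mul1r // mulfV.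
  rewrite E1; move: (qs n0 b tau) (h tau) (h1 tau) (eA tau) hn => y a a1 c a0; by field.
pose ts := t1 (Y + 1); have Hts : Y < cIm ts by rewrite t1I; lra.
exists (qs n0 b ts / h ts), Y; split; last first.
  move=> tau t0 Ht; rewrite -(cder0_cst (@height_convex Y) Dc Ht Hts) -/(h tau) divfK //; exact: Hn.
(* If c were 0, the series b would vanish near q = 0, against b 0 <> 0. *)
apply/eqP => Z; move/eqP: b0; apply.
apply: (@ps_zero0 R d b dp).
  by apply: PS_mono Pb; rewrite !ge_min lexx !orbT.
move=> z z0 zd; have [tau Ht] := e2pi_surj z0.
have Yt : Y < cIm tau by rewrite -heightP // Ht.
have hn := Hn _ Yt.
have E : qs n0 b tau / h tau = 0 := etrans (cder0_cst (@height_convex Y) Dc Yt Hts) Z.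
have : qs n0 b tau = 0 by rewrite -[LHS](divfK hn) E mul0r.
rewrite qsE Ht => /eqP; rewrite mulf_eq0 (negbTE (e2pi_neq0 _)) => /eqP; exact.
Qed.
End Wronskian.

Lemma e2pi_exprz z (n : int) : e2pi z ^ n = e2pi (n%:~R * z).
Proof.
case: n => n; first by rewrite -exprnP -e2piMn.
by rewrite NegzE mulrNz mulNr e2piN -exprz_inv -exprnP exprVn -[n.+1%:~R]/(n.+1%:R) e2piMn.
Qed.

Lemma lambert_series (l : nat) q : disc q ->
  limn (series (fun n => (divisor_sigma l n.+1)%:R * q ^+ n.+1)) = ps (@sg R l) q.
Proof.
move=> q1; rewrite /ps (sumC_recl (PS_asum (@PS_sg R l) q1)) sg0 mul0r add0r.
exact: eq_sumC.
Qed.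

Lemma qpow1 tau : qpow 1 tau = e2pi tau :> C.
Proof. by rewrite /qpow mul1r. Qed.

Lemma E2_sE2 tau : upper tau -> E2 tau = sE2 (e2pi tau).
Proof. by move=> t0; rewrite /E2 qpow1 lambert_series //; exact: e2pi_disc. Qed.
Lemma E4_sE4 tau : upper tau -> E4 tau = sE4 (e2pi tau).
Proof. by move=> t0; rewrite /E4 qpow1 lambert_series //; exact: e2pi_disc. Qed.
Lemma G_sG tau : upper tau -> G tau = sG (e2pi tau).
Proof.
move=> t0; have t2 : upper (2%:R * tau) := upper_natM 1 t0.
by rewrite /G (E2_sE2 t0) (E2_sE2 t2) /sG e2piMn.
Qed.

Lemma frakJ_inv tau : upper tau -> (frakJ tau)^-1 = zq (e2pi tau).
Proof. by move=> t0; rewrite /frakJ E4_sE4 // G_sG // invf_div /zq -/(sE _) expr2. Qed.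

Lemma eta_eq tau : upper tau -> dedekind_eta tau = e2pi (24%:R^-1 * tau) * etaq (e2pi tau).
Proof. by move=> t0; rewrite /dedekind_eta qpow1 eta_limit //; exact: e2pi_disc. Qed.

Lemma binomial_series_ps r (u : C) : binomial_series r u = ps (binom r) u.
Proof. by []. Qed.

Lemma J_vq tau : upper tau -> 64%:R * qpow 1 tau * frakJ tau - 1 = vq (e2pi tau).
Proof.
move=> t0; have q1 := e2pi_disc t0; have q0 := e2pi_neq0 tau.
rewrite qpow1 /frakJ E4_sE4 // G_sG // -/(sE _) sE_prod // /vq /uinvq.
have := expsol_inv (@PS_chiE R) q1; have := expsol_neq0 (@PS_chiE R) q1.
move: (ps (expsol (@chiE R)) _) (ps (expsol (fun n => -1 * _)) _) (sG _) => u v g.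
move: (e2pi tau) q0 {q1} => q q0 u0 uv.
have -> : v = u^-1 by apply: (mulfI u0); rewrite uv mulfV.
by field; rewrite q0 u0.
Qed.

(** The constant is 64^(A - r), from the branch chosen for J^(r - A). *)
Lemma solution_closed_form (k : int) (n0 r A B : C) tau : n0 = A - r + k%:~R / 12%:R -> upper tau ->
  dedekind_eta tau ^ (2 * k) * J1pow_Jpow r A tau * hyp2F1 A (2%:R^-1 + A) (1 + A - B) (frakJ tau)^-1 =
  cexp ((A - r) * ofR (ln 64%:R)) * (e2pi (n0 * tau) * HQ k r A B (e2pi tau)).
Proof.
move=> n0E t0; rewrite hyp2F1E /J1pow_Jpow /Jpow /pow64q !binomial_series_ps J_vq // frakJ_inv // eta_eq //.
rewrite expfzMl e2pi_exprz opprB /HQ /PiQ /hypz /qpow.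
have -> : e2pi (n0 * tau) = e2pi ((2 * k)%:~R * (24%:R^-1 * tau)) * e2pi ((A - r) * tau).
  by rewrite -e2piD n0E intrM; congr e2pi; field.
move: (cexp _) (e2pi ((A - r) * tau)) (e2pi (_%:~R * _)) (etaq _ ^ _)
  (ps (binom (r - A)) (vq (e2pi tau))) (ps (binom r) (- zq (e2pi tau))) (ps _ (zq (e2pi tau))) => a b c d e f g.
ring.
Qed.
End Comparison.

(** * The closed form of the forms of least weight *)

Section Main.
Variable R : realType.
Local Notation C := (Cfield R).
Local Notation upper := (@upper_half_plane R).
Implicit Types (rho : 'M[int]_2 -> 'M[C]_2) (F : C -> 'cV[C]_2).

Lemma diagonalize_rhoT rho : representation rho -> diagonalizable (rho Tmx) ->
  exists P0 nu, [/\ P0 \in unitmx, forall i : 'I_2, 0 <= cRe (nu i) < 1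
    & P0 *m rho Tmx *m invmx P0 = diag_mx (\row_i e2pi (nu i))].
Proof.
move=> rho_rep [P Pu /diagonalizable_forPex [D /(simmxRL Pu) DE]].
have Tu : rho Tmx \in unitmx by apply: rho_rep.1; have := Gamma02_Tmx 1; rewrite expr1.
have Dn i : D 0 i != 0.
  have Du : diag_mx D \in unitmx by rewrite DE !unitmx_mul Pu Tu unitmx_inv Pu.
  apply: contraTneq Du => D0; rewrite unitmxE det_diag unitfE negbK.
  by rewrite (bigD1 i) //= D0 mul0r.
have [z0 E0 R0] := e2pi_surj01 (Dn 0); have [z1 E1 R1] := e2pi_surj01 (Dn 1).
exists P, (fun i => if i == 0 then z0 else z1); split => //.
  by move=> i; case: (i == 0).
rewrite -DE; congr diag_mx; apply/rowP => i; rewrite mxE.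
by case: (ord2 i) => -> /=; rewrite ?E0 ?E1.
Qed.

Lemma quadratic_root (b c : C) : exists r : C, r ^+ 2 + r * b - c = 0.
Proof.
exists ((sqrtC (b ^+ 2 + 4%:R * c) - b) / 2%:R).
have E := sqrtCK (b ^+ 2 + 4%:R * c); move: (sqrtC _) E => s E.
have -> : ((s - b) / 2%:R) ^+ 2 + (s - b) / 2%:R * b - c = (s ^+ 2 - (b ^+ 2 + 4%:R * c)) / 4%:R by field.
by rewrite E subrr mul0r.
Qed.

(** Both exponents lie in a strip of width 1, so Re (n0 - n1) > -1; this is the source of the
    conditions on 1 + A - B and 1 + B - A. *)
Lemma re_gap_neq (n0 n1 : C) (m : nat) : 0 <= cRe n0 < 1 -> 0 <= cRe n1 < 1 -> 1 + (n0 - n1) + m%:R != 0.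
Proof.
move=> /andP[a1 a2] /andP[b1 b2]; apply/eqP => /(congr1 (@cRe R)).
rewrite !cReD cReN cRe_nat -[X in cRe X]/(1%:R) cRe_nat -[cRe 0]/(0 : R).
have : 0 <= m%:R :> R by [].
lra.
Qed.

Section Forms.
Variables (rho : 'M[int]_2 -> 'M[C]_2) (P0 : 'M[C]_2) (nu : 'I_2 -> C).
Hypotheses (P0u : P0 \in unitmx).

Lemma form_eq0 b tau : form P0 nu b tau = 0 -> forall i, qs (nu i) (b i) tau = 0.
Proof.
rewrite formV => E i; rewrite -(vecqE nu b tau i).
have -> : vecq nu b tau = 0 by rewrite -[LHS](mulKVmx P0u) E mulmx0.
by rewrite mxE.
Qed.

Lemma form_neq0 F b : (forall tau, upper tau -> F tau = form P0 nu b tau) -> nonzero_on_H F ->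
  exists i n, b i n != 0.
Proof.
move=> FE [tau t0]; rewrite FE //; apply: contraNP => H; apply/eqP.
rewrite formV (_ : vecq nu b tau = 0) ?mulmx0 //; apply/colP => i; rewrite vecqE mxE.
have -> : b i = fun=> 0; last exact: qs0.
apply/funext => n; apply/eqP/negPn/negP => bn; apply: H; by exists i, n.
Qed.

Lemma form_nonzero b : (forall i, PS 1 (b i)) -> (exists i n, b i n != 0) -> nonzero_on_H (form P0 nu b).
Proof.
move=> Pb [i [n]]; apply: contraNP => H; apply/eqP.
apply: (qs_eq0 (n := nu i) (Pb i)) => tau t0; apply: form_eq0.
by apply/eqP/negPn/negP => fn; apply: H; exists tau.
Qed.
End Forms.

(** Stated for the exponent n0; exchanging n0 and n1 preserves the equation of r and gives the other
    component. *)
Lemma component_closed_form (k : int) (n0 n1 be r A B : C) (b b1 : nat -> C) (a0 := n0 - k%:~R / 12%:R) (a1 := n1 - k%:~R / 12%:R) :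
  0 <= cRe n0 < 1 -> 0 <= cRe n1 < 1 -> A = a0 + r -> B = a1 + r ->
  r ^+ 2 + r * (a0 + a1 - 6%:R^-1 - 3%:R^-1) - (- (a0 * a1) + 3%:R * be) = 0 ->
  PS 1 b -> PS 1 b1 -> b1 0%N = a0 * b 0%N -> b 0%N != 0 ->
  (forall tau, upper tau -> isD (qs n0 b) tau (qs n0 b1 tau + k%:~R / 12%:R * eA tau * qs n0 b tau)) ->
  (forall tau, upper tau -> isD (qs n0 b1) tau ((a0 + a1 - 6%:R^-1) * eG tau * qs n0 b1 tau
     - a0 * a1 * eG tau ^+ 2 * qs n0 b tau + be * eE tau * qs n0 b tau + (k + 2)%:~R / 12%:R * eA tau * qs n0 b1 tau)) ->
  exists c, exists2 Y : R, c != 0 & forall tau, upper tau -> Y < cIm tau ->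
    qs n0 b tau = c * (dedekind_eta tau ^ (2 * k) * J1pow_Jpow r A tau *
      hyp2F1 A (2%:R^-1 + A) (1 + A - B) (frakJ tau)^-1).
Proof.
move=> H0 H1 AE BE rE Pb Pb1 b10 b0 D1 D2.
have n0E : n0 = A - r + k%:~R / 12%:R by rewrite AE /a0; ring.
have n1E : n1 = B - r + k%:~R / 12%:R by rewrite BE /a1; ring.
have cn (m : nat) : 1 + A - B + m%:R != 0.
  by have := re_gap_neq m H0 H1; rewrite n0E n1E; apply: contraNneq => <-; apply/eqP; ring.
have gap : -1 < cRe n0 - cRe n1 by case/andP: H0 => ? ?; case/andP: H1 => ? ?; lra.
have D2' tau : upper tau -> isD (qs n0 b1) tau ((a0 + a1 - 6%:R^-1) * eG tau * qs n0 b1 tau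
     + - (a0 * a1) * eG tau ^+ 2 * qs n0 b tau + be * eE tau * qs n0 b tau + (k + 2)%:~R / 12%:R * eA tau * qs n0 b1 tau).
  by move=> t0; apply: isD_eq (D2 _ t0) _; rewrite !mulNr.
have [c [Y [c0 H]]] := frobenius_proportional n0E n1E rE cn gap Pb Pb1 b10 b0 D1 D2'.
have e0 := cexp_neq0 ((A - r) * ofR (ln 64%:R)).
exists (c / cexp ((A - r) * ofR (ln 64%:R))), Y; first by rewrite mulf_neq0 // invr_eq0.
move=> tau t0 tY; rewrite H // (solution_closed_form B n0E t0).
by move: (cexp _) e0 (e2pi _ * _) => e e0 f; field.
Qed.
End Main.

Theorem theorem1p5 (R : realType) (rho : 'M[int]_2 -> 'M[Cfield R]_2)
    (rho_rep : representation rho) (rho_irr : irreducible rho)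
    (rhoT_diag : diagonalizable (rho Tmx))
    (k0 : int) (k0_least : least_weight rho k0) :
  exists A B r : Cfield R,
    [/\ forall n : nat, 1 + A - B != - n%:R,
        forall n : nat, 1 + B - A != - n%:R
      & forall F : Cfield R -> 'cV[Cfield R]_2,
          modular_form k0 rho F -> nonzero_on_H F ->
          exists2 Q : 'M[Cfield R]_2, Q \in unitmx &
          exists Y : R, forall tau : Cfield R,
            upper_half_plane tau -> Y < cIm tau ->
            F tau =
            Q *m col2
              (dedekind_eta tau ^ (2 * k0) * J1pow_Jpow r A tau *
               hyp2F1 A (2%:R^-1 + A) (1 + A - B) (frakJ tau)^-1)
              (dedekind_eta tau ^ (2 * k0) * J1pow_Jpow r B tau *
               hyp2F1 B (2%:R^-1 + B) (1 + B - A) (frakJ tau)^-1)].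
Proof.
have [P0 [nu [P0u nuR P0T]]] := diagonalize_rhoT rho_rep rhoT_diag.
have [[F1 F1m F1n] k0m] := k0_least.
have [_ _ F1c] := F1m.
have MF F : modular_form k0 rho F -> nonzero_on_H F -> exists b,
    [/\ goodc rho P0 nu k0 b, exists i n, b i n != 0 & forall tau, upper_half_plane tau -> F tau = form P0 nu b tau].
  move=> Fm Fn; have [b Gb FE] := mf_good P0u nuR P0T Fm.
  by exists b; split; [exact/goodP | exact: form_neq0 FE Fn |].
have k0_min k b : goodc rho P0 nu k b -> k < k0 -> forall i n, b i n = 0.
  move=> Gb kk i n; apply/eqP/negPn/negP => bn.
  have Gb' : good rho P0 nu k b by exact/goodP.
  have := k0m _ _ (good_mf rho_rep P0u nuR P0T F1c Gb').
  have nz := form_nonzero nu P0u (goodc_PS Gb) (ex_intro _ i (ex_intro _ n bn)).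
  by move=> /(_ nz); rewrite leNgt kk.
have [b [Gb bn F1E]] := MF _ F1m F1n.
have Pb := goodc_PS Gb.
have [b00 b01 _] := leading_nonzero rho_irr P0u k0_min Gb bn.
have [be ODE] := ode_system rho_irr P0u k0_min Gb bn.
have Pt i := PS_theta nu k0 (Pb i).
pose a i := nu i - k0%:~R / 12%:R.
(* The indicial equation at z = 1, the cusp 0. *)
have [r rE] := quadratic_root (a 0 + a 1 - 6%:R^-1 - 3%:R^-1) (- (a 0 * a 1) + 3%:R * be).
have D1 i tau (t0 : upper_half_plane tau) := qs_isD nu k0 (Pb i) t0.
have [c0 [Y0 c00 H0]] := component_closed_form (nuR 0) (nuR 1) erefl erefl rE (Pb 0) (Pt 0)
  (theta_at0 nu k0 b 0) b00 (D1 0) (ODE 0).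
have rE' : r ^+ 2 + r * (a 1 + a 0 - 6%:R^-1 - 3%:R^-1) - (- (a 1 * a 0) + 3%:R * be) = 0.
  by rewrite [a 1 + _]addrC [a 1 * _]mulrC.
have ODE' := ODE 1; rewrite -/(a 0) -/(a 1) [a 0 + a 1]addrC [a 0 * a 1]mulrC in ODE'.
have [c1 [Y1 c10 H1]] := component_closed_form (nuR 1) (nuR 0) erefl erefl rE' (Pb 1) (Pt 1)
  (theta_at0 nu k0 b 1) b01 (D1 1) ODE'.
exists (a 0 + r), (a 1 + r), r; split.
- move=> n; rewrite -addr_eq0; have := re_gap_neq n (nuR 0) (nuR 1).
  by apply: contraNneq => <-; rewrite /a; apply/eqP; ring.
- move=> n; rewrite -addr_eq0; have := re_gap_neq n (nuR 1) (nuR 0).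
  by apply: contraNneq => <-; rewrite /a; apply/eqP; ring.
move=> F Fm Fn; have [b' [Gb' [i [n bn']] FE]] := MF _ Fm Fn.
(* Uniqueness up to a scalar lets A, B and r, computed from b, serve for every F. *)
have [s sE] := proportional rho_irr P0u k0_min Gb bn Gb'.
have s0 : s != 0 by apply: contraNneq bn' => s0; rewrite sE s0 mul0r.
(* Q undoes the diagonalization of rho(T) and carries the three proportionality factors s, c0 and
   c1. *)
exists (invmx P0 *m diag_mx (\row_j (s * (if j == 0 then c0 else c1)))).
  rewrite unitmx_mul unitmx_inv P0u unitmxE det_diag unitfE.
  by apply/prodf_neq0 => j _; rewrite mxE mulf_neq0 //; case: (j == 0).
exists (Num.max Y0 Y1) => tau t0; rewrite gt_max => /andP[t1 t2].
rewrite FE // formV -mulmxA; congr (_ *m _); apply/colP => j.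
rewrite vecqE mul_diag_mx !mxE.
have -> : b' j = (fun m => s * b j m) by apply/funext => m; exact: sE.
rewrite (qsZ _ _ (Pb j) t0) -mulrA; congr (_ * _).
by case: (ord2 j) => -> /=; [exact: H0 | exact: H1].
Qed.
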